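(* Let $\Omega\subset\mathbb C^n$ be a bounded domain, $x\in\Omega$, and $f\in C(\overline\Omega)$ with $f\ge 0$. Then for every $\varphi\in C(\partial\Omega)$, $$P_f^{\mathrm{PSH}}\varphi(x)=\inf_{\mu\in J_{x,\mathrm{PSH}}^{\partial}}\left(\int_{\partial\Omega}\varphi\,d\mu-B_f^{\mathrm{PSH}}(x,\mu)\right).$$
   Context: $\mathrm{PSH}(\Omega)$ is the set of plurisubharmonic functions on $\Omega$; $dV$ is Lebesgue measure; $dd^c$ is a fixed positive multiple of $i\partial\bar\partial$; $(dd^cu)^n$ is the Bedford--Taylor Monge--Amp\`ere measure of a locally bounded plurisubharmonic function $u$. $\mathcal P(\partial\Omega)$ is the set of Borel probability measures on $\partial\Omega$. $$J_{x,\mathrm{PSH}}^{\partial}=\Big\{\mu\in\mathcal P(\partial\Omega): v(x)\le\int_{\partial\Omega}v\,d\mu\ \text{ for all } v\in\mathrm{PSH}(\Omega)\cap C(\overline\Omega)\Big\},$$ $$\mathcal P_f=\{u\in\mathrm{PSH}(\Omega)\cap C(\overline\Omega):(dd^cu)^n\ge f\,dV\},$$ $$P_f^{\mathrm{PSH}}\varphi(x)=\sup\{u(x):u\in\mathcal P_f,\ u|_{\partial\Omega}\le\varphi\},$$ $$B_f^{\mathrm{PSH}}(x,\mu)=\inf_{u\in\mathcal P_f}\Big(\int_{\partial\Omega}u\,d\mu-u(x)\Big).$$ *)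

(* Defs.v *)
From HB Require Import structures.
From mathcomp Require Import all_boot all_order all_algebra.
From mathcomp Require Import complex ring lra.
From mathcomp Require Import all_classical all_reals all_analysis.
From mathcomp Require Import measurable_realfun.

Set Implicit Arguments.
Unset Strict Implicit.
Unset Printing Implicit Defensive.

Import Order.TTheory GRing.Theory Num.Theory.
Import numFieldNormedType.Exports.

Local Open Scope classical_set_scope.
Local Open Scope ring_scope.
Local Open Scope complex_scope.

(* R[i] itself carries no topology in the library; its regular module does. *)
Notation Cn R n := ('rV[R[i]^o]_n).

Notation borelC R n := (g_sigma_algebraType (@open (Cn R n))).

Section measurable_fun_borelC.
Context {R : realType}.

Local Definition box n (q : 'rV[rat * rat]_n) (m : nat) : set (Cn R n) :=
  \bigcap_(j : 'I_n) [set w | `|complex.Re (w 0 j) - ratr (q 0 j).1| < m.+1%:R^-1 /\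
      `|complex.Im (w 0 j) - ratr (q 0 j).2| < m.+1%:R^-1].

Local Lemma norm_le_ReIm (z : R[i]) : `|z| <= (`|complex.Re z| + `|complex.Im z|)%:C.
Proof.
case: z => a b; rewrite (_ : a +i* b = a%:C + (0 +i* b)); last by simpc.
apply: (le_trans (ler_normD _ _)).
by rewrite !normc_def /= !expr0n /= !addr0 !add0r !sqrtr_sqr raddfD.
Qed.

Local Lemma open_box n (U : set (Cn R n)) : open U ->
  U = \bigcup_(qm in [set qm | box qm.1 qm.2 `<=` U]) box qm.1 qm.2.
Proof.
move=> oU; apply/seteqP; split => [z Uz|z [[q m]/= + zB]]; last exact.
have /nbhs_ballP[e /= e0 eU] := open_nbhs_nbhs (conj oU Uz).
have [r r0 er] : exists2 r : R, 0 < r & e = r%:C.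
  move: e0; case: e {eU} => a b; rewrite ltcE /= => /andP[/eqP -> a0].
  by exists a.
have [m mr] : exists m, 4 * m.+1%:R^-1 < r.
  have := @ltr_add_invr R 0 (r / 4).
  move=> /(_ ltac:(lra)) [m]; rewrite add0r => mr; exists m.
  rewrite mulrC -ltr_pdivlMr//.
have [d dE] : exists d : R, d = m.+1%:R^-1 by exists m.+1%:R^-1.
have d0 : 0 < d by rewrite dE invr_gt0.
have dr : 4 * d < r by rewrite dE.
have dq (x : R) : {q : rat | `|x - ratr q| < d}.
  apply: cid; have [|q] := @rat_in_itvoo R (x - d) (x + d); first lra.
  by rewrite in_itv /= => /andP[q1 q2]; exists q; rewrite ltr_norml; lra.
pose q : 'rV[rat * rat]_n := \row_j
  (sval (dq (complex.Re (z 0 j))), sval (dq (complex.Im (z 0 j)))).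
have zB : box q m z.
  by move=> j _ /=; rewrite -dE mxE /=; split; [case: (dq _)|case: (dq _)].
exists (q, m) => //= w wB; apply: eU; split => // i j.
rewrite (ord1 i) /ball /= er; apply: le_lt_trans (norm_le_ReIm _) _.
have [zr zi] := zB j I; have [wr wi] := wB j I.
move: zr zi wr wi; rewrite -dE ltcR; case: (z 0 j) (w 0 j) => [a b] [c e'] /=.
rewrite !ltr_norml => /andP[h1 h2] /andP[h3 h4] /andP[h5 h6] /andP[h7 h8].
have : `|a - c| < 2 * d by rewrite ltr_norml; lra.
have : `|b - e'| < 2 * d by rewrite ltr_norml; lra.
lra.
Qed.

Lemma measurable_fun_borelC d (T : measurableType d) n (h : T -> borelC R n) :
  (forall j, measurable_fun setT (fun t => complex.Re (h t 0 j))) ->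
  (forall j, measurable_fun setT (fun t => complex.Im (h t 0 j))) ->
  measurable_fun setT h.
Proof.
move=> hr hi.
refine (@measurability _ _ T (borelC R n) setT h (@open (Cn R n)) erefl _).
move=> _ [U oU <-]; rewrite (open_box oU) setTI preimage_bigcup.
rewrite bigcup_mkcond; apply: countable_bigcupT_measurable => [|qm].
  exact: countableP.
case: ifPn => // _.
rewrite /box preimage_bigcap; apply: fin_bigcap_measurable => [|j _].
  exact: finite_finset.
have mb (g : T -> R) (a e : R) : measurable_fun setT g ->
    measurable [set t | `|g t - a| < e].
  move=> mg; rewrite (_ : [set _ | _] = g @^-1` ball a e); last first.
    by apply/seteqP; split => t /=; rewrite distrC.
  rewrite -[X in measurable X]setTI; apply: mg => //.
  apply: open_measurable; exact: (@ball_open R R).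
exact: measurableI (mb _ _ _ (hr j)) (mb _ _ _ (hi j)).
Qed.
End measurable_fun_borelC.

Section lebesgue_Cn.
Context {R : realType}.
Local Notation tup n := (n.-tuple (measurableTypeR R)).

Definition image_measure d d' (T : measurableType d) (T' : measurableType d')
    (m : {measure set T -> \bar R}) (h : T -> T') (mh : measurable_fun setT h) :
    {measure set T' -> \bar R} :=
  measure_function_pushforward__canonical__measure_function_Measure m mh.

Definition tcons n (tx : tup n * measurableTypeR R) : tup n.+1 :=
  [the n.+1.-tuple _ of tx.2 :: tx.1].

Lemma measurable_tcons n : measurable_fun setT (@tcons n).
Proof. exact: (measurable_cons measurable_snd measurable_fst). Qed.

Fixpoint lebesgue_tuple n : {measure set (tup n) -> \bar R} :=
  match n with
  | 0 => @dirac _ (tup 0) [tuple] R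
  | m.+1 => image_measure
      (lebesgue_tuple m \x (@lebesgue_measure R))%E (@measurable_tcons m)
  end.

Definition tuple_Cn n (t : tup (n + n)) : borelC R n :=
  \row_j (tnth t (lshift n j) +i* tnth t (rshift n j)).

Lemma measurable_tuple_Cn n : measurable_fun setT (@tuple_Cn n).
Proof.
apply: measurable_fun_borelC => j.
- by under eq_fun do rewrite mxE; exact: measurable_tnth.
- by under eq_fun do rewrite mxE; exact: measurable_tnth.
Qed.

Definition lebesgue_Cn n : {measure set (borelC R n) -> \bar R} :=
  image_measure (lebesgue_tuple (n + n)) (@measurable_tuple_Cn n).

End lebesgue_Cn.

Section plurisubharmonic.
Context {R : realType} {n : nat}.
Implicit Types (Omega : set (Cn R n)).

Definition boundary Omega : set (Cn R n) := closure Omega `\` Omega°.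

Definition expi (t : R) : R[i] := cos t +i* sin t.

Definition circle_mean (u : Cn R n -> \bar R) (z w : Cn R n) : \bar R :=
  (((2 * pi)^-1)%:E *
   \int[lebesgue_measure]_(t in `[0%R, (2 * pi)%R]) u (z + expi t *: w)%R)%E.

Definition psh Omega (u : Cn R n -> \bar R) : Prop :=
  [/\ forall z, Omega z -> (u z < +oo)%E,
      forall z (a : R), Omega z -> (u z < a%:E)%E ->
        \forall w \near z, (u w < a%:E)%E &
      forall z w : Cn R n,
        (forall zeta : R[i], `|zeta| <= 1 -> Omega (z + zeta *: w)) ->
        (u z <= circle_mean u z w)%E].

Definition pshC Omega : set (Cn R n -> R) :=
  [set u : Cn R n -> R |
    psh Omega (EFin \o u) /\ {within closure Omega, continuous u}].

End plurisubharmonic.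

Section test_functions.
Context {R : realType} {n : nat}.

Definition along (phi : Cn R n -> R) (z v : Cn R n) : R -> R :=
  fun t => phi (z + t%:C *: v).

Definition dder (v : Cn R n) (phi : Cn R n -> R) : Cn R n -> R :=
  fun z => derive1 (along phi z v) 0.

Fixpoint Ck k (phi : Cn R n -> R) : Prop :=
  continuous phi /\
  if k is k'.+1 then
    forall v, (forall z, derivable (along phi z v) 0 1) /\ Ck k' (dder v phi)
  else True.

Definition test_function (Omega : set (Cn R n)) (phi : Cn R n -> R) : Prop :=
  (forall k, Ck k phi) /\
  exists K : set (Cn R n),
    [/\ compact K, K `<=` Omega & forall z, ~ K z -> phi z = 0].

Definition dx (p : 'I_n) := dder (delta_mx 0 p : Cn R n).
Definition dy (p : 'I_n) := dder ('i%C *: delta_mx 0 p : Cn R n).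

(* d^2 phi / (dz_p dzbar_q), with d/dz = (d/dx - i d/dy) / 2 and
   d/dzbar = (d/dx + i d/dy) / 2. *)
Definition ddbar (p q : 'I_n) (phi : Cn R n -> R) (z : Cn R n) : R[i] :=
  4^-1 * ((dx p (dx q phi) z + dy p (dy q phi) z) +i*
          (dx p (dy q phi) z - dy p (dx q phi) z)).

End test_functions.

Section monge_ampere.
Context {R : realType} {n : nat}.
Implicit Types (Omega : set (Cn R n)) (c : R) (u phi : Cn R n -> R).

(* A complex Radon measure on Omega, written as cm_dens times the positive
   measure cm_base; only the restriction to Omega is relevant. *)
Record cmeasure := CMeasure {
  cm_base : {measure set (borelC R n) -> \bar R};
  cm_dens : Cn R n -> R[i] }.

Definition radon Omega (T : cmeasure) : Prop :=
  forall K : set (Cn R n), compact K -> K `<=` Omega ->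
    (cm_base T).-integrable K (fun z => (complex.Re (cm_dens T z))%:E) /\
    (cm_base T).-integrable K (fun z => (complex.Im (cm_dens T z))%:E).

Definition cm_int Omega (T : cmeasure) (psi : Cn R n -> R[i]) : R[i] :=
  Rintegral (cm_base T) Omega (fun z => complex.Re (psi z * cm_dens T z)) +i*
  Rintegral (cm_base T) Omega (fun z => complex.Im (psi z * cm_dens T z)).

(* A (k,k)-current of order zero is given by its coefficients:
     T = \sum_(#|I| = #|J| = k) T_IJ beta_IJ,
     beta_IJ = (i dz_(i_1) /\ dzbar_(j_1)) /\ ... /\ (i dz_(i_k) /\ dzbar_(j_k))
   where I = {i_1 < ... < i_k} and J = {j_1 < ... < j_k}. The factors of beta_IJ
   are 2-forms, so they commute. *)
Definition current := {set 'I_n} -> {set 'I_n} -> cmeasure.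

(* The (0,0)-current 1; as bidegree (0,0), only I = J = set0 is relevant. *)
Definition current1 : current := fun _ _ => CMeasure (@lebesgue_Cn R n) (fun=> 1).

(* The sign eps such that dz_p /\ dz_(I :\ p) = eps dz_I for p in I. *)
Definition wsign (I : {set 'I_n}) (p : 'I_n) : R[i] :=
  (-1) ^+ #|[set i in I | (i < p)%N]|.

(* S = dd^c u /\ T := dd^c (u T) in the sense of currents on Omega, for T of
   bidegree (k,k), where dd^c = c i d dbar. *)
Definition ddc_wedge c Omega k u (T S : current) : Prop :=
  forall I J : {set 'I_n}, #|I| = k.+1 -> #|J| = k.+1 ->
    radon Omega (S I J) /\
    forall phi, test_function Omega phi ->
      cm_int Omega (S I J) (fun z => (phi z)%:C) =
      c%:C * \sum_(p in I) \sum_(q in J) wsign I p * wsign J q *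
        cm_int Omega (T (I :\ p) (J :\ q))
          (fun z => (u z)%:C * ddbar p q phi z).

(* mu = (dd^c u)^n on Omega, by the Bedford-Taylor induction
   (dd^c u)^(k+1) = dd^c (u (dd^c u)^k). The factor 2 ^+ n comes from
   beta_IJ = 2 ^ n dV for I = J = [set: 'I_n]. *)
Definition monge_ampere c Omega u (mu : {measure set (borelC R n) -> \bar R}) :
    Prop :=
  (forall K : set (Cn R n), compact K -> K `<=` Omega -> (mu K < +oo)%E) /\
  exists T : nat -> current,
    [/\ T 0%N = current1,
        forall k, (k < n)%N -> ddc_wedge c Omega k u (T k) (T k.+1) &
        forall phi, test_function Omega phi ->
          (Rintegral mu Omega phi)%:C =
          2 ^+ n * cm_int Omega (T n [set: 'I_n]%SET [set: 'I_n]%SET)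
                     (fun z => (phi z)%:C)].

Definition monge_ampere_ge c Omega u (f : Cn R n -> R) : Prop :=
  exists2 mu : {measure set (borelC R n) -> \bar R},
    monge_ampere c Omega u mu &
    forall A : set (borelC R n), measurable A -> A `<=` Omega ->
      (\int[@lebesgue_Cn R n]_(z in A) (f z)%:E <= mu A)%E.

End monge_ampere.

Section envelopes.
Context {R : realType} {n : nat}.
Implicit Types (Omega : set (Cn R n)) (c : R) (f phi : Cn R n -> R) (x : Cn R n).
Local Open Scope ereal_scope.

(* Probability measures on the boundary are those on C^n that it carries. *)
Definition jensen Omega x : set (probability (borelC R n) R) :=
  [set mu : probability (borelC R n) R | mu (boundary Omega) = 1 /\
     forall v, pshC Omega v ->
       (v x)%:E <= \int[mu]_(z in boundary Omega) (v z)%:E].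

Definition subsolutions c Omega f : set (Cn R n -> R) :=
  [set u : Cn R n -> R | pshC Omega u /\ monge_ampere_ge c Omega u f].

Definition perron c Omega f phi x : \bar R :=
  ereal_sup [set (u x)%:E | u in
    [set u : Cn R n -> R | subsolutions c Omega f u /\
             forall z, boundary Omega z -> (u z <= phi z)%R]].

Definition Bpsh c Omega f x (mu : probability (borelC R n) R) : \bar R :=
  ereal_inf [set \int[mu]_(z in boundary Omega) (u z)%:E - (u x)%:E
            | u in subsolutions c Omega f].

End envelopes.

(* Main.v *)
Require Import Defs.
From HB Require Import structures.
From mathcomp Require Import all_boot all_order all_algebra.
From mathcomp Require Import complex ring lra.
From mathcomp Require Import all_classical all_reals all_analysis.
From mathcomp Require Import measurable_realfun sesquilinear spectral.

Set Implicit Arguments.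
Unset Strict Implicit.
Unset Printing Implicit Defensive.

Import Order.TTheory GRing.Theory Num.Theory.
Import numFieldNormedType.Exports.

Local Open Scope classical_set_scope.
Local Open Scope ring_scope.
Local Open Scope complex_scope.

(** A competitor [u] satisfies [u x = int u dmu - (int u dmu - u x) <= int phi dmu - B_f (x, mu)] for every
Jensen measure [mu], which is one inequality. For the other, let [alpha = P_f phi x] and let [q h] be
the infimum of the [b] such that [h <= b + t ((phi - u) - (alpha - u x))] on the boundary for some
[t >= 0] and [u] in the class. If the class is convex, [q] is sublinear, and a linear functional below
[q] (Hahn-Banach) is integration against a probability measure [mu], with value at most [alpha - u x]
at [phi - u]. As [A |z|^2 + t v] is in the class for [t >= 0] and [v] in PSH, [mu] is a Jensen measure,
and [int phi dmu - B_f (x, mu) <= alpha].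

Convexity is the analytic core. By the arithmetic-geometric inequality, [(dd^c u)^n >= f dV] amounts
to linear inequalities [tr (H D) >= n l] on the complex Hessian [H] of [u], over positive [D] of
determinant one, where [l^n] is [f] up to a constant. Subsolutions satisfy them in the viscosity sense,
because a smooth function touching [u] from above cannot have less Monge-Ampere mass, hence in the
sense of distributions (comparison with the heat flow), and so do their mollifications. This class is
convex, and mollifying at a scale that shrinks towards the boundary and gluing with regularized maxima
approximates its members uniformly by smooth strict subsolutions. *)

(** The obstacle is that [monge_ampere] gives a continuous function no pointwise Hessian: (dd^c u)^n
    is a measure obtained by iterated weak derivatives, and the power of a convex combination is
    hard to bound from below there. Hence the working class, [smoothable], is not defined through
    measures but through pointwise inequalities for mollifications of cut-off functions, which are
    linear in the function. Its members enter as uniform limits of subsolutions, and that suffices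
    because the Perron value is stable under uniform limits. A matrix D of determinant one is
    absorbed into a linear change of variables, so one Laplacian and one Gaussian kernel serve for
    all D. In the constant 2^n c^n n! l^n, the factor 2^n comes from the volume form, c^n from dd^c,
    and n! from expanding the n-th power of a (1,1)-form. On the dual side, Hahn-Banach is applied
    to all functions bounded on the boundary, not only to continuous ones: indicator functions are
    then available, and the representing measure is the image of Lebesgue measure on [0, 1) under an
    explicit map. *)

Local Notation Re := complex.Re.
Local Notation Im := complex.Im.
Local Notation mtR := measurableTypeR.
Local Notation full := [set: 'I_ _]%SET.

Ltac ext := apply/funext.
Ltac bigr := apply: eq_bigr.
Ltac to_EFin := apply/measurable_EFinP.

(** * Finite sums of functions *)

Section function_sums.
Context {T I : Type} {V W : nmodType}.
Variables (Q : (T -> V) -> Prop) (phi : (T -> V) -> W).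
Hypotheses (Q0 : Q (fun=> 0)) (QD : forall f g, Q f -> Q g -> Q (fun z => f z + g z)).

Lemma sum_closed (r : seq I) (P : pred I) (F : I -> T -> V) :
 (forall i, P i -> Q (F i)) -> Q (fun z => \sum_(i <- r | P i) F i z).
move=> QF; elim: r => [|i r IH]; first by under eq_fun do rewrite big_nil.
have [Pi|Pi] := boolP (P i); under eq_fun do rewrite big_cons ?Pi ?(negbTE Pi); last exact: IH.
exact: QD (QF i Pi) IH.
Qed.

Lemma sum_morph (r : seq I) (P : pred I) (F : I -> T -> V) : phi (fun=> 0) = 0 ->
 (forall f g, Q f -> Q g -> phi (fun z => f z + g z) = phi f + phi g) ->
 (forall i, P i -> Q (F i)) -> phi (fun z => \sum_(i <- r | P i) F i z) = \sum_(i <- r | P i) phi (F i).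
move=> p0 pD QF; elim: r => [|i r IH].
 by rewrite big_nil -p0; congr phi; ext => z; rewrite big_nil.
rewrite big_cons -IH; have [Pi|Pi] := boolP (P i).
 rewrite -(pD _ _ (QF i Pi) (sum_closed r QF)).
 by congr phi; ext => z; rewrite big_cons Pi.
by congr phi; ext => z; rewrite big_cons (negbTE Pi).
Qed.

End function_sums.

(** * The norm of C^n with real values *)

Section realnorm.
Context {R : realType} {n : nat}.
Local Notation C := (Cn R n).
Implicit Types (z w v : C).

(** The norm of [Cn R n] has values in [R[i]], whose order is partial; its real part lives in an
    ordered field. It is the maximum of the moduli of the coordinates, not the Euclidean norm. *)
Definition nr z : R := Re `|z|.

Lemma nrE z : `|z| = (nr z)%:C.
rewrite /nr; have : 0 <= `|z| by exact: normr_ge0.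
by case: (`|z|) => a b; rewrite lecE /= => /andP[/eqP -> _].
Qed.

Lemma nr_ge0 z : 0 <= nr z.
by rewrite -lecR -nrE normr_ge0. Qed.
Lemma nr0 : nr 0 = 0.
by rewrite /nr normr0. Qed.
Lemma nrN z : nr (- z) = nr z.
by rewrite /nr normrN. Qed.
Lemma nrB z w : nr (z - w) = nr (w - z).
by rewrite /nr distrC. Qed.
Lemma nrD z w : nr (z + w) <= nr z + nr w.
by rewrite -lecR rmorphD /= -!nrE ler_normD. Qed.

Lemma nrZ (t : R) v : nr (t%:C *: v) = `|t| * nr v.
apply: (@complexI R); rewrite -nrE normrZ nrE rmorphM /=; congr (_ * _).
by rewrite normc_def /= expr0n addr0 sqrtr_sqr.
Qed.

Lemma nrcZ (a : R[i]) v : nr (a *: v) = Re `|a| * nr v.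
apply: (@complexI R); rewrite -nrE normrZ nrE rmorphM /=; congr (_ * _).
Qed.

Lemma nbhs_nr z (U : set C) :
 nbhs z U <-> exists2 r : R, 0 < r & forall w, nr (w - z) < r -> U w.
split.
- move=> /nbhs_ballP[e /= e0 eU].
 have [r r0 er] : exists2 r : R, 0 < r & e = r%:C.
 move: e0; case: e {eU} => a b; rewrite ltcE /= => /andP[/eqP -> a0].
 by exists a.
 exists r => // w wr; apply: eU; rewrite -ball_normE /= er.
 by rewrite nrE nrB ltcR.
- move=> [r r0 rU]; apply/nbhs_ballP; exists r%:C => /=; first by rewrite ltcR.
 by move=> w; rewrite -ball_normE /= nrE nrB ltcR; exact: rU.
Qed.

Lemma nearP_nr z (P : C -> Prop) :
 (\forall w \near z, P w) <-> exists2 r : R, 0 < r & forall w, nr (w - z) < r -> P w.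
exact: nbhs_nr. Qed.

Lemma openP_nr (U : set C) :
 open U <-> forall z, U z -> exists2 r : R, 0 < r & forall w, nr (w - z) < r -> U w.
rewrite openE; split=> [oU z Uz|H z Uz]; first by apply/nbhs_nr; exact: oU.
by apply/nbhs_nr; exact: H.
Qed.

Lemma cont_nr (f : C -> R) z : {for z, continuous f} <->
 forall e, 0 < e -> exists2 r : R, 0 < r & forall w, nr (w - z) < r -> `|f w - f z| < e.
split.
- move=> /cvgrPdist_lt H e e0; have /nearP_nr[r r0 rH] := H e e0.
 by exists r => // w /rH; rewrite distrC.
- move=> H; apply/(@cvgrPdist_lt _ _ _ (nbhs z)) => e e0; apply/nearP_nr.
 have [r r0 rH] := H e e0; exists r => // w /rH.
 by rewrite distrC.
Qed.

Lemma nr_lip z w : `|nr z - nr w| <= nr (z - w).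
have H a b : nr a - nr b <= nr (a - b).
 by rewrite lerBlDr -{1}(subrK b a) nrD.
by rewrite ler_norml lerNl opprB H nrB H.
Qed.

Lemma nr_continuous : continuous nr.
move=> z; apply/cont_nr => e e0; exists e => // w wz.
exact: le_lt_trans (nr_lip _ _) wz.
Qed.

Lemma nr_ball_open z (r : R) : open [set w | nr (w - z) < r].
apply/openP_nr => w /= wr; exists (r - nr (w - z)); first by rewrite subr_gt0.
move=> y yr; rewrite (_ : y - z = (y - w) + (w - z)) //; last first.
 by rewrite addrA subrK.
by apply: le_lt_trans (nrD _ _) _; rewrite -ltrBrDr.
Qed.

Lemma nr_lt z (r : R) : 0 < r -> (nr z < r) = [forall j, `|z 0 j| < r%:C].
move=> r0; have r0' : 0 < (r%:C : R[i]) by rewrite ltcR.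
have -> : (nr z < r) = (`|z| < r%:C) by rewrite nrE ltcR.
apply/idP/forallP => [zr j|H].
 have : ball (0 : C) r%:C z by rewrite -ball_normE /= sub0r normrN.
 by case=> _ /(_ 0 j); rewrite mxE /ball /= sub0r normrN.
have : ball (0 : C) r%:C z.
 by split=> // i j; rewrite (ord1 i) mxE /ball /= sub0r normrN.
by rewrite -ball_normE /= sub0r normrN.
Qed.

Lemma coord_le_nr z j : `|z 0 j| <= (nr z)%:C.
have E : `|z 0 j| = (Re `|z 0 j|)%:C by rewrite normc_def.
rewrite E lecR; apply/ler_addgt0Pr => e e0.
have : nr z < nr z + e by rewrite ltrDl.
rewrite nr_lt; last by rewrite ltr_wpDl// nr_ge0.
by move=> /forallP/(_ j); rewrite E ltcR => /ltW.
Qed.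

Lemma Re_le_nr z j : `|Re (z 0 j)| <= nr z.
rewrite -lecR; apply: le_trans (coord_le_nr z j).
case: (z 0 j) => a b; rewrite normc_def lecR /=.
by rewrite -[leLHS]sqrtr_sqr ler_wsqrtr// lerDl sqr_ge0.
Qed.

Lemma Im_le_nr z j : `|Im (z 0 j)| <= nr z.
rewrite -lecR; apply: le_trans (coord_le_nr z j).
case: (z 0 j) => a b; rewrite normc_def lecR /=.
by rewrite -[leLHS]sqrtr_sqr ler_wsqrtr// lerDr sqr_ge0.
Qed.

(** A modulus is at most sqrt 2 times the larger of the real and imaginary parts; 2 is a convenient
    bound. *)
Lemma nr_le z (r : R) : 0 <= r ->
 (forall j, `|Re (z 0 j)| <= r) -> (forall j, `|Im (z 0 j)| <= r) ->
 nr z <= 2 * r.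
move=> r0 Hr Hi; apply/ler_addgt0Pr => e e0; apply/ltW.
rewrite nr_lt; last by rewrite ltr_wpDl// mulr_ge0.
apply/forallP => j; move: (Hr j) (Hi j); case: (z 0 j) => a b /= ha hb.
rewrite normc_def ltcR /=.
have rr : 0 <= 2 * r + e by lra.
rewrite -(ger0_norm rr) -sqrtr_sqr ltr_sqrt; last by rewrite exprn_gt0//; lra.
rewrite -[a ^+ 2]real_normK ?num_real// -[b ^+ 2]real_normK ?num_real//.
have := normr_ge0 a; have := normr_ge0 b; nra.
Qed.

End realnorm.

(** * Directional derivatives and smoothness on C^n *)

Section along_derive.
Context {R : realType} {n : nat}.
Local Notation C := (Cn R n).
Implicit Types (z w v : C) (f g : C -> R).

Lemma contC (a : R) : continuous (fun _ : C => a).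
by move=> z; apply/cont_nr => e e0; exists 1 => // w _; rewrite subrr normr0. Qed.
Lemma contD f g : continuous f -> continuous g -> continuous (fun z => f z + g z).
by move=> cf cg z; apply: (@cvgD R R C (nbhs z) _ f g); [exact: cf|exact: cg]. Qed.
Lemma contM f g : continuous f -> continuous g -> continuous (fun z => f z * g z).
by move=> cf cg z; apply: (@cvgM R C (nbhs z) _ f g); [exact: cf|exact: cg]. Qed.

Lemma along_shift f z v (s t : R) : along f z v (t + s) = along f (z + s%:C *: v) v t.
rewrite /along; congr (f _).
by rewrite rmorphD /= scalerDl addrCA [RHS]addrC. Qed.

Lemma along0 f z v : along f z v 0 = f z.
by rewrite /along scale0r addr0. Qed.

(** [dder] is total and does not record that the derivative exists. This relation carries existence
    and value together; asking for it at the parameter 0 from every base point gives it all along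
    each line, by translation ([isd_at]). *)
Definition isd v f f' := forall z, is_derive (0 : R) (1 : R) (along f z v) (f' z).

Lemma isdP v f f' : isd v f f' <->
 (forall z, derivable (along f z v) 0 1) /\ dder v f = f'.
split=> [H|[H <-] z].
 split=> [z|]; first by have := H z; case.
 by ext => z; rewrite /dder derive1E; have := H z; case.
by apply: DeriveDef; [exact: H|rewrite /dder derive1E].
Qed.

Lemma isd_at v f f' z (s : R) : isd v f f' ->
 is_derive s (1 : R) (along f z v) (f' (z + s%:C *: v)).
move=> H; have := H (z + s%:C *: v).
have -> : along f (z + s%:C *: v) v = (along f z v) \o shift s.
 by ext => t /=; rewrite along_shift.
have E : (fun h : R => h^-1 *: (((along f z v \o shift s) \o shift 0) (h *: 1) -
 (along f z v \o shift s) 0)) =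
 (fun h : R => h^-1 *: ((along f z v \o shift s) (h *: 1) - along f z v s)).
 by ext => h /=; rewrite addr0 add0r.
by case; rewrite /derivable /derive E => h1 h2; exact: DeriveDef.
Qed.

Lemma line_cont (z v : C) (e : R) : 0 < e ->
 exists2 d : R, 0 < d & forall t : R, `|t| < d -> nr (t%:C *: v) < e.
move=> e0; exists (e / (nr v + 1)); first by rewrite divr_gt0// ltr_wpDl// nr_ge0.
move=> t; rewrite ltr_pdivlMr; last by rewrite ltr_wpDl// nr_ge0.
move=> te; rewrite nrZ; apply: le_lt_trans te.
by rewrite ler_wpM2l// lerDl.
Qed.

Lemma along_continuous f z v : continuous f -> continuous (along f z v).
move=> cf t; apply/(@cvgrPdist_lt _ _ _ (nbhs t)) => e e0.
have /cont_nr/(_ _ e0)[r r0 rH] := cf (z + t%:C *: v).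
have [d d0 dH] := line_cont z v r0.
near=> s; rewrite distrC; apply: rH.
rewrite (_ : _ - _ = (s - t)%:C *: v); last first.
 by rewrite opprD addrACA subrr add0r rmorphB scalerBl.
apply: dH; rewrite distrC; near: s.
exact: (@nbhsx_ballx R R t d d0).
Unshelve. all: by end_near. Qed.

Lemma mvt_along f f' z v (s : R) : continuous f -> isd v f f' -> 0 < s ->
 exists2 c : R, 0 < c < s & f (z + s%:C *: v) - f z = f' (z + c%:C *: v) * s.
move=> cf H s0.
have [||c] := @MVT R (along f z v) (fun t => f' (z + t%:C *: v)) 0 s s0.
- by move=> x _; exact: isd_at.
- by apply: continuous_subspaceT; exact: along_continuous.
rewrite in_itv /= => c0s; rewrite along0 subr0 => E.
by exists c.
Qed.

Lemma CkS k f : Ck k.+1 f <-> continuous f /\ forall v, exists2 f', isd v f f' & Ck k f'.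
split=> [[cf H]|[cf H]]; split=> // v.
 by exists (dder v f); [apply/isdP; split=> //; case: (H v)|case: (H v)].
by have [f' /isdP[h1 h2] h3] := H v; split=> //; rewrite h2.
Qed.

Lemma Ck_cont k f : Ck k f -> continuous f.
by case: k => [|k] []. Qed.

Lemma Ck_pred k f : Ck k.+1 f -> Ck k f.
elim: k f => [f [cf _]|k IH f]; first by split.
move=> [cf H]; split=> // v; have [h1 h2] := H v; split=> //.
exact: IH.
Qed.

Definition sm f := forall k, Ck k f.

Lemma sm_cont f : sm f -> continuous f.
by move=> /(_ 0%N); exact: Ck_cont. Qed.
Lemma sm_isd f v : sm f -> isd v f (dder v f).
by move=> /(_ 1%N) [_ /(_ v)[H _]]; apply/isdP. Qed.
Lemma sm_dder f v : sm f -> sm (dder v f).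
by move=> H k; have [_ /(_ v)[_]] := H k.+1. Qed.
Lemma isd_dder v f f' : isd v f f' -> dder v f = f'.
by move=> /isdP[]. Qed.

(** Coinduction: [Ck] descends one order at a time, so a class of continuous functions stable under
    all directional derivatives never leaves it. Convolutions, affine images and locally smooth
    functions are treated this way. *)
Lemma sm_coind (P : (C -> R) -> Prop) :
 (forall f, P f -> continuous f /\ forall v, exists2 f', isd v f f' & P f') ->
 forall f, P f -> sm f.
move=> H f Pf k; elim: k f Pf => [f /H[]|k IH f /H[cf Hf]]; first by split.
by apply/CkS; split=> // v; have [f' h1 /IH h2] := Hf v; exists f'.
Qed.

Lemma isdD v f f' g g' : isd v f f' -> isd v g g' ->
 isd v (fun z => f z + g z) (fun z => f' z + g' z).
by move=> hf hg z; have := is_deriveD (hf z) (hg z). Qed.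

Lemma isdM v f f' g g' : isd v f f' -> isd v g g' ->
 isd v (fun z => f z * g z) (fun z => f z * g' z + g z * f' z).
by move=> hf hg z; have := is_deriveM (hf z) (hg z); rewrite !along0. Qed.

Lemma isd_cst v (a : R) : isd v (fun=> a) (fun=> 0).
by move=> z; exact: (is_derive_cst a). Qed.
Lemma isdZ v f f' (a : R) : isd v f f' -> isd v (fun z => a * f z) (fun z => a * f' z).
by move=> hf z; have := is_deriveZ a (hf z). Qed.

Lemma sm_cst (a : R) : sm (fun=> a).
apply: (@sm_coind (fun f => exists a, f = fun=> a)); last by exists a.
move=> _ [b ->]; split; first exact: contC.
by move=> v; exists (fun=> 0); [exact: isd_cst|exists 0].
Qed.

Lemma CkD k f g : Ck k f -> Ck k g -> Ck k (fun z => f z + g z).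
elim: k f g => [|k IH] f g Hf Hg.
 by split=> //; exact: contD (Ck_cont Hf) (Ck_cont Hg).
apply/CkS; split; first exact: contD (Ck_cont Hf) (Ck_cont Hg).
move=> v; have [_ hf] := (CkS _ _).1 Hf; have [_ hg] := (CkS _ _).1 Hg.
have [a ha ca] := hf v; have [b hb cb] := hg v.
by exists (fun z => a z + b z); [exact: isdD|exact: IH].
Qed.

Lemma CkM k f g : Ck k f -> Ck k g -> Ck k (fun z => f z * g z).
elim: k f g => [|k IH] f g Hf Hg.
 by split=> //; exact: contM (Ck_cont Hf) (Ck_cont Hg).
apply/CkS; split; first exact: contM (Ck_cont Hf) (Ck_cont Hg).
move=> v; have [_ hf] := (CkS _ _).1 Hf; have [_ hg] := (CkS _ _).1 Hg.
have [a ha ca] := hf v; have [b hb cb] := hg v.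
exists (fun z => f z * b z + g z * a z); first exact: isdM.
by apply: CkD; apply: IH => //; exact: Ck_pred.
Qed.

Lemma smD f g : sm f -> sm g -> sm (fun z => f z + g z).
by move=> hf hg k; exact: CkD. Qed.
Lemma smM f g : sm f -> sm g -> sm (fun z => f z * g z).
by move=> hf hg k; exact: CkM. Qed.
Lemma smZ f (a : R) : sm f -> sm (fun z => a * f z).
by move=> hf; apply: smM => //; exact: sm_cst. Qed.
Lemma smN f : sm f -> sm (fun z => - f z).
by move=> /(smZ (-1)); congr sm; ext => z; rewrite mulN1r. Qed.
Lemma smB f g : sm f -> sm g -> sm (fun z => f z - g z).
by move=> hf hg; apply: smD => //; exact: smN. Qed.

Lemma sm_sum I (r : seq I) (P : pred I) (F : I -> C -> R) :
 (forall i, P i -> sm (F i)) -> sm (fun z => \sum_(i <- r | P i) F i z).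
by move=> H; apply: (@sum_closed C I R) H; [exact: sm_cst|exact: smD]. Qed.

Lemma dderD f g v : sm f -> sm g -> dder v (fun z => f z + g z) = fun z => dder v f z + dder v g z.
by move=> hf hg; apply: isd_dder; apply: isdD; exact: sm_isd. Qed.

Lemma dderM f g v : sm f -> sm g ->
 dder v (fun z => f z * g z) = fun z => f z * dder v g z + g z * dder v f z.
by move=> hf hg; apply: isd_dder; apply: isdM; exact: sm_isd. Qed.

Lemma dderZ f (a : R) v : sm f -> dder v (fun z => a * f z) = fun z => a * dder v f z.
by move=> hf; apply: isd_dder; apply: isdZ; exact: sm_isd. Qed.
Lemma dder_cst (a : R) v : dder v (fun=> a) = fun=> 0.
by apply: isd_dder; exact: isd_cst. Qed.

Lemma dderN f v : sm f -> dder v (fun z => - f z) = fun z => - dder v f z.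
move=> hf; have := dderZ (-1) v hf.
rewrite (_ : (fun z => -1 * f z) = fun z => - f z); last by ext => z; rewrite mulN1r.
by move=> ->; ext => z; rewrite mulN1r.
Qed.

Lemma dderB f g v : sm f -> sm g -> dder v (fun z => f z - g z) = fun z => dder v f z - dder v g z.
by move=> hf hg; rewrite dderD ?dderN//; exact: smN. Qed.

Lemma dder_sum I (r : seq I) (P : pred I) (F : I -> C -> R) v :
 (forall i, P i -> sm (F i)) ->
 dder v (fun z => \sum_(i <- r | P i) F i z) = fun z => \sum_(i <- r | P i) dder v (F i) z.
move=> H; ext => z; apply: (@sum_morph C I R R sm (fun f => dder v f z)) H; [exact: sm_cst|exact: smD|by rewrite dder_cst|].
by move=> f g sf sg; rewrite dderD.
Qed.

End along_derive.

(** * Smooth functions of one real variable *)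

Section smooth1.
Context {R : realType}.
Definition sm1 (h : R -> R) := forall k (x : R), derivable (derive1n k h) x 1.

Lemma sm1_derive h : sm1 h -> sm1 (derive1 h).
by move=> H k x; rewrite -derive1Sn; exact: H. Qed.
Lemma sm1_is_derive h (x : R) : sm1 h -> is_derive x (1 : R) h (derive1 h x).
by move=> H; apply: DeriveDef; [exact: (H 0%N)|rewrite derive1E]. Qed.

Lemma sm1_cont h : sm1 h -> continuous h.
move=> H x; apply: differentiable_continuous; apply/derivable1_diffP.
exact: (H 0%N).
Qed.

Lemma sm1_coind (P : (R -> R) -> Prop) :
 (forall h, P h -> exists2 h', (forall x : R, is_derive x (1 : R) h (h' x)) & P h') ->
 forall h, P h -> sm1 h.
move=> H h Ph k; elim: k h Ph => [|k IH] h Ph x.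
 by have [h' /(_ x)[]] := H h Ph.
have [h' h1 h2] := H h Ph; rewrite derive1Sn (_ : derive1 h = h'); first exact: IH.
by ext => y; rewrite derive1E; case: (h1 y).
Qed.
End smooth1.

(** * Chain rule and local character of smoothness *)

Section compositions.
Context {R : realType} {n : nat}.
Local Notation C := (Cn R n).
Implicit Types (z w v : C) (f g : C -> R).

Lemma isd_comp v (h h' : R -> R) f f' : (forall x : R, is_derive x (1 : R) h (h' x)) ->
 isd v f f' -> isd v (fun z => h (f z)) (fun z => h' (f z) * f' z).
move=> hh hf z.
have := @is_derive1_comp R h (along f z v) 0 (h' (f z)) (f' z).
rewrite along0 => H; have := H (hh _) (hf z).
by rewrite mulrC.
Qed.

Lemma Ck_comp k (h : R -> R) f : sm1 h -> Ck k f -> Ck k (fun z => h (f z)).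
have cc (h' : R -> R) g : sm1 h' -> continuous g -> continuous (fun z => h' (g z)).
 move=> hh' cg z.
 by apply: (@continuous_comp _ _ _ g h'); [exact: cg|have := sm1_cont hh'; apply].
elim: k h f => [|k IH] h f hh Hf; first by split=> //; apply: cc => //; exact: (Ck_cont Hf).
apply/CkS; split; first by apply: cc => //; exact: (Ck_cont Hf).
move=> v; have [_ /(_ v)[a ha ca]] := (CkS _ _).1 Hf.
exists (fun z => derive1 h (f z) * a z).
 by apply: isd_comp => // x; exact: sm1_is_derive.
by apply: CkM => //; apply: IH; [exact: sm1_derive|exact: Ck_pred].
Qed.

Lemma sm_comp (h : R -> R) f : sm1 h -> sm f -> sm (fun z => h (f z)).
by move=> hh hf k; exact: Ck_comp. Qed.

Lemma dder_comp (h : R -> R) f v : sm1 h -> sm f ->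
 dder v (fun z => h (f z)) = fun z => derive1 h (f z) * dder v f z.
move=> hh hf; apply: isd_dder; apply: isd_comp => [x|]; first exact: sm1_is_derive.
exact: sm_isd.
Qed.

Lemma near_line z v (r : R) w : nr (w - z) < r ->
 \forall t \near (0 : R), nr (w + t%:C *: v - z) < r.
move=> wr; have [d d0 dH] := @line_cont R n z v (r - nr (w - z)) ltac:(by rewrite subr_gt0).
near=> t; rewrite addrAC; apply: le_lt_trans (nrD _ _) _.
rewrite -ltrBrDl; apply: dH; rewrite -[t]opprK normrN -[X in `|X|]add0r.
by near: t; exact: (@nbhsx_ballx R R 0 d d0).
Unshelve. all: by end_near. Qed.

Lemma sm_local f :
 (forall z, exists2 g, sm g & exists2 r : R, 0 < r & forall w, nr (w - z) < r -> f w = g w) ->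
 sm f.
apply: (@sm_coind _ _ (fun f => forall z, exists2 g, sm g &
 exists2 r : R, 0 < r & forall w, nr (w - z) < r -> f w = g w)) => {}f H.
split.
 move=> z; have [g sg [r r0 rH]] := H z; apply/cont_nr => e e0.
 have cg := sm_cont sg. have /cont_nr/(_ _ e0)[d d0 dH] := cg z.
 exists (Num.min r d); first by rewrite lt_min r0 d0.
 move=> w; rewrite lt_min => /andP[wr wd]; rewrite !rH ?subrr ?nr0//.
 exact: dH.
move=> v; exists (dder v f).
 apply/isdP; split=> // z; have [g sg [r r0 rH]] := H z.
 have : derivable (along g z v) 0 1 by have [] := sm_isd v sg z.
 apply: near_eq_derivable; have := @near_line z v r z; rewrite subrr nr0 => /(_ r0).
 by apply: filterS => t tr; rewrite /along rH.
move=> z; have [g sg [r r0 rH]] := H z; exists (dder v g); first exact: sm_dder.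
exists r => // w wr; rewrite /dder !derive1E; apply: near_eq_derive.
by have := near_line v wr; apply: filterS => t tr; rewrite /along rH.
Qed.

Lemma dder_near f g v z (r : R) : 0 < r ->
 (forall w, nr (w - z) < r -> f w = g w) -> dder v f z = dder v g z.
move=> r0 rH; rewrite /dder !derive1E; apply: near_eq_derive.
have [d d0 dH] := @line_cont R n z v r r0.
near=> t; rewrite /along rH// addrC addKr; apply: dH.
rewrite -[t]opprK normrN -[X in `|X|]add0r.
by near: t; exact: (@nbhsx_ballx R R 0 d d0).
Unshelve. all: by end_near. Qed.

End compositions.

Arguments sm_cont {R n f} _ _.
Arguments sm1_cont {R h} _ _.
Arguments Ck_cont {R n k f} _ _.

Lemma add2_subl (V : zmodType) (z a b : V) : z + a + b - z = a + b.
by rewrite -(addrA z a b) addrAC subrr add0r. Qed.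

Lemma three_close (R : realType) (e a b a' b' d : R) : `|a + b - d| < e / 3 -> `|b - b'| < e / 3 ->
 `|a - a'| < e / 3 -> `|d - (a' + b')| <= e.
rewrite !ltr_norml ler_norml => /andP[? ?] /andP[? ?] /andP[? ?].
by apply/andP; split; lra.
Qed.

(** * Linearity in the direction and symmetry of second derivatives *)

Section directions.
Context {R : realType} {n : nat}.
Local Notation C := (Cn R n).
Implicit Types (z w v : C) (f g : C -> R).

(** Mean value theorems give equality only at two unknown points; these are as close to [z] as
    wished, and continuity brings the equality to [z]. *)
Lemma eq_of_near (F G : C -> R) z (K : R) : continuous F -> continuous G ->
 (forall s : R, 0 < s -> exists z1, exists2 z2, F z1 = G z2 &
 nr (z1 - z) <= s * K /\ nr (z2 - z) <= s * K) -> F z = G z.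
move=> cF cG H; apply/eqP; rewrite -subr_eq0 -normr_le0.
apply/ler_addgt0Pr => e e0; rewrite add0r.
have e2 : 0 < e / 2 by rewrite divr_gt0.
have /cont_nr/(_ _ e2)[r r0 rF] := cF z.
have /cont_nr/(_ _ e2)[r' r'0 rG] := cG z.
pose m := Num.min r r'; have m0 : 0 < m by rewrite lt_min r0 r'0.
pose s := m / (`|K| + 1); have K0 : 0 < `|K| + 1 by rewrite ltr_wpDl.
have s0 : 0 < s by rewrite divr_gt0.
have sK : s * K < m.
 apply: (@le_lt_trans _ _ (s * `|K|)); first by rewrite ler_wpM2l ?ler_norm// ltW.
 by rewrite /s mulrAC ltr_pdivrMr// ltr_pM2l// ltrDl.
have [z1 [z2 E [h1 h2]]] := H s s0.
have /rF a1 : nr (z1 - z) < r by apply: le_lt_trans h1 _; apply: lt_le_trans sK _; rewrite ge_min lexx.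
have /rG a2 : nr (z2 - z) < r' by apply: le_lt_trans h2 _; apply: lt_le_trans sK _; rewrite ge_min lexx orbT.
rewrite (_ : F z - G z = (G z2 - G z) - (F z1 - F z)); last by rewrite E; ring.
by apply: le_trans (ler_normB _ _) _; lra.
Qed.

(** [sm] speaks only of derivatives along lines. The increment along [v + w] is the sum of one along
    [v] and one along [w]; the mean value theorem is applied to all three and continuity of the
    derivatives concludes. *)
Lemma dder_addv f v w : sm f -> dder (v + w) f = fun z => dder v f z + dder w f z.
move=> sf; ext => z.
pose K := nr v + nr w.
have sv := sm_dder v sf; have sw := sm_dder w sf; have svw := sm_dder (v + w) sf.
apply/eqP; rewrite -subr_eq0 -normr_le0; apply/ler_addgt0Pr => e e0; rewrite add0r.
have e3 : 0 < e / 3 by rewrite divr_gt0.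
have /cont_nr/(_ _ e3)[r1 r10 H1] := sm_cont sv z.
have /cont_nr/(_ _ e3)[r2 r20 H2] := sm_cont sw z.
have /cont_nr/(_ _ e3)[r3 r30 H3] := sm_cont svw z.
pose m := Num.min r1 (Num.min r2 r3).
have m0 : 0 < m by rewrite !lt_min r10 r20 r30.
have [d d0 dv] := @line_cont R n z v (m / 2) ltac:(by rewrite divr_gt0).
have [d' d'0 dw] := @line_cont R n z w (m / 2) ltac:(by rewrite divr_gt0).
pose s := (Num.min d d') / 2.
have s0 : 0 < s by rewrite divr_gt0// lt_min d0 d'0.
have hlt (x y : R) : 0 < x -> x <= y -> x / 2 < y by move=> *; lra.
have md0 : 0 < Num.min d d' by rewrite lt_min d0 d'0.
have sd : s < d by apply: hlt md0 _; rewrite ge_min lexx.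
have sd' : s < d' by apply: hlt md0 _; rewrite ge_min lexx orbT.
have [c1 /andP[c10 c1s] E1] := mvt_along (z) (sm_cont sf) (sm_isd v sf) s0.
have [c2 /andP[c20 c2s] E2] := mvt_along (z + s%:C *: v) (sm_cont sf) (sm_isd w sf) s0.
have [c3 /andP[c30 c3s] E3] := mvt_along (z) (sm_cont sf) (sm_isd (v + w) sf) s0.
have nv c : 0 < c -> c <= s -> nr (c%:C *: v) < m / 2.
 by move=> c0 cs; apply: dv; rewrite gtr0_norm//; exact: le_lt_trans cs sd.
have nw c : 0 < c -> c <= s -> nr (c%:C *: w) < m / 2.
 by move=> c0 cs; apply: dw; rewrite gtr0_norm//; exact: le_lt_trans cs sd'.
have hm r : m <= r -> m / 2 <= r.
 by move=> mr; apply: le_trans mr; exact: ltW (hlt _ _ m0 (lexx _)).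
have nvw c c' r : 0 < c -> c <= s -> 0 < c' -> c' <= s -> m <= r ->
 nr (c%:C *: v + c'%:C *: w) < r.
 move=> c0 cs c'0 c's mr; apply: lt_le_trans mr; apply: le_lt_trans (nrD _ _) _.
 by rewrite [ltRHS]splitr; apply: ltrD; [exact: nv|exact: nw].
have m1 : m <= r1 by rewrite ge_min lexx.
have m2 : m <= r2 by rewrite !ge_min lexx orbT.
have m3 : m <= r3 by rewrite !ge_min lexx !orbT.
have := H1 (z + c1%:C *: v); rewrite addrC addKr => /(_ (lt_le_trans (nv _ c10 (ltW c1s)) (hm _ m1))).
have := H2 (z + s%:C *: v + c2%:C *: w).
rewrite add2_subl.
move=> /(_ (nvw _ _ _ s0 (lexx _) c20 (ltW c2s) m2)).
have := H3 (z + c3%:C *: (v + w)); rewrite addrC addKr scalerDr.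
move=> /(_ (nvw _ _ _ c30 (ltW c3s) c30 (ltW c3s) m3)).
have E4 : s * dder (v + w) f (z + c3%:C *: (v + w)) =
 s * (dder v f (z + c1%:C *: v) + dder w f (z + s%:C *: v + c2%:C *: w)).
 move: E1 E2 E3; rewrite scalerDr addrA => E1 E2 E3.
 by rewrite mulrDr [s * dder v _ _]mulrC [s * dder w _ _]mulrC -E1 -E2 mulrC -E3; ring.
have := mulfI (lt0r_neq0 s0) E4; rewrite scalerDr !addrA => ->.
move: (dder v f _) (dder w f _) (dder v f z) (dder w f z) (dder (v + w) f z) => a b a' b' d''.
exact: three_close.
Qed.

Lemma dder_scalev f v (a : R) : sm f -> dder (a%:C *: v) f = fun z => a * dder v f z.
move=> sf; apply: isd_dder => z.
have -> : along f z (a%:C *: v) = along f z v \o (fun t => a * t).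
 by ext => t /=; rewrite /along scalerA -rmorphM mulrC.
have h : is_derive (0:R) (1:R) (fun t : R => a * t) a.
 by have := is_deriveZ a (is_derive_id (0 : R) (1 : R)); rewrite /GRing.scale /= mulr1.
have h2 : is_derive (a * 0) (1 : R) (along f z v) (dder v f z).
 by rewrite mulr0; exact: sm_isd.
by have := is_derive1_comp h2 h; rewrite mulrC.
Qed.

(** The second difference of [f] is symmetric in [v] and [w], and two mean value theorems turn it
    into either mixed derivative at a nearby point, times [s * s]. *)
Lemma dder_comm f v w : sm f -> dder v (dder w f) = dder w (dder v f).
move=> sf; ext => z.
apply: (@eq_of_near _ _ z (nr v + nr w)).
- exact/sm_cont/sm_dder/sm_dder.
- exact/sm_cont/sm_dder/sm_dder.
move=> s s0.
have key v' w' : exists2 y, f (z + s%:C *: v' + s%:C *: w') - f (z + s%:C *: v') -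
 f (z + s%:C *: w') + f z = dder w' (dder v' f) y * s * s & nr (y - z) <= s * (nr v' + nr w').
 pose g : C -> R := fun y : C => f (y + s%:C *: w') - f y.
 have sg : isd v' g (fun y => dder v' f (y + s%:C *: w') - dder v' f y).
 move=> y; have h1 := sm_isd v' sf (y + s%:C *: w'); have h2 := sm_isd v' sf y.
 have := is_deriveB h1 h2; congr (is_derive _ _ _ _).
 by ext => t; rewrite /along /g /= fctE addrAC.
 have cg : continuous g.
 move=> y; apply/cont_nr => e e0; have e2 : 0 < e / 2 by rewrite divr_gt0.
 have /cont_nr/(_ _ e2)[r r0 H] := sm_cont sf (y + s%:C *: w').
 have /cont_nr/(_ _ e2)[r' r'0 H'] := sm_cont sf y.
 exists (Num.min r r'); first by rewrite lt_min r0 r'0.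
 move=> x; rewrite lt_min => /andP[xr xr'].
 have := H (x + s%:C *: w'); rewrite opprD addrACA subrr addr0 => /(_ xr).
 have := H' _ xr'; rewrite /g !ltr_norml => /andP[? ?] /andP[? ?].
 by apply/andP; split; lra.
 have [c /andP[c0 cs] E] := mvt_along z cg sg s0.
 have [c' /andP[c'0 c's] E'] := mvt_along (z + c%:C *: v') (sm_cont (sm_dder v' sf)) (sm_isd w' (sm_dder v' sf)) s0.
 exists (z + c%:C *: v' + c'%:C *: w').
 by rewrite -E' -E /g; ring.
 rewrite add2_subl; apply: le_trans (nrD _ _) _; rewrite !nrZ mulrDr.
 by apply: lerD; apply: ler_wpM2r => //; rewrite ?nr_ge0// gtr0_norm// ltW.
have [y1 E1 n1] := key w v; have [y2 E2 n2] := key v w.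
exists y1, y2; last by split=> //; rewrite [nr v + _]addrC.
apply: (mulIf (lt0r_neq0 s0)); apply: (mulIf (lt0r_neq0 s0)).
apply: etrans (esym E1) _; apply: etrans E2; congr (_ + _).
rewrite (addrAC z) -!addrA; congr (_ + _); exact: addrC.
Qed.

Lemma isd_linear (l : C -> R) v : (forall z w (t : R), l (z + t%:C *: w) = l z + t * l w) ->
 isd v l (fun=> l v).
move=> H z.
have -> : along l z v = (fun t : R => l z + t * l v) by ext => t; rewrite /along H.
have h : is_derive (0 : R) (1 : R) (fun t : R => t * l v) (l v).
 have := is_deriveZ (l v) (is_derive_id (0 : R) (1 : R)); rewrite /GRing.scale /= mulr1.
 by congr (is_derive _ _ _ _); ext => t; rewrite /= mulrC.
by have := is_deriveD (is_derive_cst (l z) (0 : R) (1 : R)) h; rewrite add0r.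
Qed.

Lemma sm_linear (l : C -> R) : continuous l ->
 (forall z w (t : R), l (z + t%:C *: w) = l z + t * l w) -> sm l.
move=> cl H.
apply: (@sm_coind _ _ (fun f => f = l \/ exists a, f = fun=> a)); last by left.
move=> f [->|[a ->]]; split.
- exact: cl.
- by move=> v; exists (fun=> l v); [exact: isd_linear|right; exists (l v)].
- exact: contC.
- by move=> v; exists (fun=> 0); [exact: isd_cst|right; exists 0].
Qed.

Definition xr (j : 'I_n) z : R := Re (z 0 j).
Definition xi (j : 'I_n) z : R := Im (z 0 j).

Lemma xr_lin j z w (t : R) : xr j (z + t%:C *: w) = xr j z + t * xr j w.
by rewrite /xr !mxE; case: (z 0 j) (w 0 j) => a b [c d] /=; rewrite mul0r subr0. Qed.
Lemma xi_lin j z w (t : R) : xi j (z + t%:C *: w) = xi j z + t * xi j w.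
by rewrite /xi !mxE; case: (z 0 j) (w 0 j) => a b [c d] /=; rewrite mul0r addr0. Qed.

Lemma sm_xr j : sm (xr j).
apply: sm_linear; last exact: xr_lin.
move=> z; apply/cont_nr => e e0; exists e => // w wz.
have := xr_lin j w z (-1); rewrite mulN1r => <-.
by rewrite rmorphN scaleN1r; apply: le_lt_trans wz; exact: Re_le_nr.
Qed.

Lemma sm_xi j : sm (xi j).
apply: sm_linear; last exact: xi_lin.
move=> z; apply/cont_nr => e e0; exists e => // w wz.
have := xi_lin j w z (-1); rewrite mulN1r => <-.
by rewrite rmorphN scaleN1r; apply: le_lt_trans wz; exact: Im_le_nr.
Qed.

Lemma dder_xr j v : dder v (xr j) = fun=> xr j v.
by apply: isd_dder; apply: isd_linear => *; exact: xr_lin. Qed.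
Lemma dder_xi j v : dder v (xi j) = fun=> xi j v.
by apply: isd_dder; apply: isd_linear => *; exact: xi_lin. Qed.

(** The squared Euclidean norm |z|^2: unlike [nr] it is smooth, and its complex Hessian is the
    identity. It serves as barrier, as reservoir of strict plurisubharmonicity and as exponent of
    the Gaussian. *)
Definition E2 z : R := \sum_j (xr j z ^+ 2 + xi j z ^+ 2).

Lemma sm_E2 : sm E2.
apply: sm_sum => j _; apply: smD.
 by under eq_fun do rewrite expr2; apply: smM; exact: sm_xr.
by under eq_fun do rewrite expr2; apply: smM; exact: sm_xi.
Qed.

Lemma sm_shift f a : sm f -> sm (fun z => f (z + a)).
move=> sf; apply: (@sm_coind _ _ (fun h => exists2 f, sm f & h = fun z => f (z + a))); last by exists f.
move=> _ [g sg ->]; split.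
 move=> z; apply/cont_nr => e e0; have /cont_nr/(_ _ e0)[r r0 H] := sm_cont sg (z + a).
 by exists r => // w wr; apply: H; rewrite opprD addrACA subrr addr0.
move=> v; exists (fun z => dder v g (z + a)); last by exists (dder v g) => //; exact: sm_dder.
move=> z; have := sm_isd v sg (z + a); congr (is_derive _ _ _ _).
by ext => t; rewrite /along addrAC.
Qed.

Lemma dder_shift f a v : dder v (fun z => f (z + a)) = fun z => dder v f (z + a).
ext => z; rewrite /dder; congr (derive1 _ 0).
by ext => t; rewrite /along addrAC.
Qed.

End directions.

(** * Affine changes of variables *)

Section affine.
Context {R : realType} {n : nat}.
Local Notation C := (Cn R n).

Lemma mulmx_bounded (B : 'M[R[i]]_n) : exists2 K : R, 0 < K & forall v : C, nr (v *m B : C) <= K * nr v.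
pose M := \sum_(i : 'I_n) \sum_(j : 'I_n) Re `|B i j|.
have nn (a : R[i]) : 0 <= Re `|a| by have := normr_ge0 a; rewrite normc_def lecR.
have nE (a : R[i]) : `|a| = (Re `|a|)%:C by rewrite normc_def.
have M0 : 0 <= M by apply: sumr_ge0 => i _; apply: sumr_ge0 => j _.
exists (M + 1) => [|v]; first by rewrite ltr_wpDl.
apply/ler_addgt0Pr => e e0; apply/ltW; rewrite nr_lt; last first.
 by rewrite ltr_wpDl// mulr_ge0// ?nr_ge0// addr_ge0.
apply/forallP => j; rewrite mxE; apply: le_lt_trans (ler_norm_sum _ _ _) _.
apply: (@le_lt_trans _ _ (M * nr v)%:C); last first.
 rewrite ltcR mulrDl mul1r -addrA ltrDl ltr_wpDl ?nr_ge0//.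
rewrite /M mulr_suml rmorph_sum /=; apply: ler_sum => i _.
rewrite normrM (nE (B i j)).
rewrite rmorphM /= [leRHS]mulrC; apply: ler_pM; rewrite ?normr_ge0//.
- by have := nn (B i j); rewrite -lecR.
- exact: coord_le_nr.
- by rewrite lecR (bigD1 j)//= lerDl sumr_ge0// => k _; exact: nn.
Qed.

Lemma sm_affine (f : C -> R) (a : C) (B : 'M[R[i]]_n) : sm f -> sm (fun z : C => f (a + z *m B)).
move=> sf; apply: (@sm_coind _ _ (fun h => exists2 f, sm f & h = fun z : C => f (a + z *m B))); last by exists f.
move=> _ [g sg ->]; have [K K0 HK] := mulmx_bounded B; split.
 move=> z; apply/cont_nr => e e0; have /cont_nr/(_ _ e0)[r r0 H] := sm_cont sg (a + z *m B).
 exists (r / K); first by rewrite divr_gt0.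
 move=> w wr; apply: H; rewrite opprD addrACA subrr add0r -mulmxBl.
 by apply: le_lt_trans (HK _) _; rewrite mulrC -ltr_pdivlMr.
move=> v; exists (fun z : C => dder (v *m B) g (a + z *m B)); last by exists (dder (v *m B) g) => //; exact: sm_dder.
move=> z; have := sm_isd (v *m B) sg (a + z *m B); congr (is_derive _ _ _ _).
by ext => t; rewrite /along mulmxDl -scalemxAl addrA.
Qed.

Lemma dder_affine (f : C -> R) (a : C) (B : 'M[R[i]]_n) v :
 dder v (fun z : C => f (a + z *m B)) = fun z : C => dder (v *m B) f (a + z *m B).
ext => z; rewrite /dder; congr (derive1 _ 0).
by ext => t; rewrite /along mulmxDl -scalemxAl addrA.
Qed.
End affine.

(** * Smooth steps and the regularized maximum *)

Section smooth1_algebra.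
Context {R : realType}.
Implicit Types (f g h : R -> R).

(** The derivative of a member is again a member, so a single coinduction in [sm1_algP] covers all
    sums, products, compositions and inverses. *)
Inductive sm1_alg : (R -> R) -> Prop :=
| sa_base h of sm1 h : sm1_alg h
| sa_add f g of sm1_alg f & sm1_alg g : sm1_alg (fun x => f x + g x)
| sa_mul f g of sm1_alg f & sm1_alg g : sm1_alg (fun x => f x * g x)
| sa_comp f g of sm1_alg f & sm1_alg g : sm1_alg (fun x => f (g x))
| sa_inv f of sm1_alg f & (forall x, f x != 0) : sm1_alg (fun x => (f x)^-1).

Lemma derivable_const (a x : R) : is_derive x (1 : R) (fun _ : R => a) 0.
exact: is_derive_cst. Qed.

Lemma sm1_cst (a : R) : sm1 (fun=> a).
apply: (@sm1_coind _ (fun f => exists a, f = fun=> a)); last by exists a.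
by move=> _ [b ->]; exists (fun=> 0); [move=> x; exact: derivable_const|exists 0].
Qed.

Lemma sm1_algP f : sm1_alg f -> sm1 f.
apply: sm1_coind => {}f; elim.
- move=> h hh; exists (derive1 h); first by move=> x; exact: sm1_is_derive.
 exact/sa_base/sm1_derive.
- move=> {}f g _ [f' hf af] _ [g' hg ag]; exists (fun x => f' x + g' x).
 by move=> x; exact: is_deriveD.
 exact: sa_add.
- move=> {}f g sf [f' hf af] sg [g' hg ag]; exists (fun x => f x * g' x + g x * f' x).
 by move=> x; exact: is_deriveM.
 by apply: sa_add; exact: sa_mul.
- move=> {}f g sf [f' hf af] sg [g' hg ag]; exists (fun x => f' (g x) * g' x).
 by move=> x; exact: is_derive1_comp.
 by apply: sa_mul => //; exact: (@sa_comp f' g).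
- move=> {}f sf [f' hf af] f0; exists (fun x => (fun=> -1) x * ((f x)^-1 * (f x)^-1) * f' x).
 move=> x; have := is_deriveV (f0 x) (hf x).
 by rewrite /GRing.scale /= mulN1r expr2 invfM.
 apply: sa_mul => //; apply: sa_mul; first exact/sa_base/sm1_cst.
 by apply: sa_mul; exact: sa_inv.
Qed.

Lemma sm1_id : sm1 (fun x : R => x).
apply: (@sm1_coind _ (fun f => f = id \/ exists a, f = fun=> a)); last by left.
move=> _ [->|[b ->]].
 by exists (fun=> 1); [move=> x; exact: is_derive_id|right; exists 1].
by exists (fun=> 0); [move=> x; exact: derivable_const|right; exists 0].
Qed.

Lemma sm1_expR : sm1 (@expR R).
apply: (@sm1_coind _ (fun f => f = @expR R)) => // _ ->.
by exists (@expR R) => // x; exact: is_derive_expR.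
Qed.

Lemma is_derive_quad0 f (K : R) : f 0 = 0 -> (forall t, `|t| <= 1 -> `|f t| <= K * t ^+ 2) ->
 is_derive (0 : R) (1 : R) f 0.
move=> f0 H.
have H' : (fun h : R => h^-1 *: ((f \o shift 0) (h *: (1 : R)) - f 0)) @ 0^' --> (0 : R).
 apply/cvgrPdist_le => e e0; near=> t.
 have t0 : t != 0 by near: t; exact: nbhs_dnbhs_neq.
 have t1 : `|t| <= Num.min 1 (e / (`|K| + 1)).
 near: t; apply: dnbhs0_le; rewrite lt_min ltr01 divr_gt0// ltr_wpDl//.
 move: t1; rewrite le_min => /andP[t1 te].
 rewrite sub0r normrN /= addr0 f0 subr0 [t *: 1]mulr1 normrM normfV.
 rewrite ler_pdivrMl ?normr_gt0//; apply: le_trans (H _ t1) _.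
 rewrite -real_normK ?num_real// expr2 mulrCA ler_wpM2l//.
 apply: (@le_trans _ _ ((`|K| + 1) * `|t|)).
 by rewrite ler_wpM2r// (le_trans (ler_norm _))// lerDl.
 by rewrite mulrC -ler_pdivlMr// ltr_wpDl.
by apply: DeriveDef; [apply/cvg_ex; exists 0; exact: H'|apply: cvg_lim => //; exact: H'].
Unshelve. all: by end_near. Qed.

(** The family p(1/t) exp(-1/t), extended by 0, is stable under differentiation: p becomes X^2 (p -
    p'). The general polynomial makes smoothness at 0 a coinduction. *)
Definition flatp (p : {poly R}) (t : R) : R := if 0 < t then p.[t^-1] * expR (- t^-1) else 0.

Lemma expr_cancel_aux (F x X : R) : F != 0 -> x != 0 -> F * x^-1 ^+ 2 * (x * (x * X) / F) = X.
by move=> F0 x0; field; rewrite F0 x0. Qed.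

(** One term of the power series of exp(1/t) dominates p(1/t) / t^2. The quadratic bound yields the
    derivative 0 at the origin through [is_derive_quad0]. *)
Lemma flatp_bound (p : {poly R}) : exists K : R, forall t, `|t| <= 1 -> `|flatp p t| <= K * t ^+ 2.
(* The power [m.+1] exceeds [size p] by two, which leaves the factor [t ^+ 2]. *)
pose M := \sum_(i < size p) `|p`_i|; pose m := (size p).+1.
exists (M * m.+1`!%:R) => t t1; rewrite /flatp; case: ifPn => [t0|_]; last first.
 by rewrite normr0 mulr_ge0 ?sqr_ge0// mulr_ge0// sumr_ge0.
set x := t^-1; have x0 : 0 < x by rewrite invr_gt0.
have x1 : 1 <= x by rewrite invf_ge1//; rewrite gtr0_norm in t1.
have hp : `|p.[x]| <= M * x ^+ (size p).
 rewrite horner_coef /M mulr_suml; apply: le_trans (ler_norm_sum _ _ _) _.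
 apply: ler_sum => i _; rewrite normrM ler_wpM2l// normrX gtr0_norm//.
 by rewrite ler_weXn2l// ltnW.
rewrite normrM [`|expR _|]gtr0_norm ?expR_gt0//.
apply: le_trans (ler_wpM2r (ltW (expR_gt0 _)) hp) _.
rewrite -mulrA -[leRHS]mulrA ler_wpM2l ?sumr_ge0//.
rewrite expRN ler_pdivrMr ?expR_gt0//.
have := expR_ge1Dxn m (ltW x0) => H.
have {}H : x ^+ m.+1 / m.+1`!%:R <= expR x by apply: le_trans H; rewrite lerDr.
have f0 : 0 < m.+1`!%:R :> R by rewrite ltr0n fact_gt0.
apply: le_trans (_ : m.+1`!%:R * t ^+ 2 * (x ^+ m.+1 / m.+1`!%:R) <= _); last first.
 by rewrite ler_wpM2l// mulr_ge0 ?sqr_ge0// ltW.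
have tx : t = x^-1 by rewrite invrK.
have -> : x ^+ m.+1 = x * (x * x ^+ size p) by rewrite /m !exprS.
by rewrite tx expr_cancel_aux// gt_eqF.
Qed.

Lemma sm1_flatp p : sm1 (flatp p).
apply: (@sm1_coind _ (fun f => exists p, f = flatp p)); last by exists p.
move=> _ [{}p ->]; pose q := 'X^2 * (p - p^`()).
exists (flatp q); last by exists q.
move=> x; have [x0|x0|<-] := ltgtP 0 x; last first.
- rewrite {2}/flatp ltxx; have [K HK] := flatp_bound p.
 by apply: is_derive_quad0 HK; rewrite /flatp ltxx.
- rewrite [flatp q x]/flatp ltNge (ltW x0) /=.
 apply: near_eq_is_derive (derivable_const 0 x).
 by near=> t; rewrite /flatp ltNge ltW//; near: t; exact: lt_nbhsl.
- rewrite [flatp q x]/flatp x0.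
 have hV : is_derive x (1 : R) (fun t : R => t^-1) (- x ^- 2).
 have := is_deriveV (f := id) (lt0r_neq0 x0) (is_derive_id x (1 : R)).
 by rewrite /GRing.scale /= mulr1.
 have h1 : is_derive x (1 : R) (fun t : R => p.[t^-1]) (p^`().[x^-1] * - x ^- 2).
 exact: (is_derive1_comp (is_derive_poly p x^-1) hV).
 have h2 : is_derive x (1 : R) (fun t : R => expR (- t^-1)) (expR (- x^-1) * x ^- 2).
 have hN : is_derive x (1 : R) (fun t : R => - t^-1) (x ^- 2).
 by have := is_deriveN hV; rewrite opprK.
 exact: (@is_derive1_comp R expR (fun t : R => - t^-1) x _ _ (is_derive_expR _) hN).
 have := is_deriveM h1 h2; rewrite /GRing.scale /= => H.
 have E : q.[x^-1] * expR (- x^-1) = p.[x^-1] * (expR (- x^-1) * x ^- 2) +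
 expR (- x^-1) * (p^`().[x^-1] * - x ^- 2).
 rewrite /q hornerM hornerXn hornerD hornerN.
 by move: p.[_] (p^`()).[_] (expR _) => a b c; field; rewrite gt_eqF.
 rewrite E; apply: near_eq_is_derive H.
 by near=> t; rewrite /flatp ifT//; near: t; exact: lt_nbhsr.
Unshelve. all: by end_near. Qed.

Definition flat : R -> R := flatp 1.

Lemma flatE t : flat t = if 0 < t then expR (- t^-1) else 0.
by rewrite /flat /flatp; case: ifP => // _; rewrite hornerE mul1r. Qed.
Lemma flat_ge0 t : 0 <= flat t.
by rewrite flatE; case: ifP => // _; rewrite ltW// expR_gt0. Qed.
Lemma flat_gt0 t : 0 < t -> 0 < flat t.
by rewrite flatE => ->; exact: expR_gt0. Qed.
Lemma flat_eq0 t : t <= 0 -> flat t = 0.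
by rewrite flatE ltNge => ->. Qed.

Lemma sm1_flat : sm1 flat. Proof. exact: sm1_flatp. Qed.

Lemma flat_ndecr x y : x <= y -> flat x <= flat y.
move=> xy; rewrite !flatE; have [x0|x0] := ltP 0 x; last first.
 by case: ifP => // _; rewrite ltW// expR_gt0.
rewrite (lt_le_trans x0 xy) ler_expR lerN2 lef_pV2// posrE//.
exact: lt_le_trans xy.
Qed.

(** It rises from 0 at -1 to 1 at 1. The symmetry [stepN] is what makes its primitive exactly the
    identity beyond 1. *)
Definition step t : R := flat (1 + t) / (flat (1 + t) + flat (1 - t)).

Lemma step_den t : 0 < flat (1 + t) + flat (1 - t).
have [t0|t0] := lerP 0 t.
 by rewrite ltr_pwDl ?flat_ge0// flat_gt0// ltr_pwDl.
by rewrite ltr_wpDl ?flat_ge0// flat_gt0// subr_gt0 (lt_trans t0).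
Qed.

Lemma sm1_step : sm1 step.
apply: sm1_algP.
have h1 : sm1_alg (fun t : R => 1 + t).
 by apply: sa_add; apply: sa_base; [exact: sm1_cst|exact: sm1_id].
have h2 : sm1_alg (fun t : R => 1 - t).
 have -> : (fun t : R => 1 - t) = (fun t : R => 1 + (-1) * t).
 by ext => t; rewrite mulN1r.
 apply: sa_add; first exact/sa_base/sm1_cst.
 by apply: sa_mul; apply: sa_base; [exact: sm1_cst|exact: sm1_id].
have hf := sa_base sm1_flat.
apply: sa_mul; first exact: (sa_comp hf h1).
apply: sa_inv; last by move=> x; rewrite gt_eqF// step_den.
by apply: sa_add; [exact: (sa_comp hf h1)|exact: (sa_comp hf h2)].
Qed.

Lemma step_ge0 t : 0 <= step t.
by rewrite divr_ge0// ?flat_ge0// ltW// step_den. Qed.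
Lemma step_le1 t : step t <= 1.
by rewrite ler_pdivrMr ?step_den// mul1r lerDl flat_ge0. Qed.
Lemma step_eq0 t : t <= -1 -> step t = 0.
by move=> t1; rewrite /step flat_eq0 ?mul0r//; lra. Qed.

Lemma step_eq1 t : 1 <= t -> step t = 1.
move=> t1; rewrite /step (@flat_eq0 (1 - t)) ?subr_le0// addr0 divff// gt_eqF// flat_gt0//; lra.
Qed.

Lemma stepN t : step (- t) = 1 - step t.
have := step_den t => d; rewrite /step opprK [flat (1 - t) + _]addrC.
apply: (mulIf (lt0r_neq0 d)); rewrite mulrBl mul1r !divfK ?gt_eqF//; ring.
Qed.

Lemma step_ndecr x y : x <= y -> step x <= step y.
move=> xy; rewrite /step ler_pdivrMr ?step_den// mulrAC ler_pdivlMr ?step_den//.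
have h1 : flat (1 + x) <= flat (1 + y) by apply: flat_ndecr; lra.
have h2 : flat (1 - y) <= flat (1 - x) by apply: flat_ndecr; lra.
have := flat_ge0 (1 + x); have := flat_ge0 (1 - y); nra.
Qed.

Lemma step_derive_ge0 t : 0 <= derive1 step t.
rewrite derive1E; apply: (@le_trans _ _ (lim ((fun h : R => h^-1 *: ((step \o shift t) (h *: (1 : R)) - step t)) @ 0^'))) => //.
have [d _] := sm1_is_derive t sm1_step.
apply: limr_ge => //; near=> h; have h0 : h != 0 by near: h; exact: nbhs_dnbhs_neq.
rewrite /= [h *: 1]mulr1 /GRing.scale /=.
have [hp|hn] := ltP 0 h.
 by apply: mulr_ge0; [rewrite invr_ge0 ltW|rewrite subr_ge0 step_ndecr// lerDr ltW].
by apply: mulr_le0; [rewrite invr_le0|rewrite subr_le0 step_ndecr// gerDr].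
Unshelve. all: by end_near. Qed.

(** A smooth convex version of max(t, 0). As [step] vanishes below -1, starting the integral at -2
    loses nothing and keeps every t >= -1 inside the range of the fundamental theorem of
    calculus. *)
Definition smax0 (t : R) : R := \int[lebesgue_measure]_(s in `[(-2 : R), t]) step s.

Lemma smax0_eq0 t : t <= -1 -> smax0 t = 0.
move=> t1; rewrite /smax0 (@eq_Rintegral _ _ _ lebesgue_measure `[(-2 : R), t]%classic (fun=> 0)) ?Rintegral_cst ?mul0r//.
by move=> s; rewrite inE /= in_itv /= => /andP[_ st]; rewrite step_eq0// (le_trans st).
Qed.

Lemma smax0_derive (t : R) : is_derive t (1 : R) smax0 (step t).
have [t1|t1] := ltP t (-1).
 rewrite step_eq0 ?ltW//; apply: near_eq_is_derive (derivable_const 0 t).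
 by near=> s; rewrite smax0_eq0// ltW//; near: s; exact: lt_nbhsl.
have tt : t < t + 1 by rewrite ltrDl.
have cs : continuous step by exact: (sm1_cont sm1_step).
have fi : lebesgue_measure.-integrable `[(-2 : R), t + 1] (EFin \o step).
 apply: continuous_compact_integrable; first exact: segment_compact.
 exact: continuous_subspaceT.
have a2 : -2 < t by lra.
by have [h1 h2] := continuous_FTC1_closed tt fi a2 (cs t); apply: DeriveDef; rewrite -?derive1E.
Unshelve. all: by end_near. Qed.

Lemma sm1_smax0 : sm1 smax0.
apply: (@sm1_coind _ (fun f => f = smax0 \/ sm1 f)); last by left.
move=> h [->|sf]; first by exists step; [exact: smax0_derive|right; exact: sm1_step].
by exists (derive1 h); [move=> x; exact: sm1_is_derive|right; exact: sm1_derive].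
Qed.

Lemma ndecr_derive (f f' : R -> R) : (forall x : R, is_derive x (1 : R) f (f' x)) ->
 (forall x, 0 <= f' x) -> forall x y, x <= y -> f x <= f y.
move=> H f'0 x y xy; apply: (@ger0_derive1_ndecr R f x y) => //.
- by move=> t _; rewrite derive1E; case: (H t) => _ ->.
- by apply: derivable_within_continuous => t _; case: (H t).
Qed.

Lemma smax0_ge0 t : 0 <= smax0 t.
have [t1|t1] := lerP t (-1); first by rewrite smax0_eq0.
rewrite -(@smax0_eq0 (-1))//; apply: ndecr_derive smax0_derive step_ge0 _ _ _.
exact: ltW.
Qed.

Lemma smax0_id t : 1 <= t -> smax0 t = t.
move=> t1.
(* By [stepN] the derivative of [F] is 0, so [F t = F 0 = 0]; for [t >= 1] the term [smax0 (- t)]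
   vanishes. *)
pose F (s : R) := smax0 s - smax0 (- s) - s.
have dF (s : R) : is_derive s (1 : R) F 0.
 have h1 : is_derive s (1 : R) (fun s : R => smax0 (- s)) (step (- s) * -1).
 exact: (@is_derive1_comp R smax0 -%R s _ _ (smax0_derive _) (is_deriveNid s (1 : R))).
 have := is_deriveB (is_deriveB (smax0_derive s) h1) (is_derive_id s (1 : R)).
 by rewrite stepN mulrN1 opprK addrCA subrr addr0 subrr.
have := @is_derive_0_is_cst R F t 0 dF.
have Et : smax0 (- t) = 0 by rewrite smax0_eq0// lerN2.
by rewrite /F oppr0 Et !subrr addr0 subr0 => /eqP; rewrite subr_eq0 => /eqP.
Qed.

Lemma smax0_le t : smax0 t <= Num.max t 0 + 1.
have [t1|t1] := lerP 1 t.
 by rewrite smax0_id// (le_trans (_ : t <= Num.max t 0))// ?le_max ?lexx// lerDl.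
apply: (@le_trans _ _ 1); last by rewrite lerDr le_max lexx orbT.
rewrite -[leRHS](@smax0_id 1)//; apply: ndecr_derive smax0_derive step_ge0 _ _ _.
exact: ltW.
Qed.

(** The maximum of u and q is regularized at scale [e] as [q + smax e (u - q)]; it equals u or q
    exactly as soon as they differ by [e]. *)
Definition smax (e t : R) := e * smax0 (t / e).

Section smax.
Variable e : R.
Hypothesis e0 : 0 < e.

Lemma smax_derive (t : R) : is_derive t (1 : R) (smax e) (step (t / e)).
have h : is_derive t (1 : R) (fun t : R => t / e) (e^-1).
 have := is_deriveZ (e^-1) (is_derive_id t (1 : R)); rewrite /GRing.scale /= mulr1.
 by congr (is_derive _ _ _ _); ext => x; rewrite /= mulrC.
have := is_deriveZ e (@is_derive1_comp R smax0 (fun t : R => t / e) t _ _ (smax0_derive _) h).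
by rewrite /GRing.scale /= mulrCA mulfV ?mulr1// gt_eqF.
Qed.

Lemma sm1_smax : sm1 (smax e).
have h : sm1_alg (fun t : R => t / e).
 by apply: sa_mul; apply: sa_base; [exact: sm1_id|exact: sm1_cst].
apply: sm1_algP; apply: (@sa_mul (fun=> e)); first exact/sa_base/sm1_cst.
exact: (sa_comp (sa_base sm1_smax0) h).
Qed.

Lemma smax_eq0 t : t <= - e -> smax e t = 0.
by move=> te; rewrite /smax smax0_eq0 ?mulr0// ler_pdivrMr// mulN1r. Qed.

Lemma smax_id t : e <= t -> smax e t = t.
by move=> te; rewrite /smax smax0_id ?ler_pdivlMr ?mul1r// mulrC divfK// gt_eqF.
Qed.

Lemma smax_ge0 t : 0 <= smax e t.
by rewrite mulr_ge0 ?smax0_ge0// ltW. Qed.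

Lemma smax_le t : smax e t <= Num.max t 0 + e.
rewrite /smax -ler_pdivlMl// [leRHS]mulrC mulrDl divff ?gt_eqF//.
apply: le_trans (smax0_le _) _; rewrite lerD2r.
rewrite ge_max; apply/andP; split.
 by rewrite ler_pM2r ?invr_gt0// le_max lexx.
by apply: divr_ge0; [rewrite le_max lexx orbT|exact: ltW].
Qed.

Lemma smax_derive1 t : derive1 (smax e) t = step (t / e).
by rewrite derive1E; have [] := smax_derive t. Qed.

Lemma smax_derive2_ge0 t : 0 <= derive1 (derive1 (smax e)) t.
rewrite (_ : derive1 (smax e) = fun t => step (t / e)); last first.
 by ext => x; exact: smax_derive1.
have h : is_derive t (1 : R) (fun t : R => t / e) (e^-1).
 have := is_deriveZ (e^-1) (is_derive_id t (1 : R)); rewrite /GRing.scale /= mulr1.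
 by congr (is_derive _ _ _ _); ext => x; rewrite /= mulrC.
have [_ E] := @is_derive1_comp R step (fun t : R => t / e) t _ _ (sm1_is_derive _ sm1_step) h.
rewrite derive1E (_ : 'D_1 _ t = derive1 step (t / e) / e)//.
by rewrite mulr_ge0 ?step_derive_ge0// invr_ge0 ltW.
Qed.
End smax.

End smooth1_algebra.

Section sigma_finite_copy.
Context d (T : measurableType d) (R : realType) (m : {measure set T -> \bar R}).
(** A copy of [m] whose type carries the proof [H], so that sigma-finiteness can be declared as a
    structure for the Fubini theorems. *)
Definition sfm (H : sigma_finite setT m) : set T -> \bar R := m.
HB.instance Definition _ H := Measure.copy (sfm H) m.
HB.instance Definition _ H := @Measure_isSigmaFinite.Build _ _ _ (sfm H) H.
End sigma_finite_copy.

(** * Lebesgue measure on real tuples *)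

Section tuples.
Context {R : realType}.
Local Notation mR := (mtR R).
Local Notation tup n := (n.-tuple mR).
Local Notation lt n := (@lebesgue_tuple R n).

Lemma tcons_tuple n (t : tup n.+1) : exists tx, t = tcons tx.
case/tupleP: t => x t; exists (t, x); exact: val_inj.
Qed.

Definition cube n (A : set R) : set (tup n) := [set t | forall i, A (tnth t i)].

Arguments cube : clear implicits.

Lemma measurable_cube n (A : set mR) : measurable A -> measurable (cube n A).
move=> mA; rewrite (_ : cube n A = \bigcap_(i : 'I_n) ((fun t : tup n => tnth t i) @^-1` A)).
 apply: fin_bigcap_measurable => [|i _]; first exact: finite_finset.
 by rewrite -[X in measurable X]setTI; exact: (measurable_tnth i).
by apply/seteqP; split => t H; [move=> i _; exact: H|move=> i; exact: H].
Qed.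

Lemma tcons_cube n (A : set R) : @tcons R n @^-1` (cube n.+1 A) = cube n A `*` A.
apply/seteqP; split => -[t x] /=.
 move=> H; split; last by have := H ord0.
 by move=> i; have := H (lift ord0 i); rewrite tnthS.
by move=> [H Ax] i; case: (unliftP ord0 i) => [j ->|->] //=; rewrite tnthS; exact: H.
Qed.

Lemma lebesgue_cube n (A : set mR) : measurable A ->
 lt n (cube n A) = ((@lebesgue_measure R A) ^+ n)%E.
move=> mA; elim: n => [|n IH].
 by rewrite expe0 /= diracE mem_set// => -[].
rewrite expeS [LHS]/= /pushforward tcons_cube product_measure1E ?IH//; last exact: measurable_cube.
by rewrite muleC.
Qed.

Lemma lebesgue_cube_itv n (r : R) : 0 <= r -> lt n (cube n `[- r, r]%classic) = ((r + r) ^+ n)%:E.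
move=> r0; rewrite lebesgue_cube// lebesgue_measure_itv /= lte_fin; case: ifPn => h.
 by rewrite -EFinD -EFin_expe opprK.
rewrite -(EFin_expe 0); congr (_ ^+ _)%:E.
by move: h; rewrite -leNgt => h; lra.
Qed.

Lemma lebesgue_tuple_sf n : sigma_finite setT (lt n).
exists (fun k : nat => cube n `[- k%:R, k%:R]%classic).
 apply/esym; rewrite -subTset => t _; pose M := \sum_i `|tnth t i|.
 have [k Mk] : exists k : nat, M < k%:R.
 by exists (Num.bound M); apply: archi_boundP; exact: sumr_ge0.
 exists k => // i; rewrite /= in_itv /= -ler_norml (le_trans _ (ltW Mk))//.
 by rewrite /M (bigD1 i)//= lerDl sumr_ge0.
move=> k; split; first exact: measurable_cube.
by rewrite lebesgue_cube_itv ?ltry.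
Qed.

Lemma tuple_tonelli n (F : tup n.+1 -> \bar R) : measurable_fun setT F -> (forall t, (0 <= F t)%E) ->
 (\int[lt n.+1]_t F t = \int[lt n]_t \int[lebesgue_measure]_x F (tcons (t, x)))%E.
move=> mF F0.
have mc : measurable_fun setT (F \o @tcons R n).
 by apply: measurableT_comp => //; exact: measurable_tcons.
rewrite /= ge0_integral_pushforward//; last exact: measurable_tcons.
rewrite preimage_setT.
pose m1 := sfm (@lebesgue_tuple_sf n).
have := @fubini_tonelli1 _ _ _ _ R m1 lebesgue_measure (F \o @tcons R n).
apply; [exact: mc|by move=> x; exact: F0].
Qed.

(** Uniqueness of Lebesgue measure: its image under the translation gives half-open intervals the
    same length. *)
Lemma integral_shift (F : mR -> \bar R) (a : R) : measurable_fun setT F -> (forall t, (0 <= F t)%E) ->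
 (\int[lebesgue_measure]_x F (x + a)%R = \int[lebesgue_measure]_x F x)%E.
move=> mF F0.
have ms : measurable_fun setT (fun x : mR => (x + a : mR)).
 by apply: measurable_funD => //; exact: measurable_id.
have E : forall A, measurable A -> lebesgue_measure A = pushforward (@lebesgue_measure R) (fun x : mR => (x + a : mR)) A.
 have := @lebesgue_measure_unique R (measure_function_pushforward__canonical__measure_function_Measure lebesgue_measure ms).
 apply => _ [[b c] _ <-] /=.
 rewrite /pushforward.
 have -> : (fun x : mR => (x + a : mR)) @^-1` `]b, c]%classic = `]b - a, c - a]%classic.
 by apply/seteqP; split => x /=; rewrite !in_itv /= ltrBlDr lerBrDr.
 rewrite !lebesgue_measure_itv /= !lte_fin ltrD2r; case: ifP => // _.
 by rewrite -!EFinD; congr EFin; rewrite opprB addrA subrK.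
have H := ge0_integral_pushforward ms lebesgue_measure measurableT mF (fun y _ => F0 y).
rewrite preimage_setT in H.
transitivity (\int[pushforward (@lebesgue_measure R) (fun x : mR => (x + a : mR)%R)]_y F y)%E.
 by rewrite H.
by apply: eq_measure_integral => A mA _; exact: (esym (E A mA)).
Qed.

Definition tshift n (a t : tup n) : tup n := [tuple (tnth t i + tnth a i : mR) | i < n].

Lemma measurable_tshift n (a : tup n) : measurable_fun setT (tshift a).
apply/measurable_fun_tnthP => i; rewrite (_ : _ \o _ = fun t => (tnth t i + tnth a i : mR)).
 by apply: measurable_funD => //; exact: measurable_tnth.
by ext => t; rewrite /= tnth_mktuple.
Qed.

(** Induction on the length: Tonelli separates one coordinate, to which translation on the line
    applies. *)
Lemma tuple_translation n (F : tup n -> \bar R) (a : tup n) :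
 measurable_fun setT F -> (forall t, (0 <= F t)%E) ->
 (\int[lt n]_t F (tshift a t) = \int[lt n]_t F t)%E.
elim: n F a => [|n IH] F a mF F0.
 by congr integral; ext => t; congr F; apply: eq_from_tnth => -[].
rewrite !tuple_tonelli//; last first.
 by apply: measurableT_comp => //; exact: measurable_tshift.
have [[a' x0] ->] := tcons_tuple a.
have E t x : tshift (tcons (a', x0)) (tcons (t, x)) = tcons (tshift a' t, x + x0 : mR).
 apply: eq_from_tnth => i; rewrite tnth_mktuple.
 by case: (unliftP ord0 i) => [j ->|->] //=; rewrite !tnthS tnth_mktuple.
have mc : measurable_fun setT (F \o @tcons R n).
 by apply: measurableT_comp => //; exact: measurable_tcons.
rewrite -[RHS](IH _ a')//; last 2 first.
- have := @measurable_fun_fubini_tonelli_F _ _ _ _ R lebesgue_measure (F \o @tcons R n) mc.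
 by apply=> x; exact: F0.
- by move=> t; exact: integral_ge0.
apply: eq_integral => t _.
under eq_integral do rewrite E.
rewrite (@integral_shift (fun x => F (tcons (tshift a' t, x))))//.
by apply: (measurableT_comp mc); exact: measurable_pair1.
Qed.

Lemma tuple_shift_measure n (a : tup n) (T : set (tup n)) : measurable T ->
 lt n (tshift a @^-1` T) = lt n T.
move=> mT; have mFT : measurable (tshift a @^-1` T).
 by rewrite -[X in measurable X]setTI; exact: measurable_tshift.
have := @tuple_translation n (EFin \o \1_T) a.
have -> : (\int[lt n]_t (EFin \o \1_T) t = lt n T)%E by rewrite integral_indic// setIT.
have -> : (\int[lt n]_t (EFin \o \1_T) (tshift a t) = lt n (tshift a @^-1` T))%E.
 by rewrite -[in RHS](setIT (_ @^-1` _)) -integral_indic.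
apply; first by to_EFin; exact: measurable_indic.
by move=> t; rewrite lee_fin.
Qed.

(** Reduces the total mass of the Gaussian kernel to dimension one. *)
Lemma tuple_prod n (g : mR -> R) : measurable_fun setT g -> (forall x, 0 <= g x) ->
 (\int[lt n]_t (\prod_i g (tnth t i))%:E = (\int[lebesgue_measure]_x (g x)%:E) ^+ n)%E.
move=> mg g0; elim: n => [|n IH].
 under eq_integral do rewrite big_ord0.
 by rewrite expe0 integral_cst// mul1e /= diracT.
have mp k : measurable_fun setT (fun t : tup k => \prod_i g (tnth t i)).
 apply: measurable_prod => i _; apply: measurableT_comp => //; exact: measurable_tnth.
rewrite tuple_tonelli//; last 2 first.
- to_EFin; exact: mp.
- by move=> t; rewrite lee_fin prodr_ge0.
transitivity (\int[lt n]_t ((\prod_i g (tnth t i))%:E * \int[lebesgue_measure]_x (g x)%:E))%E.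
 apply: eq_integral => t _; rewrite -ge0_integralZl//; last 3 first.
 - by to_EFin; exact: mg.
 - by move=> x _; rewrite lee_fin.
 - by rewrite lee_fin prodr_ge0.
 apply: eq_integral => x _; rewrite big_ord_recl /= mulrC EFinM.
 by congr (_%:E * _)%E; bigr => i _; rewrite tnthS.
rewrite ge0_integralZr//; last 3 first.
- to_EFin; exact: mp.
- by move=> x _; rewrite lee_fin prodr_ge0.
- by apply: integral_ge0 => x _; rewrite lee_fin.
by rewrite IH expeS muleC.
Qed.

End tuples.

Arguments cube {R} n A.

(** * Lebesgue measure and compact sets in C^n *)

Section CnMeasure.
Context {R : realType} {n : nat}.
Local Notation C := (Cn R n).
Local Notation B := (borelC R n).
Local Notation L := (@lebesgue_Cn R n).
Implicit Types (z w a : C).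

Lemma open_borel (U : set C) : open U -> measurable (U : set B).
by move=> oU; exact: sub_sigma_algebra. Qed.

Lemma closed_borel (U : set C) : closed U -> measurable (U : set B).
by move=> cU; rewrite -[U]setCK; apply: measurableC; apply: open_borel; exact: closed_openC.
Qed.

Lemma cont_measurable (F : C -> R) : continuous F -> measurable_fun (setT : set B) (F : B -> R).
move=> cF; refine (@measurability _ _ B R setT F (@RGenOInfty.G R) _ _).
 exact: RGenOInfty.measurableE.
move=> _ [_ [a ->] <-]; rewrite setTI; apply: open_borel.
by apply: open_comp => [z _|]; [exact: cF|exact: interval_open].
Qed.

Definition cball z (r : R) : set C := [set w | nr (w - z) <= r].

Lemma cball_closed z r : closed (cball z r).
rewrite (_ : cball z r = ~` [set w | r < nr (w - z)]); last first.
 by apply/seteqP; split => w /=; rewrite /cball /= leNgt => /negP.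
apply: open_closedC; apply/openP_nr => w /= rw.
exists (nr (w - z) - r); first by rewrite subr_gt0.
move=> y yw; have := nrD (w - y) (y - z); rewrite addrA subrK => H.
rewrite nrB in yw; have := le_lt_trans H (ltrD yw (ltr_pwDl ltr01 (lexx (nr (y - z))))) => _.
by move: H yw; lra.
Qed.

(** Transports compactness from real row vectors: a closed ball of C^n is a closed subset of the
    image of a cube. *)
Definition coordC (x : 'rV[R]_(n + n)) : C := \row_j (x 0 (lshift n j) +i* x 0 (rshift n j)).

Lemma coordC_continuous : continuous coordC.
move=> x; apply/(@cvgrPdist_lt _ _ _ (nbhs x)) => e e0.
have [r r0 er] : exists2 r : R, 0 < r & e = r%:C.
 move: e0; case: e => a b; rewrite ltcE /= => /andP[/eqP -> a0].
 by exists a.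
have r3 : 0 < r / 3 by rewrite divr_gt0.
near=> y; rewrite nrE er ltcR.
have : `|x - y| < r / 3.
 near: y; apply/nbhs_ballP; exists (r / 3) => //= y.
 by rewrite -ball_normE.
move=> xy; have H j : `|(x - y) 0 j| <= r / 3.
 by apply: le_trans (ltW xy); rewrite [leRHS]mx_normrE; exact: (le_bigmax _ (fun ij => `|(x - y) ij.1 ij.2|) (0, j)).
apply: (@le_lt_trans _ _ (2 * (r / 3))); last by lra.
apply: nr_le; first exact: ltW.
- by move=> j; have := H (lshift n j); rewrite !mxE.
- by move=> j; have := H (rshift n j); rewrite !mxE.
Unshelve. all: by end_near. Qed.

Lemma cball_compact z r : compact (cball z r).
pose D : set 'rV[R]_(n + n) := [set x | forall j, x 0 j \in `[- (nr z + r), nr z + r]].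
have cD : compact D.
 apply: bounded_closed_compact.
 exists (nr z + `|r|); split; first exact: num_real.
 move=> M HM x Dx /=; rewrite [leLHS]mx_normrE; apply: bigmax_le.
 by apply: le_trans (ltW HM); rewrite addr_ge0// nr_ge0.
 move=> [i j] _ /=; have := Dx j; rewrite (ord1 i) in_itv /= -ler_norml => h.
 by apply: le_trans h _; apply: le_trans (ltW HM); rewrite lerD2l ler_norm.
 rewrite (_ : D = \bigcap_(j in [set: 'I_(n + n)]) ((fun x : 'rV[R]_(n + n) => x 0 j) @^-1` `[- (nr z + r), nr z + r]%classic)); last first.
 by apply/seteqP; split => x H; [move=> j _; exact: H|move=> j; exact: H].
 apply: closed_bigI => j _; apply: closed_comp => [x _|]; last exact: interval_closed.
 exact: coord_continuous.
have cI : compact (coordC @` D).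
 by apply: continuous_compact cD; apply: continuous_subspaceT; exact: coordC_continuous.
apply: (subclosed_compact _ cI); first exact: cball_closed.
move=> w wr; exists (row_mx (\row_j Re (w 0 j)) (\row_j Im (w 0 j))); last first.
 by apply/rowP => j; rewrite mxE row_mxEl row_mxEr !mxE; case: (w 0 j).
have nw : nr w <= nr z + r.
 by rewrite -[w](subrK z) addrC; apply: le_trans (nrD _ _) _; rewrite lerD2l.
move=> j; rewrite in_itv /= -ler_norml; case: (splitP j) => k jk.
 have -> : j = lshift n k by apply: val_inj.
 by rewrite row_mxEl mxE (le_trans (Re_le_nr _ _)).
have -> : j = rshift n k by apply: val_inj.
by rewrite row_mxEr mxE (le_trans (Im_le_nr _ _)).
Qed.

Lemma closed_bounded_compact (K : set C) (M : R) : closed K -> (forall z, K z -> nr z <= M) -> compact K.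
move=> cK HM; apply: (subclosed_compact cK (@cball_compact 0 M)).
by move=> z Kz; rewrite /cball /= subr0; exact: HM.
Qed.

Lemma compact_nr_bounded (K : set C) : compact K -> exists M : R, forall z, K z -> nr z <= M.
move=> cK; have := continuous_compact (continuous_subspaceT nr_continuous) cK.
move=> /compact_bounded[M [_ HM]]; exists (M + 1) => z Kz.
have := HM (M + 1); rewrite ltrDl ltr01 => /(_ isT (nr z)) H.
by apply: le_trans (ler_norm _) (H _); exists z.
Qed.

Lemma compact_closedC (K : set C) : compact K -> closed K.
by apply: compact_closed; exact: norm_hausdorff. Qed.
Lemma compact_borel (K : set C) : compact K -> measurable (K : set B).
by move=> /compact_closedC; exact: closed_borel. Qed.

Lemma cont_bdd (F : C -> R) (K : set C) : {within K, continuous F} -> compact K ->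
 exists2 M : R, 0 < M & forall z, K z -> `|F z| <= M.
move=> cF cK; have := continuous_compact cF cK.
move=> /compact_bounded[M [_ HM]]; exists (`|M| + 1) => [|z Kz]; first by rewrite ltr_wpDl.
have := HM (`|M| + 1); rewrite (le_lt_trans (ler_norm M)) ?ltrDl// => /(_ isT (F z)) H.
by apply: H; exists z.
Qed.

Lemma lebesgue_Cn_cball z r : (L (cball z r) < +oo)%E.
have mB : measurable (cball z r : set B) by apply: closed_borel; exact: cball_closed.
rewrite /= /pushforward.
pose A := `[- (nr z + r), nr z + r]%classic : set (mtR R).
apply: (@le_lt_trans _ _ (@lebesgue_tuple R (n + n) (cube (n + n) A))).
 apply: le_measure.
 - by rewrite inE -[X in measurable X]setTI; exact: measurable_tuple_Cn.
 - by rewrite inE; apply: measurable_cube; exact: measurable_itv.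
 - move=> t /=; rewrite /cball /= => H.
 have nw : nr (tuple_Cn t) <= nr z + r.
 by rewrite -[tuple_Cn t](subrK z) addrC; apply: le_trans (nrD _ _) _; rewrite lerD2l.
 move=> j; rewrite /A /= in_itv /= -ler_norml; case: (splitP j) => k jk.
 have -> : j = lshift n k by apply: val_inj.
 by apply: le_trans nw; have := Re_le_nr (tuple_Cn t) k; rewrite mxE.
 have -> : j = rshift n k by apply: val_inj.
 by apply: le_trans nw; have := Im_le_nr (tuple_Cn t) k; rewrite mxE.
have [r0|r0] := lerP 0 (nr z + r); first by rewrite lebesgue_cube_itv ?ltry.
rewrite lebesgue_cube; last exact: measurable_itv.
rewrite (_ : A = set0) ?measure0 -?(EFin_expe 0) ?ltry//.
by rewrite -subset0 => x; rewrite /A /= in_itv /= => /andP[h1 h2]; lra.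
Qed.

Lemma lebesgue_Cn_sf : sigma_finite setT L.
exists (fun k : nat => cball 0 k%:R).
 apply/esym; rewrite -subTset => z _; exists (Num.bound (nr z)) => //=.
 by rewrite /cball /= subr0 ltW// archi_boundP// nr_ge0.
move=> k; split; last exact: lebesgue_Cn_cball.
by apply: closed_borel; exact: cball_closed.
Qed.

Lemma lebesgue_Cn_compact (K : set C) : compact K -> (L K < +oo)%E.
move=> cK; have [M HM] := compact_nr_bounded cK.
apply: le_lt_trans (lebesgue_Cn_cball 0 M); apply: le_measure.
- by rewrite inE; exact: compact_borel.
- by rewrite inE; apply: closed_borel; exact: cball_closed.
- by move=> z Kz; rewrite /cball /= subr0; exact: HM.
Qed.

(** In real coordinates the open set contains a translated cube of half side [r / 3]; by [nr_le] its
    points are within [2 * (r / 3) < r] of [z]. *)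
Lemma lebesgue_Cn_open (U : set C) z : open U -> U z -> (0 < L U)%E.
move=> oU Uz; have [r r0 rU] := (openP_nr U).1 oU z Uz.
pose cz (j : 'I_(n + n)) : R := match fintype.split j with inl k => Re (z 0 k) | inr k => Im (z 0 k) end.
pose F : (n + n).-tuple (mtR R) -> (n + n).-tuple (mtR R) := tshift [tuple (- cz j : mtR R) | j < n + n].
pose A := `[- (r / 3), r / 3]%classic : set (mtR R).
have mA : measurable (cube (n + n) A) by apply: measurable_cube; exact: measurable_itv.
have mFA : measurable (F @^-1` cube (n + n) A).
 by rewrite -[X in measurable X]setTI; exact: measurable_tshift.
have E : lebesgue_tuple (n + n) (F @^-1` cube (n + n) A) = lebesgue_tuple (n + n) (cube (n + n) A).
 exact: tuple_shift_measure.
apply: (@lt_le_trans _ _ (@lebesgue_tuple R (n + n) (F @^-1` cube (n + n) A))).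
 by rewrite E lebesgue_cube_itv ?lte_fin ?exprn_gt0 ?addr_gt0 ?divr_gt0// ltW ?divr_gt0.
rewrite /= /pushforward; apply: le_measure.
- by rewrite inE.
- by rewrite inE -[X in measurable X]setTI; apply: measurable_tuple_Cn => //; exact: open_borel.
- move=> t Ft; apply: rU; apply: (@le_lt_trans _ _ (2 * (r / 3))); last by lra.
 have r3 : 0 <= r / 3 by rewrite ltW// divr_gt0.
 apply: nr_le => // j.
 have := Ft (lshift n j); rewrite !tnth_mktuple /A /= in_itv /= -ler_norml /cz (unsplitK (inl j : 'I_n + 'I_n)).
 by rewrite !mxE; case: (z 0 j).
 have := Ft (rshift n j); rewrite !tnth_mktuple /A /= in_itv /= -ler_norml /cz (unsplitK (inr j : 'I_n + 'I_n)).
 by rewrite !mxE; case: (z 0 j).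
Qed.

Lemma lebesgue_Cn_shift a (A : set B) : measurable A -> L ((fun z : C => z + a) @^-1` A) = L A.
move=> mA; rewrite /= /pushforward.
pose ca (j : 'I_(n + n)) : mtR R := match fintype.split j with inl k => Re (a 0 k) | inr k => Im (a 0 k) end.
pose T : set ((n + n).-tuple (mtR R)) := @tuple_Cn R n @^-1` A.
have mT : measurable T by rewrite -[X in measurable X]setTI; exact: measurable_tuple_Cn.
have -> : @tuple_Cn R n @^-1` ((fun z : C => z + a) @^-1` A) = tshift [tuple ca j | j < n + n] @^-1` T.
 have Et t : @tuple_Cn R n (tshift [tuple ca j | j < n + n] t) = @tuple_Cn R n t + a.
 apply/rowP => j; rewrite !mxE !tnth_mktuple /ca.
 rewrite (unsplitK (inl j : 'I_n + 'I_n)) (unsplitK (inr j : 'I_n + 'I_n)).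
 by case: (a 0 j).
 by apply/seteqP; split => t; rewrite /T /preimage /= Et.
have mFT : measurable (tshift [tuple ca j | j < n + n] @^-1` T).
 by rewrite -[X in measurable X]setTI; exact: measurable_tshift.
exact: tuple_shift_measure.
Qed.

End CnMeasure.

(** * Integrals of compactly supported continuous functions *)

Section CcIntegral.
Context {R : realType} {n : nat}.
Local Notation C := (Cn R n).
Local Notation B := (borelC R n).
Local Notation L := (@lebesgue_Cn R n).
Implicit Types (z w a v : C) (F G K : C -> R).

Definition bsupp F := exists M : R, forall z, M < nr z -> F z = 0.
Definition Cc F := continuous F /\ bsupp F.
Definition integ F : R := \int[L]_z F z.

Lemma bsuppMl F G : bsupp F -> bsupp (fun z => F z * G z).
by move=> [M H]; exists M => z /H ->; rewrite mul0r. Qed.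
Lemma bsuppMr F G : bsupp F -> bsupp (fun z => G z * F z).
by move=> [M H]; exists M => z /H ->; rewrite mulr0. Qed.

Lemma bsuppD F G : bsupp F -> bsupp G -> bsupp (fun z => F z + G z).
move=> [M H] [M' H']; exists (Num.max M M') => z; rewrite gt_max => /andP[h h'].
by rewrite H// H'// addr0.
Qed.

Lemma CcD F G : Cc F -> Cc G -> Cc (fun z => F z + G z).
by move=> [cF bF] [cG bG]; split; [exact: contD|exact: bsuppD]. Qed.
Lemma CcMl F G : Cc F -> continuous G -> Cc (fun z => F z * G z).
by move=> [cF bF] cG; split; [exact: contM|exact: bsuppMl]. Qed.
Lemma CcMr F G : Cc F -> continuous G -> Cc (fun z => G z * F z).
by move=> [cF bF] cG; split; [exact: contM|exact: bsuppMr]. Qed.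
Lemma CcZ F (a : R) : Cc F -> Cc (fun z => a * F z).
by move=> cF; apply: CcMr => //; exact: contC. Qed.
Lemma CcN F : Cc F -> Cc (fun z => - F z).
by move=> /(CcZ (-1)); congr Cc; ext => z; rewrite mulN1r. Qed.
Lemma CcB F G : Cc F -> Cc G -> Cc (fun z => F z - G z).
by move=> cF cG; apply: CcD => //; exact: CcN. Qed.

Lemma cont_norm F : continuous F -> continuous (fun z => `|F z|).
move=> cF z; apply/cont_nr => e e0; have /cont_nr/(_ _ e0)[r r0 H] := cF z.
by exists r => // w /H; apply: le_lt_trans; exact: ler_dist_dist.
Qed.

Lemma cont_shift F a : continuous F -> continuous (fun z => F (z + a)).
move=> cF z; apply/cont_nr => e e0; have /cont_nr/(_ _ e0)[r r0 H] := cF (z + a).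
by exists r => // w wr; apply: H; rewrite opprD addrACA subrr addr0.
Qed.

Lemma Cc_norm F : Cc F -> Cc (fun z => `|F z|).
move=> [cF [M H]]; split; first exact: cont_norm.
by exists M => z /H ->; rewrite normr0.
Qed.

Lemma Cc_shift F a : Cc F -> Cc (fun z => F (z + a)).
move=> [cF [M H]]; split; first exact: cont_shift.
exists (M + nr a) => z; rewrite -ltrBrDr => h; apply: H; apply: lt_le_trans h _.
by rewrite lerBlDr -{1}(addrK a z) -(nrN a) nrD.
Qed.

Lemma cont_bounded_ball F (M : R) : continuous F -> exists2 K : R, 0 < K & forall z, nr z <= M -> `|F z| <= K.
move=> cF; have [K K0 HK] := @cont_bdd R n F _ (continuous_subspaceT cF) (@cball_compact R n 0 M).
by exists K => // z zM; apply: HK; rewrite /cball /= subr0.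
Qed.

Lemma Cc_bounded F : Cc F -> exists2 K : R, 0 < K & forall z, `|F z| <= K.
move=> [cF [M H]]; have [K K0 HK] := cont_bounded_ball M cF.
exists K => // z; have [zM|/H ->] := lerP (nr z) M; first exact: HK.
by rewrite normr0 ltW.
Qed.

Lemma bounded_integrable F (K M : R) : measurable_fun (setT : set B) (F : B -> R) ->
 (forall z, `|F z| <= K) -> (forall z, M < nr z -> F z = 0) -> L.-integrable setT (EFin \o F).
move=> mF HK HM.
have mb : measurable (cball 0 M : set B) by apply: closed_borel; exact: cball_closed.
have : L.-integrable (cball 0 M) (EFin \o F).
 apply: measurable_bounded_integrable => //; first exact: lebesgue_Cn_cball.
 exact: measurable_funS mF.
 exists `|K|; split; first exact: num_real.
 by move=> x Kx z _ /=; apply: le_trans (HK z) _; apply: le_trans (ler_norm _) (ltW Kx).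
rewrite integrable_mkcond//; congr (integrable _ _); ext => z.
rewrite patchE; case: ifPn => // /negP; rewrite inE /cball /= subr0 => /negP.
by rewrite -ltNge => /HM ->.
Qed.

Lemma Cc_integrable F : Cc F -> L.-integrable setT (EFin \o F).
move=> cF; have [K _ HK] := Cc_bounded cF; have [c [M HM]] := cF.
by apply: (bounded_integrable (K := K) (M := M)) => //; exact: cont_measurable.
Qed.

Lemma integD F G : Cc F -> Cc G -> integ (fun z => F z + G z) = integ F + integ G.
by move=> cF cG; rewrite /integ RintegralD//; exact: Cc_integrable. Qed.
Lemma integB F G : Cc F -> Cc G -> integ (fun z => F z - G z) = integ F - integ G.
by move=> cF cG; rewrite /integ RintegralB//; exact: Cc_integrable. Qed.
Lemma integZ F (a : R) : Cc F -> integ (fun z => a * F z) = a * integ F.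
by move=> cF; rewrite /integ RintegralZl//; exact: Cc_integrable. Qed.
Lemma Cc0 : Cc (fun=> 0).
by split; [exact: contC|exists 0]. Qed.
Lemma integ0 : integ (fun=> 0) = 0.
by rewrite /integ /Rintegral integral0. Qed.

Lemma Cc_sum I (r : seq I) (P : pred I) (F : I -> C -> R) :
 (forall i, P i -> Cc (F i)) -> Cc (fun z => \sum_(i <- r | P i) F i z).
by move=> H; apply: (@sum_closed C I R) H; [exact: Cc0|exact: CcD]. Qed.

Lemma integ_sum I (r : seq I) (P : pred I) (F : I -> C -> R) :
 (forall i, P i -> Cc (F i)) ->
 integ (fun z => \sum_(i <- r | P i) F i z) = \sum_(i <- r | P i) integ (F i).
by move=> H; apply: (@sum_morph C I R R Cc) H; [exact: Cc0|exact: CcD|exact: integ0|exact: integD]. Qed.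

Lemma integ_le F G : Cc F -> Cc G -> (forall z, F z <= G z) -> integ F <= integ G.
by move=> cF cG FG; apply: le_Rintegral => //; exact: Cc_integrable. Qed.
Lemma integ_ge0 F : (forall z, 0 <= F z) -> 0 <= integ F.
by move=> F0; apply: Rintegral_ge0. Qed.
Lemma integ_norm F : Cc F -> `|integ F| <= integ (fun z => `|F z|).
by move=> cF; apply: le_normr_Rintegral => //; exact: Cc_integrable. Qed.

Lemma integ_shift F a : Cc F -> integ (fun z => F (z + a)) = integ F.
move=> cF; rewrite /integ /Rintegral; congr fine.
have ms : measurable_fun (setT : set B) (fun z : B => (z + a : B)).
 refine (@measurability _ _ B B setT _ (@open C) erefl _).
 move=> _ [U oU <-]; rewrite setTI; apply: open_borel; apply/openP_nr => z Uz.
 have [r r0 rU] := (openP_nr U).1 oU _ Uz; exists r => // w wr; apply: rU.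
 by rewrite opprD addrACA subrr addr0.
have mF := cont_measurable cF.1.
rewrite -[LHS]/(\int[L]_(x in (fun z : B => (z + a : B)%R) @^-1` setT) ((EFin \o F) \o (fun z : B => (z + a : B)%R)) x)%E.
rewrite -(integral_pushforward ms)//.
- by apply: eq_measure_integral => A mA _; exact: lebesgue_Cn_shift.
- exact/measurable_EFinP.
- exact: (Cc_integrable (Cc_shift a cF)).
Qed.

(** Continuity at the points of [K] is meant in the ambient space, so the second point may leave
    [K]; mollification at the edge of a shell uses this. *)
Lemma unif_cont_compact F (K : set C) : (forall z, K z -> {for z, continuous F}) -> compact K ->
 forall e, 0 < e -> exists2 r : R, 0 < r & forall z w, K z -> nr (w - z) < r -> `|F w - F z| < e.
move=> cF cK e e0.
pose P (r : R) z := forall w, nr (w - z) < r -> `|F w - F z| < e.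
have near_cov : forall z, K z -> \forall z' \near z & r \near (0 : R)^'+, P r z'.
 move=> z Kz; have e2 : 0 < e / 2 by rewrite divr_gt0.
 have /cont_nr/(_ _ e2)[d d0 H] := cF z Kz.
 exists ([set w | nr (w - z) < d / 2], [set r | r < d / 2]) => /=.
 split; first by apply/nbhs_nr; exists (d / 2) => //; rewrite divr_gt0.
 by apply: nbhs_right_lt; rewrite divr_gt0.
 move=> [z' r] /= [h1 h2] w wr.
 have h3 : nr (w - z) < d.
 rewrite (_ : w - z = (w - z') + (z' - z)); last by rewrite addrA subrK.
 by apply: le_lt_trans (nrD _ _) _; rewrite [ltRHS]splitr ltrD// (lt_trans wr).
 have h4 : nr (z' - z) < d by move: h1; lra.
 have := H _ h3; have := H _ h4; rewrite !ltr_norml => /andP[? ?] /andP[? ?].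
 by apply/andP; split; lra.
have := (compact_near_coveringP K).1 cK R (0 : R)^'+ P _ near_cov.
move=> H; have {}H : \forall r \near (0 : R)^'+, K `<=` P r by apply: H.
near (0 : R)^'+ => r; exists r; first by near: r; exact: nbhs_right_gt.
move=> z w Kz; have : K `<=` P r by near: r; exact: H.
by move=> /(_ z Kz w).
Unshelve. all: by end_near. Qed.

Lemma Cc_unif F : Cc F -> forall e, 0 < e ->
 exists2 r : R, 0 < r & forall z w, nr (w - z) < r -> `|F w - F z| < e.
move=> [cF [M HM]] e e0.
have [r r0 Hr] := @unif_cont_compact F (cball 0 (M + 1)) (fun z _ => cF z) (@cball_compact R n 0 (M + 1)) e e0.
exists (Num.min r 1); first by rewrite lt_min r0 ltr01.
move=> z w; rewrite lt_min => /andP[wr w1].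
have [zM|zM] := lerP (nr z) (M + 1); first by apply: Hr => //; rewrite /cball /= subr0.
rewrite !HM ?subrr ?normr0//; first by apply: lt_trans zM; rewrite ltrDl.
have := nrD w (z - w); rewrite addrC subrK => h; rewrite nrB in w1.
by rewrite -(ltrD2r 1); apply: lt_le_trans zM (le_trans h _); rewrite lerD2l ltW.
Qed.

Lemma integ_bound F (K : R) (M : R) : Cc F -> (forall z, `|F z| <= K) -> (forall z, M < nr z -> F z = 0) ->
 `|integ F| <= K * fine (L (cball 0 M)).
move=> cF HK HM.
have mb : measurable (cball 0 M : set B) by apply: closed_borel; exact: cball_closed.
have E : integ F = \int[L]_(z in cball 0 M) F z.
 rewrite /integ [RHS]Rintegral_mkcond; congr Rintegral; ext => z.
 rewrite patchE; case: ifPn => // /negP; rewrite inE /cball /= subr0 => /negP.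
 by rewrite -ltNge => /HM ->.
have iF : L.-integrable (cball 0 M) (EFin \o F) by apply: integrableS (Cc_integrable cF).
rewrite E; apply: le_trans (le_normr_Rintegral mb iF) _.
rewrite -(Rintegral_cst _ mb); apply: le_Rintegral => //.
 have := integrable_norm iF; exact.
apply: measurable_bounded_integrable => //; first exact: lebesgue_Cn_cball.
exists `|K|; split; first exact: num_real.
by move=> x Kx z _ /=; apply: le_trans (ler_norm _) _; rewrite normr_id ltW.
Qed.

Lemma integ_derive F (f f' : R -> C -> R) (u v a G0 : R) : Cc F -> u < a < v ->
 (forall t, u < t < v -> continuous (f t)) ->
 (forall t y, u < t < v -> is_derive t (1 : R) (f ^~ y) (f' t y)) ->
 (forall t y, u < t < v -> F y != 0 -> `|f' t y| <= G0) ->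
 is_derive a (1 : R) (fun t => integ (fun y => F y * f t y)) (integ (fun y => F y * f' a y)).
move=> cF uav cf df bf.
pose h (t : R) (y : B) := F y * f t y.
have dh t y : u < t < v -> is_derive t (1 : R) (h^~ y) (F y * f' t y).
 by move=> ut; exact: (is_deriveZ (F y) (df t y ut)).
have hI t : u < t < v -> L.-integrable setT (EFin \o h t).
 by move=> ut; apply: Cc_integrable; apply: CcMl => //; exact: cf.
have hG : L.-integrable setT (EFin \o (fun y => `|F y| * `|G0|)).
 by apply: Cc_integrable; apply: CcMl; [exact: Cc_norm|exact: contC].
have d1 t y : u < t < v -> partial1of2 h t y = F y * f' t y.
 by move=> ut; rewrite /partial1of2 derive1E; have [_ ->] := dh t y ut.
have ina : a \in `]u, v[ by rewrite in_itv.
have bG t y : `]u, v[%classic t -> setT y -> `|partial1of2 h t y| <= `|F y| * `|G0|.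
 rewrite /= in_itv /= => ut _; rewrite d1// normrM; have [->|F0] := eqVneq (F y) 0.
 by rewrite normr0 !mul0r.
 by rewrite ler_wpM2l// (le_trans (bf t y ut F0))// ler_norm.
have dr t y : `]u, v[%classic t -> setT y -> derivable (h^~ y) t 1.
 by rewrite /= in_itv /= => ut _; have [] := dh t y ut.
have hI' t : `]u, v[%classic t -> L.-integrable setT (EFin \o h t).
 by rewrite /= in_itv /= => /hI.
have G0' y : 0 <= `|F y| * `|G0| by rewrite mulr_ge0.
have e1 := @derivable_under_integral R _ _ L h setT measurableT a u v ina hI' dr _ G0' hG bG.
have e2 := @differentiation_under_integral R _ _ L h setT measurableT a u v ina hI' dr _ G0' hG bG.
apply: DeriveDef; first exact: e1.
rewrite -derive1E [LHS]e2; congr Rintegral; ext => y; exact: d1.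
Qed.

End CcIntegral.

(** * Convolution and integration by parts *)

Section Convolution.
Context {R : realType} {n : nat}.
Local Notation C := (Cn R n).
Local Notation B := (borelC R n).
Local Notation L := (@lebesgue_Cn R n).
Implicit Types (z w a v : C) (F G K : C -> R).

Lemma E2_ge z : nr z ^+ 2 <= E2 z.
rewrite leNgt; apply/negP => H.
have z0 : 0 < nr z.
 rewrite lt_neqAle nr_ge0 andbT; apply: contraL H => /eqP <-.
 rewrite expr0n -leNgt; apply: sumr_ge0 => j _; rewrite addr_ge0 ?sqr_ge0//.
have : nr z < nr z; last by rewrite ltxx.
rewrite nr_lt//; apply/forallP => j.
have : xr j z ^+ 2 + xi j z ^+ 2 < nr z ^+ 2.
 apply: le_lt_trans H; rewrite /E2 (bigD1 j)//= lerDl.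
 by apply: sumr_ge0 => k _; rewrite addr_ge0 ?sqr_ge0.
rewrite /xr /xi; case: (z 0 j) => a b /= h; rewrite normc_def ltcR /=.
by rewrite -[ltRHS]ger0_norm ?nr_ge0// -sqrtr_sqr ltr_sqrt// exprn_gt0.
Qed.

Lemma E2_le z : E2 z <= n%:R * 2 * nr z ^+ 2.
apply: (@le_trans _ _ (\sum_(j < n) 2 * nr z ^+ 2)); last first.
 by rewrite sumr_const card_ord -[_ *+ n]mulr_natl mulrA lexx.
apply: ler_sum => j _.
rewrite mulr2n mulrDl mul1r; have := Re_le_nr z j; have := Im_le_nr z j.
rewrite /xr /xi -(real_normK (num_real (Re (z 0 j)))) -(real_normK (num_real (Im (z 0 j)))).
by move=> h1 h2; rewrite lerD// lerXn2r// nnegrE nr_ge0.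
Qed.

Definition tf F := sm F /\ bsupp F.

Lemma tf_Cc F : tf F -> Cc F.
by move=> [sF bF]; split => //; exact: sm_cont. Qed.

Lemma open_outside (M : R) z : M < nr z -> exists2 r : R, 0 < r & forall w, nr (w - z) < r -> M < nr w.
move=> zM; exists (nr z - M); first by rewrite subr_gt0.
move=> w wr; have := nrD w (z - w); rewrite addrC subrK => h; rewrite nrB in wr.
by have := ler_wpM2l ler01 h; move: wr; rewrite !mul1r ltrBrDr => h1 h2; rewrite -(ltrD2l (nr (z - w))); apply: lt_le_trans h1 _; rewrite addrC.
Qed.

Lemma bsupp_dder F v : bsupp F -> bsupp (dder v F).
move=> [M H]; exists M => z zM; have [r r0 rM] := open_outside zM.
rewrite (@dder_near _ _ F (fun=> 0) v z r r0); last by move=> w /rM /H.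
by rewrite dder_cst.
Qed.

Lemma tf_dder F v : tf F -> tf (dder v F).
by move=> [sF bF]; split; [exact: sm_dder|exact: bsupp_dder]. Qed.
Lemma tfMl F G : tf F -> sm G -> tf (fun z => F z * G z).
by move=> [sF bF] sG; split; [exact: smM|exact: bsuppMl]. Qed.
Lemma tfMr F G : tf F -> sm G -> tf (fun z => G z * F z).
by move=> [sF bF] sG; split; [exact: smM|exact: bsuppMr]. Qed.
Lemma tfD F G : tf F -> tf G -> tf (fun z => F z + G z).
by move=> [sF bF] [sG bG]; split; [exact: smD|exact: bsuppD]. Qed.

Lemma dder_scaleN v F : sm F -> dder (- v) F = fun z => - dder v F z.
move=> sF; have := dder_scalev v (-1) sF; rewrite rmorphN rmorph1 scaleN1r => ->.
by ext => z; rewrite mulN1r.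
Qed.

Lemma dder_at F v z (t : R) : sm F -> is_derive t (1 : R) (along F z v) (dder v F (z + t%:C *: v)).
by move=> sF; apply: isd_at; exact: sm_isd. Qed.
Lemma sm_bounded F (M : R) : sm F -> exists2 K : R, 0 < K & forall z, nr z <= M -> `|F z| <= K.
by move=> sF; apply: cont_bounded_ball; exact: sm_cont. Qed.

(** Convolution with the reflected kernel. Each derivative of the result falls on [K] with a minus
    sign, so second-order operators pass through unchanged. *)
Definition mollify F K z := integ (fun y => F y * K (y - z)).

Lemma conv_isd F K v : Cc F -> sm K -> isd v (mollify F K) (mollify F (fun y => - dder v K y)).
move=> cF sK z; have [_ [M HM]] := cF.
have sK' := sm_dder v sK.
have [G0 G00 HG] := sm_bounded (M + nr z + nr v) sK'.
pose f (t : R) y := K (y - (z + t%:C *: v)).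
pose f' (t : R) y := - dder v K (y - (z + t%:C *: v)).
have df (t : R) y : is_derive t (1 : R) (f^~ y) (f' t y).
 have E : f^~ y = along K (y - z) (- v).
 by ext => s; rewrite /f /along opprD addrA scalerN.
 have := dder_at (- v) (y - z) t sK; rewrite dder_scaleN// -E.
 by rewrite /f' opprD addrA scalerN.
have := @integ_derive R n F f f' (-1) 1 0 G0 cF.
have -> : (fun t : R => integ (fun y => F y * f t y)) = along (mollify F K) z v.
 by apply/funext.
have -> : integ (fun y => F y * f' 0 y) = mollify F (fun y => - dder v K y) z.
 by rewrite /mollify /f'; congr integ; ext => y; rewrite scale0r addr0.
apply; first by rewrite ltrN10 ltr01.
- by move=> t _; apply: (@cont_shift R n K (- (z + t%:C *: v))); exact: sm_cont.
move=> t y /andP[t1 t2] Fy; rewrite normrN; apply: HG.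
have yM : nr y <= M by rewrite leNgt; apply: contra Fy => /HM ->.
apply: le_trans (nrD _ _) _; rewrite nrN -addrA lerD//.
apply: le_trans (nrD _ _) _; rewrite lerD2l nrZ ler_piMl ?nr_ge0//.
by rewrite ler_norml !ltW.
Qed.

Lemma dder_conv F K v : Cc F -> sm K -> dder v (mollify F K) = mollify F (fun y => - dder v K y).
by move=> cF sK; apply: isd_dder; exact: conv_isd. Qed.

Lemma conv_continuous F K : Cc F -> sm K -> continuous (mollify F K).
move=> cF sK z; apply/cont_nr => e e0; have [cc [M HM]] := cF.
have [KF KF0 HKF] := Cc_bounded cF.
pose V := KF * fine (L (cball 0 M)) + 1.
have fV : 0 <= fine (L (cball 0 M)) by rewrite fine_ge0.
have V0 : 0 < V by rewrite ltr_wpDl// mulr_ge0// ltW.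
have eV : 0 < e / V by rewrite divr_gt0.
have [r r0 Hr] := @unif_cont_compact R n K _ (fun y _ => sm_cont sK y) (@cball_compact R n 0 (M + nr z)) _ eV.
exists r => // w wr; rewrite /mollify -integB; last 2 first.
- by apply: CcMl => //; apply: cont_shift; exact: sm_cont.
- by apply: CcMl => //; apply: cont_shift; exact: sm_cont.
apply: (@le_lt_trans _ _ (KF * (e / V) * fine (L (cball 0 M)))); last first.
 rewrite (_ : KF * (e / V) * fine (L (cball 0 M)) = e * (KF * fine (L (cball 0 M))) / V); last by ring.
 by rewrite ltr_pdivrMr// ltr_pM2l// /V ltrDl.
apply: integ_bound.
- by apply: CcB; apply: CcMl => //; apply: cont_shift; exact: sm_cont.
- move=> y; rewrite -mulrBr normrM; have [yM|yM] := lerP (nr y) M; last first.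
 by rewrite HM// normr0 mul0r mulr_ge0// ltW.
 apply: ler_pM => //; apply/ltW/Hr.
 rewrite /cball /= subr0; apply: le_trans (nrD _ _) _.
 by rewrite nrN lerD2r.
 rewrite (_ : y - w - (y - z) = z - w); first by rewrite nrB.
 by rewrite opprB addrC addrA subrK.
- by move=> y yM; rewrite HM// !mul0r subrr.
Qed.

Lemma conv_sm F K : Cc F -> sm K -> sm (mollify F K).
move=> cF sK; apply: (@sm_coind _ _ (fun f => exists2 K, sm K & f = mollify F K)); last by exists K.
move=> _ [{}K {}sK ->]; split; first exact: conv_continuous.
move=> v; exists (mollify F (fun y => - dder v K y)); first exact: conv_isd.
by exists (fun y => - dder v K y) => //; apply: smN; exact: sm_dder.
Qed.

Lemma conv_bsupp F K : Cc F -> bsupp K -> bsupp (mollify F K).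
move=> [_ [M HM]] [M' HM']; exists (M + M') => z zM.
rewrite /mollify -[RHS](@integ0 R n); congr integ; ext => y.
have [yM|/HM ->] := lerP (nr y) M; last by rewrite mul0r.
rewrite HM' ?mulr0//; rewrite nrB; have := nrD (z - y) y; rewrite subrK => h.
by rewrite -(ltrD2r (nr y)); apply: lt_le_trans h; apply: le_lt_trans zM; rewrite addrC lerD2r.
Qed.

Lemma conv_shiftE F K z : Cc F -> continuous K -> mollify F K z = integ (fun y => F (y + z) * K y).
move=> cF cK; have := @integ_shift R n (fun y => F y * K (y - z)) z.
rewrite /mollify => <-; last by apply: CcMl => //; exact: cont_shift.
by congr integ; ext => y; rewrite addrK.
Qed.

(** The integrals of the translates of [F] along [v] are all equal; the derivative in the
    translation parameter is the claim. The plateau [H], equal to 1 on the supports of all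
    translates used, is the weight that [integ_derive] asks for. *)
Lemma integ_dder F v : tf F -> integ (dder v F) = 0.
move=> tF; have [sF [M HM]] := tF; have sF' := sm_dder v sF.
have tF' := tf_dder v tF.
have [G0 G00 HG] := Cc_bounded (tf_Cc tF').
pose M1 := M + nr v + 1.
have [H [cH H1]] : exists H : C -> R, Cc H /\ forall z, nr z <= M1 -> H z = 1.
 pose M2 := n%:R * 2 * M1 ^+ 2 + 1.
 exists (fun z => step (M2 - E2 z)); split; last first.
 move=> z zM; rewrite step_eq1// /M2 addrAC lerDr subr_ge0.
 apply: le_trans (E2_le z) _; rewrite ler_wpM2l// lerXn2r// ?nnegrE ?nr_ge0//.
 exact: le_trans (nr_ge0 z) zM.
 split.
 apply: sm_cont; apply: (@sm_comp _ _ step (fun z => M2 - E2 z)); first exact: sm1_step.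
 by apply: smB; [exact: sm_cst|exact: sm_E2].
 exists (M2 + 1 + 1) => z zM; rewrite step_eq0// lerBlDr addrC -lerBlDr opprK.
 have M20 : 0 <= M2 by rewrite /M2 addr_ge0// mulr_ge0 ?sqr_ge0.
 have z1 : 1 <= nr z by move: zM; lra.
 apply: le_trans (E2_ge z); apply: le_trans (_ : nr z <= _).
 by apply: ltW; apply: le_lt_trans zM; rewrite lerDl.
 by rewrite expr2 ler_peMl// nr_ge0.
pose f (t : R) y := F (y + t%:C *: v).
have E t : `|t| <= 1 -> integ (fun y => H y * f t y) = integ F.
 move=> t1; rewrite -(integ_shift (t%:C *: v) (tf_Cc tF)); congr integ; ext => y.
 have [yM|yM] := lerP (nr y) M1; first by rewrite H1// mul1r.
 rewrite [F _]HM ?mulr0 /f ?HM ?mulr0//.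
 apply: lt_le_trans (_ : M1 - nr v <= _); first by rewrite /M1 addrAC addrK ltrDl.
 rewrite lerBlDr; have := nrD (y + t%:C *: v) (- (t%:C *: v)); rewrite addrK nrN nrZ => h.
 by apply: le_trans (ltW yM) (le_trans h _); rewrite lerD2l ler_piMl ?nr_ge0.
 apply: lt_le_trans (_ : M1 - nr v <= _); first by rewrite /M1 addrAC addrK ltrDl.
 rewrite lerBlDr; have := nrD (y + t%:C *: v) (- (t%:C *: v)); rewrite addrK nrN nrZ => h.
 by apply: le_trans (ltW yM) (le_trans h _); rewrite lerD2l ler_piMl ?nr_ge0.
have D := @integ_derive R n H f (fun t y => dder v F (y + t%:C *: v)) (-1) 1 0 G0 cH.
have {}D : is_derive (0 : R) (1 : R) (fun t => integ (fun y => H y * f t y)) (integ (fun y => H y * dder v F (y + 0%:C *: v))).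
 apply: D; first by rewrite ltrN10 ltr01.
 - by move=> t _; apply: cont_shift; exact: sm_cont.
 - by move=> t y _; exact: (dder_at v y t sF).
 - by move=> t y _ _; exact: HG.
have D0 : is_derive (0 : R) (1 : R) (fun t => integ (fun y => H y * f t y)) 0.
 apply: near_eq_is_derive (is_derive_cst (integ F) (0 : R) (1 : R)).
 apply/nbhs_ballP; exists 1 => //= t; rewrite /ball /= sub0r normrN => t1.
 by rewrite E// ltW.
have -> : integ (dder v F) = integ (fun y => H y * dder v F (y + 0%:C *: v)).
 congr integ; ext => y; rewrite scale0r addr0.
 have [yM|yM] := lerP (nr y) M1; first by rewrite H1// mul1r.
 have yM' : M < nr y by apply: lt_trans yM; rewrite /M1 -addrA ltrDl ltr_wpDl// nr_ge0.
 have [r r0 rM] := open_outside yM'.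
 by rewrite (@dder_near _ _ F (fun=> 0) v y r r0) ?dder_cst ?mulr0// => w /rM /HM.
by have [_ <-] := D; have [_ ->] := D0.
Qed.

Lemma integ_by_parts F G v : tf F -> sm G ->
 integ (fun z => dder v F z * G z) = - integ (fun z => F z * dder v G z).
move=> tF sG; have sF := tF.1; have tFG := tfMl tF sG.
have := integ_dder v tFG; rewrite dderM// integD; last 2 first.
- by apply: CcMl; [exact: tf_Cc|exact/sm_cont/sm_dder].
- by apply: CcMr; [exact/tf_Cc/tf_dder|exact/sm_cont].
move=> /eqP; rewrite addrC addr_eq0 => /eqP <-.
by congr integ; ext => z; rewrite mulrC.
Qed.

Lemma integ_fubini (F : C -> C -> R) (K M : R) :
 measurable_fun (setT : set (B * B)) (fun p : B * B => F p.1 p.2) ->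
 (forall z y, `|F z y| <= K) -> (forall z y, M < nr z -> F z y = 0) -> (forall z y, M < nr y -> F z y = 0) ->
 integ (fun z => integ (F z)) = integ (fun y => integ (F^~ y)).
move=> mF HK H1 H2.
pose m := sfm (@lebesgue_Cn_sf R n).
have iy z : L.-integrable setT (EFin \o F z).
 apply: (bounded_integrable (K := K) (M := M)) => //.
 exact: (measurableT_comp mF (measurable_pair1 (z : B))).
 by move=> y; exact: H2.
have iz y : L.-integrable setT (EFin \o F^~ y).
 apply: (bounded_integrable (K := K) (M := M)) => //.
 exact: (measurableT_comp mF (measurable_pair2 (y : B))).
 by move=> z; exact: H1.
have mE : measurable_fun (setT : set (B * B)) (fun p : B * B => (F p.1 p.2)%:E) by exact/measurable_EFinP.
have iF : (m \x m)%E.-integrable setT (fun p : B * B => (F p.1 p.2)%:E).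
 apply/integrable12ltyP => //.
 apply: (@le_lt_trans _ _ (\int[m]_x ((K * fine (L (cball 0 M)))%:E * (\1_(cball 0 M) x)%:E))%E).
 apply: ge0_le_integral => //.
 - by move=> z _; exact: integral_ge0.
 - have := @measurable_fun_fubini_tonelli_F _ _ B B R m (fun p => `|(F p.1 p.2)%:E|%E).
 by apply; [exact: measurableT_comp|move=> x].
 - apply: measurable_funeM; to_EFin; apply: measurable_indic.
 by apply: closed_borel; exact: cball_closed.
 move=> z _; rewrite indicE; have [zM|zM] := lerP (nr z) M; last first.
 rewrite integral0_eq//; last by move=> y _ /=; rewrite H1// normr0.
 rewrite -EFinM lee_fin mulr_ge0// mulr_ge0 ?fine_ge0//.
 exact: le_trans (HK 0 0).
 rewrite mem_set; last by rewrite /cball /= subr0.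
 rewrite [X in (_ <= _ * X)%E](_ : _ = 1%E)// mule1; apply: (@le_trans _ _ (\int[m]_y (K%:E * (\1_(cball 0 M) y)%:E))%E).
 apply: ge0_le_integral => //.
 - by apply: measurableT_comp => //; exact: (measurableT_comp mE (measurable_pair1 (z : B))).
 - apply: measurable_funeM; to_EFin; apply: measurable_indic.
 by apply: closed_borel; exact: cball_closed.
 move=> y _; rewrite indicE; have [yM|yM] := lerP (nr y) M; last first.
 by rewrite /= H2// normr0 -EFinM lee_fin mulr_ge0// (le_trans _ (HK 0 0)).
 rewrite mem_set; last by rewrite /cball /= subr0.
 by rewrite [X in (_ <= _ * X)%E](_ : _ = 1%E)// mule1 lee_fin.
 rewrite ge0_integralZl//; last 2 first.
 - to_EFin; apply: measurable_indic; apply: closed_borel; exact: cball_closed.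
 - by rewrite lee_fin (le_trans _ (HK 0 0)).
 rewrite integral_indic ?setIT//; last by apply: closed_borel; exact: cball_closed.
 rewrite EFinM fineK ?lexx// ge0_fin_numE//; exact: lebesgue_Cn_cball.
 rewrite ge0_integralZl//; last 2 first.
 - to_EFin; apply: measurable_indic; apply: closed_borel; exact: cball_closed.
 - by rewrite lee_fin mulr_ge0 ?fine_ge0// (le_trans _ (HK 0 0)).
 rewrite integral_indic ?setIT//; last by apply: closed_borel; exact: cball_closed.
 have := @lebesgue_Cn_cball R n 0 M; rewrite -ge0_fin_numE// => /fineK <-.
 by rewrite -EFinM ltry.
have := @Fubini _ _ B B R m m (fun p => (F p.1 p.2)%:E) iF => /= H.
rewrite /integ /Rintegral; congr fine.
transitivity (\int[m]_x \int[m]_y (F x y)%:E)%E.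
 apply: eq_integral => z _; rewrite fineK//; exact: (integrable_fin_num measurableT (iy z)).
rewrite H; apply: eq_integral => y _; rewrite fineK//.
exact: (integrable_fin_num measurableT (iz y)).
Qed.

End Convolution.

Lemma integE (R : realType) (n : nat) (F : Cn R n -> R) : integ F = \int[@lebesgue_Cn R n]_z F z.
by []. Qed.

Opaque dder integ.

(** * The Laplacian on complex lines *)

Section Laplacian.
Context {R : realType} {n : nat}.
Local Notation C := (Cn R n).
Implicit Types (z w a v : C) (F G K : C -> R).

(** A quarter of the real Laplacian of [F] along the complex line spanned by [v]: the Levi form of
    [F] at [v], as [lap_hess] shows. *)
Definition lap v F z : R := 4^-1 * (dder v (dder v F) z + dder ('i%C *: v) (dder ('i%C *: v) F) z).

Definition basis (j : 'I_n) : C := delta_mx 0 j.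

Definition laplacian F z : R := \sum_j lap (basis j) F z.

Lemma sm_lap v F : sm F -> sm (lap v F).
by move=> sF; apply: smZ; apply: smD; apply: sm_dder; exact: sm_dder. Qed.
Lemma sm_laplacian F : sm F -> sm (laplacian F).
by move=> sF; apply: sm_sum => j _; exact: sm_lap. Qed.

Lemma tf_lap v F : tf F -> tf (lap v F).
move=> tF; split; first exact: (sm_lap v tF.1).
by apply: bsuppMr; apply: bsuppD; apply: bsupp_dder; apply: bsupp_dder; exact: tF.2.
Qed.

Lemma tf_sum I (r : seq I) (F : I -> C -> R) :
 (forall i, tf (F i)) -> tf (fun z => \sum_(i <- r) F i z).
move=> H; apply: (@sum_closed C I R) (fun i _ => H i); last exact: tfD.
by split; [exact: sm_cst|exists 0].
Qed.

Lemma tf_laplacian F : tf F -> tf (laplacian F).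
by move=> tF; apply: tf_sum => j; exact: tf_lap. Qed.

Lemma lap_by_parts v F G : tf F -> sm G ->
 integ (fun z => lap v F z * G z) = integ (fun z => F z * lap v G z).
move=> tF sG.
have key w : integ (fun z => dder w (dder w F) z * G z) = integ (fun z => F z * dder w (dder w G) z).
 rewrite integ_by_parts//; last exact: tf_dder.
 by rewrite integ_by_parts ?opprK//; exact: sm_dder.
have cc w : Cc (fun z => dder w (dder w F) z * G z).
 by apply: CcMl; [apply/tf_Cc/tf_dder/tf_dder|exact: sm_cont].
have cc' w : Cc (fun z => F z * dder w (dder w G) z).
 by apply: CcMl; [exact: tf_Cc|apply/sm_cont/sm_dder/sm_dder].
transitivity (4^-1 * (integ (fun z => dder v (dder v F) z * G z) + integ (fun z => dder ('i%C *: v) (dder ('i%C *: v) F) z * G z))).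
 rewrite -(integD (cc v) (cc ('i%C *: v))) -(integZ _ (CcD (cc v) (cc ('i%C *: v)))).
 by congr integ; ext => z; rewrite /lap -mulrDl mulrA.
transitivity (4^-1 * (integ (fun z => F z * dder v (dder v G) z) + integ (fun z => F z * dder ('i%C *: v) (dder ('i%C *: v) G) z))).
 by congr (_ * (_ + _)); exact: key.
rewrite -(integD (cc' v) (cc' ('i%C *: v))) -(integZ _ (CcD (cc' v) (cc' ('i%C *: v)))).
by congr integ; ext => z; rewrite /lap -mulrDr mulrCA.
Qed.

Lemma laplacian_by_parts F G : tf F -> sm G ->
 integ (fun z => laplacian F z * G z) = integ (fun z => F z * laplacian G z).
move=> tF sG.
transitivity (\sum_j integ (fun z => lap (basis j) F z * G z)).
 rewrite -integ_sum; last by move=> j _; apply: CcMl; [apply/tf_Cc/tf_lap|exact: sm_cont].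
 by congr integ; ext => z; rewrite /laplacian mulr_suml.
under eq_bigr do rewrite lap_by_parts//.
rewrite -integ_sum; last by move=> j _; apply: CcMl; [exact: tf_Cc|apply/sm_cont/sm_lap].
by congr integ; ext => z; rewrite /laplacian mulr_sumr.
Qed.

Lemma lap_conv v F K : Cc F -> sm K -> lap v (mollify F K) = mollify F (lap v K).
move=> cF sK; ext => z.
have key w : dder w (dder w (mollify F K)) = mollify F (dder w (dder w K)).
 rewrite dder_conv// dder_conv//; last by apply: smN; exact: sm_dder.
 by congr mollify; ext => y; rewrite dderN ?opprK//; exact: sm_dder.
have cc w : Cc (fun y => F y * dder w (dder w K) (y - z)).
 by apply: CcMl => //; apply: cont_shift; apply/sm_cont/sm_dder/sm_dder.
transitivity (4^-1 * (mollify F (dder v (dder v K)) z + mollify F (dder ('i%C *: v) (dder ('i%C *: v) K)) z)).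
 by rewrite /lap; congr (_ * (_ + _)); rewrite key.
rewrite /mollify -(integD (cc v) (cc ('i%C *: v))) -(integZ _ (CcD (cc v) (cc ('i%C *: v)))).
by congr integ; ext => y; rewrite -mulrDr mulrCA.
Qed.

Lemma laplacian_conv F K : Cc F -> sm K -> laplacian (mollify F K) = mollify F (laplacian K).
move=> cF sK; ext => z; rewrite /laplacian.
transitivity (\sum_j mollify F (lap (basis j) K) z).
 by bigr => j _; have := lap_conv (basis j) cF sK => ->.
rewrite /mollify.
transitivity (integ (fun y => \sum_j F y * lap (basis j) K (y - z))).
 rewrite (@integ_sum _ _ _ _ _ (fun j y => F y * lap (basis j) K (y - z)))//.
 by move=> j _; apply: CcMl => //; apply: cont_shift; apply/sm_cont/sm_lap.
by congr integ; ext => y; rewrite mulr_sumr.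
Qed.

End Laplacian.

(** * The heat kernel *)

Section Gaussian.
Context {R : realType} {n : nat}.
Local Notation C := (Cn R n).
Local Notation B := (borelC R n).
Local Notation L := (@lebesgue_Cn R n).
Implicit Types (z w a v : C) (F G K : C -> R) (s : R).

(** The heat kernel at time s for [laplacian], which is a quarter of the Laplacian of R^(2n); this
    removes the usual factor 4 from the exponent. *)
Definition gk s z := (pi * s)^-1 ^+ n * expR (- E2 z / s).

Lemma gk_ge0 s z : 0 < s -> 0 <= gk s z.
by move=> s0; rewrite mulr_ge0 ?expR_ge0// exprn_ge0// invr_ge0 mulr_ge0 ?pi_ge0// ltW. Qed.

Lemma sm_gk s : sm (gk s).
apply: smZ; apply: (@sm_comp _ _ expR (fun z => - E2 z / s)); first exact: sm1_expR.
by apply: smM; [apply: smN; exact: sm_E2|exact: sm_cst].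
Qed.

Lemma dder_E2 v : dder v E2 = fun z => \sum_j 2 * (xr j v * xr j z + xi j v * xi j z).
have s1 j : sm (fun z => xr j z * xr j z) by apply: smM; exact: sm_xr.
have s2 j : sm (fun z => xi j z * xi j z) by apply: smM; exact: sm_xi.
have -> : E2 = fun z : C => \sum_j (xr j z * xr j z + xi j z * xi j z).
 by ext => z; rewrite /E2; bigr => j _; rewrite !expr2.
rewrite dder_sum; last by move=> j _; exact: smD.
ext => z; bigr => j _.
rewrite dderD// dderM; [|exact: sm_xr|exact: sm_xr].
rewrite dderM; [|exact: sm_xi|exact: sm_xi].
by rewrite dder_xr dder_xi; ring.
Qed.

Lemma dder2_E2 v : dder v (dder v E2) = fun=> 2 * E2 v.
rewrite dder_E2 dder_sum; last first.
 move=> j _; apply: smZ; apply: smD; apply: smZ; [exact: sm_xr|exact: sm_xi].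
ext => z; rewrite /E2 mulr_sumr; bigr => j _.
rewrite dderZ; last by apply: smD; apply: smZ; [exact: sm_xr|exact: sm_xi].
rewrite dderD; [|by apply: smZ; exact: sm_xr|by apply: smZ; exact: sm_xi].
rewrite !dderZ; [|exact: sm_xi|exact: sm_xr].
by rewrite dder_xr dder_xi !expr2.
Qed.

Lemma dder_gk s v : dder v (gk s) = fun z => - (dder v E2 z / s) * gk s z.
have sE : sm (fun z : C => - E2 z / s) by apply: smM; [apply: smN; exact: sm_E2|exact: sm_cst].
have se : sm (fun z : C => expR (- E2 z / s)).
 by apply: (@sm_comp _ _ expR (fun z => - E2 z / s)); first exact: sm1_expR.
rewrite /gk dderZ//.
rewrite (@dder_comp _ _ expR (fun z => - E2 z / s))//; last exact: sm1_expR.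
have -> : dder v (fun z : C => - E2 z / s) = fun z => - (dder v E2 z / s).
 rewrite dderM; [|by apply: smN; exact: sm_E2|exact: sm_cst].
 rewrite dder_cst dderN; last exact: sm_E2.
 by ext => z; ring.
have -> : derive1 (@expR R) = expR.
 by ext => x; rewrite derive1E; have [_ ->] := is_derive_expR x.
by ext => z; ring.
Qed.

Lemma dder2_gk s v : dder v (dder v (gk s)) =
 fun z => (- (2 * E2 v / s) + (dder v E2 z / s) ^+ 2) * gk s z.
have sD : sm (fun z : C => - (dder v E2 z / s)).
 by apply: smN; apply: smM; [apply: sm_dder; exact: sm_E2|exact: sm_cst].
rewrite dder_gk dderM//; last exact: sm_gk.
rewrite dder_gk dderN; last by apply: smM; [apply: sm_dder; exact: sm_E2|exact: sm_cst].
rewrite dderM; [|by apply: sm_dder; exact: sm_E2|exact: sm_cst].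
by rewrite dder_cst dder2_E2; ext => z; ring.
Qed.

Lemma xr_basis (j k : 'I_n) : xr k (basis j : C) = (j == k)%:R.
by rewrite /xr /basis mxE eqxx /= eq_sym; case: eqP. Qed.
Lemma xi_basis (j k : 'I_n) : xi k (basis j : C) = 0.
by rewrite /xi /basis mxE eqxx /= eq_sym; case: eqP. Qed.
Lemma xr_ibasis (j k : 'I_n) : xr k ('i%C *: basis j : C) = 0.
by rewrite /xr /basis !mxE eqxx /= eq_sym; case: eqP => _ /=; ring. Qed.
Lemma xi_ibasis (j k : 'I_n) : xi k ('i%C *: basis j : C) = (j == k)%:R.
by rewrite /xi /basis !mxE eqxx /= eq_sym; case: eqP => _ /=; ring. Qed.

Lemma sum_pick (j : 'I_n) (F : 'I_n -> R) : \sum_k (j == k)%:R * F k = F j.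
rewrite (bigD1 j)//= eqxx mul1r big1 ?addr0// => k kj.
by rewrite eq_sym (negbTE kj) mul0r.
Qed.

Lemma lap_gk s j z : 0 < s ->
 lap (basis j) (gk s) z = (- s^-1 + (xr j z ^+ 2 + xi j z ^+ 2) / s ^+ 2) * gk s z.
move=> s0; have s1 : s != 0 by rewrite gt_eqF.
have e1 : dder (basis j) E2 z = 2 * xr j z.
 rewrite dder_E2 -(sum_pick j (fun k => 2 * xr k z)); bigr => k _.
 by rewrite xr_basis xi_basis; ring.
have e2 : dder ('i%C *: basis j) E2 z = 2 * xi j z.
 rewrite dder_E2 -(sum_pick j (fun k => 2 * xi k z)); bigr => k _.
 by rewrite xr_ibasis xi_ibasis; ring.
have e3 : E2 (basis j : C) = 1.
 rewrite -[RHS](sum_pick j (fun=> 1)) /E2; bigr => k _.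
 by rewrite xr_basis xi_basis; case: eqP => _; rewrite ?expr1n ?expr0n /=; ring.
have e4 : E2 ('i%C *: basis j : C) = 1.
 rewrite -[RHS](sum_pick j (fun=> 1)) /E2; bigr => k _.
 by rewrite xr_ibasis xi_ibasis; case: eqP => _; rewrite ?expr1n ?expr0n /=; ring.
by rewrite /lap !dder2_gk e1 e2 e3 e4; field.
Qed.

Lemma laplacian_gk s z : 0 < s ->
 laplacian (gk s) z = (- (n%:R / s) + E2 z / s ^+ 2) * gk s z.
move=> s0; rewrite /laplacian; under eq_bigr do rewrite lap_gk//.
rewrite -mulr_suml big_split /= -mulr_suml; congr ((_ + _) * _).
by rewrite sumrN sumr_const card_ord -[s^-1 *+ n]mulr_natl.
Qed.

Lemma gk_dt s z : 0 < s -> is_derive s (1 : R) (fun t => gk t z) (laplacian (gk s) z).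
move=> s0; have s1 : s != 0 by rewrite gt_eqF.
rewrite laplacian_gk//.
have hV : is_derive s (1 : R) (fun t : R => t^-1) (- s ^- 2).
 have := is_deriveV (f := id) s1 (is_derive_id s (1 : R)).
 by rewrite /GRing.scale /= mulr1.
have h1 : is_derive s (1 : R) (fun t : R => pi^-1 * t^-1) (pi^-1 * - s ^- 2).
 exact: (is_deriveZ pi^-1 hV).
have h2 := is_deriveX n h1.
have h3 : is_derive s (1 : R) (fun t : R => - E2 z * t^-1) (- E2 z * - s ^- 2).
 exact: (is_deriveZ (- E2 z) hV).
have h4 := @is_derive1_comp R expR _ s _ _ (is_derive_expR _) h3.
have := is_deriveM h2 h4.
have -> : ((fun t : R => pi^-1 * t^-1) ^+ n * (expR \o (fun t : R => - E2 z * t^-1))) = fun t => gk t z.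
 by ext => t; rewrite /gk /= invfM; congr (_ * _); elim: (n) => [|k IH] //; rewrite !exprS -IH.
move=> H; apply: is_derive_eq H _.
have -> : ((fun t : R => pi^-1 * t^-1) ^+ n) s = (pi * s)^-1 ^+ n.
 by elim: (n) => [|k IH] //; rewrite !exprS -IH invfM.
rewrite /gk /GRing.scale /= -invfM.
have p0 : (pi : R) != 0 by rewrite gt_eqF// pi_gt0.
move: (E2 z) => e; case: (n) => [|k]; first by rewrite !expr0 mulr0n !mul0r; field.
rewrite /= exprS; move: (pi) p0 => p p0; move: (expR _) ((p * s)^-1 ^+ k) => a b; field.
by rewrite s1 p0.
Qed.

(** Half of the exponent is spent on the decay in [r], the other half is the exponent at time
    [2 * s]; the factor 2^n adjusts the normalization. *)
Lemma nr_tuple_tail s z (r : R) : 0 < s -> 0 <= r -> r <= nr z ->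
 gk s z <= 2 ^+ n * expR (- r ^+ 2 / (2 * s)) * gk (2 * s) z.
move=> s0 r0 rz; rewrite /gk.
have -> : 2 ^+ n * expR (- r ^+ 2 / (2 * s)) * ((pi * (2 * s))^-1 ^+ n * expR (- E2 z / (2 * s))) =
 (pi * s)^-1 ^+ n * (expR (- r ^+ 2 / (2 * s)) * expR (- E2 z / (2 * s))).
 have -> : (pi * s)^-1 ^+ n = 2 ^+ n * (pi * (2 * s))^-1 ^+ n.
 rewrite -exprMn; congr (_ ^+ _); rewrite (mulrCA pi) (invfM 2) mulrA divff ?mul1r//.
 by rewrite mulrACA mulrA.
rewrite ler_wpM2l//; first by rewrite exprn_ge0// invr_ge0 mulr_ge0 ?pi_ge0// ltW.
rewrite -expRD ler_expR.
have h : r ^+ 2 <= E2 z.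
 by apply: le_trans (E2_ge z); rewrite lerXn2r// nnegrE nr_ge0.
rewrite -mulrDl ler_pdivrMr// mulrAC ler_pdivlMr ?mulr_gt0//.
by nra.
Qed.

Lemma measurable_gk s : measurable_fun (setT : set B) (gk s : B -> R).
apply: cont_measurable; exact: (sm_cont (sm_gk s)). Qed.

(** The kernel is a product of 2n normal densities of variance s / 2. *)
Lemma integral_gk s : 0 < s -> (\int[L]_z (gk s z)%:E = 1)%E.
move=> s0; have [sg sg0 sg2] : exists2 sg : R, 0 < sg & sg ^+ 2 = s / 2.
 by exists (Num.sqrt (s / 2)); rewrite ?sqrtr_gt0 ?divr_gt0// sqr_sqrtr// divr_ge0// ltW.
rewrite ge0_integral_pushforward//; last 3 first.
- exact: measurable_tuple_Cn.
- by to_EFin; exact: measurable_gk.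
- by move=> z _; rewrite lee_fin gk_ge0.
rewrite preimage_setT.
transitivity (\int[@lebesgue_tuple R (n + n)]_t (\prod_i normal_pdf 0 sg (tnth t i))%:E)%E.
 apply: eq_integral => t _ /=; congr EFin.
 rewrite normal_pdfE ?gt_eqF// big_split /= prodr_const card_ord /normal_peak /normal_fun -expR_sum.
 rewrite /gk; congr (_ * expR _).
 rewrite exprD -exprMn -invfM -expr2 sqr_sqrtr; last first.
 by rewrite mulrn_wge0// mulr_ge0 ?sqr_ge0// pi_ge0.
 by congr (_^-1 ^+ _); rewrite sg2 -mulr_natr; field.
 rewrite big_split_ord /= /E2 -big_split /= -sumrN mulr_suml; bigr => j _.
 rewrite /xr /xi !mxE /= !subr0 sg2.
 rewrite -[s / 2 *+ 2]mulr_natr divfK// !mulNr mulrDl opprD.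
 by [].
rewrite tuple_prod//; last first.
- by move=> x; exact: normal_pdf_ge0.
- exact: measurable_normal_pdf.
have -> : (\int[@lebesgue_measure R]_x (normal_pdf 0 sg x)%:E = 1)%E.
 by apply: integral_normal_pdf; rewrite gt_eqF.
by elim: (n + n)%N => [|k IH]; rewrite ?expe0// expeS IH mule1.
Qed.

Lemma integrable_gk s : 0 < s -> L.-integrable setT (EFin \o gk s).
move=> s0; apply/integrableP; split; first by to_EFin; exact: measurable_gk.
under eq_integral do rewrite /= ger0_norm ?gk_ge0//.
by rewrite integral_gk// ltry.
Qed.

Lemma integ_gk s : 0 < s -> integ (gk s) = 1.
by move=> s0; rewrite integE /Rintegral integral_gk. Qed.

(** The time [s0] depends on [F] only through the bound [K] and the modulus [r]; in
    [viscosity_distribution] it must serve a whole family of functions at once. *)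
Lemma heat_approx_unif (K r e : R) : 0 < K -> 0 < r -> 0 < e -> exists2 s0 : R, 0 < s0 &
 forall F, Cc F -> (forall z, `|F z| <= K) -> (forall z w, nr (w - z) < r -> `|F w - F z| < e / 2) ->
 forall s z, 0 < s < s0 -> `|mollify F (gk s) z - F z| <= e.
move=> K0 r0 e0; have e2 : 0 < e / 2 by rewrite divr_gt0.
(* The tail is at most 2 K 2^n exp(- r^2 / (2 s)), and exp(-y) <= 1/y turns this into [A * s]. *)
pose A := 2 * K * 2 ^+ n * (2 / r ^+ 2).
have A0 : 0 < A.
 by apply: mulr_gt0; [apply: mulr_gt0; [exact: mulr_gt0|exact: exprn_gt0]|apply: divr_gt0 => //; exact: exprn_gt0].
exists (e / 2 / A) => [|F cF HK Hr s z /andP[s0 sA]]; first by rewrite divr_gt0.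
have s20 : 0 < 2 * s by rewrite mulr_gt0.
rewrite conv_shiftE//; last exact: (sm_cont (sm_gk s)).
have i1 : L.-integrable setT (EFin \o (fun y => F (y + z) * gk s y)).
 apply: Cc_integrable; apply: CcMl; first exact: Cc_shift.
 exact: (sm_cont (sm_gk s)).
have igk t (a : R) : 0 < t -> L.-integrable setT (EFin \o (fun y => a * gk t y)).
 move=> t0; have -> : EFin \o (fun y => a * gk t y) = (fun y => a%:E * (EFin \o gk t) y)%E.
 by ext => y /=; rewrite EFinM.
 by apply: integrableZl => //; exact: integrable_gk.
have gZ t (a : R) : 0 < t -> \int[L]_y (a * gk t y) = a.
 move=> t0; have := integ_gk t0; rewrite integE => h.
 by have := RintegralZl a measurableT (integrable_gk t0); rewrite h mulr1.
have E : integ (fun y => F (y + z) * gk s y) - F z = integ (fun y => F (y + z) * gk s y - F z * gk s y).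
 rewrite !integE RintegralB//; last exact: igk.
 by rewrite gZ.
have i2 : L.-integrable setT (EFin \o (fun y => F (y + z) * gk s y - F z * gk s y)).
 have := integrableB measurableT i1 (igk s (F z) s0); congr (integrable _ _ _).
rewrite E; apply: le_trans (le_normr_Rintegral measurableT i2) _.
pose b := 2 * K * (2 ^+ n * expR (- r ^+ 2 / (2 * s))).
have i3 : L.-integrable setT (EFin \o (fun y => e / 2 * gk s y + b * gk (2 * s) y)).
 have := integrableD measurableT (igk s (e / 2) s0) (igk (2 * s) b s20); congr (integrable _ _ _).
apply: (@le_trans _ _ (\int[L]_y (e / 2 * gk s y + b * gk (2 * s) y))).
 apply: le_Rintegral => //; first exact: integrable_norm.
 move=> y _; rewrite -mulrBl normrM [`|gk _ _|]ger0_norm ?gk_ge0//.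
 have b0 : 0 <= b by rewrite !mulr_ge0 ?expR_ge0 ?exprn_ge0// ltW.
 have [yr|yr] := ltP (nr y) r.
 apply: (@le_trans _ _ (e / 2 * gk s y)); last by rewrite lerDl mulr_ge0// gk_ge0.
 by rewrite ler_wpM2r ?gk_ge0// ltW// Hr// addrK.
 apply: (@le_trans _ _ (b * gk (2 * s) y)); last by rewrite lerDr mulr_ge0 ?gk_ge0// ltW.
 rewrite /b -mulrA; apply: ler_pM => //; first exact: gk_ge0.
 by apply: le_trans (ler_normB _ _) _; rewrite mulr2n mulrDl mul1r lerD.
 by apply: nr_tuple_tail => //; exact: ltW.
rewrite RintegralD//; [|exact: igk|exact: igk].
rewrite (gZ _ _ s0) (gZ _ _ s20) [leRHS]splitr lerD2l.
apply: (@le_trans _ _ (A * s)); last first.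
 by apply: ltW; rewrite mulrC -ltr_pdivlMr.
have -> : b = 2 * K * 2 ^+ n * expR (- r ^+ 2 / (2 * s)) by rewrite /b mulrA.
have -> : A * s = 2 * K * 2 ^+ n * (2 * ((r ^+ 2)^-1 * s)) by rewrite /A -!mulrA.
rewrite ler_wpM2l//; first by rewrite !mulr_ge0 ?exprn_ge0// ltW.
have r2 : 0 < r ^+ 2 by rewrite exprn_gt0.
rewrite mulNr expRN -[leLHS]mul1r ler_pdivrMr ?expR_gt0//.
have := expR_ge1Dx (r ^+ 2 / (2 * s)) => h.
have h0 : 0 < r ^+ 2 / (2 * s) by rewrite divr_gt0.
have h1 : r ^+ 2 / (2 * s) <= expR (r ^+ 2 / (2 * s)) by apply: le_trans h; rewrite lerDr.
apply: (@le_trans _ _ (2 * ((r ^+ 2)^-1 * s) * (r ^+ 2 / (2 * s)))).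
 by rewrite [leRHS](_ : _ = 1)//; field; rewrite !gt_eqF.
rewrite ler_wpM2l//; apply: mulr_ge0 => //; apply: mulr_ge0; first by rewrite invr_ge0 ltW.
exact: ltW.
Qed.

Lemma heat_approx F : Cc F -> forall e : R, 0 < e ->
 exists2 s0 : R, 0 < s0 & forall s z, 0 < s < s0 -> `|mollify F (gk s) z - F z| <= e.
move=> cF e e0; have e2 : 0 < e / 2 by rewrite divr_gt0.
have [r r0 Hr] := Cc_unif cF e2; have [K K0 HK] := Cc_bounded cF.
by have [s0 s00 H] := heat_approx_unif K0 r0 e0; exists s0 => // s z; exact: H.
Qed.

Lemma heat_dt F s z : Cc F -> 0 < s ->
 is_derive s (1 : R) (fun t => mollify F (gk t) z) (laplacian (mollify F (gk s)) z).
move=> cF s0; rewrite laplacian_conv//; last exact: sm_gk.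
(* Times are confined to (s / 2, 2 s): there the Laplacian of the kernel is bounded on the bounded
   set of arguments where [F] does not vanish. *)
have [_ [M HM]] := cF.
pose s' := s / 2; have s'0 : 0 < s' by rewrite divr_gt0.
pose E := n%:R * 2 * (M + nr z) ^+ 2.
apply: (@integ_derive R n F (fun t y => gk t (y - z)) (fun t y => laplacian (gk t) (y - z)) s' (2 * s) s
 ((n%:R / s' + E / s' ^+ 2) * (pi * s')^-1 ^+ n)) => //.
- by apply/andP; split; rewrite /s'; lra.
- by move=> t _; apply: cont_shift; exact: (sm_cont (sm_gk t)).
- by move=> t y /andP[t1 _]; apply: gk_dt; exact: lt_trans t1.
move=> t y /andP[t1 t2] Fy; have t0 := lt_trans s'0 t1.
have yM : nr y <= M by rewrite leNgt; apply: contra Fy => /HM ->.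
rewrite laplacian_gk// normrM; apply: ler_pM => //.
 apply: le_trans (ler_normD _ _) _; rewrite normrN; apply: lerD.
 rewrite ger0_norm; last by rewrite divr_ge0 ?ler0n// ltW.
 by rewrite ler_wpM2l// lef_pV2 ?posrE// ltW.
 have EE : 0 <= E2 (y - z) by apply: le_trans (E2_ge _); rewrite sqr_ge0.
 rewrite ger0_norm; last by rewrite divr_ge0// sqr_ge0.
 apply: ler_pM => //; first by rewrite invr_ge0 sqr_ge0.
 apply: le_trans (E2_le _) _; rewrite ler_wpM2l// lerXn2r// ?nnegrE ?nr_ge0//.
 by rewrite addr_ge0 ?nr_ge0// (le_trans (nr_ge0 y)).
 by apply: le_trans (nrD _ _) _; rewrite nrN lerD2r.
 by rewrite lef_pV2 ?posrE ?exprn_gt0// lerXn2r// ?nnegrE ltW.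
rewrite ger0_norm ?gk_ge0// /gk.
rewrite -[leRHS]mulr1; apply: ler_pM.
- by rewrite exprn_ge0// invr_ge0 mulr_ge0 ?pi_ge0// ltW.
- exact: expR_ge0.
- rewrite lerXn2r// ?nnegrE ?invr_ge0 ?mulr_ge0 ?pi_ge0// ?ltW//.
 by rewrite ltf_pV2 ?posrE ?mulr_gt0 ?pi_gt0// ltr_pM2l ?pi_gt0.
- rewrite -expR0 ler_expR mulNr oppr_le0 divr_ge0//; last exact: ltW.
 by apply: le_trans (E2_ge _); rewrite sqr_ge0.
Qed.

(** First-order expansion of the heat flow at time 0. The heat equation holds at positive times
    only, so the mean value theorem is used on [t, s] with t small. *)
Lemma heat_small Q : tf Q -> forall e : R, 0 < e ->
 exists2 s0 : R, 0 < s0 & forall s, 0 < s < s0 ->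
 `|mollify Q (gk s) 0 - Q 0 - s * laplacian Q 0| <= e * s.
move=> tQ e e0; have e2 : 0 < e / 2 by rewrite divr_gt0.
have tL := tf_laplacian tQ.
have [s0 s00 H] := heat_approx (tf_Cc tL) e2.
exists s0 => // s /andP[s1 s2].
set l := laplacian Q 0; set q := mollify Q (gk s) 0.
apply/ler_addgt0Pr => d d0.
have d2 : 0 < d / 2 by rewrite divr_gt0.
have [s3 s30 H3] := heat_approx (tf_Cc tQ) d2.
(* So small that the flow at time [t] is within [d / 2] of [Q 0] and [t * l] is at most [d / 2]. *)
pose t := Num.min (Num.min (s / 2) (s3 / 2)) (d / 2 / (`|l| + 1)).
have l0 : 0 < `|l| + 1 by rewrite ltr_wpDl.
have t0 : 0 < t by rewrite !lt_min !divr_gt0.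
have ts : t <= s / 2 by rewrite /t !ge_min lexx.
have ts3 : t <= s3 / 2 by rewrite /t !ge_min lexx orbT.
have td : t <= d / 2 / (`|l| + 1) by rewrite /t !ge_min lexx !orbT.
have tds : t * `|l| <= d / 2.
 apply: (@le_trans _ _ (t * (`|l| + 1))); first by rewrite ler_wpM2l ?lerDl// ltW.
 by rewrite -ler_pdivlMr.
have tlt : t < s by apply: le_lt_trans ts _; lra.
have dq x : x \in `]t, s[ -> is_derive x (1 : R) (fun x => mollify Q (gk x) 0) (laplacian (mollify Q (gk x)) 0).
 rewrite in_itv /= => /andP[x1 _]; apply: heat_dt; first exact: tf_Cc.
 exact: lt_trans x1.
have cq : {within `[t, s], continuous (fun x => mollify Q (gk x) 0)}.
 apply: derivable_within_continuous => x; rewrite in_itv /= => /andP[x1 _].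
 by have [] := heat_dt (0 : C) (tf_Cc tQ) (lt_le_trans t0 x1).
have [c] := MVT tlt dq cq; rewrite in_itv /= => /andP[c1 c2] E.
have c0 := lt_trans t0 c1.
have Hc := H c 0; rewrite c0 (lt_trans c2 s2) in Hc.
have {}Hc := Hc isT.
(* The Laplacian is moved from the kernel to [Q]; the mean of the continuous function [laplacian Q]
   then converges as the time tends to 0. *)
have EL : laplacian (mollify Q (gk c)) 0 = mollify (laplacian Q) (gk c) 0.
 have c0E G K : mollify G K 0 = integ (fun y => G y * K y).
 by congr integ; ext => y; rewrite subr0.
 rewrite (laplacian_conv (tf_Cc tQ) (sm_gk c)) c0E c0E.
 by rewrite (laplacian_by_parts tQ (sm_gk c)).
rewrite EL in E.
have Ht := H3 t 0; rewrite t0 /= (le_lt_trans ts3) in Ht; last by rewrite ltr_pdivrMr// ltr_pMr// ltr1n.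
have {}Ht := Ht isT.
rewrite (_ : q - Q 0 - s * l = (q - mollify Q (gk t) 0 - (s - t) * l) + (mollify Q (gk t) 0 - Q 0) - t * l); last by ring.
apply: le_trans (ler_normB _ _) _; rewrite normrM gtr0_norm//.
have h1 : `|(q - mollify Q (gk t) 0 - (s - t) * l)| <= e / 2 * s.
 rewrite E [_ * (s - t)]mulrC -mulrBr normrM gtr0_norm ?subr_gt0// mulrC.
 by apply: ler_pM => //; rewrite ?subr_ge0 ?(ltW tlt)// gerBl ltW.
have := ler_normD (q - mollify Q (gk t) 0 - (s - t) * l) (mollify Q (gk t) 0 - Q 0).
move: h1 Ht tds; move: (`|_ + _|) (`|_ - (s - t) * l|) (`|_ - Q 0|) (t * _) => A1 A2 A3 A4.
move=> h1 h2 h3 h4.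
have h5 : 0 <= e / 2 * s by rewrite mulr_ge0 ?ltW.
have -> : e * s = e / 2 * s + e / 2 * s by rewrite -mulrDl -splitr.
by clear -h1 h2 h3 h4 h5; lra.
Qed.

End Gaussian.

(** * Powers of sums of commuting nilpotents *)

Section nilpotent_sum.
Variables (K : comPzRingType) (X : lmodType K) (I : eqType) (E : I -> X -> X) (d : I -> K).
Hypothesis Elin : forall k a x y, E k (a *: x + y) = a *: E k x + E k y.
Hypothesis Ecomm : forall k l x, E k (E l x) = E l (E k x).
Hypothesis Enil : forall k x, E k (E k x) = 0.

Let E0 k : E k 0 = 0.
by have := Elin k 0 0 0; rewrite !scale0r !add0r => h; have := Elin k 1 0 0; rewrite !scale1r !addr0 => /esym/eqP; rewrite -subr_eq0 addrK => /eqP. Qed.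
Let EZ k a x : E k (a *: x) = a *: E k x.
by have := Elin k a x 0; rewrite !addr0 E0 addr0. Qed.
Let ED k x y : E k (x + y) = E k x + E k y.
by have := Elin k 1 x y; rewrite !scale1r. Qed.

Definition wsum (l : seq I) x := \sum_(k <- l) d k *: E k x.
Definition composite (l : seq I) x := foldr (fun k y => E k y) x l.

Let sumD l x y : wsum l (x + y) = wsum l x + wsum l y.
by rewrite -big_split /=; bigr => k _; rewrite ED scalerDr. Qed.
Let sumZ l a x : wsum l (a *: x) = a *: wsum l x.
by rewrite scaler_sumr; bigr => k _; rewrite EZ !scalerA mulrC. Qed.

Let sumE l k x : wsum l (E k x) = E k (wsum l x).
rewrite /wsum; elim: l => [|m l IH]; first by rewrite !big_nil E0.
by rewrite !big_cons ED EZ IH Ecomm.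
Qed.

Let comp_kill l x k : k \in l -> E k (composite l x) = 0.
elim: l => //= m l IH; rewrite inE => /orP[/eqP ->|/IH h]; first exact: Enil.
by rewrite Ecomm h E0.
Qed.

(** The multinomial formula for commuting operators of square zero: with as many factors as
    operators, only the product of all of them survives, and it occurs in m! orders. *)
Lemma iter_weighted_sum l x :
 iter (size l) (wsum l) x = ((size l)`!%:R * \prod_(k <- l) d k) *: composite l x.
elim: l x => [|k l IH] x; first by rewrite big_nil mulr1 scale1r.
(* The binomial formula for the new operator plus the rest; only the powers 0 and 1 of the new
   operator are nonzero. *)
have H j y : iter j (wsum (k :: l)) y =
 iter j (wsum l) y + (j%:R * d k) *: E k (iter j.-1 (wsum l) y).
 elim: j => [|j IHj]; first by rewrite mul0r scale0r addr0.
 rewrite iterS IHj /wsum big_cons -/(wsum l _) -/(wsum l _) sumD sumZ sumE.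
 rewrite ED EZ Enil scaler0 addr0 /= addrC -addrA; congr (_ + _).
 case: j {IHj} => [|j] /=; first by rewrite mul0r scale0r add0r mul1r.
 rewrite -[LHS]scalerDl; congr (_ *: _).
 by rewrite -[in RHS]natr1 mulrDl mul1r.
rewrite H /= -/(size l) IH.
have -> : wsum l (((size l)`!%:R * \prod_(k0 <- l) d k0) *: composite l x) = 0.
 rewrite sumZ [X in _ *: X]big_seq [X in _ *: X]big1 ?scaler0// => m ml.
 by rewrite comp_kill// scaler0.
rewrite add0r EZ scalerA big_cons factS natrM; congr (_ *: _).
by rewrite mulrACA.
Qed.

End nilpotent_sum.

(** * Exterior algebra on coefficient arrays *)

Section wedge.
Context {R : realType} {n : nat}.
Local Notation K := R[i].
Local Notation array := ({set 'I_n} -> {set 'I_n} -> K).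
Implicit Types (I J : {set 'I_n}) (T : array) (v w : 'I_n -> K) (p q : 'I_n).

Lemma wsign2 I p : @wsign R n I p * wsign I p = 1.
by rewrite /wsign -exprD addnn -muln2 exprM sqrr_sign. Qed.

(** The rule dz_p /\ dz_q = - dz_q /\ dz_p: removing the smaller of two indices lowers the rank of
    the larger by one. *)
Lemma wsign_swap I p q : p \in I -> q \in I -> p != q ->
 @wsign R n I p * wsign (I :\ p) q = - (wsign I q * wsign (I :\ q) p).
move=> pI qI pq.
wlog lt_pq : p q pI qI pq / (p < q)%N.
 move=> H; case: (ltngtP p q) => h; first exact: H.
 - by rewrite [in RHS]H ?opprK// eq_sym.
 - by move/eqP: pq; case; exact: val_inj.
have e1 : @wsign R n (I :\ q) p = wsign I p.
 rewrite /wsign; congr (_ ^+ _); apply: eq_card => i; rewrite !inE.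
 by case: (i =P q) => [->|_] //=; apply/esym/negP => /andP[_]; rewrite ltnNge (ltnW lt_pq).
have e2 : @wsign R n I q = - wsign (I :\ p) q.
 rewrite /wsign (cardsD1 p) !inE pI lt_pq /= add1n exprS mulN1r; congr (- (_ ^+ _)).
 by apply: eq_card => i; rewrite !inE; case: eqP.
by rewrite e1 e2 mulNr opprK mulrC.
Qed.

(** Exchange of the two summation indices. It gives both the anticommutation of one-forms and, with
    [alt_sum0], the vanishing of a repeated d. *)
Lemma alt_sum I (G : 'I_n -> 'I_n -> K) :
 \sum_(p in I) \sum_(q in I :\ p) wsign I p * wsign (I :\ p) q * G p q =
 - \sum_(p in I) \sum_(q in I :\ p) wsign I p * wsign (I :\ p) q * G q p.
rewrite (exchange_big_dep (mem I)) /=; last by move=> p q pI; rewrite !inE => /andP[].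
rewrite -sumrN; bigr => p pI; rewrite -sumrN.
rewrite (eq_bigl (fun q => q \in I :\ p)); last first.
 by move=> q; rewrite !inE pI andbT eq_sym andbC.
bigr => q; rewrite !inE => /andP[qp qI].
by rewrite wsign_swap// mulNr.
Qed.

Lemma alt_sum0 I (G : 'I_n -> 'I_n -> K) : (forall p q, G p q = G q p) ->
 \sum_(p in I) \sum_(q in I :\ p) wsign I p * wsign (I :\ p) q * G p q = 0.
move=> H; have := alt_sum I G.
under [in RHS]eq_bigr do under eq_bigr do rewrite H.
by move/eqP; rewrite -addr_eq0 -mulr2n mulrn_eq0 /= => /eqP.
Qed.

(** The product of the (1,1)-form with matrix [H] and the form with coefficients [T], with the signs
    of [ddc_wedge]. *)
Definition wedge (H : 'I_n -> 'I_n -> K) T : array := fun I J =>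
 \sum_(p in I) \sum_(q in J) wsign I p * wsign J q * H p q * T (I :\ p) (J :\ q).

Definition wedgel v T : array := fun I J => \sum_(p in I) wsign I p * v p * T (I :\ p) J.
Definition wedger v T : array := fun I J => \sum_(q in J) wsign J q * v q * T I (J :\ q).

Lemma wedge_rank1 v w T : wedge (fun p q => v p * w q) T = wedgel v (wedger w T).
ext => I; ext => J; bigr => p _.
by rewrite mulr_sumr; bigr => q _; ring.
Qed.

Lemma wedgel_anti v w T : wedgel v (wedgel w T) = fun I J => - wedgel w (wedgel v T) I J.
ext => I; ext => J; rewrite /wedgel.
transitivity (\sum_(p in I) \sum_(q in I :\ p) wsign I p * wsign (I :\ p) q * (v p * w q * T (I :\ p :\ q) J)).
 by bigr => p _; rewrite mulr_sumr; bigr => q _; ring.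
rewrite (alt_sum I (fun p q => v p * w q * T (I :\ p :\ q) J)); congr (- _).
bigr => p _; rewrite mulr_sumr; bigr => q _.
have -> : I :\ q :\ p = I :\ p :\ q by apply/setP => i; rewrite !inE andbCA.
by ring.
Qed.

Lemma wedger_anti v w T : wedger v (wedger w T) = fun I J => - wedger w (wedger v T) I J.
ext => I; ext => J.
by have := congr1 (fun X : array => X J I) (wedgel_anti v w (fun I J => T J I)).
Qed.

Lemma wedge_lr v w T : wedgel v (wedger w T) = wedger w (wedgel v T).
ext => I; ext => J; rewrite /wedgel /wedger.
transitivity (\sum_(p in I) \sum_(q in J) wsign I p * wsign J q * v p * w q * T (I :\ p) (J :\ q)).
 by bigr => p _; rewrite mulr_sumr; bigr => q _; ring.
rewrite exchange_big; bigr => q _; rewrite mulr_sumr.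
by bigr => p _; ring.
Qed.

Lemma wedgelN v T : wedgel v (fun I J => - T I J) = fun I J => - wedgel v T I J.
by ext => I; ext => J; rewrite /wedgel -sumrN; bigr => p _; rewrite mulrN. Qed.

Lemma wedgel_nil v T I J : wedgel v (wedgel v T) I J = 0.
have := congr1 (fun X : array => X I J) (wedgel_anti v v T) => /= /eqP.
by rewrite -addr_eq0 -mulr2n mulrn_eq0 /= => /eqP.
Qed.

Definition wedge1 v T := wedgel v (wedger (fun q => (v q)^*%R) T).

(** Exchanging the holomorphic factors and exchanging the antiholomorphic ones each give a sign; the
    two signs cancel. *)
Lemma wedge1_comm v w T : wedge1 v (wedge1 w T) = wedge1 w (wedge1 v T).
rewrite /wedge1 -(wedge_lr w) wedgel_anti wedger_anti !wedgelN.
rewrite -(wedge_lr v); ext => I; ext => J.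
by rewrite opprK.
Qed.

Lemma wedge1_nil v T : wedge1 v (wedge1 v T) = 0 :> array.
by ext => I; ext => J; rewrite /wedge1 -(wedge_lr v) wedgel_nil.
Qed.

Lemma wedge1_lin v (a : K) T (S : array) : wedge1 v (a *: T + S) = a *: wedge1 v T + wedge1 v S.
ext => I; ext => J; rewrite /wedge1 /wedgel.
have -> : (a *: (fun I J => \sum_(p in I) wsign I p * v p * wedger (fun q => (v q)^*%R) T (I :\ p) J) +
 (fun I J => \sum_(p in I) wsign I p * v p * wedger (fun q => (v q)^*%R) S (I :\ p) J)) I J =
 a * (\sum_(p in I) wsign I p * v p * wedger (fun q => (v q)^*%R) T (I :\ p) J) +
 (\sum_(p in I) wsign I p * v p * wedger (fun q => (v q)^*%R) S (I :\ p) J) by [].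
rewrite mulr_sumr -big_split /=; bigr => p _.
have -> : wedger (fun q => (v q)^*%R) (a *: T + S) (I :\ p) J =
 a * wedger (fun q => (v q)^*%R) T (I :\ p) J + wedger (fun q => (v q)^*%R) S (I :\ p) J.
 rewrite /wedger mulr_sumr -big_split /=; bigr => q _.
 have -> : (a *: T + S) (I :\ p) (J :\ q) = a * T (I :\ p) (J :\ q) + S (I :\ p) (J :\ q) by [].
 by ring.
by ring.
Qed.

Definition one_array : array := fun _ _ => 1.

(* The wedge product of n forms has only one coefficient. *)
Definition mass H : K := iter n (wedge H) one_array full full.

Lemma iter_wedge_id k I J : #|I| = k -> #|J| = k ->
 iter k (wedge (fun p q => (p == q)%:R)) one_array I J = if I == J then k`!%:R else 0.
elim: k I J => [|k IH] I J.
 by move=> /cards0_eq -> /cards0_eq ->; rewrite eqxx.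
move=> cI cJ; rewrite iterS /wedge.
have cD (A : {set 'I_n}) p : #|A| = k.+1 -> p \in A -> #|A :\ p| = k.
 by move=> cA pA; have := cardsD1 p A; rewrite pA cA => -[].
transitivity (\sum_(p in I | p \in J) (if I == J then k`!%:R else 0 : K)).
 rewrite [RHS]big_mkcondr /=; bigr => p pI.
 case: ifP => pJ; last first.
 rewrite big1// => q qJ; case: eqP => [pq|_]; last by rewrite mulr0 mul0r.
 by rewrite pq qJ in pJ.
 rewrite (bigD1 p)//= big1 ?addr0; last first.
 by move=> q /andP[_ qp]; rewrite eq_sym (negbTE qp) mulr0 mul0r.
 rewrite eqxx mulr1 IH ?cD//.
 have -> : (I :\ p == J :\ p) = (I == J).
 by apply/eqP/eqP => [h|->//]; rewrite -(finset.setD1K pI) h finset.setD1K.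
 by case: eqP => [->|_]; rewrite ?mulr0// wsign2 mul1r.
case: eqP => [<-|_]; last by rewrite big1.
rewrite (eq_bigl (mem I)); last by move=> p; rewrite andbb.
by rewrite sumr_const cI factS natrM mulr_natl.
Qed.

Lemma mass_id : mass (fun p q => (p == q)%:R) = n`!%:R.
by rewrite /mass iter_wedge_id ?eqxx// cardsT card_ord. Qed.

Lemma wedge_sum (I : finType) (H : I -> 'I_n -> 'I_n -> K) T :
 wedge (fun p q => \sum_i H i p q) T = fun A B => \sum_i wedge (H i) T A B.
ext => A; ext => B; rewrite /wedge [RHS]exchange_big; bigr => p _.
rewrite [RHS]exchange_big; bigr => q _ /=.
by rewrite mulr_sumr mulr_suml.
Qed.

(** For an orthonormal [P] this says that [mass] is n! times the determinant. The rank-one factors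
    commute and have square zero, so the power reduces to their product, which does not depend on
    [d]; its value is read off from the identity matrix. *)
Lemma mass_diag (P : 'I_n -> 'I_n -> K) (d : 'I_n -> K) :
 (forall p q, \sum_k P k p * (P k q)^*%R = (p == q)%:R) ->
 mass (fun p q => \sum_k d k * (P k p * (P k q)^*%R)) = n`!%:R * \prod_k d k.
move=> HP.
pose l := index_enum 'I_n.
have sl : size l = n by rewrite -[RHS](card_ord n) cardT enumT.
have key (d' : 'I_n -> K) : mass (fun p q => \sum_k d' k * (P k p * (P k q)^*%R)) =
 (n`!%:R * \prod_k d' k) * composite (fun k => wedge1 (P k)) l one_array full full.
 have := @iter_weighted_sum K array 'I_n (fun k => wedge1 (P k)) d' _ _ _ l one_array.
 rewrite sl => H; rewrite /mass.
 have -> : wedge (fun p q => \sum_k d' k * (P k p * (P k q)^*%R)) = wsum (fun k => wedge1 (P k)) d' l.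
 ext => T; rewrite wedge_sum; ext => I; ext => J.
 have E (r : seq 'I_n) : (\sum_(k <- r) d' k *: wedge1 (P k) T : array) I J = \sum_(k <- r) d' k * wedge1 (P k) T I J.
 by elim: r => [|k r IH]; rewrite ?big_nil// !big_cons -IH.
 rewrite /wsum E; bigr => k _.
 rewrite /wedge1 -wedge_rank1 /wedge mulr_sumr; bigr => p _.
 by rewrite mulr_sumr; bigr => q _; ring.
 rewrite H//.
 - by move=> k a x y; exact: wedge1_lin.
 - by move=> k m x; exact: wedge1_comm.
 - by move=> k x; exact: wedge1_nil.
have := key (fun=> 1); rewrite big1// mulr1.
have -> : (fun p q => \sum_k 1 * (P k p * (P k q)^*%R)) = fun p q => (p == q)%:R.
 by ext => p; ext => q; rewrite -HP; bigr => k _; rewrite mul1r.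
rewrite mass_id => h.
rewrite key -[RHS]mulr1; congr (_ * _).
have n0 : n`!%:R != 0 :> K by rewrite pnatr_eq0 -lt0n fact_gt0.
by apply: (mulfI n0); rewrite mulr1 -h.
Qed.

(** Positive semidefinite arrays, as sums of squares indexed by multi-indices. Nonnegativity of
    diagonal coefficients alone would not propagate through [wedge], whereas this property does. *)
Definition rcone T := exists r : seq ({set 'I_n} -> K), T = fun I J => \sum_(V <- r) V I * (V J)^*%R.

Lemma rcone1 : rcone one_array.
exists [:: fun=> 1]; ext => I; ext => J.
by rewrite big_seq1 rmorph1 mulr1.
Qed.

(** Each pair of a vector [v i] and a square [V] contributes the square of their antisymmetrized
    product. *)
Lemma rcone_wedge (I : finType) (v : I -> 'I_n -> K) T : rcone T ->
 rcone (wedge (fun p q => \sum_i v i p * (v i q)^*%R) T).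
move=> [r ->].
exists [seq (fun A : {set 'I_n} => \sum_(p in A) wsign A p * v i p * V (A :\ p)) | i <- index_enum I, V <- r].
ext => A; ext => B; rewrite wedge_sum big_allpairs_dep /=.
bigr => i _; rewrite /wedge.
transitivity (\sum_(p in A) \sum_(V <- r) \sum_(q in B)
 wsign A p * wsign B q * (v i p * (v i q)^*%R) * (V (A :\ p) * (V (B :\ q))^*%R)).
 bigr => p _; rewrite exchange_big; bigr => q _.
 by rewrite mulr_sumr.
rewrite exchange_big /=; bigr => V _.
rewrite rmorph_sum mulr_suml; bigr => p _.
rewrite mulr_sumr; bigr => q _.
have wC : (wsign B q : K)^*%R = wsign B q by rewrite /wsign rmorphXn rmorphN1.
have cM (a b c : K) : (a * b * c)^*%R = a^*%R * b^*%R * c^*%R by rewrite -!rmorphM.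
have cE : (wsign B q * v i q * V (B :\ q))^*%R = wsign B q * (v i q)^*%R * (V (B :\ q))^*%R.
 by apply: etrans (cM _ _ _) _; congr (_ * _ * _).
apply: etrans (congr1 (fun x => wsign A p * v i p * V (A :\ p) * x) (esym cE)).
by ring.
Qed.

Lemma rcone_ge0 T I : rcone T -> 0 <= T I I.
by move=> [r ->]; apply: sumr_ge0 => V _; exact: mul_conjC_ge0. Qed.

End wedge.

(** * Hermitian forms and the arithmetic-geometric inequality *)

Section hermitian_forms.
Context {R : realType} {n : nat}.
Local Notation K := R[i].
Implicit Types (H : 'I_n -> 'I_n -> K) (v w : 'I_n -> K) (P : 'I_n -> 'I_n -> K) (d t : 'I_n -> R).

Definition hform H v : K := \sum_p \sum_q v p * (v q)^*%R * H p q.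
Definition qf H v : R := Re (hform H v).
Definition dotc v w : K := \sum_p v p * (w p)^*%R.
Definition orthonormal P := forall k l, dotc (P k) (P l) = (k == l)%:R.

Lemma orthonormal_cols P : orthonormal P -> forall p q, \sum_k P k p * (P k q)^*%R = (p == q)%:R.
move=> oP p q.
pose A : 'M[K]_n := \matrix_(k, p) P k p.
have uA : A *m (map_mx Num.conj A)^T = 1%:M.
 apply/matrixP => k l; rewrite !mxE -(oP k l); bigr => j _.
 by rewrite !mxE.
have := mulmx1C uA => /matrixP/(_ q p); rewrite !mxE eq_sym => <-.
by bigr => k _; rewrite !mxE mulrC.
Qed.

Lemma herm_decomp H : (forall p q, H q p = (H p q)^*%R) ->
 exists P d, orthonormal P /\ forall p q, H p q = \sum_k (d k)%:C * (P k p * (P k q)^*%R).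
move=> hH; pose A : 'M[K]_n := \matrix_(p, q) H p q.
have hA : A \is hermsymmx.
 apply/is_hermitianmxP; rewrite expr0 scale1r; apply/matrixP => p q.
 by rewrite !mxE hH.
have /hermitian_normalmx /orthomx_spectralP AE := hA.
have rD := hermitian_spectral_diag_real hA.
have uP := spectral_unitarymx A.
exists (fun k p => (spectralmx A k p)^*%R), (fun k => Re (spectral_diag A 0 k)); split.
 move=> k l; move/unitarymxP: uP => /matrixP/(_ l k); rewrite !mxE eq_sym => <-.
 by bigr => p _; rewrite !mxE conjCK mulrC.
move=> p q; have := AE; rewrite invmx_unitary// => /matrixP/(_ p q).
rewrite !mxE => ->; bigr => k _.
rewrite !mxE (bigD1 k)//= big1 ?addr0; last first.
 by move=> l lk; rewrite !mxE (negbTE lk) mulr0.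
rewrite !mxE eqxx mulr1n conjCK.
have -> : (Re (spectral_diag A 0 k))%:C = spectral_diag A 0 k.
 have /mxOverP/(_ 0 k) := rD; move: (spectral_diag A 0 k) => [a b].
 by rewrite CrealE => /eqP[] /eqP; rewrite eq_sym -addr_eq0 -mulr2n mulrn_eq0 /= => /eqP ->.
by rewrite mulrAC mulrC.
Qed.

Lemma hform_diag H P d v : (forall p q, H p q = \sum_k (d k)%:C * (P k p * (P k q)^*%R)) ->
 hform H v = \sum_k (d k)%:C * (dotc v (fun p => (P k p)^*%R) * (dotc v (fun p => (P k p)^*%R))^*%R).
move=> HE; rewrite /hform.
transitivity (\sum_k \sum_p \sum_q v p * (v q)^*%R * ((d k)%:C * (P k p * (P k q)^*%R))).
 rewrite [RHS]exchange_big; bigr => p _; rewrite [RHS]exchange_big; bigr => q _.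
 by rewrite HE mulr_sumr.
bigr => k _; rewrite /dotc.
have -> : (\sum_p v p * ((P k p)^*%R)^*%R)^*%R = \sum_q (v q)^*%R * (P k q)^*%R.
 by rewrite rmorph_sum; bigr => q _; rewrite conjCK -rmorphM.
rewrite mulr_suml mulr_sumr; bigr => p _.
rewrite !mulr_sumr; bigr => q _.
by rewrite conjCK; ring.
Qed.

Lemma mulC_real (a : K) : a * a^*%R = (Re (a * a^*%R))%:C.
by have := mul_conjC_ge0 a; case: (a * a^*%R) => x y; rewrite lecE /= => /andP[/eqP ->]. Qed.
Lemma RemulC_ge0 (a : K) : 0 <= Re (a * a^*%R).
by have := mul_conjC_ge0 a; rewrite mulC_real lecE /= eqxx. Qed.
Lemma Re_sum (I : Type) (r : seq I) (F : I -> K) : Re (\sum_(i <- r) F i) = \sum_(i <- r) Re (F i).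
by rewrite raddf_sum. Qed.
Lemma ReZ (a : R) (b : K) : Re (a%:C * b) = a * Re b.
by case: b => x y /=; rewrite mul0r subr0. Qed.

Lemma qf_diag H P d v : (forall p q, H p q = \sum_k (d k)%:C * (P k p * (P k q)^*%R)) ->
 qf H v = \sum_k d k * Re (dotc v (fun p => (P k p)^*%R) * (dotc v (fun p => (P k p)^*%R))^*%R).
by move=> HE; rewrite /qf (hform_diag _ HE) Re_sum; bigr => k _; rewrite ReZ.
Qed.

Lemma qf_eigen H P d k : orthonormal P ->
 (forall p q, H p q = \sum_k (d k)%:C * (P k p * (P k q)^*%R)) ->
 qf H (fun p => (P k p)^*%R) = d k.
move=> oP HE; rewrite (qf_diag _ HE).
have E l : dotc (fun p => (P k p)^*%R) (fun p => (P l p)^*%R) = (l == k)%:R.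
 by rewrite -oP /dotc; bigr => p _; rewrite conjCK mulrC.
rewrite (bigD1 k)//= big1 ?addr0; last first.
 by move=> l lk; rewrite E (negbTE lk) mul0r mulr0.
by rewrite E eqxx mulr1n rmorph1 mulr1 /= mulr1.
Qed.

Lemma rcone_wedge_psd H T : (forall p q, H q p = (H p q)^*%R) -> (forall v, 0 <= qf H v) ->
 rcone T -> rcone (wedge H T).
move=> hH pH; have [P [d [oP HE]]] := herm_decomp hH.
have d0 k : 0 <= d k by rewrite -(qf_eigen k oP HE).
move=> /(rcone_wedge (fun k p => (Num.sqrt (d k))%:C * P k p)); congr (rcone (wedge _ T)).
ext => p; ext => q; rewrite HE; bigr => k _.
have sC : ((Num.sqrt (d k))%:C : K)^*%R = (Num.sqrt (d k))%:C by exact: conjc_real.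
rewrite rmorphM /= sC mulrACA; congr (_ * _).
by rewrite -rmorphM /= -expr2 sqr_sqrtr.
Qed.

Lemma mass_herm H P d : orthonormal P ->
 (forall p q, H p q = \sum_k (d k)%:C * (P k p * (P k q)^*%R)) ->
 mass H = (n`!%:R * \prod_k d k)%:C.
move=> oP HE.
have -> : H = fun p q => \sum_k (d k)%:C * (P k p * (P k q)^*%R).
 by ext => p; ext => q.
rewrite mass_diag; last exact: orthonormal_cols.
by rewrite rmorphM rmorph_nat rmorph_prod.
Qed.

(** Encodes a positive matrix D of determinant one by orthonormal eigenvectors [P] and the square
    roots [t] of its eigenvalues; [frame_trace] is then tr(H D). *)
Definition unit_frame P t := [/\ orthonormal P, forall j, 0 < t j & \prod_j t j = 1].

Definition frame_trace H P t : R := \sum_j t j ^+ 2 * qf H (P j).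

Lemma ln_prod (F : 'I_n -> R) : (forall j, 0 < F j) -> ln (\prod_j F j) = \sum_j ln (F j).
move=> F0; suff : 0 < \prod_j F j /\ ln (\prod_j F j) = \sum_j ln (F j) by case.
apply: (big_ind2 (fun a b => 0 < a /\ ln a = b)) => [||i _].
- by rewrite ltr01 ln1.
- by move=> a b c e [a0 <-] [c0 <-]; rewrite mulr_gt0// lnM.
- by split.
Qed.

(** The trace is the sum of w_jk t_j^2 d_k with a doubly stochastic w. Summing ln y <= y - 1 at y =
    t_j^2 d_k / l with these weights, the logarithms of the t_j cancel since their product is 1. *)
Lemma frame_trace_ge H P t (l : R) : (forall p q, H q p = (H p q)^*%R) -> (forall v, 0 <= qf H v) ->
 unit_frame P t -> 0 < l -> n`!%:R * l ^+ n <= Re (mass H) ->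
 n%:R * l <= frame_trace H P t.
move=> hH pH [oP t0 t1] l0; have [D [d [oD HE]]] := herm_decomp hH.
rewrite (mass_herm oD HE) /= ler_pM2l ?ltr0n ?fact_gt0// => hl.
have d0 k : 0 <= d k by rewrite -(qf_eigen k oD HE).
have dp k : 0 < d k.
 rewrite lt_neqAle d0 andbT eq_sym; apply/eqP => dk.
 have : 0 < \prod_k d k by apply: lt_le_trans hl; exact: exprn_gt0.
 by rewrite (bigD1 k)//= dk mul0r ltxx.
(* Squared moduli of the coordinates of one orthonormal family in the other; rows and columns sum to
   1. *)
pose w j k := Re (dotc (P j) (fun p => (D k p)^*%R) * (dotc (P j) (fun p => (D k p)^*%R))^*%R).
have w0 j k : 0 <= w j k by exact: RemulC_ge0.
have key (A B : 'I_n -> 'I_n -> K) j : orthonormal A -> orthonormal B ->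
 \sum_k Re (dotc (A j) (fun p => (B k p)^*%R) * (dotc (A j) (fun p => (B k p)^*%R))^*%R) = 1.
 move=> oA oB.
 have := @qf_diag (fun p q => (p == q)%:R) B (fun=> 1) (A j).
 have E p q : (p == q)%:R = \sum_k (1%:C : K) * (B k p * (B k q)^*%R).
 by rewrite -(orthonormal_cols oB); bigr => k _; rewrite mul1r.
 move=> /(_ E); under eq_bigr do rewrite mul1r.
 move=> <-; rewrite /qf /hform -[RHS]/(Re 1).
 transitivity (Re (dotc (A j) (A j))); last by rewrite (oA j j) eqxx.
 congr Re; bigr => p _.
 rewrite (bigD1 p)//= big1 ?addr0; last by move=> q qp; rewrite eq_sym (negbTE qp) mulr0.
 by rewrite eqxx mulr1.
have w1 j : \sum_k w j k = 1 by exact: key.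
have w2 k : \sum_j w j k = 1.
 rewrite -(key (fun k p => (D k p)^*%R) (fun k p => (P k p)^*%R) k); last 2 first.
 - move=> i j; rewrite eq_sym -(oD j i) /dotc; bigr => p _.
 by rewrite conjCK mulrC.
 - move=> i j; rewrite eq_sym -(oP j i) /dotc; bigr => p _.
 by rewrite conjCK mulrC.
 bigr => j _; rewrite /w; congr Re.
 have -> : dotc (fun p => (D k p)^*%R) (fun p => ((P j p)^*%R)^*%R) = (dotc (P j) (fun p => (D k p)^*%R))^*%R.
 by rewrite /dotc rmorph_sum; bigr => p _; rewrite rmorphM !conjCK mulrC.
 by rewrite conjCK mulrC.
have tE : frame_trace H P t = \sum_j \sum_k w j k * (t j ^+ 2 * d k).
 rewrite /frame_trace; bigr => j _; rewrite (qf_diag _ HE) mulr_sumr.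
 by bigr => k _; rewrite -/(w j k) mulrA mulrC.
have step j k : w j k * (ln (t j) *+ 2 + ln (d k / l)) <= w j k * (t j ^+ 2 * d k) / l - w j k.
 rewrite -[X in _ - X]mulr1 -mulrA -mulrBr ler_wpM2l//.
 rewrite -mulrA; have h : 0 < t j ^+ 2 * (d k / l) by rewrite mulr_gt0 ?exprn_gt0 ?divr_gt0.
 have -> : ln (t j) *+ 2 + ln (d k / l) = ln (t j ^+ 2 * (d k / l)).
 by rewrite [RHS]lnM ?posrE ?exprn_gt0 ?divr_gt0// lnXn.
 have := @le_ln1Dx R (t j ^+ 2 * (d k / l) - 1); rewrite [1 + _]addrC subrK; apply.
 by rewrite ltrBrDl addrN.
have : \sum_j \sum_k w j k * (ln (t j) *+ 2 + ln (d k / l)) <=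
 \sum_j \sum_k (w j k * (t j ^+ 2 * d k) / l - w j k).
 by apply: ler_sum => j _; apply: ler_sum => k _; exact: step.
have -> : \sum_j \sum_k w j k * (ln (t j) *+ 2 + ln (d k / l)) = ln (\prod_k (d k / l)).
 transitivity (\sum_j (ln (t j) *+ 2) + \sum_k ln (d k / l)).
 under eq_bigr do (under eq_bigr do rewrite mulrDr; rewrite big_split /= -mulr_suml w1 mul1r).
 rewrite big_split /=; congr (_ + _); rewrite exchange_big; bigr => k _.
 by rewrite -mulr_suml w2 mul1r.
 have -> : \sum_j (ln (t j) *+ 2) = 0 by rewrite sumrMnl -ln_prod// t1 ln1 mul0rn.
 by rewrite add0r ln_prod// => k; rewrite divr_gt0.
have -> : \sum_j \sum_k (w j k * (t j ^+ 2 * d k) / l - w j k) = frame_trace H P t / l - n%:R.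
 have -> : (n%:R : R) = \sum_(j < n) 1 by rewrite sumr_const card_ord.
 rewrite tE mulr_suml -sumrB; bigr => j _.
 by rewrite sumrB w1 -mulr_suml.
have : 0 <= ln (\prod_k (d k / l)).
 apply: ln_ge0; rewrite big_split /= prodr_const card_ord exprVn ler_pdivlMr ?exprn_gt0//.
 by rewrite mul1r.
move=> h1 h2; have := le_trans h1 h2; rewrite subr_ge0 ler_pdivlMr//.
Qed.

(** Converse of [frame_trace_ge]: equality in the arithmetic-geometric inequality is reached by the
    eigenframe of [H] with weights making all t_k^2 d_k equal to the geometric mean of the
    eigenvalues. *)
Lemma mass_ge H (l : R) : (0 < n)%N -> (forall p q, H q p = (H p q)^*%R) ->
 (forall v, dotc v v = 1 -> 0 < qf H v) -> 0 <= l ->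
 (forall P t, unit_frame P t -> n%:R * l <= frame_trace H P t) ->
 n`!%:R * l ^+ n <= Re (mass H).
move=> n0 hH pH l0 Hl; have [D [d [oD HE]]] := herm_decomp hH.
rewrite (mass_herm oD HE) /= ler_pM2l ?ltr0n ?fact_gt0//.
have oD' : orthonormal (fun k p => (D k p)^*%R).
 move=> i j; rewrite eq_sym -(oD j i) /dotc; bigr => p _.
 by rewrite conjCK mulrC.
have d0 k : 0 < d k.
 by rewrite -(qf_eigen k oD HE); apply: pH; rewrite (oD' k k) eqxx.
pose m := (\sum_k ln (d k)) / n%:R; pose c := expR m.
have nr0 : (n%:R : R) != 0 by rewrite pnatr_eq0 -lt0n.
pose t k := expR ((m - ln (d k)) / 2).
have t2 k : t k ^+ 2 * d k = c.
 have -> : t k ^+ 2 = expR (m - ln (d k)) by rewrite /t -expRM_natl; congr expR; field.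
 by rewrite expRB lnK ?posrE// divfK// gt_eqF.
have ft : unit_frame (fun k p => (D k p)^*%R) t.
 split=> // [j|]; first exact: expR_gt0.
 rewrite -expR_sum -mulr_suml sumrB sumr_const card_ord -[m *+ n]mulr_natr /m divfK// subrr mul0r.
 exact: expR0.
have := Hl _ _ ft; rewrite /frame_trace.
have -> : \sum_j t j ^+ 2 * qf H (fun p => (D j p)^*%R) = \sum_(j < n) c.
 by bigr => j _; rewrite -(t2 j); congr (_ * _); exact: (qf_eigen _ oD HE).
rewrite sumr_const card_ord -[c *+ n]mulr_natl ler_pM2l ?ltr0n// => lc.
have -> : \prod_k d k = c ^+ n.
 rewrite /c -expRM_natl /m mulrCA divff// mulr1 expR_sum.
 by bigr => k _; rewrite lnK// posrE.
by rewrite lerXn2r// nnegrE// expR_ge0.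
Qed.

End hermitian_forms.

(** * Wirtinger derivatives and the complex Hessian *)

Section complex_smooth.
Context {R : realType} {n : nat}.
Local Notation K := R[i].
Local Notation C := (Cn R n).
Implicit Types (F G : C -> K) (u f : C -> R) (z v w : C) (p q : 'I_n) (e : K).

Lemma complex_eq (a b : K) : Re a = Re b -> Im a = Im b -> a = b.
by case: a b => x y [x' y'] /= -> ->. Qed.

Lemma ReD (a b : K) : Re (a + b) = Re a + Re b. Proof. by case: a b => x y []. Qed.
Lemma ImD (a b : K) : Im (a + b) = Im a + Im b. Proof. by case: a b => x y []. Qed.
Lemma ReM (a b : K) : Re (a * b) = Re a * Re b - Im a * Im b.
by case: a b => x y []. Qed.
Lemma ImM (a b : K) : Im (a * b) = Re a * Im b + Im a * Re b.
by case: a b => x y []. Qed.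
Lemma ReN (a : K) : Re (- a) = - Re a. Proof. by case: a. Qed.
Lemma ImN (a : K) : Im (- a) = - Im a. Proof. by case: a. Qed.

Definition csm F := sm (fun z => Re (F z)) /\ sm (fun z => Im (F z)).

Lemma csm_cst e : csm (fun=> e).
by split; exact: sm_cst. Qed.
Lemma csm_real u : sm u -> csm (fun z => (u z)%:C).
by split => //; exact: sm_cst. Qed.

Lemma csmD F G : csm F -> csm G -> csm (fun z => F z + G z).
move=> [F1 F2] [G1 G2]; split.
- by under eq_fun do rewrite ReD; exact: smD.
- by under eq_fun do rewrite ImD; exact: smD.
Qed.

Lemma csmM F G : csm F -> csm G -> csm (fun z => F z * G z).
move=> [F1 F2] [G1 G2]; split.
- by under eq_fun do rewrite ReM; apply: smB; exact: smM.
- by under eq_fun do rewrite ImM; apply: smD; exact: smM.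
Qed.

Lemma csmZ e F : csm F -> csm (fun z => e * F z).
exact: (csmM (csm_cst e)). Qed.

Lemma csm_sum I (r : seq I) (P : pred I) (F : I -> C -> K) :
 (forall i, P i -> csm (F i)) -> csm (fun z => \sum_(i <- r | P i) F i z).
by move=> H; apply: (@sum_closed C I K) H; [exact: csm_cst|exact: csmD]. Qed.

Definition cd v F z : K := dder v (fun z => Re (F z)) z +i* dder v (fun z => Im (F z)) z.

Lemma csm_cd v F : csm F -> csm (cd v F).
by move=> [F1 F2]; split; exact: sm_dder. Qed.

Lemma cdD v F G z : csm F -> csm G -> cd v (fun z => F z + G z) z = cd v F z + cd v G z.
move=> [F1 F2] [G1 G2]; rewrite /cd; apply: complex_eq => /=.
- have -> : (fun z => Re (F z + G z)) = fun z => Re (F z) + Re (G z).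
 by ext => y; rewrite ReD.
 by rewrite (dderD v F1 G1).
- have -> : (fun z => Im (F z + G z)) = fun z => Im (F z) + Im (G z).
 by ext => y; rewrite ImD.
 by rewrite (dderD v F2 G2).
Qed.

Lemma cdM v F G z : csm F -> csm G -> cd v (fun z => F z * G z) z = cd v F z * G z + F z * cd v G z.
move=> [F1 F2] [G1 G2]; rewrite /cd; apply: complex_eq => /=.
- have -> : (fun z => Re (F z * G z)) =
 fun z => Re (F z) * Re (G z) - Im (F z) * Im (G z).
 by ext => y; rewrite ReM.
 rewrite (dderB v (smM F1 G1) (smM F2 G2)) (dderM v F1 G1) (dderM v F2 G2) ReD !ReM /=.
 by ring.
- have -> : (fun z => Im (F z * G z)) =
 fun z => Re (F z) * Im (G z) + Im (F z) * Re (G z).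
 by ext => y; rewrite ImM.
 rewrite (dderD v (smM F1 G2) (smM F2 G1)) (dderM v F1 G2) (dderM v F2 G1) ImD !ImM /=.
 by ring.
Qed.

Lemma cd_cst v e z : cd v (fun=> e) z = 0.
by apply: complex_eq; rewrite /cd /= dder_cst. Qed.

Lemma cd_comm v w F : csm F -> cd v (cd w F) = cd w (cd v F).
move=> [F1 F2]; ext => z; apply: complex_eq; rewrite /cd /=.
- by have := congr1 (fun g => g z) (dder_comm v w F1).
- by have := congr1 (fun g => g z) (dder_comm v w F2).
Qed.

(* [wd (-1) p] is d/dz_p and [wd 1 p] is d/dzbar_p. *)
Definition wd e p F z : K := 2^-1 * (cd (basis p) F z + e * ('i%C * cd ('i%C *: basis p) F z)).

Lemma csm_wd e p F : csm F -> csm (wd e p F).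
move=> cF; apply: csmZ; apply: csmD; first exact: csm_cd.
by apply: csmZ; apply: csmZ; exact: csm_cd.
Qed.

Lemma wdD e p F G z : csm F -> csm G -> wd e p (fun z => F z + G z) z = wd e p F z + wd e p G z.
move=> cF cG; rewrite /wd (cdD (basis p) z cF cG) (cdD ('i%C *: basis p) z cF cG).
by move: (cd _ F z) (cd _ G z) (cd _ F z) (cd _ G z) => a b c d; ring.
Qed.

Lemma wdM e p F G z : csm F -> csm G -> wd e p (fun z => F z * G z) z = wd e p F z * G z + F z * wd e p G z.
move=> cF cG; rewrite /wd (cdM (basis p) z cF cG) (cdM ('i%C *: basis p) z cF cG).
by move: (F z) (G z) (cd _ F z) (cd _ G z) (cd _ F z) (cd _ G z) => f g a b c d; ring.
Qed.

Lemma wd_cst e p (a : K) z : wd e p (fun=> a) z = 0.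
by rewrite /wd !cd_cst !mulr0 addr0 mulr0. Qed.
Lemma wdZ e p (a : K) F z : csm F -> wd e p (fun z => a * F z) z = a * wd e p F z.
by move=> cF; rewrite (wdM _ _ _ (csm_cst a) cF) wd_cst mul0r add0r. Qed.

Lemma wd_sum e p I (r : seq I) (P : pred I) (F : I -> C -> K) z :
 (forall i, csm (F i)) -> wd e p (fun z => \sum_(i <- r | P i) F i z) z = \sum_(i <- r | P i) wd e p (F i) z.
move=> H; elim: r => [|i r IH].
 have -> : (fun z : C => \sum_(i <- [::] | P i) F i z) = fun=> 0.
 by ext => y; rewrite big_nil.
 by rewrite wd_cst big_nil.
have -> : (fun z => \sum_(j <- i :: r | P j) F j z) =
 if P i then fun z => F i z + \sum_(j <- r | P j) F j z else fun z => \sum_(j <- r | P j) F j z.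
 by ext => y; rewrite big_cons; case: ifP.
rewrite big_cons; case: ifP => // Pi; rewrite wdD ?IH//.
by apply: csm_sum => j _; exact: H.
Qed.

Let wv_comm (e e' : K) (a a' b b' : C) F z : csm F ->
 2^-1 * (cd a (fun z => 2^-1 * (cd b F z + e' * ('i%C * cd b' F z))) z +
 e * ('i%C * cd a' (fun z => 2^-1 * (cd b F z + e' * ('i%C * cd b' F z))) z)) =
 2^-1 * (cd b (fun z => 2^-1 * (cd a F z + e * ('i%C * cd a' F z))) z +
 e' * ('i%C * cd b' (fun z => 2^-1 * (cd a F z + e * ('i%C * cd a' F z))) z)).
move=> cF.
have key (x y y' : C) (c : K) : cd x (fun z => 2^-1 * (cd y F z + c * ('i%C * cd y' F z))) z =
 2^-1 * (cd x (cd y F) z + c * ('i%C * cd x (cd y' F) z)).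
 have c1 := csm_cd y cF; have c2 := csm_cd y' cF.
 rewrite (cdM x z (csm_cst 2^-1) (csmD c1 (csmZ c (csmZ 'i%C c2)))) cd_cst mul0r add0r.
 rewrite (cdD x z c1 (csmZ c (csmZ 'i%C c2))) (cdM x z (csm_cst c) (csmZ 'i%C c2)) cd_cst mul0r add0r.
 by rewrite (cdM x z (csm_cst 'i%C) c2) cd_cst mul0r add0r.
rewrite (key a) (key a') (key b) (key b').
rewrite (cd_comm b a cF) (cd_comm b a' cF) (cd_comm b' a cF) (cd_comm b' a' cF).
by move: (cd _ _ z) (cd _ _ z) (cd _ _ z) (cd _ _ z) => w x y t; ring.
Qed.

Lemma wd_comm e e' p q F : csm F -> wd e p (wd e' q F) = wd e' q (wd e p F).
by move=> cF; ext => z; exact: wv_comm. Qed.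

Definition cddbar p q F := wd (-1) p (wd 1 q F).

Lemma csm_cddbar p q F : csm F -> csm (cddbar p q F).
by move=> cF; do 2 apply: csm_wd. Qed.

(** Factors the real formula of [ddbar] into two first-order operators, which obey the product rule
    and integrate by parts. *)
Lemma ddbarE p q u z : sm u -> ddbar p q u z = cddbar p q (fun z => (u z)%:C) z.
move=> su.
have E v F : cd v F = fun z => dder v (fun z => Re (F z)) z +i* dder v (fun z => Im (F z)) z by [].
have half : (2^-1 : K) = (2^-1 : R)%:C by rewrite fmorphV rmorph_nat.
have W : wd 1 q (fun z => (u z)%:C) = fun z => (2^-1 * dx q u z) +i* (2^-1 * dy q u z).
 ext => y; rewrite /wd !E /= !dder_cst half /dx /dy -/(basis q).
 by move: (dder _ _ y) (dder _ _ y) => a b; apply: complex_eq => /=; ring.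
have sx : sm (dx q u) := sm_dder (basis q) su; have sy : sm (dy q u) := sm_dder ('i%C *: basis q) su.
have f1 := congr1 (fun g => g z) (dderZ 2^-1 (basis p) sx).
have f2 := congr1 (fun g => g z) (dderZ 2^-1 (basis p) sy).
have f3 := congr1 (fun g => g z) (dderZ 2^-1 ('i%C *: basis p) sx).
have f4 := congr1 (fun g => g z) (dderZ 2^-1 ('i%C *: basis p) sy).
pose D (a b c d : R) : K := 2^-1 * ((a +i* b) + -1 * ('i%C * (c +i* d))).
transitivity (D (2^-1 * dx p (dx q u) z) (2^-1 * dx p (dy q u) z) (2^-1 * dy p (dx q u) z) (2^-1 * dy p (dy q u) z)); last first.
 rewrite /cddbar W; apply: esym.
 have E' (A B : C -> R) : wd (-1) p (fun z => A z +i* B z) z = D (dder (basis p) A z) (dder (basis p) B z)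
 (dder ('i%C *: basis p) A z) (dder ('i%C *: basis p) B z) by [].
 apply: etrans (E' _ _) _.
 by congr D; [exact: f1|exact: f2|exact: f3|exact: f4].
have alg (a b c d : R) : (4^-1 : K) * ((a + d) +i* (b - c)) = D (2^-1 * a) (2^-1 * b) (2^-1 * c) (2^-1 * d).
 rewrite /D half (_ : (4^-1 : K) = (4^-1 : R)%:C); last by rewrite fmorphV rmorph_nat.
 by apply: complex_eq => /=; field.
exact: (alg (dx p (dx q u) z) (dx p (dy q u) z) (dy p (dx q u) z) (dy p (dy q u) z)).
Qed.

Definition hess u z p q : K := ddbar p q u z.

Lemma csm_hess u p q : sm u -> csm (fun z => hess u z p q).
move=> su; have := csm_cddbar p q (csm_real su); congr csm.
by ext => z; rewrite /hess ddbarE.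
Qed.

Lemma hess_herm u z p q : sm u -> hess u z q p = (hess u z p q)^*%R.
move=> su; pose D (a b c d : R) : K := 4^-1 * ((a + b) +i* (c - d)).
have e1 := congr1 (fun g => g z) (dder_comm (basis q) (basis p) su).
have e2 := congr1 (fun g => g z) (dder_comm ('i%C *: basis q) ('i%C *: basis p) su).
have e3 := congr1 (fun g => g z) (dder_comm (basis q) ('i%C *: basis p) su).
have e4 := congr1 (fun g => g z) (dder_comm ('i%C *: basis q) (basis p) su).
transitivity (D (dx p (dx q u) z) (dy p (dy q u) z) (dy p (dx q u) z) (dx p (dy q u) z)).
 have c4 a a' b b' c c' d d' : a = a' -> b = b' -> c = c' -> d = d' -> D a b c d = D a' b' c' d'.
 by move=> -> -> -> ->.
 exact: (c4 _ _ _ _ _ _ _ _ e1 e2 e3 e4).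
rewrite /hess -[ddbar p q u z]/(D (dx p (dx q u) z) (dy p (dy q u) z) (dx p (dy q u) z) (dy p (dx q u) z)).
have alg (a b c d : R) : D a b c d = (D a b d c)^*%R.
 rewrite /D (_ : (4^-1 : K) = (4^-1 : R)%:C); last by rewrite fmorphV rmorph_nat.
 by apply: complex_eq => /=; ring.
exact: alg.
Qed.

Lemma vec_decomp v : v = \sum_p ((xr p v)%:C *: basis p + (xi p v)%:C *: ('i%C *: basis p)).
apply/rowP => j; rewrite summxE (bigD1 j)//= big1 ?addr0; last first.
 by move=> p pj; rewrite !mxE eqxx /= eq_sym (negbTE pj); rewrite /GRing.scale /= !mulr0 addr0.
rewrite !mxE eqxx /= /GRing.scale /= /xr /xi; case: (v 0 j) => a b /=.
by apply: complex_eq; simpc => /=.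
Qed.

Lemma dder_vec v u z : sm u ->
 dder v u z = \sum_p (xr p v * dx p u z + xi p v * dy p u z).
move=> su; rewrite [in LHS](vec_decomp v).
elim: (index_enum _) => [|p r IH].
 rewrite !big_nil -[0 in LHS](scale0r (0 : C)) -(rmorph0 (real_complex R)).
 by have := congr1 (fun g => g z) (dder_scalev 0 0 su) => /= ->; rewrite mul0r.
rewrite !big_cons dder_addv// IH dder_addv// dder_scalev// dder_scalev//.
Qed.

Lemma lap_hess u v z : sm u -> lap v u z = qf (hess u z) (fun p => v 0 p).
move=> su; rewrite /lap.
have D2 (w : C) : dder w (dder w u) z = \sum_p \sum_q
 (xr p w * (xr q w * dx p (dx q u) z + xi q w * dx p (dy q u) z) +
 xi p w * (xr q w * dy p (dx q u) z + xi q w * dy p (dy q u) z)).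
 rewrite dder_vec; last exact: sm_dder.
 bigr => p _; rewrite /dx /dy -/(basis p).
 have E (b : C) : dder b (dder w u) z = \sum_q (xr q w * dder b (dx q u) z + xi q w * dder b (dy q u) z).
 have := dder_comm b w su => /(congr1 (fun g => g z)) ->.
 rewrite dder_vec; last exact: sm_dder.
 bigr => q _.
 have e1 := congr1 (fun g => g z) (dder_comm (basis q) b su).
 have e2 := congr1 (fun g => g z) (dder_comm ('i%C *: basis q) b su).
 exact: (congr2 (fun s t => xr q w * s + xi q w * t) e1 e2).
 by rewrite !E mulr_sumr mulr_sumr -big_split.
rewrite !D2 -big_split /= mulr_sumr /qf /hform Re_sum.
bigr => p _; rewrite -big_split /= mulr_sumr Re_sum; bigr => q _.
have x1 k : xr k ('i%C *: v) = - xi k v by rewrite /xr /xi mxE ReM /=; ring.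
have x2 k : xi k ('i%C *: v) = xr k v by rewrite /xr /xi mxE ImM /=; ring.
rewrite !x1 !x2.
have alg (vp vq : K) (a b c d : R) : 4^-1 *
 (Re vp * (Re vq * a + Im vq * b) + Im vp * (Re vq * c + Im vq * d) +
 (- Im vp * (- Im vq * a + Re vq * b) + Re vp * (- Im vq * c + Re vq * d))) =
 Re (vp * vq^*%R * (4^-1 * ((a + d) +i* (b - c)))).
 rewrite (_ : (4^-1 : K) = (4^-1 : R)%:C); last by rewrite fmorphV rmorph_nat.
 by case: vp vq => x y [x' y'] /=; ring.
exact: alg.
Qed.

End complex_smooth.

(** * Integration by parts for Wirtinger derivatives *)

Section complex_integral.
Context {R : realType} {n : nat}.
Local Notation K := R[i].
Local Notation C := (Cn R n).
Implicit Types (F G : C -> K) (u f : C -> R) (z v w : C) (p q : 'I_n) (e : K).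

Definition cCc F := Cc (fun z => Re (F z)) /\ Cc (fun z => Im (F z)).
Definition ctf F := csm F /\ exists M : R, forall z, M < nr z -> F z = 0.
Definition cinteg F : K := integ (fun z => Re (F z)) +i* integ (fun z => Im (F z)).

Lemma ctf_real u : tf u -> ctf (fun z => (u z)%:C).
move=> [su [M HM]]; split; first exact: csm_real.
by exists M => z /HM ->.
Qed.

Lemma ctf_tf F : ctf F -> tf (fun z => Re (F z)) /\ tf (fun z => Im (F z)).
by move=> [[F1 F2] [M HM]]; split; split=> //; exists M => z /HM ->. Qed.
Lemma ctf_cCc F : ctf F -> cCc F.
by move=> /ctf_tf[F1 F2]; split; exact: tf_Cc. Qed.

Lemma ctfM F G : ctf F -> csm G -> ctf (fun z => F z * G z).
move=> [cF [M HM]] cG; split; first exact: csmM.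
by exists M => z /HM ->; rewrite mul0r.
Qed.

Lemma ctfMr F G : ctf F -> csm G -> ctf (fun z => G z * F z).
move=> [cF [M HM]] cG; split; first exact: csmM.
by exists M => z /HM ->; rewrite mulr0.
Qed.

Lemma cd_out v F (M : R) z : (forall z, M < nr z -> F z = 0) -> M < nr z -> cd v F z = 0.
move=> HM Mz; have [r r0 Hr] := open_outside Mz.
apply: complex_eq; rewrite /cd /=.
- rewrite (@dder_near _ _ _ (fun=> 0) v z r)// ?dder_cst// => w /Hr /HM -> //.
- rewrite (@dder_near _ _ _ (fun=> 0) v z r)// ?dder_cst// => w /Hr /HM -> //.
Qed.

Lemma ctf_wd e p F : ctf F -> ctf (wd e p F).
move=> [cF [M HM]]; split; first exact: csm_wd.
by exists M => z Mz; rewrite /wd (cd_out _ HM Mz) (cd_out _ HM Mz) !mulr0 addr0 mulr0.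
Qed.

Lemma cintegD F G : cCc F -> cCc G -> cinteg (fun z => F z + G z) = cinteg F + cinteg G.
move=> [F1 F2] [G1 G2]; apply: complex_eq; rewrite /cinteg /=.
- by rewrite -(integD F1 G1); congr integ; ext => z; rewrite ReD.
- by rewrite -(integD F2 G2); congr integ; ext => z; rewrite ImD.
Qed.

Lemma cCcZ e F : cCc F -> cCc (fun z => e * F z).
move=> [F1 F2]; split.
- by under eq_fun do rewrite ReM; apply: CcB; exact: CcZ.
- by under eq_fun do rewrite ImM; apply: CcD; exact: CcZ.
Qed.

Lemma cintegZ e F : cCc F -> cinteg (fun z => e * F z) = e * cinteg F.
move=> [F1 F2]; apply: complex_eq; rewrite /cinteg ?ReM ?ImM /=.
- rewrite -(integZ _ F1) -(integZ _ F2) -(integB (CcZ _ F1) (CcZ _ F2)).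
 by congr integ; ext => z; rewrite ReM.
- rewrite -(integZ _ F1) -(integZ _ F2) -(integD (CcZ _ F2) (CcZ _ F1)).
 by congr integ; ext => z; rewrite ImM.
Qed.

Lemma cinteg0 : cinteg (fun=> 0) = 0.
by apply: complex_eq; rewrite /cinteg /= (@integ0 R n). Qed.

Lemma cCcD F G : cCc F -> cCc G -> cCc (fun z => F z + G z).
move=> [F1 F2] [G1 G2]; split.
- by under eq_fun do rewrite ReD; exact: CcD.
- by under eq_fun do rewrite ImD; exact: CcD.
Qed.

Lemma cCc0 : cCc (fun=> 0). Proof. by split; exact: Cc0. Qed.

Lemma cCc_sum I (r : seq I) (P : pred I) (F : I -> C -> K) :
 (forall i, cCc (F i)) -> cCc (fun z => \sum_(i <- r | P i) F i z).
by move=> H; apply: (@sum_closed C I K) (fun i _ => H i); [exact: cCc0|exact: cCcD]. Qed.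

Lemma cinteg_sum I (r : seq I) (P : pred I) (F : I -> C -> K) :
 (forall i, cCc (F i)) -> cinteg (fun z => \sum_(i <- r | P i) F i z) = \sum_(i <- r | P i) cinteg (F i).
by move=> H; apply: (@sum_morph C I K K cCc) (fun i _ => H i); [exact: cCc0|exact: cCcD|exact: cinteg0|exact: cintegD]. Qed.

Lemma cinteg_wd e p F : ctf F -> cinteg (wd e p F) = 0.
move=> tF; have [F1 F2] := ctf_tf tF.
have H v : cCc (cd v F) /\ cinteg (cd v F) = 0.
 split; first by split; apply/tf_Cc/tf_dder.
 by apply: complex_eq; rewrite /cinteg /= integ_dder.
have [c1 e1] := H (basis p); have [c2 e2] := H ('i%C *: basis p).
have -> : cinteg (wd e p F) = 2^-1 * (cinteg (cd (basis p) F) + e * ('i%C * cinteg (cd ('i%C *: basis p) F))).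
 rewrite -(cintegZ 'i%C c2) -(cintegZ e (cCcZ 'i%C c2)) -(cintegD c1 (cCcZ e (cCcZ 'i%C c2))).
 by rewrite -(cintegZ 2^-1 (cCcD c1 (cCcZ e (cCcZ 'i%C c2)))).
apply: (etrans (congr2 (fun a b : K => 2^-1 * (a + e * ('i%C * b))) e1 e2)).
by rewrite !mulr0 addr0 mulr0.
Qed.

Lemma cinteg_by_parts e p F G : ctf F -> csm G ->
 cinteg (fun z => wd e p F z * G z) = - cinteg (fun z => F z * wd e p G z).
move=> tF cG; apply/eqP; rewrite -addr_eq0 -cintegD; last 2 first.
- by apply/ctf_cCc/ctfM => //; exact: ctf_wd.
- by apply/ctf_cCc/ctfM => //; exact: csm_wd.
have := cinteg_wd e p (ctfM tF cG) => /eqP; congr (_ == _); congr cinteg.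
by ext => z; rewrite wdM//; case: tF.
Qed.

Lemma wd_conj p F z : csm F -> wd (-1) p (fun z => (F z)^*%R) z = (wd 1 p F z)^*%R.
move=> [F1 F2].
have half : (2^-1 : K) = (2^-1 : R)%:C by rewrite fmorphV rmorph_nat.
have Re_conj (a : K) : Re (a^*%R) = Re a by case: a.
have Im_conj (a : K) : Im (a^*%R) = - Im a by case: a.
have cc v : cd v (fun z => (F z)^*%R) z = (cd v F z)^*%R.
 apply: complex_eq; rewrite /cd ?Re_conj ?Im_conj /=.
 - by congr (dder v _ z); ext => y; rewrite Re_conj.
 - rewrite -[RHS](congr1 (fun g => g z) (dderN v F2)).
 by congr (dder v _ z); ext => y; rewrite Im_conj.
have alg (a b : K) : 2^-1 * (a^*%R + -1 * ('i%C * b^*%R)) = (2^-1 * (a + 1 * ('i%C * b)))^*%R.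
 by rewrite half; case: a b => x y [x' y']; apply: complex_eq => /=; ring.
exact: (etrans (congr2 (fun a b : K => 2^-1 * (a + -1 * ('i%C * b))) (cc (basis p)) (cc ('i%C *: basis p))) (alg _ _)).
Qed.

End complex_integral.

Opaque wd cinteg.

(** * Products of Hessians as closed forms *)

Section forms.
Context {R : realType} {n : nat}.
Local Notation K := R[i].
Local Notation C := (Cn R n).
Implicit Types (F G : C -> K) (u f : C -> R) (z v w : C) (p q : 'I_n) (I J : {set 'I_n}) (us : seq (C -> R)).

Definition form us z := foldr (fun u T => wedge (hess u z) T) one_array us.

Definition smooth us := foldr (fun u P => sm u /\ P) True us.

Lemma csm_form us I J : smooth us -> csm (fun z => form us z I J).
elim: us I J => [|u us IH] I J /=; first by move=> _; exact: csm_cst.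
move=> [su sus]; apply: csm_sum => p _; apply: csm_sum => q _.
apply: csmM; last exact: IH.
by apply: csmZ; exact: csm_hess.
Qed.

(** By the Leibniz rule, terms with the derivative on the leading Hessian cancel, third derivatives
    being symmetric ([alt_sum0]); the others vanish by induction. *)
Lemma form_closed_l us I J z : smooth us ->
 \sum_(p in I) wsign I p * wd (-1) p (fun z => form us z (I :\ p) J) z = 0.
elim: us I J => [|u us IH] I J /=.
 by move=> _; rewrite big1// => p _; rewrite wd_cst mulr0.
move=> [su sus].
have cf A B := csm_form A B sus.
have ch p q := csm_hess p q su.
transitivity (\sum_(p in I) \sum_(p' in I :\ p) wsign I p * wsign (I :\ p) p' *
 \sum_(q in J) wsign J q * (wd (-1) p (fun z => hess u z p' q) z * form us z (I :\ p :\ p') (J :\ q) +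
 hess u z p' q * wd (-1) p (fun z => form us z (I :\ p :\ p') (J :\ q)) z)).
 bigr => p _.
 rewrite wd_sum; last first.
 by move=> p'; apply: csm_sum => q _; apply: csmM => //; exact: csmZ.
 rewrite mulr_sumr; bigr => p' _.
 rewrite wd_sum; last by move=> q; apply: csmM => //; exact: csmZ.
 rewrite !mulr_sumr; bigr => q _.
 have -> : (fun z => wsign (I :\ p) p' * wsign J q * hess u z p' q * form us z (I :\ p :\ p') (J :\ q)) =
 fun z => wsign (I :\ p) p' * wsign J q * (hess u z p' q * form us z (I :\ p :\ p') (J :\ q)).
 by ext => y; rewrite !mulrA.
 rewrite (wdZ _ _ _ _ (csmM (ch p' q) (cf (I :\ p :\ p') (J :\ q)))).
 rewrite (wdM _ _ _ (ch p' q) (cf (I :\ p :\ p') (J :\ q))).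
 by rewrite !mulrA.
pose A p p' := \sum_(q in J) wsign J q * (wd (-1) p (fun z => hess u z p' q) z * form us z (I :\ p :\ p') (J :\ q)).
pose B p p' := \sum_(q in J) wsign J q * (hess u z p' q * wd (-1) p (fun z => form us z (I :\ p :\ p') (J :\ q)) z).
have sDD p p' : I :\ p' :\ p = I :\ p :\ p' by apply/setP => i; rewrite !inE andbCA.
transitivity (\sum_(p in I) \sum_(p' in I :\ p) wsign I p * wsign (I :\ p) p' * A p p' +
 \sum_(p in I) \sum_(p' in I :\ p) wsign I p * wsign (I :\ p) p' * B p p').
 rewrite -big_split; bigr => p _; rewrite -big_split; bigr => p' _ /=.
 rewrite -mulrDr -big_split /=; congr (_ * _); bigr => q _.
 by rewrite mulrDr.
rewrite (alt_sum0 I (G := A)) ?add0r; last first.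
 move=> p p'; bigr => q _; rewrite (sDD p p').
 pose G := wd 1 q (fun z => (u z)%:C).
 have E r : (fun z => hess u z r q) = wd (-1) r G.
 by ext => y; rewrite /hess ddbarE.
 have e1 := congr1 (fun g => wd (-1) p g z) (E p').
 have e2 := congr1 (fun g => wd (-1) p' g z) (E p).
 have e3 := congr1 (fun g => g z) (wd_comm (-1) (-1) p p' (csm_wd 1 q (csm_real su))).
 have e4 := etrans e1 (etrans e3 (esym e2)).
 exact: (congr1 (fun x => wsign J q * (x * form us z (I :\ p :\ p') (J :\ q))) e4).
rewrite (alt_sum I B); apply/eqP; rewrite oppr_eq0; apply/eqP.
rewrite big1// => p pI.
transitivity (wsign I p * \sum_(q in J) wsign J q * hess u z p q *
 \sum_(p' in I :\ p) wsign (I :\ p) p' * wd (-1) p' (fun z => form us z (I :\ p :\ p') (J :\ q)) z).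
 rewrite mulr_sumr; under [RHS]eq_bigr do rewrite !mulr_sumr.
 rewrite exchange_big /=; bigr => p' _; rewrite /B mulr_sumr; bigr => q _.
 rewrite (sDD p p').
 have alg (a b c d e : K) : a * b * (c * (d * e)) = a * (c * d * (b * e)) by ring.
 exact: alg.
by rewrite big1 ?mulr0// => q _; rewrite IH// mulr0.
Qed.

Lemma form_tr us z I J : smooth us -> form us z J I = (form us z I J)^*%R.
elim: us I J => [|u us IH] I J /=; first by rewrite /one_array rmorph1.
move=> [su sus]; rewrite /wedge exchange_big rmorph_sum; bigr => p _.
rewrite rmorph_sum; bigr => q _.
have wC (A : {set 'I_n}) r : (wsign A r : K)^*%R = wsign A r by rewrite /wsign rmorphXn rmorphN1.
rewrite (IH _ _ sus) (hess_herm z p q su).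
apply: esym; apply: etrans (rmorphM _ _ _) _; congr (_ * _).
apply: etrans (rmorphM _ _ _) _; congr (_ * _).
apply: etrans (rmorphM _ _ _) _; rewrite mulrC; congr (_ * _); exact: wC.
Qed.

Lemma form_closed_r us I J z : smooth us ->
 \sum_(q in J) wsign J q * wd 1 q (fun z => form us z I (J :\ q)) z = 0.
move=> sus.
have h : (\sum_(p in J) wsign J p * wd (-1) p (fun z => form us z (J :\ p) I) z)^*%R = 0.
 by rewrite form_closed_l// rmorph0.
apply: etrans h; apply: etrans (esym (rmorph_sum _ _ _ _)); bigr => q _.
have wC (A : {set 'I_n}) r : (wsign A r : K)^*%R = wsign A r by rewrite /wsign rmorphXn rmorphN1.
apply: esym; apply: etrans (rmorphM _ _ _) _; congr (_ * _); first exact: wC.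
have -> : (fun z => form us z (J :\ q) I) = fun z => (form us z I (J :\ q))^*%R.
 by ext => y; rewrite form_tr.
exact: (etrans (congr1 Num.conj (wd_conj q z (csm_form I (J :\ q) sus))) (conjCK _)).
Qed.

(** Both derivatives move from [F] to [u]; terms that differentiate the remaining factors vanish
    because those factors form a closed form. So for smooth potentials the weak definition in
    [ddc_wedge] is the pointwise product. *)
Lemma wedge_by_parts F u us I J : ctf F -> sm u -> smooth us ->
 \sum_(p in I) \sum_(q in J) wsign I p * wsign J q *
 cinteg (fun z => (u z)%:C * cddbar p q F z * form us z (I :\ p) (J :\ q)) =
 cinteg (fun z => F z * form (u :: us) z I J).
move=> tF su sus.
have cf A B := csm_form A B sus.
have cu := csm_real su.
have step1 q : \sum_(p in I) wsign I p *
 cinteg (fun z => (u z)%:C * cddbar p q F z * form us z (I :\ p) (J :\ q)) =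
 \sum_(p in I) wsign I p *
 cinteg (fun z => F z * wd 1 q (fun z => wd (-1) p (fun z => (u z)%:C) z * form us z (I :\ p) (J :\ q)) z).
 have tq := ctf_wd 1 q tF.
 have cUT p := csmM cu (cf (I :\ p) (J :\ q)).
 have cDT p := csmM (csm_wd (-1) p cu) (cf (I :\ p) (J :\ q)).
 transitivity (- cinteg (fun z => wd 1 q F z * \sum_(p in I) wsign I p * wd (-1) p (fun z => (u z)%:C * form us z (I :\ p) (J :\ q)) z)).
 transitivity (- \sum_(p in I) wsign I p * cinteg (fun z => wd 1 q F z * wd (-1) p (fun z => (u z)%:C * form us z (I :\ p) (J :\ q)) z)).
 rewrite -sumrN; bigr => p _; rewrite -mulrN; congr (_ * _).
 rewrite -(cinteg_by_parts (-1) p tq (cUT p)); congr cinteg; ext => z.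
 by rewrite /cddbar mulrA; congr (_ * _); rewrite mulrC.
 have cc p : cCc (fun z => wd 1 q F z * wd (-1) p (fun z => (u z)%:C * form us z (I :\ p) (J :\ q)) z).
 by apply/ctf_cCc/ctfM => //; exact: csm_wd.
 congr (- _); under eq_bigr => p do rewrite -(cintegZ _ (cc p)).
 rewrite -cinteg_sum; last by move=> p; apply: cCcZ; exact: cc.
 by congr cinteg; ext => z; rewrite mulr_sumr; bigr => p _; rewrite mulrCA.
 transitivity (- cinteg (fun z => wd 1 q F z * \sum_(p in I) wsign I p * (wd (-1) p (fun z => (u z)%:C) z * form us z (I :\ p) (J :\ q)))).
 congr (- cinteg _); ext => z; congr (_ * _).
 have h : (u z)%:C * (\sum_(p in I) wsign I p * wd (-1) p (fun z => form us z (I :\ p) (J :\ q)) z) = 0.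
 by rewrite form_closed_l// mulr0.
 rewrite -[RHS]addr0 -[X in _ = _ + X]h mulr_sumr -big_split.
 bigr => p _ /=; rewrite (wdM _ _ _ cu (cf _ _)) mulrDr; congr (_ + _).
 by rewrite mulrCA.
 have cc p : cCc (fun z => wd 1 q F z * (wd (-1) p (fun z => (u z)%:C) z * form us z (I :\ p) (J :\ q))).
 by apply/ctf_cCc/ctfM.
 transitivity (- \sum_(p in I) wsign I p * cinteg (fun z => wd 1 q F z * (wd (-1) p (fun z => (u z)%:C) z * form us z (I :\ p) (J :\ q)))).
 congr (- _); under [RHS]eq_bigr => p do rewrite -(cintegZ _ (cc p)).
 rewrite -cinteg_sum; last by move=> p; apply: cCcZ; exact: cc.
 by congr cinteg; ext => z; rewrite mulr_sumr; bigr => p _; rewrite mulrCA.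
 rewrite -sumrN; bigr => p _; rewrite -mulrN; congr (_ * _).
 by rewrite (cinteg_by_parts 1 q tF (cDT p)) opprK.
have cD p q : csm (fun z => wd 1 q (fun z => wd (-1) p (fun z => (u z)%:C) z * form us z (I :\ p) (J :\ q)) z).
 by apply: csm_wd; apply: csmM => //; exact: csm_wd.
transitivity (\sum_(p in I) \sum_(q in J) wsign I p * wsign J q *
 cinteg (fun z => F z * wd 1 q (fun z => wd (-1) p (fun z => (u z)%:C) z * form us z (I :\ p) (J :\ q)) z)).
 rewrite exchange_big [RHS]exchange_big /=; bigr => q _.
 have := congr1 (fun x => wsign J q * x) (step1 q); rewrite !mulr_sumr => E.
 transitivity (\sum_(p in I) wsign J q * (wsign I p * cinteg (fun z => (u z)%:C * cddbar p q F z * form us z (I :\ p) (J :\ q)))).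
 by bigr => p _; rewrite mulrA [wsign J q * _]mulrC.
 by rewrite E; bigr => p _; rewrite mulrA [wsign J q * _]mulrC.
have cc p q : cCc (fun z => F z * wd 1 q (fun z => wd (-1) p (fun z => (u z)%:C) z * form us z (I :\ p) (J :\ q)) z).
 by apply/ctf_cCc/ctfM.
under eq_bigr => p do under eq_bigr => q do rewrite -(cintegZ _ (cc p q)).
under eq_bigr => p do (rewrite -cinteg_sum; last by move=> q; apply: cCcZ; exact: cc).
rewrite -cinteg_sum; last by move=> p; apply: cCc_sum => q; apply: cCcZ; exact: cc.
congr cinteg; ext => z; rewrite /= /wedge.
transitivity (F z * \sum_(p in I) \sum_(q in J) wsign I p * wsign J q *
 wd 1 q (fun z => wd (-1) p (fun z => (u z)%:C) z * form us z (I :\ p) (J :\ q)) z).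
 rewrite mulr_sumr; bigr => p _; rewrite mulr_sumr; bigr => q _.
 by rewrite mulrCA.
congr (_ * _); bigr => p _.
have h : wsign I p * wd (-1) p (fun z => (u z)%:C) z *
 (\sum_(q in J) wsign J q * wd 1 q (fun z => form us z (I :\ p) (J :\ q)) z) = 0.
 by rewrite form_closed_r// mulr0.
rewrite -[RHS]addr0 -[X in _ = _ + X]h mulr_sumr -big_split; bigr => q _ /=.
rewrite (wdM _ _ _ (csm_wd (-1) p cu) (cf _ _)).
have -> : hess u z p q = wd 1 q (wd (-1) p (fun z => (u z)%:C)) z.
 exact: (etrans (ddbarE p q z su) (congr1 (fun g => g z) (wd_comm (-1) 1 p q cu))).
have alg (a b c d e g : K) : a * b * (c * d + e * g) = a * b * c * d + a * e * (b * g) by ring.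
exact: alg.
Qed.

End forms.

(** * Integration against currents of order zero *)

Section current_integrals.
Context {R : realType} {n : nat}.
Local Notation K := R[i].
Local Notation C := (Cn R n).
Variables (Omega B : set C).
Hypotheses (Bc : compact B) (BO : B `<=` Omega).
Implicit Types (F G : C -> K) (u f : C -> R) (z v w : C) (p q : 'I_n) (e : K) (T : @cmeasure R n).

(** Continuous and supported in the fixed compact [B]. Unlike test functions, this class is stable
    under multiplication by the potential, which is merely continuous. *)
Definition adm F := [/\ continuous (fun z => Re (F z)), continuous (fun z => Im (F z)) &
 forall z, ~ B z -> F z = 0].

Lemma admD F G : adm F -> adm G -> adm (fun z => F z + G z).
move=> [F1 F2 F3] [G1 G2 G3]; split.
- by under eq_fun do rewrite ReD; exact: contD.
- by under eq_fun do rewrite ImD; exact: contD.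
- by move=> z Bz; rewrite F3// G3// addr0.
Qed.

Lemma admZ e F : adm F -> adm (fun z => e * F z).
move=> [F1 F2 F3]; split.
- under eq_fun do rewrite ReM -mulNr.
 by apply: contD; apply: contM => //; exact: contC.
- under eq_fun do rewrite ImM.
 by apply: contD; apply: contM => //; exact: contC.
- by move=> z Bz; rewrite F3// mulr0.
Qed.

Lemma adm_scale u F : continuous u -> adm F -> adm (fun z => (u z)%:C * F z).
move=> cu [F1 F2 F3]; split.
- by under eq_fun do rewrite ReM /= mul0r subr0; exact: contM.
- by under eq_fun do rewrite ImM /= mul0r addr0; exact: contM.
- by move=> z Bz; rewrite F3// mulr0.
Qed.

Lemma adm_bounded F : adm F -> exists2 M : R, 0 < M &
 forall z, `|Re (F z)| <= M /\ `|Im (F z)| <= M.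
move=> [F1 F2 F3].
have [M M0 HM] := cont_bdd (continuous_subspaceT F1) Bc.
have [N N0 HN] := cont_bdd (continuous_subspaceT F2) Bc.
exists (M + N) => [|z]; first exact: addr_gt0.
have [Bz|Bz] := pselect (B z).
 split; first by apply: le_trans (HM z Bz) _; rewrite lerDl ltW.
 by apply: le_trans (HN z Bz) _; rewrite lerDr ltW.
by rewrite F3//= normr0 addr_ge0// ltW.
Qed.

Lemma borelB : measurable (B : set (borelC R n)). Proof. exact: compact_borel. Qed.

Let mulE T F z : Re (F z * cm_dens T z) =
 Re (F z) * Re (cm_dens T z) - Im (F z) * Im (cm_dens T z).
exact: ReM. Qed.

Let int_prod (nu : {measure set (borelC R n) -> \bar R}) (h g : C -> R) (M : R) :
 continuous h -> (forall z, `|h z| <= M) -> nu.-integrable B (EFin \o g) -> nu.-integrable B (EFin \o (fun z => h z * g z)).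
move=> ch hM ig.
have mh : measurable_fun (B : set (borelC R n)) (h : borelC R n -> R).
 by apply: measurable_funTS; exact: cont_measurable.
have bh : [bounded h x | x in B].
 exists M; split; first exact: num_real.
 by move=> x Mx z _ /=; apply: le_trans (hM z) _; exact: ltW.
have := integrableMr borelB mh bh ig.
by congr (integrable _ _ _); ext => z /=; rewrite EFinM.
Qed.

Lemma adm_integrable T F : radon Omega T -> adm F ->
 (cm_base T).-integrable B (EFin \o (fun z => Re (F z * cm_dens T z))) /\
 (cm_base T).-integrable B (EFin \o (fun z => Im (F z * cm_dens T z))).
move=> rT aF; have [M _ HM] := adm_bounded aF; have [F1 F2 _] := aF.
have [r1 r2] := rT B Bc BO.
have i11 := int_prod F1 (fun z => (HM z).1) r1.
have i12 := int_prod F1 (fun z => (HM z).1) r2.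
have i21 := int_prod F2 (fun z => (HM z).2) r1.
have i22 := int_prod F2 (fun z => (HM z).2) r2.
split.
- have := integrableB borelB i11 i22; congr (integrable _ _ _).
 by ext => z /=; rewrite ReM EFinB.
- have := integrableD borelB i12 i21; congr (integrable _ _ _).
 by ext => z /=; rewrite ImM EFinD.
Qed.

Lemma Rintegral_supp (nu : {measure set (borelC R n) -> \bar R}) (g : C -> R) :
 (forall z, ~ B z -> g z = 0) -> Rintegral nu Omega g = Rintegral nu B g.
move=> g0; rewrite Rintegral_mkcond [RHS]Rintegral_mkcond; congr Rintegral; ext => z.
rewrite /patch; have [Bz|Bz] := pselect (B z).
 by rewrite !mem_set//; exact: BO.
by rewrite [z \in B]memNset// g0//; case: ifP.
Qed.

Lemma cm_intE T F : adm F -> cm_int Omega T F = cm_int B T F.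
move=> [_ _ F0]; rewrite /cm_int !Rintegral_supp// => z Bz; rewrite F0// mul0r//.
Qed.

Lemma cm_intD T F G : radon Omega T -> adm F -> adm G ->
 cm_int Omega T (fun z => F z + G z) = cm_int Omega T F + cm_int Omega T G.
move=> rT aF aG; rewrite !cm_intE//; last exact: admD.
have [f1 f2] := adm_integrable rT aF; have [g1 g2] := adm_integrable rT aG.
rewrite /cm_int; apply: complex_eq => /=.
- rewrite -RintegralD//; last exact: borelB.
 by apply: eq_Rintegral => z _; rewrite mulrDl ReD.
- rewrite -RintegralD//; last exact: borelB.
 by apply: eq_Rintegral => z _; rewrite mulrDl ImD.
Qed.

Lemma cm_intZ T e F : radon Omega T -> adm F ->
 cm_int Omega T (fun z => e * F z) = e * cm_int Omega T F.
move=> rT aF; rewrite !cm_intE//; last exact: admZ.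
have [f1 f2] := adm_integrable rT aF.
have zi (a : R) (g : C -> R) : (cm_base T).-integrable B (EFin \o g) -> (cm_base T).-integrable B (EFin \o (fun z => a * g z)).
 move=> ig; have := integrableZl borelB a ig; congr (integrable _ _ _).
rewrite /cm_int; apply: complex_eq; rewrite ?ReM ?ImM /=.
- rewrite -(RintegralZl _ borelB f1) -(RintegralZl _ borelB f2) -RintegralB//; [|exact: borelB|exact: zi|exact: zi].
 by apply: eq_Rintegral => z _; rewrite -mulrA [LHS]ReM.
- rewrite -(RintegralZl _ borelB f1) -(RintegralZl _ borelB f2) -RintegralD//; [|exact: borelB|exact: zi|exact: zi].
 by apply: eq_Rintegral => z _; rewrite -mulrA [LHS]ImM.
Qed.

(** Order zero means continuity for the sup norm on [B]; this lets a uniform approximation of the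
    potential pass through a coefficient of the current. *)
Lemma cm_int_bound T : radon Omega T -> exists2 M : R, 0 <= M &
 forall F (h : R), adm F -> (forall z, `|Re (F z)| <= h /\ `|Im (F z)| <= h) ->
 `|cm_int Omega T F| <= (h * M)%:C.
move=> rT; have [r1 r2] := rT B Bc BO.
have n1 := integrable_norm r1; have n2 := integrable_norm r2.
have s12 : (cm_base T).-integrable B (EFin \o (fun z => `|Re (cm_dens T z)| + `|Im (cm_dens T z)|)).
 have := integrableD borelB n1 n2; congr (integrable _ _ _); by ext => z /=; rewrite EFinD.
pose D := \int[cm_base T]_(z in B) (`|Re (cm_dens T z)| + `|Im (cm_dens T z)|).
have D0 : 0 <= D by apply: Rintegral_ge0 => z _; exact: addr_ge0.
exists (2 * D) => [|F h aF Hh]; first by rewrite mulr_ge0.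
have h0 : 0 <= h by apply: le_trans (Hh 0).1; exact: normr_ge0.
have [f1 f2] := adm_integrable rT aF.
have i3 : (cm_base T).-integrable B (EFin \o (fun z => h * (`|Re (cm_dens T z)| + `|Im (cm_dens T z)|))).
 have := integrableZl borelB h s12; congr (integrable _ _ _).
rewrite cm_intE//; apply: le_trans (Defs.norm_le_ReIm _) _; rewrite lecR /= mulrCA mulr2n mulrDl mul1r.
apply: lerD.
- apply: le_trans (le_normr_Rintegral borelB f1) _.
 rewrite -(RintegralZl h borelB s12); apply: le_Rintegral => //; first exact: borelB.
 by have := integrable_norm f1.
 move=> z _; rewrite ReM mulrDr; apply: le_trans (ler_normB _ _) _; rewrite !normrM.
 by have [a b] := Hh z; rewrite lerD// ler_wpM2r.
- apply: le_trans (le_normr_Rintegral borelB f2) _.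
 rewrite -(RintegralZl h borelB s12); apply: le_Rintegral => //; first exact: borelB.
 by have := integrable_norm f2.
 move=> z _; rewrite ImM addrC mulrDr; apply: le_trans (ler_normD _ _) _; rewrite !normrM.
 by have [a b] := Hh z; rewrite lerD// ler_wpM2r.
Qed.

Lemma supp_wd e p F : (forall z, ~ B z -> F z = 0) -> forall z, ~ B z -> wd e p F z = 0.
move=> F0 z Bz.
have [r r0 Hr] : exists2 r : R, 0 < r & forall w, nr (w - z) < r -> ~ B w.
 exact: (openP_nr (~` B)).1 (closed_openC (compact_closedC Bc)) z Bz.
have cz v : cd v F z = 0.
 apply: complex_eq; rewrite /cd /=.
 - rewrite (@dder_near _ _ _ (fun=> 0) v z r)// ?dder_cst// => w /Hr /F0 -> //.
 - rewrite (@dder_near _ _ _ (fun=> 0) v z r)// ?dder_cst// => w /Hr /F0 -> //.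
Transparent wd.
apply: (etrans (congr2 (fun a b : K => 2^-1 * (a + e * ('i%C * b))) (cz (basis p)) (cz ('i%C *: basis p)))).
by rewrite !mulr0 addr0 mulr0.
Qed.

Lemma csm_adm F : csm F -> (forall z, ~ B z -> F z = 0) -> adm F.
by move=> [F1 F2] F0; split => //; exact: sm_cont. Qed.

Lemma csm_ctf F : csm F -> (forall z, ~ B z -> F z = 0) -> ctf F.
move=> cF F0; split => //; have [M HM] := compact_nr_bounded Bc.
by exists M => z Mz; apply: F0 => /HM; rewrite leNgt Mz.
Qed.

Lemma radon1 I J : radon Omega (@current1 R n I J).
move=> A cA AO.
have H (a : R) : (@lebesgue_Cn R n).-integrable A (fun=> a%:E).
 apply/integrableP; split; first exact: measurable_cst.
 rewrite (_ : (fun z => `|a%:E|)%E = cst `|a|%:E)//.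
 rewrite integral_cst; last exact: compact_borel.
 by rewrite lte_mul_pinfty// ?lee_fin//; exact: lebesgue_Cn_compact.
by split; exact: H.
Qed.

End current_integrals.

Definition all_in {R : realType} {n : nat} (U : (Cn R n -> R) -> Prop) (us : seq (Cn R n -> R)) : Prop :=
 foldr (fun (w : Cn R n -> R) P => U w /\ P) True us.

(** * Bedford-Taylor products approximated by smooth forms *)

Section current_approximation.
Context {R : realType} {n : nat}.
Local Notation K := R[i].
Local Notation C := (Cn R n).
Variables (Omega B : set C) (c : R) (u ut : C -> R) (T : nat -> @current R n) (U : (C -> R) -> Prop).
Hypotheses (Bc : compact B) (BO : B `<=` Omega) (c0 : 0 < c).
Hypotheses (T0 : T 0%N = @current1 R n)
 (TS : forall k, (k < n)%N -> ddc_wedge c Omega k u (T k) (T k.+1)).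
Hypotheses (utc : continuous ut) (utE : forall z, B z -> ut z = u z).
Hypothesis (Uapprox : forall h : R, 0 < h -> exists w, [/\ U w, sm w & forall z, B z -> `|w z - ut z| <= h]).
Implicit Types (F G : C -> K) (f : C -> R) (z v w : C) (p q : 'I_n) (e : K).

Let supp F := forall z, ~ B z -> F z = 0.

Lemma radon_T k (I J : {set 'I_n}) : (k <= n)%N -> #|I| = k -> #|J| = k -> radon Omega (T k I J).
case: k => [_ _ _|k kn cI cJ]; first by rewrite T0; exact: radon1.
by have [] := TS kn cI cJ.
Qed.

Let cD p q F : csm F -> supp F -> adm B (cddbar p q F).
move=> cF sF; apply: csm_adm; first exact: csm_cddbar.
by do 2 apply: supp_wd => //.
Qed.

(** Extends the defining identity of [ddc_wedge] from real test functions to complex ones by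
    linearity, and replaces [u] by [ut], which is continuous on all of C^n. *)
Lemma ddc_complex k (I J : {set 'I_n}) F : (k < n)%N -> #|I| = k.+1 -> #|J| = k.+1 -> csm F -> supp F ->
 cm_int Omega (T k.+1 I J) F = c%:C * \sum_(p in I) \sum_(q in J) wsign I p * wsign J q *
 cm_int Omega (T k (I :\ p) (J :\ q)) (fun z => (ut z)%:C * cddbar p q F z).
move=> kn cI cJ [F1 F2] F0; have [rS HS] := TS kn cI cJ.
have t1 : test_function Omega (fun z => Re (F z)).
 by split=> //; exists B; split=> // z /F0 ->.
have t2 : test_function Omega (fun z => Im (F z)).
 by split=> //; exists B; split=> // z /F0 ->.
have c1 : csm (fun z => (Re (F z))%:C) by exact: csm_real.
have c2 : csm (fun z => (Im (F z))%:C) by exact: csm_real.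
have s1 : supp (fun z => (Re (F z))%:C) by move=> z /F0 ->.
have s2 : supp (fun z => (Im (F z))%:C) by move=> z /F0 ->.
have FE : F = fun z => (Re (F z))%:C + 'i%C * (Im (F z))%:C.
 by ext => z; case: (F z) => a b; simpc.
have a1 := csm_adm c1 s1; have a2 := csm_adm c2 s2.
have utu f p q : sm f -> (forall z, ~ B z -> f z = 0) ->
 (fun z => (u z)%:C * ddbar p q f z) = fun z => (ut z)%:C * cddbar p q (fun z => (f z)%:C) z.
 move=> sf f0; ext => z; rewrite (ddbarE p q z sf).
 have [Bz|Bz] := pselect (B z); first by rewrite utE.
 have [_ _ ->//] := cD p q (csm_real sf) (fun z Bz => congr1 (real_complex R) (f0 z Bz)).
 by rewrite !mulr0.
rewrite [in LHS]FE (cm_intD Bc BO rS a1 (admZ 'i%C a2)) (cm_intZ Bc BO 'i%C rS a2).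
rewrite (HS _ t1) (HS _ t2) mulrCA -mulrDr; congr (_ * _).
rewrite mulr_sumr -big_split; bigr => p pI /=; rewrite mulr_sumr -big_split.
bigr => q qJ /=; rewrite mulrCA -mulrDr; congr (_ * _).
have h1 z : ~ B z -> Re (F z) = 0 by move=> /F0 ->.
have h2 z : ~ B z -> Im (F z) = 0 by move=> /F0 ->.
apply: (etrans (congr2 (fun a b => cm_int Omega (T k (I :\ p) (J :\ q)) a + 'i%C * cm_int Omega (T k (I :\ p) (J :\ q)) b)
 (utu _ p q F1 h1) (utu _ p q F2 h2))).
have rT : radon Omega (T k (I :\ p) (J :\ q)).
 apply: radon_T; first exact: ltnW.
 - by have := cardsD1 p I; rewrite pI cI => -[].
 - by have := cardsD1 q J; rewrite qJ cJ => -[].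
have b1 := adm_scale utc (cD p q c1 s1); have b2 := adm_scale utc (cD p q c2 s2).
rewrite -(cm_intZ Bc BO 'i%C rT b2) -(cm_intD Bc BO rT b1 (admZ 'i%C b2)).
congr cm_int; ext => z.
have alg (a b d f : K) : a * b + d * (a * f) = a * (b + d * f) by ring.
have wE y : wd 1 q F y = wd 1 q (fun z => (Re (F z))%:C) y + 'i%C * wd 1 q (fun z => (Im (F z))%:C) y.
 apply: etrans (congr1 (fun g => wd 1 q g y) FE) _.
 exact: (etrans (wdD _ _ _ c1 (csmZ 'i%C c2)) (congr1 (fun s => _ + s) (wdZ _ _ _ _ c2))).
have E : cddbar p q F z = cddbar p q (fun z => (Re (F z))%:C) z + 'i%C * cddbar p q (fun z => (Im (F z))%:C) z.
 have wE' := funext wE.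
 apply: etrans (congr1 (fun g => wd (-1) p g z) wE') _.
 have d1 := csm_wd 1 q c1; have d2 := csm_wd 1 q c2.
 exact: (etrans (wdD _ _ _ d1 (csmZ 'i%C d2)) (congr1 (fun s => _ + s) (wdZ _ _ _ _ d2))).
exact: (etrans (alg _ _ _ _) (congr1 (fun y => (ut z)%:C * y) (esym E))).
Qed.

(** Induction on the degree. The outer potential is replaced by a smooth [w], at a cost bounded
    through the masses of [T k]; the products of [w] with the second derivatives of [F] are the data
    for the induction hypothesis. One list [us] must serve all of them, hence the finite family
    [X]. *)
Lemma current_approx k : (k <= n)%N -> forall (X : finType) (I J : X -> {set 'I_n}) (F : X -> C -> K) (e : R),
 (forall x, #|I x| = k /\ #|J x| = k) -> (forall x, csm (F x)) -> (forall x, supp (F x)) -> 0 < e ->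
 exists us, [/\ size us = k, all_in U us, smooth us & forall x,
 `|cm_int Omega (T k (I x) (J x)) (F x) - c%:C ^+ k * cinteg (fun z => F x z * form us z (I x) (J x))| <= e%:C].
elim: k => [_|k IH kn] X I J F e cIJ cF sF e0.
 exists [::]; split=> // x; rewrite T0 expr0 mul1r /=.
 rewrite [X in `|X|](_ : _ = 0) ?normr0 ?lecR ?ltW//; apply/eqP; rewrite subr_eq0; apply/eqP.
Transparent cinteg.
 have h (g : C -> R) : (forall z, ~ B z -> g z = 0) -> \int[@lebesgue_Cn R n]_(z in Omega) g z = integ g.
 move=> g0; rewrite integE [LHS]Rintegral_mkcond; congr Rintegral; ext => z; rewrite /patch.
 by case: ifPn => //; rewrite notin_setE => Oz; rewrite g0//; move=> /BO.
 rewrite /cm_int /cinteg; apply: complex_eq => /=.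
 - by apply: h => z Bz; rewrite sF// mul0r.
 - by apply: h => z Bz; rewrite sF// mul0r.
(* One member for each pair of indices removed from each member of [X]. *)
pose X' : finType := {t : X * 'I_n * 'I_n | (t.1.2 \in I t.1.1) && (t.2 \in J t.1.1)}.
pose I' (t : X') := I (val t).1.1 :\ (val t).1.2.
pose J' (t : X') := J (val t).1.1 :\ (val t).2.
have cIJ' t : #|I' t| = k /\ #|J' t| = k.
 have /andP[pI qJ] := valP t; have [cI cJ] := cIJ (val t).1.1; rewrite /I' /J'; split.
 - by have := cardsD1 (val t).1.2 (I (val t).1.1); rewrite pI cI => -[].
 - by have := cardsD1 (val t).2 (J (val t).1.1); rewrite qJ cJ => -[].
pose G (t : X') := cddbar (val t).1.2 (val t).2 (F (val t).1.1).
have aG t : adm B (G t) by exact: cD.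
have rT t : radon Omega (T k (I' t) (J' t)).
 by have [? ?] := cIJ' t; apply: radon_T => //; exact: ltnW.
have MP : forall t, exists m : R, 0 <= m /\ forall (w : C -> R) (h : R), continuous w -> 0 <= h ->
 (forall z, B z -> `|w z| <= h) -> `|cm_int Omega (T k (I' t) (J' t)) (fun z => (w z)%:C * G t z)| <= (h * m)%:C.
 move=> t; have [M M0 HM] := cm_int_bound Bc BO (rT t).
 have [N N0 HN] := adm_bounded Bc (aG t).
 exists (N * M); split=> [|w h cw h0 Hw]; first by rewrite mulr_ge0// ltW.
 rewrite mulrA; apply: HM; first exact: adm_scale.
 move=> z; have [Bz|Bz] := pselect (B z).
 have rr (a : R) (b : K) : Re (a%:C * b) = a * Re b /\ Im (a%:C * b) = a * Im b.
 by case: b => x y /=; rewrite !mul0r subr0 addr0.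
 rewrite (rr _ _).1 (rr _ _).2 !normrM; have [a b] := HN z.
 by split; apply: ler_pM => //; exact: Hw.
 have [_ _ ->//] := aG t; rewrite mulr0 /= normr0; by rewrite mulr_ge0// ltW.
have [M HM] := choice MP.
(* At most n * n terms, each carrying the factor [c]: each may cost [e / D], half for replacing [ut]
   by [w] and half for the induction hypothesis. *)
pose D := c * (n%:R * n%:R) + 1.
have D0 : 0 < D by rewrite ltr_wpDl// mulr_ge0// ?mulr_ge0// ltW.
pose SM := \sum_t M t + 1.
have SM0 : 0 < SM by rewrite ltr_wpDl// sumr_ge0// => t _; exact: (HM t).1.
have e1 : 0 < e / (2 * D) by rewrite divr_gt0// mulr_gt0.
have h0 : 0 < e / (2 * D) / SM by rewrite divr_gt0.
have [w [Uw sw wu]] := Uapprox h0.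
have cG t : csm (fun z => (w z)%:C * G t z) by apply: csmM; [exact: csm_real|exact: csm_cddbar].
have sG t : supp (fun z => (w z)%:C * G t z) by move=> z Bz; have [_ _ ->//] := aG t; rewrite mulr0.
have [us [sz aU sus Hus]] := IH (ltnW kn) X' I' J' (fun t z => (w z)%:C * G t z) (e / (2 * D)) cIJ' cG sG e1.
exists (w :: us); split=> [||//|x]; first by rewrite /= sz.
- by [].
have [cI cJ] := cIJ x.
rewrite (ddc_complex kn cI cJ (cF x) (sF x)).
rewrite -(wedge_by_parts (I x) (J x) (csm_ctf Bc (cF x) (sF x)) sw sus).
rewrite exprS -mulrA -mulrBr mulr_sumr -sumrB normrM.
have nc : `|c%:C : K| = c%:C by rewrite ger0_norm// lecR ltW.
have bound p q : p \in I x -> q \in J x ->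
 `|wsign (I x) p * wsign (J x) q * cm_int Omega (T k (I x :\ p) (J x :\ q)) (fun z => (ut z)%:C * cddbar p q (F x) z) -
 c%:C ^+ k * (wsign (I x) p * wsign (J x) q * cinteg (fun z => (w z)%:C * cddbar p q (F x) z * form us z (I x :\ p) (J x :\ q)))|
 <= (e / D)%:C.
 move=> pI qJ; rewrite [c%:C ^+ k * _]mulrCA -mulrBr normrM.
 have -> : `|wsign (I x) p * wsign (J x) q : K| = 1 by rewrite normrM /wsign !normrX !normrN1 !expr1n mulr1.
 rewrite mul1r.
 have pq : (p \in I (x, p, q).1.1) && (q \in J (x, p, q).1.1) by rewrite /= pI.
 have tE : e / D = e / (2 * D) + e / (2 * D) by field; rewrite gt_eqF.
 have := Hus (exist _ (x, p, q) pq); rewrite /I' /J' /G /= => H1.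
 have ca : continuous (fun z => ut z - w z).
 by have := contD utc (sm_cont (smN sw)).
 have hM : forall z, B z -> `|ut z - w z| <= e / (2 * D) / SM by move=> z /wu; rewrite distrC.
 have [Mt0 /(_ (fun z => ut z - w z) _ ca (ltW h0) hM)] := HM (exist _ (x, p, q) pq).
 rewrite /I' /J' /G /= => H2.
 have aX : adm B (cddbar p q (F x)) by exact: cD.
 have rX := rT (exist _ (x, p, q) pq); rewrite /I' /J' /= in rX.
 have E : cm_int Omega (T k (I x :\ p) (J x :\ q)) (fun z => (ut z)%:C * cddbar p q (F x) z) =
 cm_int Omega (T k (I x :\ p) (J x :\ q)) (fun z => (ut z - w z)%:C * cddbar p q (F x) z) +
 cm_int Omega (T k (I x :\ p) (J x :\ q)) (fun z => (w z)%:C * cddbar p q (F x) z).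
 rewrite -(cm_intD Bc BO rX (adm_scale ca aX) (adm_scale (sm_cont sw) aX)).
 by congr cm_int; ext => z; rewrite -mulrDl -rmorphD /= subrK.
 rewrite E -addrA tE rmorphD; apply: le_trans (ler_normD _ _) _; apply: lerD; last exact: H1.
 apply: le_trans H2 _; rewrite lecR -mulrA ger_pMr// mulrC ler_pdivrMr// mul1r /SM.
 rewrite (bigD1 (exist _ (x, p, q) pq))//= -addrA lerDl addr_ge0// sumr_ge0// => t _.
 exact: (HM t).1.
have e' : 0 <= e / D by rewrite divr_ge0// ltW.
apply: (@le_trans _ _ (c%:C * (n%:R * n%:R * (e / D))%:C)); last first.
 rewrite -rmorphM lecR mulrA [X in X <= _]mulrA ler_pdivrMr//.
 by rewrite [X in X <= _]mulrA [X in X <= _]mulrC ler_pM2l// /D lerDl.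
rewrite nc ler_wpM2l//; first by rewrite lecR ltW.
have sumbound (A : {set 'I_n}) (a : 'I_n -> K) (b : R) : 0 <= b -> (forall p, p \in A -> `|a p| <= b%:C) ->
 `|\sum_(p in A) a p| <= (n%:R * b)%:C.
 move=> b0 Ha; apply: le_trans (ler_norm_sum _ _ _) _.
 apply: (@le_trans _ _ (\sum_(p in A) b%:C)); first exact: ler_sum.
 rewrite sumr_const -rmorphMn lecR /= -mulr_natl ler_wpM2r// ler_nat.
 by rewrite -[leqRHS](card_ord n); exact: max_card.
rewrite -mulrA; have sb := sumbound; apply: sumbound => [|p pI]; first by rewrite mulr_ge0.
rewrite mulr_sumr -sumrB; apply: sb => // q qJ; exact: bound.
Qed.

End current_approximation.

(** * The submean value property of smooth functions *)

Section smooth_submean.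
Context {R : realType} {n : nat}.
Local Notation C := (Cn R n).
Implicit Types (f u q : C -> R) (z v w : C).

(** Only a local maximum of [u - q] is asked for, so additive constants in [q] do not matter. *)
Definition touches u q z := exists2 r : R, 0 < r & forall w, nr (w - z) < r -> u w - q w <= u z - q z.

Lemma expi_norm (t : R) : `|expi t| = 1.
by rewrite /expi normc_def /= cos2Dsin2 sqrtr1. Qed.

Lemma expi_scale (t : R) v : expi t *: v = (cos t)%:C *: v + (sin t)%:C *: ('i%C *: v).
rewrite scalerA -scalerDl; congr (_ *: _); rewrite /expi; apply/eqP; rewrite eq_complex /=; apply/andP; split; apply/eqP; ring.
Qed.

Definition submean (Omega : set C) u := forall z w,
 (forall zeta : R[i], `|zeta| <= 1 -> Omega (z + zeta *: w)) -> ((u z)%:E <= circle_mean (EFin \o u) z w)%E.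

Lemma lapD f g v z : sm f -> sm g -> lap v (fun z => f z + g z) z = lap v f z + lap v g z.
move=> sf sg; have d2 w : dder w (dder w (fun z => f z + g z)) z = dder w (dder w f) z + dder w (dder w g) z.
 by rewrite (dderD w sf sg) (dderD w (sm_dder w sf) (sm_dder w sg)).
have alg (a b c d : R) : 4^-1 * ((a + b) + (c + d)) = 4^-1 * (a + c) + 4^-1 * (b + d) by field.
apply: (etrans (congr2 (fun x y : R => 4^-1 * (x + y)) (d2 v) (d2 ('i%C *: v)))).
exact: alg.
Qed.

Lemma lapZ f (k : R) v z : sm f -> lap v (fun z => k * f z) z = k * lap v f z.
move=> sf; have d2 w : dder w (dder w (fun z => k * f z)) z = k * dder w (dder w f) z.
 by rewrite (dderZ k w sf) (dderZ k w (sm_dder w sf)).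
have alg (a b : R) : 4^-1 * (k * a + k * b) = k * (4^-1 * (a + b)) by field.
apply: (etrans (congr2 (fun x y : R => 4^-1 * (x + y)) (d2 v) (d2 ('i%C *: v)))).
exact: alg.
Qed.

Lemma lap_E2 a v z : lap v (fun z => E2 (z + a)) z = E2 v.
have d2 w : dder w (dder w (fun z => E2 (z + a))) z = 2 * E2 w.
 by rewrite dder_shift dder_shift dder2_E2.
have e : E2 ('i%C *: v) = E2 v.
 bigr => j _; rewrite /xr /xi !mxE; case: (v 0 j) => x y /=; ring.
apply: (etrans (congr2 (fun x y : R => 4^-1 * (x + y)) (d2 v) (d2 ('i%C *: v)))).
by rewrite e; field.
Qed.

Lemma lap_scaleR (a : R) (v : C) u z : sm u -> lap (a%:C *: v) u z = a ^+ 2 * lap v u z.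
move=> su; have d2 (w : C) : dder (a%:C *: w) (dder (a%:C *: w) u) z = a ^+ 2 * dder w (dder w u) z.
 rewrite (dder_scalev w a su) (dderZ a (a%:C *: w) (sm_dder w su)) (dder_scalev w a (sm_dder w su)).
 by rewrite mulrA.
have E : 'i%C *: (a%:C *: v) = a%:C *: ('i%C *: v) by rewrite !scalerA mulrC.
have d2' : dder ('i%C *: (a%:C *: v)) (dder ('i%C *: (a%:C *: v)) u) z = a ^+ 2 * dder ('i%C *: v) (dder ('i%C *: v) u) z.
 by rewrite E; exact: d2.
have alg (x y : R) : 4^-1 * (a ^+ 2 * x + a ^+ 2 * y) = a ^+ 2 * (4^-1 * (x + y)) by field.
exact: (etrans (congr2 (fun x y : R => 4^-1 * (x + y)) (d2 v) d2') (alg _ _)).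
Qed.

Lemma move_first (V : lmodType R[i]) (z v w : V) x x' y : z + x' *: v + y *: w = z + x *: v + y *: w + (x' - x) *: v.
by rewrite scalerBl [RHS]addrAC -[z + x *: v + _]addrA (addrC (x *: v)) subrK. Qed.

Lemma move_both (V : lmodType R[i]) (z v w : V) x y y' g :
 z + x *: v + y' *: w + g *: v - (z + x *: v + y *: w) = (y' - y) *: w + g *: v.
rewrite scalerBl opprD addrA; move: (z + x *: v) (y' *: w) (g *: v) (y *: w) => a b c d.
by rewrite -(addrA a) [a + _]addrC addrK addrAC.
Qed.

Lemma mvt_signed f z v (s : R) : sm f -> exists2 c : R, `|c| <= `|s| & f (z + s%:C *: v) - f z = dder v f (z + c%:C *: v) * s.
move=> sf; have cf := sm_cont sf; have df := sm_isd v sf.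
have [s0|s0|<-] := ltgtP 0 s; last by exists 0 => //; rewrite scale0r addr0 subrr mulr0.
- have [c /andP[c0 cs] E] := mvt_along z cf df s0; exists c => //.
 by rewrite !ger0_norm ?(ltW c0) ?(ltW s0)// ltW.
- have s0' : 0 < - s by rewrite oppr_gt0.
 have [c /andP[c0 cs] E] := mvt_along (z + s%:C *: v) cf df s0'.
 exists (s + c); first by rewrite !ler0_norm ?(ltW s0)//; move: c0 cs; clear; lra.
 move: E; rewrite -addrA -scalerDl -rmorphD subrr scale0r addr0 -addrA -scalerDl -rmorphD mulrN => E.
 by rewrite -[LHS]opprB E opprK.
Qed.

(** The mean value theorem handles the increment along [v], the one-variable chain rule the
    increment along [w]. *)
Lemma curve_derive f (a b : R -> R) (t a' b' : R) z v w : sm f -> is_derive t (1 : R) a a' -> is_derive t (1 : R) b b' ->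
 is_derive t (1 : R) (fun t => f (z + (a t)%:C *: v + (b t)%:C *: w))
 (a' * dder v f (z + (a t)%:C *: v + (b t)%:C *: w) + b' * dder w f (z + (a t)%:C *: v + (b t)%:C *: w)).
move=> sf da db; pose p x y := z + (x : R)%:C *: v + (y : R)%:C *: w.
have ca : {for t, continuous a} by apply: differentiable_continuous; apply/derivable1_diffP; case: da.
have cb : {for t, continuous b} by apply: differentiable_continuous; apply/derivable1_diffP; case: db.
have pE x x' y : p x' y = p x y + (x' - x)%:C *: v by rewrite /p rmorphB; exact: move_first.
pose P (s c : R) := `|c| <= `|a s - a t| /\
 f (p (a t) (b s) + (a s - a t)%:C *: v) - f (p (a t) (b s)) = dder v f (p (a t) (b s) + c%:C *: v) * (a s - a t).
have exP s : exists c, P s c by have [c h1 h2] := mvt_signed (p (a t) (b s)) v (a s - a t) sf; exists c.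
have [g Hg] := choice exP.
have h2 : is_derive t (1 : R) (fun s => f (p (a t) (b s))) (dder w f (p (a t) (b t)) * b').
 have h := @is_derive1_comp R (along f (z + (a t)%:C *: v) w) b t _ _ (isd_at (z + (a t)%:C *: v) (b t) (sm_isd w sf)) db.
 exact: h.
have lim1 : (fun s => dder v f (p (a t) (b s) + (g s)%:C *: v)) s @[s --> t] --> dder v f (p (a t) (b t)).
 apply/cvgrPdist_lt => e e0.
 have [r r0 Hr] := (cont_nr _ _).1 (sm_cont (sm_dder v sf) (p (a t) (b t))) _ e0.
 pose k := r / (nr v + nr w + 1); have k1 : 0 < nr v + nr w + 1 by rewrite ltr_wpDl// addr_ge0 ?nr_ge0.
 have k0 : 0 < k by rewrite divr_gt0.
 have /cvgrPdist_lt/(_ _ k0) na := ca; have /cvgrPdist_lt/(_ _ k0) nb := cb.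
 near=> s; rewrite distrC; apply: Hr.
 have -> : p (a t) (b s) + (g s)%:C *: v - p (a t) (b t) = (b s - b t)%:C *: w + (g s)%:C *: v.
 by rewrite /p rmorphB; exact: move_both.
 apply: le_lt_trans (nrD _ _) _; rewrite !nrZ.
 have ga : `|g s| <= k.
 have [h _] := Hg s; apply: le_trans h _; rewrite distrC; apply: ltW.
 by near: s; exact: na.
 have gb : `|b s - b t| <= k.
 by rewrite distrC; apply: ltW; near: s; exact: nb.
 apply: (@le_lt_trans _ _ (k * nr w + k * nr v)); first by rewrite lerD// ler_wpM2r ?nr_ge0.
 by rewrite -mulrDr addrC /k mulrAC ltr_pdivrMr// ltr_pM2l// ltrDl.
pose D s := dder v f (p (a t) (b s) + (g s)%:C *: v).
pose F1 s := f (p (a s) (b s)) - f (p (a t) (b s)).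
have F1t : F1 t = 0 by rewrite /F1 subrr.
have F1E s : F1 s = D s * (a s - a t) by rewrite /F1 /D -(Hg s).2 -pE.
have Q : h^-1 *: ((F1 \o shift t) (h *: 1) - F1 t) @[h --> 0^'] --> dder v f (p (a t) (b t)) * a'.
 rewrite (_ : (fun h => _) = fun h => D (h + t) * (h^-1 *: ((a \o shift t) (h *: 1) - a t))); last first.
 by ext => h /=; rewrite F1t subr0 F1E [h *: 1]mulr1 scalerAr.
 apply: cvgM; last by have [d1 <-] := da; exact: d1.
 apply: (cvg_comp _ _ _ lim1).
 have h : (x + t) @[x --> 0^'] --> (0 : R) + t by apply: cvgD; [exact: (@nbhs_dnbhs R 0)|exact: cvg_cst].
 by rewrite add0r in h; exact: h.
have h1 : is_derive t (1 : R) F1 (dder v f (p (a t) (b t)) * a').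
 by apply: DeriveDef; [exact: cvgP Q|exact: cvg_lim Q].
have := is_deriveD h1 h2; rewrite mulrC [b' * _]mulrC; congr is_derive.
by ext => s; rewrite /F1 /= subrK.
Unshelve. all: by end_near. Qed.

Local Notation I := `[(0 : R), (2 * pi : R)]%classic.
Local Notation lam := (@lebesgue_measure R).

(** The open interval (-1, 2) surrounds the radii [0, 1], so that derivatives at the end points are
    two-sided. *)
Lemma int_derive (f f' : R -> R -> R) (a G : R) : -1 < a < 2 ->
 (forall s t : R, -1 < s < 2 -> is_derive s (1 : R) (f ^~ t) (f' s t)) ->
 (forall s : R, continuous (f s)) -> (forall s t : R, -1 < s < 2 -> `|f' s t| <= G) ->
 is_derive a (1 : R) (fun s : R => \int[lam]_(t in I) f s t) (\int[lam]_(t in I) f' a t).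
move=> a12 df cf bf.
have mI : measurable (I : set (mtR R)) by exact: measurable_itv.
have cI : compact (I : set R) by exact: segment_compact.
have d1 s t : -1 < s < 2 -> partial1of2 f s t = f' s t.
 by move=> s12; rewrite /partial1of2 derive1E; have [_ ->] := df s t s12.
have ina : a \in `]-1, 2[ by rewrite in_itv.
have hI s : `]-1, 2[%classic s -> lam.-integrable I (EFin \o f s).
 by move=> _; apply: continuous_compact_integrable => //; exact: continuous_subspaceT.
have hG : lam.-integrable I (EFin \o (fun=> `|G|)).
 apply: continuous_compact_integrable => //; apply: continuous_subspaceT; exact: cst_continuous.
have bG s t : `]-1, 2[%classic s -> I t -> `|partial1of2 f s t| <= `|G|.
 by rewrite /= in_itv /= => s12 _; rewrite d1// (le_trans (bf s t s12))// ler_norm.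
have dr s t : `]-1, 2[%classic s -> I t -> derivable (f^~ t) s 1.
 by rewrite /= in_itv /= => s12 _; have [] := df s t s12.
have G0 (y : R) : 0 <= `|G| by [].
have e1 := @derivable_under_integral R _ _ lam f I mI a (-1) 2 ina hI dr _ G0 hG bG.
have e2 := @differentiation_under_integral R _ _ lam f I mI a (-1) 2 ina hI dr _ G0 hG bG.
apply: DeriveDef; first exact: e1.
by rewrite -derive1E [LHS]e2; apply: eq_Rintegral => t _; exact: d1.
Qed.

(** Polar form of the divergence theorem. Let m(s) be the integral over the circle of radius s: s
    m'(s) vanishes at 0 and has derivative the integral of 4 s [lap w V], which is nonnegative, so m
    increases from 2 pi V(z). *)
Lemma sm_circle_ge V z w : sm V -> (forall x : R[i], `|x| <= 1 -> 0 <= lap w V (z + x *: w)) ->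
 ((V z)%:E <= circle_mean (EFin \o V) z w)%E.
move=> sV pV; pose w' : C := 'i%C *: w.
pose A := dder w V; pose B := dder w' V.
have sA : sm A by exact: sm_dder.
have sB : sm B by exact: sm_dder.
pose p (s t : R) : C := z + (s * cos t)%:C *: w + (s * sin t)%:C *: w'.
have ds (f : C -> R) (s t : R) : sm f -> is_derive s (1 : R) (fun s => f (p s t)) (cos t * dder w f (p s t) + sin t * dder w' f (p s t)).
 move=> sf; apply: curve_derive => //.
 - have := is_deriveM (is_derive_id s (1 : R)) (is_derive_cst (cos t) s (1 : R)).
 by move=> H; apply: is_derive_eq H _; rewrite /GRing.scale /= mulr0 add0r mulr1.
 - have := is_deriveM (is_derive_id s (1 : R)) (is_derive_cst (sin t) s (1 : R)).
 by move=> H; apply: is_derive_eq H _; rewrite /GRing.scale /= mulr0 add0r mulr1.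
have dt (f : C -> R) (s t : R) : sm f -> is_derive t (1 : R) (fun t => f (p s t)) (- (s * sin t) * dder w f (p s t) + s * cos t * dder w' f (p s t)).
 move=> sf; apply: curve_derive => //.
 have := is_deriveZ s (is_derive_cos t); move=> H; apply: is_derive_eq H _; rewrite /GRing.scale /= mulrN//.
have dcont (g : R -> R) : (forall t : R, exists d, is_derive t (1 : R) g d) -> continuous g.
 by move=> H t; apply: differentiable_continuous; apply/derivable1_diffP; have [d []] := H t.
have ct f s : sm f -> continuous (fun t => f (p s t)).
 by move=> sf; apply: dcont => t; eexists; exact: dt.
have cc : continuous (@cos R) := @continuous_cos R.
have cs : continuous (@sin R) := @continuous_sin R.
have cM (g h : R -> R) : continuous g -> continuous h -> continuous (fun t => g t * h t) by move=> cg ch t; apply: cvgM; [exact: cg|exact: ch].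
have cD (g h : R -> R) : continuous g -> continuous h -> continuous (fun t => g t + h t) by move=> cg ch t; apply: cvgD; [exact: cg|exact: ch].
have cK (a : R) : continuous (fun _ : R => a) by exact: cst_continuous.
have pball (s t : R) : -1 < s < 2 -> nr (p s t) <= nr z + 2 * nr w + 2 * nr w'.
 move=> /andP[s1 s2]; have s3 : `|s| <= 2 by rewrite ler_norml; move: s1 s2; clear; lra.
 have h (x : R) (v : C) : `|x| <= 1 -> nr ((s * x)%:C *: v) <= 2 * nr v.
 by move=> x1; rewrite nrZ ler_wpM2r ?nr_ge0// normrM -[2 : R]mulr1 ler_pM.
 rewrite /p; apply: le_trans (nrD _ _) _; apply: lerD; last by apply: h; exact: sin_max.
 by apply: le_trans (nrD _ _) _; apply: lerD => //; apply: h; exact: cos_max.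
have bnd f : sm f -> exists2 G : R, 0 < G & forall s t : R, -1 < s < 2 -> `|f (p s t)| <= G.
 move=> sf; have [G G0 HG] := cont_bounded_ball (nr z + 2 * nr w + 2 * nr w') (sm_cont sf).
 by exists G => // s t /(pball s t) /HG.
have bnd2 (a b t G H : R) : 0 < G -> 0 < H -> `|a| <= G -> `|b| <= H -> `|cos t * a + sin t * b| <= G + H.
 move=> G0 H0 fG gH; apply: le_trans (ler_normD _ _) _; rewrite !normrM; apply: lerD.
 - by rewrite -[G]mul1r ler_pM//; exact: cos_max.
 - by rewrite -[H]mul1r ler_pM//; exact: sin_max.
(* The radial derivative of [V] at radius [s] and angle [t], followed by its own radial
   derivative. *)
pose E (s t : R) : R := cos t * A (p s t) + sin t * B (p s t).
pose Es (s t : R) : R := cos t * (cos t * dder w A (p s t) + sin t * dder w' A (p s t)) +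
 sin t * (cos t * dder w B (p s t) + sin t * dder w' B (p s t)).
have cE s : continuous (E s) by apply: (cD); apply: (cM) => //; exact: ct.
have [GA GA0 HA] := bnd A sA. have [GB GB0 HB] := bnd B sB.
have [G1 G10 H1] := bnd _ (sm_dder w sA). have [G2 G20 H2] := bnd _ (sm_dder w' sA).
have [G3 G30 H3] := bnd _ (sm_dder w sB). have [G4 G40 H4] := bnd _ (sm_dder w' sB).
have bE (s t : R) : -1 < s < 2 -> `|E s t| <= GA + GB by move=> h; apply: bnd2 => //; [exact: HA|exact: HB].
have bEs (s t : R) : -1 < s < 2 -> `|Es s t| <= (G1 + G2) + (G3 + G4).
 by move=> h; apply: (bnd2); rewrite ?addr_gt0//; apply: (bnd2) => //; [exact: H1|exact: H2|exact: H3|exact: H4].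
have dE (s t : R) : is_derive s (1 : R) (E ^~ t) (Es s t).
 exact: is_deriveD (is_deriveZ (cos t) (ds A s t sA)) (is_deriveZ (sin t) (ds B s t sB)).
have dN (s t : R) : is_derive s (1 : R) (fun s => s * E s t) (E s t + s * Es s t).
 have := is_deriveM (is_derive_id s (1 : R)) (dE s t); move=> H; apply: is_derive_eq H _.
 by rewrite /GRing.scale /= mulr1 addrC.
have mder (a : R) : -1 < a < 2 -> is_derive a (1 : R) (fun s : R => \int[lam]_(t in I) V (p s t)) (\int[lam]_(t in I) E a t).
 by move=> h; exact: (@int_derive (fun s t : R => V (p s t)) E a (GA + GB) h (fun s t _ => ds V s t sV) (fun s => ct V s sV) bE).
have Nder (a : R) : -1 < a < 2 -> is_derive a (1 : R) (fun s : R => \int[lam]_(t in I) (s * E s t)) (\int[lam]_(t in I) (E a t + a * Es a t)).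
 move=> h; apply: (@int_derive (fun s t : R => s * E s t) (fun s t : R => E s t + s * Es s t) a ((GA + GB) + 2 * ((G1 + G2) + (G3 + G4))) h).
 - by move=> s; apply: (cM).
 - move=> s t st; apply: le_trans (ler_normD _ _) _; apply: lerD; first exact: bE.
 rewrite normrM ler_pM//; last exact: bEs.
 by rewrite ler_norml; case/andP: st; clear; lra.
(* The angular derivative divided by [s]. Its derivative in [t] is the difference between the
   Laplacian term [lp] and the radial terms, and its integral over a period vanishes. *)
pose Kt (s t : R) : R := - sin t * A (p s t) + cos t * B (p s t).
pose lp (s t : R) : R := 4 * s * lap w V (p s t).
have dK (s t : R) : is_derive t (1 : R) (Kt s) (lp s t - (E s t + s * Es s t)).
 have h1 := is_deriveN (is_derive_sin t).
 have := is_deriveD (is_deriveM h1 (dt A s t sA)) (is_deriveM (is_derive_cos t) (dt B s t sB)).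
 move=> H; apply: is_derive_eq H _; rewrite /GRing.scale /=.
 have -> : lp s t = s * (dder w A (p s t) + dder w' B (p s t)).
 have al (k a b : R) : 4 * k * (4^-1 * (a + b)) = k * (a + b) by field.
 exact: al.
 have -> : (- (@sin R)) t = - sin t by [].
 rewrite /E /Es; have sc : sin t * sin t = 1 - cos t * cos t by rewrite -expr2 -expr2 -(cos2Dsin2 t) addrAC subrr add0r.
 move: (A _) (B _) (dder w A _) (dder w' A _) (dder w B _) (dder w' B _) sc; move: (sin t) (cos t) => x y a b c d e f sc.
 apply/eqP; rewrite -subr_eq0 (_ : _ - _ = (x * x + y * y - 1) * (s * (c + f))); last by ring.
 by rewrite sc subrK subrr mul0r.
pose h (s t : R) : R := lp s t - (E s t + s * Es s t).
have cEs s : continuous (Es s).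
 by apply: (cD); apply: (cM) => //; apply: (cD); apply: (cM) => //; apply: (ct); exact: sm_dder.
have cES s : continuous (fun t => E s t + s * Es s t) by apply: (cD) => //; apply: (cM).
have clp s : continuous (lp s) by apply: (cM (fun=> 4 * s)) => //; apply: (ct); exact: sm_lap.
have ch s : continuous (h s).
 by move=> t; apply: cvgB; [exact: clp|exact: cES].
have p0 : 0 < 2 * pi :> R by rewrite mulr_gt0// pi_gt0.
have iI (g : R -> R) : continuous g -> lam.-integrable I (EFin \o g).
 by move=> cg; apply: continuous_compact_integrable; [exact: segment_compact|exact: continuous_subspaceT].
have inth (s : R) : \int[lam]_(t in I) h s t = 0.
 rewrite /Rintegral (@continuous_FTC2 R (h s) (Kt s) 0 (2 * pi) p0).
 - have sp : sin (2 * pi) = 0 :> R by rewrite mulr_natl sin2pi.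
 have cp : cos (2 * pi) = 1 :> R by rewrite mulr_natl cos2pi.
 by rewrite -EFinB /Kt /p sp cp sin0 cos0 subrr.
 - exact: continuous_subspaceT.
 - have cKt : continuous (Kt s) by apply: dcont => t; eexists; exact: dK.
 split; first by move=> x _; case: (dK s x).
 + apply: cvg_at_right_filter; exact: cKt.
 + apply: cvg_at_left_filter; exact: cKt.
 - by move=> x _; rewrite derive1E; case: (dK s x).
have mI : measurable (I : set (mtR R)) by exact: measurable_itv.
have N'0 (s : R) : 0 <= s -> s <= 1 -> 0 <= \int[lam]_(t in I) (E s t + s * Es s t).
 move=> s0 s1; have := RintegralD mI (iI _ (cES s)) (iI _ (ch s)); rewrite inth addr0 => <-.
 apply: Rintegral_ge0 => t _; rewrite /h addrC subrK; apply: mulr_ge0; first by rewrite mulr_ge0.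
 have := pV (s%:C * expi t); rewrite normrM expi_norm mulr1 normc_def /= expr0n /= addr0 sqrtr_sqr ger0_norm// lecR => /(_ s1).
 by rewrite -scalerA expi_scale scalerDr !scalerA -!rmorphM addrA /p /w' scalerA.
pose m (s : R) : R := \int[lam]_(t in I) V (p s t).
have in12 (s : R) : 0 <= s -> s <= 1 -> -1 < s < 2 by move=> *; apply/andP; split; lra.
have mc : {within `[0, 1], continuous m}.
 apply: derivable_within_continuous => s; rewrite in_itv /= => /andP[s0 s1].
 by have [] := mder s (in12 s s0 s1).
have m01 : m 0 <= m 1.
 have [|s] := @MVT R m (fun s : R => \int[lam]_(t in I) E s t) 0 1 ltr01 _ mc.
 by move=> s; rewrite in_itv /= => /andP[s0 s1]; apply: mder; apply: in12; exact: ltW.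
 rewrite in_itv /= subr0 mulr1 => /andP[s0 s1] Em; rewrite -subr_ge0 Em.
 pose N (s : R) : R := \int[lam]_(t in I) (s * E s t).
 have Nc : {within `[0, s], continuous N}.
 apply: derivable_within_continuous => r; rewrite in_itv /= => /andP[r0 rs].
 by have [] := Nder r (in12 r r0 (le_trans rs (ltW s1))).
 have [|r] := @MVT R N (fun s : R => \int[lam]_(t in I) (E s t + s * Es s t)) 0 s s0 _ Nc.
 by move=> r; rewrite in_itv /= => /andP[r0 rs]; apply: Nder; apply: in12; [exact: ltW|exact: ltW (lt_trans rs s1)].
 rewrite in_itv /= subr0 => /andP[r0 rs].
 have -> : N 0 = 0 by rewrite /N; under eq_Rintegral do rewrite mul0r; rewrite Rintegral_cst// mul0r.
 rewrite subr0 /N (RintegralZl _ mI (iI _ (cE s))) => EN.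
 have : 0 <= s * \int[lam]_(t in I) E s t.
 rewrite EN; apply: mulr_ge0; last exact: ltW.
 by apply: N'0; [exact: ltW|exact: ltW (lt_trans rs s1)].
 by rewrite pmulr_rge0.
have m0E : m 0 = V z * (2 * pi).
 rewrite /m; under eq_Rintegral do rewrite /p !mul0r !scale0r !addr0.
 rewrite Rintegral_cst//; congr (_ * _).
 have /= := @lebesgue_measure_itv R `[(0 : R), (2 * pi : R)]; rewrite lte_fin p0 oppr0 adde0 => H.
 exact: (congr1 fine H).
rewrite /circle_mean.
rewrite (_ : (\int[_]_(t in _) _)%E = (m 1)%:E); last first.
 rewrite /m /Rintegral fineK; last by apply: integrable_fin_num => //; exact: iI (ct V 1 sV).
 by apply: eq_integral => t _ /=; rewrite expi_scale /p !mul1r addrA.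
by rewrite -EFinM lee_fin mulrC ler_pdivlMr// -m0E.
Qed.

End smooth_submean.

(** * Functions touching from above *)

Section circle_means.
Context {R : realType} {n : nat}.
Local Notation C := (Cn R n).
Variable Omega : set C.
Implicit Types (u v w q : C -> R) (z : C).

Local Notation I := `[(0 : R), (2 * pi : R)]%classic.

Lemma circle_integrable u z (w : C) : (forall z, Omega z -> {for z, continuous u}) ->
 (forall x : R[i], `|x| <= 1 -> Omega (z + x *: w)) ->
 (@lebesgue_measure R).-integrable I (EFin \o (fun s : R => u (z + expi s *: w))).
move=> cu HO; apply: continuous_compact_integrable; first exact: segment_compact.
apply: continuous_subspaceT => t; apply/cvgrPdist_lt => e e0.
have Ot : Omega (z + expi t *: w) by apply: HO; rewrite expi_norm.
have [r r0 Hr] := (cont_nr _ _).1 (cu _ Ot) _ e0.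
pose k := nr w + nr ('i%C *: w) + 1; have k0 : 0 < k by rewrite ltr_wpDl// addr_ge0 ?nr_ge0.
have rk : 0 < r / k by rewrite divr_gt0.
have cc : {for t, continuous (@cos R)} by exact: continuous_cos.
have cs : {for t, continuous (@sin R)} by exact: continuous_sin.
have /cvgrPdist_lt/(_ _ rk) nc := cc; have /cvgrPdist_lt/(_ _ rk) ns := cs.
near=> x; rewrite distrC; apply: Hr; rewrite !expi_scale.
have -> : z + ((cos x)%:C *: w + (sin x)%:C *: ('i%C *: w)) - (z + ((cos t)%:C *: w + (sin t)%:C *: ('i%C *: w))) =
 (cos x - cos t)%:C *: w + (sin x - sin t)%:C *: ('i%C *: w).
 by rewrite !rmorphB !scalerBl opprD addrACA subrr add0r opprD addrACA.
apply: le_lt_trans (nrD _ _) _; rewrite !nrZ.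
apply: (@le_lt_trans _ _ (r / k * nr w + r / k * nr ('i%C *: w))).
 apply: lerD; (apply: ler_wpM2r; first exact: nr_ge0); rewrite distrC; apply: ltW.
 by near: x; exact: nc.
 by near: x; exact: ns.
by rewrite -mulrDr mulrAC ltr_pdivrMr// ltr_pM2l// ltrDl.
Unshelve. all: by end_near. Qed.

Lemma circle_meanE u z (w : C) : (forall z, Omega z -> {for z, continuous u}) ->
 (forall x : R[i], `|x| <= 1 -> Omega (z + x *: w)) ->
 circle_mean (EFin \o u) z w = ((2 * pi)^-1 * \int[@lebesgue_measure R]_(s in I) u (z + expi s *: w)%R)%:E.
move=> cu HO; have mI : measurable (I : set (mtR R)) by exact: measurable_itv.
by rewrite /circle_mean EFinM /Rintegral fineK//; apply: integrable_fin_num => //; exact: circle_integrable.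
Qed.

Lemma submean_lin (k1 k2 : R) w1 w2 : 0 <= k1 -> 0 <= k2 ->
 (forall z, Omega z -> {for z, continuous w1}) -> (forall z, Omega z -> {for z, continuous w2}) ->
 submean Omega w1 -> submean Omega w2 -> submean Omega (fun y => k1 * w1 y + k2 * w2 y).
move=> k10 k20 cw1 cw2 s1 s2 z w HO.
have cM (k : R) u x : {for x, continuous u} -> {for x, continuous (fun y : C => k * u y)}.
 by move=> h; apply: (@cvgM R C (nbhs x) _ (fun=> k) u); [exact: cvg_cst|exact: h].
have c12 x : Omega x -> {for x, continuous (fun y : C => k1 * w1 y + k2 * w2 y)}.
 by move=> Ox; apply: (@cvgD R R C (nbhs x) _ (fun y => k1 * w1 y) (fun y => k2 * w2 y)); apply: cM; [exact: cw1|exact: cw2].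
have mI : measurable (I : set (mtR R)) by exact: measurable_itv.
have i1 := circle_integrable cw1 HO; have i2 := circle_integrable cw2 HO.
have i1' := circle_integrable (fun x Ox => cM k1 w1 x (cw1 x Ox)) HO.
have i2' := circle_integrable (fun x Ox => cM k2 w2 x (cw2 x Ox)) HO.
have := s1 z w HO; have := s2 z w HO; rewrite (circle_meanE cw1 HO) (circle_meanE cw2 HO) (circle_meanE c12 HO) !lee_fin.
rewrite (RintegralD mI i1' i2') (RintegralZl k1 mI i1) (RintegralZl k2 mI i2) => h2 h1.
have al (x a b : R) : x * (k1 * a + k2 * b) = k1 * (x * a) + k2 * (x * b) by ring.
by rewrite al; apply: lerD; apply: ler_wpM2l.
Qed.

Lemma sum_le_of_means (p x y k i j : R) : 0 < p -> x <= p^-1 * i -> y <= p^-1 * j -> i + j <= k * p -> x + y <= k.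
by move=> p0 h1 h2 h; apply: le_trans (lerD h1 h2) _; rewrite -mulrDr ler_pdivrMl// mulrC. Qed.
Lemma contact_bound (a b a' b' d g h : R) : h <= d * g -> a - b <= a' - b' -> a + (-1 * b + - d * g) <= a' - b' - h.
by rewrite mulN1r mulNr; move: (d * g) => k; lra. Qed.
Lemma dist_lt_ge0 (a b : R) : `|a - b| < b -> 0 <= a.
by rewrite ltr_norml => /andP[+ _]; lra. Qed.

(** If the Levi form of [q] were negative at [v], then V = - q - d |y - z|^2 would satisfy the mean
    value inequality on a small disc. Adding that of [u] contradicts that [u + V] on the circle lies
    below its central value by [d * (r / 2) ^+ 2]. *)
Lemma psh_touch u q z (v : C) : open Omega -> submean Omega u ->
 (forall y, Omega y -> {for y, continuous u}) -> Omega z -> sm q -> touches u q z ->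
 0 <= lap v q z.
move=> oO pu cu Oz sq [r1 r10 H1]; rewrite leNgt; apply/negP => k0.
have v0 : 0 < nr v.
 rewrite lt_def nr_ge0 andbT; apply/eqP => nv; move: k0; apply/negP; rewrite -leNgt.
 have E : v = (0 : R)%:C *: v by rewrite scale0r; apply/eqP; rewrite -normr_eq0 nrE nv.
 by have := lap_scaleR 0 v z sq; rewrite -E expr0n mul0r => ->.
have E20 : 0 <= E2 v := le_trans (sqr_ge0 _) (E2_ge v).
(* Small enough that subtracting [d] times the barrier leaves the Levi form of [V] positive at
   [z]. *)
pose d := - lap v q z / (E2 v + 1); have d0 : 0 < d by rewrite divr_gt0 ?oppr_gt0// ltr_wpDl.
have dk : d * E2 v < - lap v q z by rewrite /d mulrAC ltr_pdivrMr ?ltr_wpDl// ltr_pM2l ?oppr_gt0// ltrDl.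
pose V y := -1 * q y + (- d) * E2 (y + (- z)).
have sE : sm (fun y : C => E2 (y + (- z))) by exact: sm_shift (@sm_E2 R n).
have sV : sm V by exact: smD (smZ _ sq) (smZ _ sE).
have lV : lap v V z = -1 * lap v q z + (- d) * E2 v.
 apply: (etrans (lapD v z (smZ _ sq) (smZ _ sE))).
 exact: (congr2 (fun x y : R => x + y) (lapZ (-1) v z sq) (etrans (lapZ (- d) v z sE) (congr1 (fun x => - d * x) (lap_E2 (- z) v z)))).
have lV0 : 0 < lap v V z by rewrite lV mulN1r mulNr subr_gt0.
have [r2 r20 H2] := (openP_nr Omega).1 oO z Oz.
have [r3 r30 H3] := (cont_nr _ _).1 (sm_cont (sm_lap v sV) z) _ lV0.
pose r := Num.min (Num.min r1 r2) r3; have r0 : 0 < r by rewrite !lt_min r10 r20 r30.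
pose s := r / (2 * nr v); have s0 : 0 < s by rewrite divr_gt0// mulr_gt0.
have sv : s * nr v = r / 2 by rewrite /s; field; exact: lt0r_neq0.
pose w : C := s%:C *: v.
have nw (x : R[i]) : nr (z + x *: w - z) = Re `|x| * (r / 2).
 by rewrite /w addrAC subrr add0r nrcZ nrZ (gtr0_norm s0) sv.
have HB (x : R[i]) : `|x| <= 1 -> nr (z + x *: w - z) < r.
 move=> x1; have x1' : Re `|x| <= 1 by case: `|x| x1 => a b; rewrite lecE => /andP[].
 rewrite nw; apply: (@le_lt_trans _ _ (1 * (r / 2))); first by rewrite ler_wpM2r// divr_ge0// ltW.
 by rewrite mul1r ltr_pdivrMr// ltr_pMr// ltr1n.
have HO (x : R[i]) : `|x| <= 1 -> Omega (z + x *: w).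
 by move=> /HB h; apply: H2; apply: lt_le_trans h _; rewrite !ge_min lexx !orbT.
have cV y : Omega y -> {for y, continuous V} by move=> _; exact: sm_cont sV y.
have := pu z w HO; rewrite (circle_meanE cu HO) lee_fin => c1.
have : ((V z)%:E <= circle_mean (EFin \o V) z w)%E.
 apply: (sm_circle_ge sV) => x x1.
 suff pos : 0 <= s ^+ 2 * lap v V (z + x *: w) by exact: (@eq_ind_r R _ (fun a => 0 <= a) pos _ (lap_scaleR s v (z + x *: w) sV)).
 apply: mulr_ge0; first exact: sqr_ge0.
 have xr : nr (z + x *: w - z) < r3 by apply: lt_le_trans (HB x x1) _; rewrite ge_min lexx orbT.
 exact: dist_lt_ge0 (H3 _ xr).
rewrite (circle_meanE cV HO) lee_fin => c2.
have i1 := circle_integrable cu HO; have i2 := circle_integrable cV HO.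
pose k := u z - q z - d * (r / 2) ^+ 2.
have mI : measurable (I : set (mtR R)) by exact: measurable_itv.
have p0 : 0 < 2 * pi :> R by rewrite mulr_gt0// pi_gt0.
have Ik : \int[@lebesgue_measure R]_(t in I) k = k * (2 * pi).
 rewrite Rintegral_cst//; congr (_ * _).
 have /= := @lebesgue_measure_itv R `[(0 : R), (2 * pi : R)]; rewrite lte_fin p0 oppr0 adde0 => H.
 exact: (congr1 fine H).
have le : \int[@lebesgue_measure R]_(t in I) (u (z + expi t *: w) + V (z + expi t *: w)) <= k * (2 * pi).
 rewrite -Ik; apply: le_Rintegral => //.
 - exact: integrableD i1 i2.
 - by apply: continuous_compact_integrable; [exact: segment_compact|apply: continuous_subspaceT; exact: cst_continuous].
 - move=> t _; have n1 : `|expi t| <= 1 by rewrite expi_norm.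
 have := H1 _ (lt_le_trans (HB _ n1) _); rewrite !ge_min lexx => /(_ isT).
 have : d * (r / 2) ^+ 2 <= d * E2 (z + expi t *: w + (- z)).
 rewrite ler_pM2l//; apply: le_trans (E2_ge _); rewrite nw expi_norm /= mul1r//.
 exact: contact_bound.
rewrite (RintegralD mI i1 i2) in le.
have Vz : V z = - q z.
 by rewrite /V subrr mulN1r /E2 big1 ?mulr0 ?addr0// => j _; rewrite /xr /xi mxE /= expr0n addr0.
have d2 : 0 < d * (r / 2) ^+ 2 by rewrite mulr_gt0// exprn_gt0// divr_gt0.
have := sum_le_of_means p0 c1 c2 le; rewrite Vz /k leNgt => /negP; apply.
by rewrite ltrBlDr ltrDl.
Qed.

End circle_means.

(** * Lipschitz functions and one-sided maxima on the line *)

Section real_lemmas.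
Context {R : realType}.

Lemma lipschitz_within (M : R -> R) (a b K : R) : 0 < K ->
 (forall s t, a <= s -> s <= t -> `|M t - M s| <= K * (t - s)) -> {within `[a, b], continuous M}.
move=> K0 H; pose N t := M (Num.max t a).
have cN : continuous N.
 move=> t; apply/cvgrPdist_lt => e e0; near=> s.
 have L x y : x <= y -> `|N x - N y| <= K * (y - x).
 move=> xy; rewrite distrC; apply: le_trans (H _ _ _ _) _; first by rewrite le_max lexx orbT.
 by rewrite ge_max !le_max xy lexx !orbT.
 rewrite ler_wpM2l ?(ltW K0)//.
 have [ya|ya] := leP y a; have [xa|xa] := leP x a; lra.
 have d : `|t - s| < e / K.
 near: s; exact: (@nbhsx_ballx R R t _ (divr_gt0 e0 K0)).
 have E : `|N t - N s| <= K * `|t - s|.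
 have [st|st] := leP s t; first by rewrite distrC (ger0_norm (_ : 0 <= t - s)) ?subr_ge0//; exact: L.
 by rewrite [X in K * X]distrC [X in K * X]ger0_norm ?subr_ge0 ?(ltW st)//; apply: L; exact: ltW.
 by apply: le_lt_trans E _; rewrite mulrC -ltr_pdivlMr.
have E : {in `[a, b]%classic, N =1 M}.
 by move=> t; rewrite inE /= in_itv /= => /andP[at_ _]; rewrite /N max_l.
apply: (subspace_eq_continuous E); exact: continuous_subspaceT.
Unshelve. all: by end_near. Qed.

Lemma derive_ge0_left (h : R -> R) (t l t0 : R) : is_derive t (1 : R) h l -> t0 < t ->
 (forall s, t0 < s < t -> h s <= h t) -> 0 <= l.
move=> [dh hl] tt0 H; rewrite leNgt; apply/negP => l0.
have e0 : 0 < - l / 2 by rewrite divr_gt0// oppr_gt0.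
have := (@cvgrPdist_lt _ _ _ _ _ _ _).1 dh _ e0.
rewrite -/(derive h t 1) hl => N.
have [d /= d0 Hd] := N.
pose s := - Num.min (d / 2) ((t - t0) / 2).
have m0 : 0 < Num.min (d / 2) ((t - t0) / 2) by rewrite lt_min !divr_gt0// subr_gt0.
have s0 : s < 0 by rewrite /s oppr_lt0.
have sd : `|0 - s| < d.
 rewrite sub0r opprK gtr0_norm//; apply: (@le_lt_trans _ _ (d / 2)); first by rewrite ge_min lexx.
 by rewrite ltr_pdivrMr// ltr_pMr// ltr1n.
have := Hd s sd (negbT (lt_eqF s0)); rewrite /= => h1.
have st : t0 < s + t < t.
 apply/andP; split; last by rewrite gtrDr.
 rewrite -ltrBlDr /s ltrNr opprB; apply: (@le_lt_trans _ _ ((t - t0) / 2)); first by rewrite ge_min lexx orbT.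
 by rewrite ltr_pdivrMr// ltr_pMr ?ltr1n// subr_gt0.
have := H _ st; rewrite -subr_le0 => h2.
move: h1; rewrite /GRing.scale /= mulr1 => h1.
have h3 : 0 <= s^-1 * (h (s + t) - h t) by apply: mulr_le0 => //; rewrite invr_le0 ltW.
move: h1 h3 l0; clear; move: (s^-1 * _) => x; rewrite ltr_norml => /andP[? ?] ? ?; lra.
Qed.

End real_lemmas.

(** * Plateau functions and measurability of affine maps *)

Section bumps.
Context {R : realType} {n : nat}.
Local Notation C := (Cn R n).
Local Notation B := (borelC R n).
Implicit Types (F u q : C -> R) (z v w a : C).

Lemma sm_step F : sm F -> sm (fun z => step (F z)).
by apply: sm_comp; exact: sm1_step. Qed.

Lemma plateau (r : R) : 0 < r -> exists2 chi : C -> R, tf chi &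
 (forall z, 0 <= chi z <= 1) /\ forall z, nr z <= r -> chi z = 1.
move=> r0; pose k : R := n%:R * 2 * r ^+ 2 + 1.
have k0 : 0 < k by rewrite ltr_wpDl// mulr_ge0 ?sqr_ge0// mulr_ge0.
exists (fun z => step (2 - E2 z / k)).
 split.
 apply: sm_step; apply: smB; first exact: sm_cst.
 by apply: smM; [exact: sm_E2|exact: sm_cst].
 exists (3 * k + 1) => z zk; apply: step_eq0.
 have z1 : 1 <= nr z by apply: ltW; apply: le_lt_trans zk; rewrite lerDr mulr_ge0// ltW.
 have : 3 * k <= E2 z.
 apply: le_trans (E2_ge z); apply: (@le_trans _ _ (nr z)).
 by apply: ltW; apply: lt_trans zk; rewrite ltrDl.
 by rewrite -[leLHS]mulr1 expr2 ler_wpM2l// nr_ge0.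
 by rewrite -ler_pdivlMr// => h; lra.
split=> [z|z zr]; first by rewrite step_ge0 step_le1.
apply: step_eq1; rewrite lerBrDr -lerBrDl (_ : 2 - 1 = 1); last by rewrite -addrA subrr addr0.
rewrite ler_pdivrMr// mul1r; apply: le_trans (E2_le z) _; apply: ler_wpDr => //.
by rewrite ler_wpM2l// ?mulr_ge0// lerXn2r// ?nnegrE ?nr_ge0// ltW.
Qed.

Lemma measurable_affine (b : 'M[R[i]]_n) :
 measurable_fun setT (fun p : B * B => (p.1 : C) + (p.2 : C) *m b : B).
have mx (f g : C -> R) : continuous f -> continuous g -> measurable_fun setT (fun p : B * B => f p.1 + g p.2).
 move=> cf cg; apply: measurable_funD.
 by apply: (measurableT_comp (cont_measurable cf)); exact: measurable_fst.
 by apply: (measurableT_comp (cont_measurable cg)); exact: measurable_snd.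
apply: measurable_fun_borelC => j.
- have := mx _ _ (sm_cont (@sm_xr R n j)) (sm_cont (sm_affine 0 b (@sm_xr R n j))); congr measurable_fun.
 by ext => p; rewrite /xr add0r [in RHS]mxE raddfD.
- have := mx _ _ (sm_cont (@sm_xi R n j)) (sm_cont (sm_affine 0 b (@sm_xi R n j))); congr measurable_fun.
 by ext => p; rewrite /xi add0r [in RHS]mxE raddfD.
Qed.

End bumps.

(** * Comparison with the heat flow *)

Section parabolic.
Context {R : realType} {n : nat}.
Local Notation C := (Cn R n).
Implicit Types (F u q : C -> R) (z v w a : C).

Lemma sm_conv_gk F (t : R) : Cc F -> sm (mollify F (gk t)).
by move=> cF; apply: conv_sm => //; exact: sm_gk. Qed.

(** The Lipschitz constant in time is uniform over a ball; this makes the maximum over the ball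
    continuous in time. *)
Lemma heat_lip F (t0 r : R) : Cc F -> 0 < t0 -> exists2 K : R, 0 < K &
 forall (s t : R) z, t0 <= s -> s <= t -> nr z <= r -> `|mollify F (gk t) z - mollify F (gk s) z| <= K * (t - s).
move=> cF t00; have [_ [M HM]] := cF; have [K K0 HK] := Cc_bounded cF.
pose N := Num.max M 0 + Num.max r 0.
pose E := (n%:R * 2 * N ^+ 2 : R).
have N0 : 0 <= N by rewrite addr_ge0// le_max lexx orbT.
have E0 : 0 <= E by rewrite mulr_ge0 ?sqr_ge0// mulr_ge0.
pose D := (n%:R / t0 + E / t0 ^+ 2) * (pi * t0)^-1 ^+ n.
have D0 : 0 <= D.
 apply: mulr_ge0; last by rewrite exprn_ge0// invr_ge0 mulr_ge0 ?pi_ge0// ltW.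
 by apply: addr_ge0; rewrite divr_ge0// ?sqr_ge0// ltW.
have bound (s : R) z : t0 <= s -> nr z <= r ->
 `|laplacian (mollify F (gk s)) z| <= K * D * fine (@lebesgue_Cn R n (cball 0 M)).
 move=> ts zr; have s0 := lt_le_trans t00 ts.
 rewrite laplacian_conv//; last exact: sm_gk.
 apply: integ_bound.
 - apply: CcMl => //; apply: cont_shift; apply: sm_cont; apply: sm_laplacian; exact: sm_gk.
 - move=> y; have [yM|yM] := ltP M (nr y); first by rewrite HM// mul0r normr0 mulr_ge0// ltW.
 rewrite normrM; apply: ler_pM => //; rewrite laplacian_gk// normrM /D; apply: ler_pM => //.
 apply: le_trans (ler_normD _ _) _; rewrite normrN; apply: lerD.
 rewrite ger0_norm; last by rewrite divr_ge0 ?ler0n// ltW.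
 by rewrite ler_wpM2l// lef_pV2 ?posrE.
 have EE : 0 <= E2 (y - z) by apply: le_trans (E2_ge _); rewrite sqr_ge0.
 rewrite ger0_norm; last by rewrite divr_ge0// sqr_ge0.
 apply: ler_pM => //; first by rewrite invr_ge0 sqr_ge0.
 apply: le_trans (E2_le _) _; rewrite ler_wpM2l ?mulr_ge0// lerXn2r// ?nnegrE ?nr_ge0//.
 apply: le_trans (nrD _ _) _; rewrite nrN /N; apply: lerD.
 by rewrite le_max yM.
 by rewrite le_max zr.
 by rewrite lef_pV2 ?posrE ?exprn_gt0// lerXn2r// ?nnegrE// ltW.
 rewrite ger0_norm ?gk_ge0// /gk -[leRHS]mulr1; apply: ler_pM.
 + by rewrite exprn_ge0// invr_ge0 mulr_ge0 ?pi_ge0// ltW.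
 + exact: expR_ge0.
 + have h : (pi * s)^-1 <= (pi * t0)^-1 :> R by rewrite lef_pV2 ?posrE ?mulr_gt0 ?pi_gt0// ler_wpM2l// pi_ge0.
 rewrite lerXn2r// nnegrE invr_ge0 mulr_ge0 ?pi_ge0//; exact: ltW.
 + rewrite -expR0 ler_expR mulNr oppr_le0 divr_ge0//; last exact: ltW.
 by apply: le_trans (E2_ge _); rewrite sqr_ge0.
 - by move=> y /HM ->; rewrite mul0r.
exists (K * D * fine (@lebesgue_Cn R n (cball 0 M)) + 1).
 by rewrite ltr_wpDl//; apply: mulr_ge0; [apply: mulr_ge0 => //; exact: ltW|rewrite fine_ge0].
move=> s t z ts; rewrite le_eqVlt => /predU1P[<-|st] zr; first by rewrite !subrr normr0 mulr0.
have s0 := lt_le_trans t00 ts.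
have dq x : x \in `]s, t[ -> is_derive x (1 : R) (fun x => mollify F (gk x) z) (laplacian (mollify F (gk x)) z).
 rewrite in_itv /= => /andP[x1 _]; apply: heat_dt => //.
 exact: lt_trans x1.
have cq : {within `[s, t], continuous (fun x => mollify F (gk x) z)}.
 apply: derivable_within_continuous => x; rewrite in_itv /= => /andP[x1 _].
 by have [] := heat_dt z cF (lt_le_trans s0 x1).
have [c] := MVT st dq cq; rewrite in_itv /= => /andP[c1 c2] ->.
rewrite normrM [X in _ * X]ger0_norm ?subr_ge0 ?(ltW st)// ler_wpM2r ?subr_ge0 ?(ltW st)//.
apply: le_trans (bound c z _ zr) _; last by rewrite lerDl.
by apply: le_trans ts _; exact: ltW.
Qed.

(* Parabolic comparison of [F] with its heat flow, with the quadratic barrier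
 [k E2 + (k n + d) t]; a positive interior maximum would contradict [vis]. *)
Lemma heat_comparison F (l r T k d w : R) : Cc F -> 0 < r -> 0 < T -> 0 <= k -> 0 < d ->
 (forall q z, sm q -> nr z < r -> touches F q z -> l <= laplacian q z) ->
 (forall t z, 0 < t <= T -> `|mollify F (gk t) z - F z| <= w) ->
 w + `|l| * T <= k * r ^+ 2 ->
 F 0 <= mollify F (gk T) 0 - l * T + (k * n%:R + d) * T.
move=> cF r0 T0 k0 d0 vis Hw kw; rewrite leNgt; apply/negP => bad.
pose g (t : R) z := F z - mollify F (gk t) z + l * t - k * E2 z - (k * n%:R + d) * t.
have gT : 0 < g T 0.
 have E0 : E2 (0 : C) = 0.
 by rewrite /E2 big1// => j _; rewrite /xr /xi mxE /= expr0n /= addr0.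
 by rewrite /g E0 mulr0 subr0; move: bad; move: (F 0) (mollify F _ _) => x y h; lra.
set m := g T 0 in gT.
have m3 : 0 < m / 3 by rewrite divr_gt0.
have [s1 s10 Hs] := heat_approx cF m3.
(* Up to time [t0] the flow stays so close to [F] that [g t0] is below [m]; the maximum over [t0, T]
   is therefore attained after [t0]. *)
pose t0 := Num.min (Num.min (T / 2) (s1 / 2)) (m / 3 / (`|l| + 1)).
have l1 : 0 < `|l| + 1 by rewrite ltr_wpDl.
have t00 : 0 < t0 by rewrite !lt_min !divr_gt0.
have t0T : t0 <= T / 2 by rewrite /t0 !ge_min lexx.
have t0s : t0 <= s1 / 2 by rewrite /t0 !ge_min lexx orbT.
have t0l : t0 <= m / 3 / (`|l| + 1) by rewrite /t0 !ge_min lexx !orbT.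
have lt0T : t0 < T by apply: le_lt_trans t0T _; rewrite ltr_pdivrMr// ltr_pMr// ltr1n.
have lt0 : `|l * t0| <= m / 3.
 rewrite normrM (gtr0_norm t00) mulrC; apply: (@le_trans _ _ (t0 * (`|l| + 1))); first by rewrite ler_wpM2l ?lerDl// ltW.
 by rewrite -ler_pdivlMr.
have E2p z : 0 <= E2 z by apply: le_trans (E2_ge z); rewrite sqr_ge0.
have knd : 0 < k * n%:R + d by rewrite ltr_wpDl// mulr_ge0.
have g0 z : g t0 z < m.
 have := Hs t0 z; rewrite t00 /= (le_lt_trans t0s) => [/(_ isT)|]; last first.
 by rewrite ltr_pdivrMr// ltr_pMr// ltr1n.
 rewrite /g; have h1 : 0 <= k * E2 z by rewrite mulr_ge0.
 have h2 : 0 <= (k * n%:R + d) * t0 by rewrite mulr_ge0// ltW.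
 move: lt0 h1 h2 gT; clear; move: (F z) (mollify F _ z) (k * E2 z) ((k * n%:R + d) * t0) (l * t0) => x y a b c.
 rewrite !ler_norml => /andP[c1 c2] a0 b0 m0 /andP[h1 h2]; lra.
have cg t : continuous (g t).
 have -> : g t = fun z => (F z - mollify F (gk t) z) + ((l * t - (k * n%:R + d) * t) - k * E2 z).
 by ext => z; rewrite /g; ring.
 have cB (f h : C -> R) : continuous f -> continuous h -> continuous (fun z => f z - h z).
 move=> cf ch; have -> : (fun z => f z - h z) = fun z => f z + -1 * h z.
 by ext => z; rewrite mulN1r.
 by apply: contD => //; apply: contM => //; exact: contC.
 apply: contD; apply: cB; [by case: cF|exact: sm_cont (sm_conv_gk t cF)|exact: contC|].
 by apply: contM; [exact: contC|exact: sm_cont (@sm_E2 R n)].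
have cK : compact (cball (0 : C) r) by exact: (@cball_compact R n 0 r).
have K0 : cball (0 : C) r 0 by rewrite /cball /= subrr nr0 ltW.
have maxz t : exists2 z, nr z <= r & forall y, nr y <= r -> g t y <= g t z.
 have [z /set_mem Kz Hz] := compact_EVT_max (ex_intro _ 0 K0) cK (continuous_subspaceT (cg t)).
 exists z; first by move: Kz; rewrite /cball /= subr0.
 by move=> y yr; apply: Hz; rewrite inE /cball /= subr0.
have [zt Hzt] := choice (fun t => let: ex_intro2 z a b := maxz t in ex_intro (fun z => nr z <= r /\ forall y, nr y <= r -> g t y <= g t z) z (conj a b)).
have [K1 K10 HK1] := heat_lip r cF t00.
pose K2 := K1 + `|l| + (k * n%:R + d).
have K20 : 0 < K2 by rewrite ltr_wpDl// addr_ge0// ltW.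
have glip s t z : t0 <= s -> s <= t -> nr z <= r -> `|g t z - g s z| <= K2 * (t - s).
 move=> ts st zr; have := HK1 s t z ts st zr; rewrite /g.
 have -> : F z - mollify F (gk t) z + l * t - k * E2 z - (k * n%:R + d) * t -
 (F z - mollify F (gk s) z + l * s - k * E2 z - (k * n%:R + d) * s) =
 - (mollify F (gk t) z - mollify F (gk s) z) + (l * (t - s) - (k * n%:R + d) * (t - s)) by ring.
 have -> : K2 * (t - s) = K1 * (t - s) + (`|l| * (t - s) + (k * n%:R + d) * (t - s)) by rewrite /K2; ring.
 move=> h; apply: le_trans (ler_normD _ _) _; rewrite normrN; apply: lerD => //.
 apply: le_trans (ler_normB _ _) _; rewrite normrM normrM (gtr0_norm knd).
 by rewrite (ger0_norm (_ : 0 <= t - s)) ?subr_ge0.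
(* The maximum over the ball inherits the Lipschitz bound in time, so it has a maximum on
   [t0, T]. *)
pose M t := g t (zt t).
have Mlip s t : t0 <= s -> s <= t -> `|M t - M s| <= K2 * (t - s).
 move=> ts st; have [a1 b1] := Hzt s; have [a2 b2] := Hzt t.
 have h1 := glip s t _ ts st a1; have h2 := glip s t _ ts st a2.
 have h3 := b1 _ a2; have h4 := b2 _ a1; rewrite /M.
 move: h1 h2 h3 h4; clear; move: (g t (zt s)) (g s (zt s)) (g t (zt t)) (g s (zt t)) (K2 * _) => x1 x2 x3 x4 x5.
 rewrite !ler_norml => /andP[? ?] /andP[? ?] ? ?; apply/andP; split; lra.
have [t1 t1in Ht1] : exists2 t1 : R, t0 <= t1 <= T & forall t, t0 <= t <= T -> M t <= M t1.
 have [t1] := EVT_max (ltW lt0T) (lipschitz_within K20 Mlip); rewrite in_itv /= => t1in H.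
 by exists t1 => // t tin; apply: H; rewrite in_itv.
have /andP[t01 t1T] := t1in.
have mM : m <= M t1.
 have TT : t0 <= T <= T by rewrite (ltW lt0T) lexx.
 apply: le_trans (Ht1 T TT); have [_ b] := Hzt T; apply: b; rewrite nr0; exact: ltW.
have t0lt : t0 < t1.
 rewrite lt_neqAle t01 andbT; apply/eqP => E; move: mM; rewrite /M -E leNgt g0//.
have t1p : 0 < t1 := lt_trans t00 t0lt.
have [z1r Hz1] := Hzt t1; set z1 := zt t1 in z1r Hz1 mM.
(* On the sphere the barrier [k * r ^+ 2] outweighs [w] and [|l| * T], so [g] is at most 0 there. *)
have z1lt : nr z1 < r.
 rewrite lt_neqAle z1r andbT; apply/eqP => E.
 have := Hw t1 z1; rewrite t1p t1T => /(_ isT) h1.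
 have h2 : r ^+ 2 <= E2 z1 by rewrite -E; exact: E2_ge.
 have h3 : k * r ^+ 2 <= k * E2 z1 by rewrite ler_wpM2l.
 have h4 : l * t1 <= `|l| * T.
 apply: le_trans (ler_norm _) _; rewrite normrM (gtr0_norm t1p) ler_wpM2l//.
 have h5 : 0 < (k * n%:R + d) * t1 by rewrite mulr_gt0.
 have : g t1 z1 <= 0.
 rewrite /g; move: kw h1 h3 h4 h5; clear.
 move: (F z1) (mollify F _ z1) (k * E2 z1) (k * r ^+ 2) (l * t1) (`|l| * T) ((k * n%:R + d) * t1) => x y a b c e f.
 rewrite ler_norml => h1 /andP[h2 h3] h4 h5 h6; lra.
 by rewrite leNgt (lt_le_trans gT mM).
(* At the maximum [F] is touched from above by the flow plus the quadratic barrier, whose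
   [laplacian] is that of the flow plus [k * n]. *)
pose q z := mollify F (gk t1) z + k * E2 z.
have sE := @sm_E2 R n; have sW := sm_conv_gk t1 cF.
have sq : sm q by apply: smD => //; exact: smZ.
have tq : touches F q z1.
 exists (r - nr z1); first by rewrite subr_gt0.
 move=> y yz; have yr : nr y <= r.
 rewrite -[y](subrK z1); apply: le_trans (nrD _ _) _; rewrite -lerBrDr; exact: ltW.
 have := Hz1 y yr; rewrite /g /q; move: (F y) (F z1) (mollify F _ y) (mollify F _ z1) (E2 y) (E2 z1) => *; lra.
have := vis q z1 sq z1lt tq.
have lq : laplacian q z1 = laplacian (mollify F (gk t1)) z1 + k * n%:R.
 rewrite /laplacian /q.
 transitivity (\sum_j (lap (basis j) (mollify F (gk t1)) z1 + k)); last first.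
 by rewrite big_split /= sumr_const card_ord [k * _]mulr_natr.
 bigr => j _; rewrite /lap.
 have dd v : dder v (dder v (fun z => mollify F (gk t1) z + k * E2 z)) z1 = dder v (dder v (mollify F (gk t1))) z1 + k * (2 * E2 v).
 have skE : sm (fun z : C => k * E2 z) by exact: smZ.
 rewrite (dderD v sW skE) (dderZ k v sE) (dderD v (sm_dder v sW) (smZ k (sm_dder v sE))).
 by rewrite (dderZ k v (sm_dder v sE)) dder2_E2.
 have e3 : E2 (basis j : C) = 1.
 rewrite -[RHS](sum_pick j (fun=> 1)) /E2; bigr => i _.
 by rewrite xr_basis xi_basis; case: eqP => _; rewrite ?expr1n ?expr0n /=; ring.
 have e4 : E2 ('i%C *: basis j : C) = 1.
 rewrite -[RHS](sum_pick j (fun=> 1)) /E2; bigr => i _.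
 by rewrite xr_ibasis xi_ibasis; case: eqP => _; rewrite ?expr1n ?expr0n /=; ring.
 have d1 := dd (basis j); rewrite e3 in d1.
 have d2 := dd ('i%C *: basis j); rewrite e4 in d2.
 have alg (a b : R) : 4^-1 * ((a + k * (2 * 1)) + (b + k * (2 * 1))) = 4^-1 * (a + b) + k by field.
 apply: (etrans (congr2 (fun a b : R => 4^-1 * (a + b)) d1 d2)).
 exact: alg.
rewrite lq => hl.
have dt := heat_dt z1 cF t1p.
(* [t1] may be the end point [T], so only earlier times can be compared: the time derivative has a
   sign. Together with [hl] this contradicts [d > 0]. *)
have : 0 <= l - laplacian (mollify F (gk t1)) z1 - (k * n%:R + d).
 pose h (t : R) := l * t - mollify F (gk t) z1 - (k * n%:R + d) * t.
 have dh : is_derive t1 (1 : R) h (l - laplacian (mollify F (gk t1)) z1 - (k * n%:R + d)).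
 have di := is_derive_id t1 (1 : R).
 have := is_deriveB (is_deriveB (is_deriveZ l di) dt) (is_deriveZ (k * n%:R + d) di).
 by move=> H; apply: is_derive_eq H _; rewrite /GRing.scale /= !mulr1.
 apply: (derive_ge0_left dh t0lt) => t /andP[tt0 tt1].
 have tT : t0 <= t <= T by rewrite (ltW tt0) (le_trans (ltW tt1) t1T).
 have [_ b] := Hzt t; have h1 := le_trans (b z1 z1r) (Ht1 t tT).
 move: h1; rewrite /M -/z1 /g /h; move: (F z1) (mollify F (gk t) z1) (mollify F (gk t1) z1) (k * E2 z1) => x1 x2 x3 x4.
 by clear; lra.
by move: hl d0; clear; move: (laplacian _ _) => x ? ?; lra.
Qed.

End parabolic.

Section real_inequalities.
Context {R : realType}.
Implicit Types (x y : R).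

Lemma add_lt_half x y (r r0 : R) : x <= r0 -> y <= (r - r0) / 2 -> r0 < r -> x + y < r.
lra. Qed.

Lemma quarter_add x y : x < y / 4 -> x + y / 4 < y / 2.
lra. Qed.

Lemma combine_ineq x1 x2 x3 (l d T X : R) : x1 <= x2 + (d * T - l * T) * x3 ->
 x2 - x1 - T * X <= d * T -> (l - d) * x3 * T <= (X + d) * T.
nra. Qed.

Lemma final_ineq x3 (l d e X : R) : (l - d) * x3 <= X + d -> d * (x3 + 1) = e -> l * x3 <= X + e.
nra. Qed.

End real_inequalities.

(** * From viscosity to distributions *)

Section viscosity_distribution.
Context {R : realType} {n : nat}.
Local Notation C := (Cn R n).
Implicit Types (F u q f g : C -> R) (z v w a : C).

Lemma dder2_near f g v z (r : R) : 0 < r ->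
 (forall w, nr (w - z) < r -> f w = g w) -> dder v (dder v f) z = dder v (dder v g) z.
move=> r0 H; have r2 : 0 < r / 2 by rewrite divr_gt0.
apply: (@dder_near _ _ _ _ v z (r / 2)) => // w wz.
apply: (@dder_near _ _ _ _ v w (r / 2)) => // y yw; apply: H.
rewrite (_ : y - z = (y - w) + (w - z)); last by rewrite addrA subrK.
by apply: le_lt_trans (nrD _ _) _; rewrite [r]splitr ltrD.
Qed.

Lemma lap_near f g v z (r : R) : 0 < r ->
 (forall w, nr (w - z) < r -> f w = g w) -> lap v f z = lap v g z.
move=> r0 H; exact: (congr2 (fun x y : R => 4^-1 * (x + y)) (dder2_near v r0 H) (dder2_near ('i%C *: v) r0 H)).
Qed.

Lemma laplacian_near f g z (r : R) : 0 < r ->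
 (forall w, nr (w - z) < r -> f w = g w) -> laplacian f z = laplacian g z.
by move=> r0 H; bigr => j _; exact: (lap_near _ r0 H). Qed.

Lemma lap_affine f a (b : 'M[R[i]]_n) v z :
 lap v (fun z : C => f (a + z *m b)) z = lap (v *m b) f (a + z *m b).
have d2 w : dder w (dder w (fun z : C => f (a + z *m b))) z = dder (w *m b) (dder (w *m b) f) (a + z *m b).
 by rewrite dder_affine dder_affine.
have e2 := d2 ('i%C *: v); rewrite -scalemxAl in e2.
exact: (congr2 (fun x y : R => 4^-1 * (x + y)) (d2 v) e2).
Qed.

Lemma cont_affine u a (b : 'M[R[i]]_n) : continuous u -> continuous (fun z : C => u (a + z *m b)).
move=> cu z; apply/cont_nr => e e0; have [k k0 Hk] := mulmx_bounded b.
have [r r0 Hr] := (cont_nr _ _).1 (cu (a + z *m b)) e e0.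
exists (r / k) => [|w wz]; first by rewrite divr_gt0.
apply: Hr; rewrite opprD addrACA subrr add0r -mulmxBl; apply: le_lt_trans (Hk _) _.
by rewrite mulrC -ltr_pdivlMr.
Qed.

Variables (u : C -> R) (b : 'M[R[i]]_n) (l r0 r : R) (z0 : C) (rho : C -> R).
Hypotheses (cu : Cc u) (rr : r0 < r) (trho : tf rho) (rho_ge0 : forall a, 0 <= rho a)
 (rho_supp : forall a, rho a != 0 -> nr (a - z0) <= r0).
Hypothesis vis : forall a q z, nr (a - z0) <= r0 -> sm q -> nr (a + z *m b - z0) < r ->
 touches (fun z : C => u (a + z *m b)) q z -> l <= laplacian q z.

(** For each [a], the function u(a + z b) is compared at the origin with its heat flow after a short
    time [T]. Averaging over [a] with weight [rho] transfers the flow to the smooth function [Q],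
    whose flow expands to first order in [T]; dividing by [T] gives the inequality up to [dl]. *)
Lemma viscosity_distribution : l * integ rho <= integ (fun y => u y * \sum_j lap (basis j *m b) rho y).
have [kb kb0 Hkb] := mulmx_bounded b.
(* For z of norm at most [r1], [b] displaces [a] by at most [(r - r0) / 2], so [a + z *m b] stays
   within [r] of [z0]. *)
pose r1 := (r - r0) / (2 * kb).
have r10 : 0 < r1 by rewrite divr_gt0 ?subr_gt0// mulr_gt0.
have [chi tchi [chi01 chi1]] := plateau (R := R) (n := n) r10.
have chi_cont := sm_cont tchi.1.
(* The cutoff supplies compact support for the heat flow; it is 1 where touching is tested. *)
pose F a : C -> R := fun z : C => u (a + z *m b) * chi z.
have cF a : Cc (F a) by apply: CcMr; [exact: tf_Cc|apply: cont_affine; case: cu].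
have [K K0 HK] := Cc_bounded cu.
have FK a z : `|F a z| <= K.
 rewrite /F normrM -[leRHS]mulr1; apply: ler_pM => //.
 by have /andP[? ?] := chi01 z; rewrite ger0_norm.
have F0 a : F a 0 = u a by rewrite /F mul0mx addr0 chi1 ?mulr1// nr0 ltW.
pose P := mollify u rho.
have sP : sm P by apply: conv_sm => //; case: trho.
pose Q : C -> R := fun z : C => chi z * P (0 + z *m b).
have tQ : tf Q by apply: tfMl => //; exact: sm_affine.
pose X := integ (fun y => u y * \sum_j lap (basis j *m b) rho y).
have LQ : laplacian Q 0 = X.
 have -> : laplacian Q 0 = laplacian (fun z : C => P (0 + z *m b)) 0.
 apply: (laplacian_near r10) => w; rewrite subr0 => wr; rewrite /Q chi1 ?mul1r//; exact: ltW.
 rewrite /laplacian.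
 transitivity (\sum_j mollify u (lap (basis j *m b) rho) 0).
 bigr => j _; rewrite lap_affine mul0mx addr0.
 exact: (congr1 (fun g => g 0) (lap_conv _ cu trho.1)).
 rewrite /mollify /X.
 transitivity (integ (fun y => \sum_j u y * lap (basis j *m b) rho (y - 0))).
 rewrite (@integ_sum _ _ _ _ _ (fun j y => u y * lap (basis j *m b) rho (y - 0)))//.
 move=> j _; apply: CcMl => //; apply: cont_shift; apply/sm_cont/sm_lap; exact: trho.1.
 by congr integ; ext => y; rewrite mulr_sumr subr0.
have Q0 : Q 0 = integ (fun a => rho a * u a).
 rewrite /Q chi1 ?nr0 ?(ltW r10)// mul1r mul0mx addr0 /P /mollify.
 by congr integ; ext => y; rewrite subr0 mulrC.
have IR0 : 0 <= integ rho by exact: integ_ge0.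
rewrite -/X; apply/ler_addgt0Pr => e e0.
pose dl := e / (integ rho + 1).
have IR1 : 0 < integ rho + 1 by rewrite ltr_wpDl.
have dl0 : 0 < dl by rewrite divr_gt0.
pose k := dl / 2 / (n%:R + 1).
have n1 : 0 < n%:R + 1 :> R by rewrite ltr_wpDl.
have k0 : 0 < k by rewrite divr_gt0// divr_gt0.
have kn : k * n%:R + dl / 2 <= dl.
 rewrite [leRHS]splitr lerD2r /k -mulrA ger_pMr ?divr_gt0// mulrC ler_pdivrMr// mul1r lerDl//.
(* [k * r1 ^+ 2] is [2 * w]: one half bounds the error of the heat approximation, the other
   [|l| * T]. *)
pose w := k * r1 ^+ 2 / 2.
have w0 : 0 < w by rewrite divr_gt0// mulr_gt0// exprn_gt0.
have w4 : 0 < w / 4 by rewrite divr_gt0.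
have wK : 0 < w / (4 * K) by rewrite divr_gt0// mulr_gt0.
have [ru ru0 Hru] := Cc_unif cu w4.
have [rc rc0 Hrc] := Cc_unif (tf_Cc tchi) wK.
pose rm := Num.min (ru / kb) rc.
have rm0 : 0 < rm by rewrite lt_min rc0 divr_gt0.
have [s1 s10 Hs1] := heat_approx_unif (n := n) K0 rm0 w0.
have [s2 s20 Hs2] := heat_small tQ dl0.
pose T := Num.min (Num.min (s1 / 2) (s2 / 2)) (w / (`|l| + 1)).
have l1 : 0 < `|l| + 1 by rewrite ltr_wpDl.
have T0 : 0 < T by rewrite !lt_min (divr_gt0 s10)// (divr_gt0 s20)// (divr_gt0 w0).
have half (x y : R) : 0 < y -> x <= y / 2 -> x < y.
 by move=> y0 xy; apply: le_lt_trans xy _; rewrite ltr_pdivrMr// ltr_pMr// ltr1n.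
have Ts1 : T < s1 by apply: half => //; rewrite /T !ge_min lexx.
have Ts2 : T < s2 by apply: half => //; rewrite /T !ge_min lexx orbT.
have Tl : `|l| * T <= w.
 apply: (@le_trans _ _ ((`|l| + 1) * T)); first by rewrite ler_wpM2r ?lerDl// ltW.
 by rewrite mulrC -ler_pdivlMr// /T !ge_min lexx !orbT.
have main a : nr (a - z0) <= r0 -> u a <= mollify (F a) (gk T) 0 - l * T + dl * T.
 move=> az; rewrite -(F0 a).
 have := @heat_comparison R n (F a) l r1 T k (dl / 2) w (cF a) r10 T0 (ltW k0).
 move=> /(_ _ _ _ _) H; apply: (le_trans (H _ _ _ _)).
 - by rewrite divr_gt0.
 - move=> q z sq zr [x x0 Hx]; apply: (vis az sq (z := z)).
 rewrite addrAC; apply: le_lt_trans (nrD _ _) _.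
 have h : nr (z *m b : C) <= (r - r0) / 2.
 apply: le_trans (Hkb z) _; apply: (@le_trans _ _ (kb * r1)); first by rewrite ler_wpM2l// ltW.
 have -> : kb * r1 = (r - r0) / 2 by rewrite /r1; field; rewrite gt_eqF.
 by [].
 exact: add_lt_half az h rr.
 exists (Num.min x (r1 - nr z)); first by rewrite lt_min x0 subr_gt0.
 move=> y; rewrite lt_min => /andP[yx yr].
 have yr1 : nr y <= r1.
 rewrite -[y](subrK z); apply: le_trans (nrD _ _) _; rewrite -lerBrDr; exact: ltW.
 by have := Hx y yx; rewrite /F !chi1 ?mulr1//; exact: ltW.
 - move=> t z /andP[t0 tT]; apply: (Hs1 (F a) (cF a) (FK a)); last by rewrite t0 (le_lt_trans tT).
 move=> y y' yy.
 have [c1 c2] : `|chi y' - chi y| < w / (4 * K) /\ `|u (a + y' *m b) - u (a + y *m b)| < w / 4.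
 move: yy; rewrite lt_min => /andP[y1 y2]; split; first exact: Hrc.
 apply: Hru; rewrite opprD addrACA subrr add0r -mulmxBl; apply: le_lt_trans (Hkb _) _.
 by rewrite mulrC -ltr_pdivlMr.
 rewrite /F (_ : _ - _ = (u (a + y' *m b) - u (a + y *m b)) * chi y' + u (a + y *m b) * (chi y' - chi y)); last by ring.
 apply: le_lt_trans (ler_normD _ _) _.
 have h1 : `|(u (a + y' *m b) - u (a + y *m b)) * chi y'| <= `|u (a + y' *m b) - u (a + y *m b)|.
 rewrite normrM ler_piMr//; have /andP[? ?] := chi01 y'; by rewrite ger0_norm.
 have h2 : `|u (a + y *m b) * (chi y' - chi y)| <= K * (w / (4 * K)).
 by rewrite normrM; apply: ler_pM => //; exact: ltW.
 have h3 : K * (w / (4 * K)) = w / 4 by field; rewrite gt_eqF.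
 rewrite h3 in h2; apply: le_lt_trans (lerD h1 h2) _; exact: quarter_add.
 - by rewrite (_ : k * r1 ^+ 2 = w + w) ?lerD2l//; rewrite /w -splitr.
 - by rewrite lerD2l ler_wpM2r// ltW.
pose G a z := rho a * (u (a + z *m b) * (chi z * gk T z)).
have GE a : integ (G a) = rho a * mollify (F a) (gk T) 0.
 rewrite /mollify -integZ; last by apply: CcMl => //; apply: cont_shift; exact: sm_cont (sm_gk T).
 by congr integ; ext => z; rewrite subr0 /G /F !mulrA.
have cchi : Cc (fun z => chi z * gk T z) by apply: CcMl; [exact: tf_Cc|exact: sm_cont (sm_gk T)].
have [Kg Kg0 HKg] := Cc_bounded cchi.
have [Kr Kr0 HKr] := Cc_bounded (tf_Cc trho).
have [_ [M1 HM1]] := trho; have [_ [M2 HM2]] := cchi.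
(* Fubini exchanges the average over [a] with the Gaussian average; the former turns [u] into the
   smooth convolution [P]. *)
have fub : integ (fun a => rho a * mollify (F a) (gk T) 0) = mollify Q (gk T) 0.
 transitivity (integ (fun a => integ (G a))); first by congr integ; ext => a; rewrite GE.
 rewrite (@integ_fubini R n G (Kr * (K * Kg)) (Num.max M1 M2)).
 - rewrite /mollify; congr integ; ext => z; rewrite subr0 /Q /P.
 rewrite (conv_shiftE _ cu (sm_cont trho.1)) mulrAC -integZ; last first.
 by apply: CcMr; [exact: tf_Cc|apply: cont_shift; case: cu].
 by congr integ; ext => a; rewrite /G add0r [RHS]mulrC [u _ * rho _]mulrC -mulrA.
 - apply: measurable_funM; first by apply: (measurableT_comp (cont_measurable (sm_cont trho.1))); exact: measurable_fst.
 apply: measurable_funM; last by apply: (measurableT_comp (cont_measurable cchi.1)); exact: measurable_snd.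
 by apply: (measurableT_comp (cont_measurable cu.1)); exact: measurable_affine.
 - move=> a z; rewrite /G normrM; apply: ler_pM => //.
 by rewrite normrM; apply: ler_pM.
 - by move=> a z; rewrite gt_max => /andP[h _]; rewrite /G HM1// mul0r.
 - by move=> a z; rewrite gt_max => /andP[_ h]; rewrite /G HM2// !mulr0.
have Icgk : 0 <= integ (fun z => chi z * gk T z).
 by apply: integ_ge0 => z; have /andP[? ?] := chi01 z; rewrite mulr_ge0 ?gk_ge0.
have cPsi : continuous (fun a => mollify (F a) (gk T) 0).
 move=> a; apply/cont_nr => d d0.
 pose d' := d / (integ (fun z => chi z * gk T z) + 1).
 have I1 : 0 < integ (fun z => chi z * gk T z) + 1 by rewrite ltr_wpDl.
 have d'0 : 0 < d' by rewrite divr_gt0.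
 have [x x0 Hx] := Cc_unif cu d'0.
 have E y : mollify (F y) (gk T) 0 = integ (fun z => u (y + z *m b) * (chi z * gk T z)).
 by rewrite /mollify; congr integ; ext => z; rewrite subr0 /F mulrA.
 have cE y : Cc (fun z => u (y + z *m b) * (chi z * gk T z)).
 by apply: CcMr => //; apply: cont_affine; case: cu.
 exists x => // y yx; rewrite !E -(integB (cE y) (cE a)).
 apply: le_lt_trans (integ_norm (CcB (cE y) (cE a))) _.
 apply: (@le_lt_trans _ _ (d' * integ (fun z => chi z * gk T z))); last first.
 by rewrite /d' -mulrA gtr_pMr// mulrC ltr_pdivrMr// mul1r ltrDl.
 rewrite -(integZ _ cchi); apply: integ_le; [exact: Cc_norm (CcB (cE y) (cE a))|exact: CcZ|].
 move=> z; rewrite -mulrBl normrM.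
 have cg : 0 <= chi z * gk T z by have /andP[? ?] := chi01 z; rewrite mulr_ge0 ?gk_ge0.
 rewrite (ger0_norm cg); apply: ler_wpM2r => //; apply: ltW; apply: Hx.
 by rewrite opprD addrACA subrr addr0.
have cr := tf_Cc trho.
have c1 : Cc (fun a => rho a * u a) by apply: CcMl => //; case: cu.
have c2 : Cc (fun a => rho a * mollify (F a) (gk T) 0) by exact: CcMl.
have c3 : Cc (fun a => (dl * T - l * T) * rho a) by exact: CcZ.
have LE : integ (fun a => rho a * u a) <= mollify Q (gk T) 0 + (dl * T - l * T) * integ rho.
 rewrite -fub -(integZ _ cr) -(integD c2 c3); apply: integ_le => //; first exact: CcD.
 move=> a; have [->|ra] := eqVneq (rho a) 0; first by rewrite !mul0r mulr0 addr0.
 rewrite [_ * rho a]mulrC -mulrDr ler_wpM2l// [dl * T - _]addrC addrA; exact: main (rho_supp ra).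
have := Hs2 T; rewrite T0 Ts2 => /(_ isT); rewrite Q0 LQ ler_norml => /andP[_ H2].
have : (l - dl) * integ rho * T <= (X + dl) * T.
 exact: combine_ineq LE H2.
rewrite ler_pM2r// => H3.
have h4 : dl * (integ rho + 1) = e by rewrite /dl divfK// gt_eqF.
exact: final_ineq H3 h4.
Qed.

End viscosity_distribution.

(** * Mollifiers *)

Section mollifiers.
Context {R : realType} {n : nat}.
Local Notation C := (Cn R n).
Local Notation B := (borelC R n).
Local Notation L := (@lebesgue_Cn R n).
Implicit Types (F u q f g : C -> R) (z v w a : C).

Lemma cont_open_gt F (e : R) : continuous F -> open [set z | e < F z].
move=> cF; apply/openP_nr => z /= ez.
have e0 : 0 < F z - e by rewrite subr_gt0.
have [r r0 Hr] := (cont_nr _ _).1 (cF z) _ e0; exists r => // w /Hr.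
by rewrite ltr_norml => /andP[h _]; rewrite -(ltrD2r (- F z)) -opprB.
Qed.

Lemma integ_gt0 F z : Cc F -> (forall w, 0 <= F w) -> 0 < F z -> 0 < integ F.
move=> cF F0 Fz; pose e := F z / 2; have e0 : 0 < e by rewrite divr_gt0.
have oU := cont_open_gt (e := e) cF.1; set U := [set w | e < F w] in oU.
have Uz : U z by rewrite /U /= /e ltr_pdivrMr// ltr_pMr// ltr1n.
have LU := lebesgue_Cn_open oU Uz.
have mU : measurable (U : set B) := open_borel oU.
have iF := Cc_integrable cF.
have mF : measurable_fun setT (EFin \o F : B -> \bar R) := measurable_int _ iF.
have h1 : (\int[L]_(w in U) (F w)%:E <= \int[L]_w (F w)%:E)%E.
 by apply: ge0_subset_integral => // w _; rewrite lee_fin.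
have h2 : (e%:E * L U <= \int[L]_(w in U) (F w)%:E)%E.
 rewrite -integral_cst//; apply: ge0_le_integral => //.
 - by move=> w _; rewrite lee_fin ltW.
 - by apply: measurable_funTS.
 - by move=> w /ltW; rewrite lee_fin.
rewrite integE -lte_fin /Rintegral fineK; last exact: integrable_fin_num.
by apply: lt_le_trans (le_trans h2 h1); rewrite mule_gt0// lte_fin.
Qed.

Definition mollifier (r : R) rho := [/\ tf rho, forall z, 0 <= rho z, integ rho = 1 & forall z, rho z != 0 -> nr z < r].

Lemma exists_mollifier (r : R) : 0 < r -> exists rho, mollifier r rho.
move=> r0; have r20 : 0 < r ^+ 2 by rewrite exprn_gt0.
pose h z : R := step (1 - 2 / r ^+ 2 * E2 z).
have h0 z : r <= nr z -> h z = 0.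
 move=> rz; apply: step_eq0.
 have : r ^+ 2 <= E2 z by apply: le_trans (E2_ge z); rewrite lerXn2r// ?nnegrE ?nr_ge0// ltW.
 have -> : 2 / r ^+ 2 * E2 z = 2 * (E2 z / r ^+ 2) by rewrite mulrAC mulrA.
 by rewrite -[X in X <= _]mul1r -ler_pdivlMr// => hh; lra.
have th : tf h.
 split; first by apply: sm_step; apply: smB; [exact: sm_cst|apply: smZ; exact: sm_E2].
 by exists r => z rz; apply: h0; exact: ltW.
have hp z : 0 <= h z := step_ge0 _.
have E20 : E2 (0 : C) = 0.
 by rewrite /E2 big1// => j _; rewrite /xr /xi mxE /= expr0n /= addr0.
have I0 : 0 < integ h.
 by apply: (@integ_gt0 h 0); [exact: tf_Cc| |rewrite /h E20 mulr0 subr0 step_eq1].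
exists (fun z => (integ h)^-1 * h z); split.
- by apply: tfMr => //; exact: sm_cst.
- by move=> z; rewrite mulr_ge0// invr_ge0 ltW.
- by rewrite (integZ _ (tf_Cc th)) mulVf// gt_eqF.
- by move=> z; apply: contraNT; rewrite -leNgt => /h0 ->; rewrite mulr0.
Qed.

Lemma mollify_close F (r e : R) rho z : Cc F -> mollifier r rho ->
 (forall y, nr (y - z) < r -> `|F y - F z| <= e) -> `|mollify F rho z - F z| <= e.
move=> cF [trho rho0 rho1 rs] He.
have c1 : Cc (fun y => F (y + z) * rho y) by apply: CcMr; [exact: tf_Cc|apply: cont_shift; case: cF].
rewrite (conv_shiftE _ cF (sm_cont trho.1)) -[F z]mulr1 -rho1 -(integZ _ (tf_Cc trho)).
have c2 : Cc (fun y => F z * rho y) := CcZ _ (tf_Cc trho).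
rewrite -(integB c1 c2); apply: le_trans (integ_norm (CcB c1 c2)) _.
rewrite -[e]mulr1 -rho1 -(integZ _ (tf_Cc trho)); apply: integ_le.
- exact: Cc_norm (CcB c1 c2).
- exact: CcZ _ (tf_Cc trho).
move=> y; rewrite -mulrBl normrM (ger0_norm (rho0 y)).
have [->|ry] := eqVneq (rho y) 0; first by rewrite !mulr0.
by apply: ler_wpM2r => //; apply: He; rewrite addrK; exact: rs.
Qed.

Lemma mollifier_shift (r : R) rho z a : mollifier r rho -> rho (a - z) != 0 -> nr (a - z) <= r.
by move=> [_ _ _ H] /H /ltW. Qed.

Lemma tf_shift rho a : tf rho -> tf (fun z => rho (z + a)).
move=> [srho [M HM]]; split; first exact: sm_shift.
exists (M + nr a) => z zM; apply: HM; rewrite -ltrBrDr in zM.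
apply: lt_le_trans zM _; rewrite lerBlDr -[z in X in X <= _](addrK a z).
by apply: le_trans (nrD _ _) _; rewrite nrN.
Qed.

Lemma lap_shift rho a v : lap v (fun z => rho (z + a)) = fun z => lap v rho (z + a).
ext => z; have d2 w : dder w (dder w (fun z => rho (z + a))) z = dder w (dder w rho) (z + a).
 by rewrite dder_shift dder_shift.
exact: (congr2 (fun x y : R => 4^-1 * (x + y)) (d2 v) (d2 ('i%C *: v))).
Qed.

(* Linear images of mollifications inherit viscosity inequalities. *)
Lemma viscosity_mollified F (b : 'M[R[i]]_n) (l r0 r : R) z rho : Cc F -> mollifier r0 rho -> r0 < r ->
 (forall a q y, nr (a - z) <= r0 -> sm q -> nr (a + y *m b - z) < r ->
 touches (fun y : C => F (a + y *m b)) q y -> l <= laplacian q y) ->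
 l <= \sum_j lap (basis j *m b) (mollify F rho) z.
move=> cF mr rr vis; have [trho rho0 rho1 rs] := mr.
have := @viscosity_distribution R n F b l r0 r z (fun y => rho (y - z)) cF rr (tf_shift (- z) trho).
move=> /(_ (fun a => rho0 _) (fun a => @mollifier_shift r0 rho z a mr) vis).
rewrite (integ_shift (- z) (tf_Cc trho)) rho1 mulr1 => h; apply: le_trans h _.
rewrite le_eqVlt; apply/orP; left; apply/eqP.
transitivity (\sum_j mollify F (lap (basis j *m b) rho) z); last first.
 by bigr => j _; exact: (congr1 (fun g => g z) (esym (lap_conv _ cF trho.1))).
rewrite /mollify.
transitivity (integ (fun y => \sum_j F y * lap (basis j *m b) rho (y - z))).
 by congr integ; ext => y; rewrite mulr_sumr; bigr => j _; rewrite lap_shift.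
rewrite (@integ_sum _ _ _ _ _ (fun j y => F y * lap (basis j *m b) rho (y - z)))//.
by move=> j _; apply: CcMl => //; apply: cont_shift; apply/sm_cont/sm_lap; case: trho.
Qed.

Lemma sub_shift (V : zmodType) (a x y z : V) : a + x - z = (x - y) + (a + y - z).
by rewrite [a + y]addrC -(addrA y) (addrA (x - y)) subrK addrA [x + a]addrC. Qed.

Lemma circle_mean_eq u1 u2 z w z' w' : (forall t : R, u1 (z + expi t *: w) = u2 (z' + expi t *: w')) ->
 circle_mean (EFin \o u1) z w = circle_mean (EFin \o u2) z' w'.
by move=> H; rewrite /circle_mean; congr (_ * _)%E; apply: eq_integral => t _ /=; rewrite H.
Qed.

Lemma submean_affine (Omega : set C) u F a (b : 'M[R[i]]_n) : submean Omega u -> (forall y, Omega y -> F y = u y) ->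
 submean [set y : C | Omega (a + y *m b)] (fun y : C => F (a + y *m b)).
move=> su Fu y w Hd.
have E (t : R[i]) : a + (y + t *: w) *m b = (a + y *m b) + t *: (w *m b).
 by rewrite mulmxDl -scalemxAl addrA.
have HO t : `|t| <= 1 -> Omega ((a + y *m b) + t *: (w *m b)) by move=> /Hd /=; rewrite E.
have Oy : Omega (a + y *m b) by have := HO 0; rewrite normr0 scale0r addr0; apply.
rewrite Fu//; apply: le_trans (su _ _ HO) _.
rewrite le_eqVlt; apply/orP; left; apply/eqP; apply: circle_mean_eq => t.
by rewrite E Fu//; apply: HO; rewrite expi_norm.
Qed.

(** All rows of [b] are taken equal to [v], so that the sum over directions is n times the Levi form
    at [v]; [psh_touch] provides the viscosity inequality with l = 0. *)
Lemma submean_mollified (Omega : set C) u F (r0 r : R) z rho v : (0 < n)%N -> Cc F -> mollifier r0 rho -> r0 < r ->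
 submean Omega u -> (forall y, nr (y - z) < r -> Omega y /\ F y = u y) -> 0 <= lap v (mollify F rho) z.
move=> n0 cF mr rr su HF.
pose b : 'M[R[i]]_n := \matrix_(i, j) v 0 j.
have rb j : basis j *m b = v.
 apply/rowP => k; rewrite mxE (bigD1 j)//= big1 ?addr0; last first.
 by move=> i ij; rewrite !mxE eqxx (negbTE ij) mul0r.
 by rewrite !mxE !eqxx mul1r.
have : 0 <= \sum_(j < n) lap (basis j *m b) (mollify F rho) z.
 apply: (viscosity_mollified cF mr rr) => a q y az sq yr tq.
 apply: sumr_ge0 => j _.
 pose D := [set y : C | nr (y - z) < r].
 have sD : submean D u by move=> y1 w1 H1; apply: su => t /H1 /HF[].
 have sF := submean_affine (a := a) (b := b) sD (fun y1 h => (HF y1 h).2).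
 apply: (@psh_touch R n [set y : C | D (a + y *m b)] (fun y : C => F (a + y *m b)) q y) => //.
 - apply/openP_nr => y1 /= Dy1; have [k k0 Hk] := mulmx_bounded b.
 exists ((r - nr (a + y1 *m b - z)) / k); first by rewrite divr_gt0// subr_gt0.
 move=> y2 h0; have h : nr (y2 - y1) * k < r - nr (a + y1 *m b - z) by rewrite -ltr_pdivlMr.
 suff : nr (a + y2 *m b - z) < r by [].
 have -> : a + y2 *m b - z = (y2 - y1) *m b + (a + y1 *m b - z).
 by rewrite mulmxBl; exact: sub_shift.
 apply: le_lt_trans (nrD _ _) _; rewrite -ltrBrDr; apply: le_lt_trans (Hk _) _.
 by rewrite mulrC.
 - by move=> y1 _; apply: cont_affine; case: cF.
under eq_bigr do rewrite rb.
by rewrite sumr_const card_ord -mulr_natl pmulr_rge0// ltr0n.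
Qed.

End mollifiers.

(** * Distance to the complement and localization *)

Section domain.
Context {R : realType} {n : nat}.
Local Notation C := (Cn R n).
Variables (Omega : set C) (M : R).
Hypotheses (oO : open Omega) (bO : forall z, Omega z -> nr z <= M) (n0 : (0 < n)%N).
Implicit Types (F u q f g : C -> R) (z v w a : C).

Let far : exists w, ~ Omega w.
pose j := Ordinal n0; pose w : C := (`|M| + 1)%:C *: delta_mx 0 j.
exists w => /bO; apply/negP; rewrite -ltNge.
apply: lt_le_trans (Re_le_nr w j); rewrite /w !mxE !eqxx mulr1 /=.
by rewrite ger0_norm ?addr_ge0// ltr_pwDr// ler_norm.
Qed.

(** Measured in [nr]. It is 0 off [Omega], hence 1-Lipschitz on all of C^n, and its positive
    superlevel sets are compact subsets of [Omega]. *)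
Definition dist z : R := inf [set nr (z - w) | w in ~` Omega].

Lemma dist_has_inf z : has_inf [set nr (z - w) | w in ~` Omega].
split; first by have [w Ow] := far; exists (nr (z - w)), w.
by exists 0 => _ [w _ <-]; exact: nr_ge0.
Qed.

Lemma dist_le z w : ~ Omega w -> dist z <= nr (z - w).
by move=> Ow; apply: ge_inf; [have [] := dist_has_inf z|exists w]. Qed.

Lemma dist_ge z (e : R) : (forall w, ~ Omega w -> e <= nr (z - w)) -> e <= dist z.
move=> H; apply: lb_le_inf; first by have [] := dist_has_inf z.
by move=> _ [w Ow <-]; exact: H.
Qed.

Lemma dist_ge0 z : 0 <= dist z.
by apply: dist_ge => w _; exact: nr_ge0. Qed.
Lemma dist_out z : ~ Omega z -> dist z = 0.
by move=> Oz; apply/le_anti; rewrite dist_ge0 andbT; have := dist_le z Oz; rewrite subrr nr0. Qed.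

Lemma dist_in z w : nr (w - z) < dist z -> Omega w.
move=> h; apply: contrapT => Ow; have := dist_le z Ow.
by rewrite nrB leNgt h.
Qed.

Lemma dist_gt0 z : Omega z -> 0 < dist z.
move=> Oz; have [r r0 Hr] := (openP_nr Omega).1 oO z Oz.
apply: lt_le_trans r0 _; apply: dist_ge => w Ow; rewrite leNgt; apply/negP => h.
by apply: Ow; apply: Hr; rewrite nrB.
Qed.

Lemma dist_in0 z : 0 < dist z -> Omega z.
by move=> h; apply: (@dist_in z); rewrite subrr nr0. Qed.

Lemma dist_lip z w : `|dist z - dist w| <= nr (z - w).
have H a b : dist a - dist b <= nr (a - b).
 rewrite lerBlDr -lerBlDl; apply: dist_ge => y Oy; rewrite lerBlDl.
 apply: le_trans (dist_le a Oy) _.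
 by rewrite -{1}(subrK b a) -addrA; exact: nrD.
rewrite ler_norml H andbT; have := H w z; rewrite nrB; lra.
Qed.

Lemma dist_cont : continuous dist.
move=> z; apply/cont_nr => e e0; exists e => // w wz.
exact: le_lt_trans (dist_lip w z) wz.
Qed.

Lemma dist_compact (e : R) : 0 < e -> compact [set z | e <= dist z].
move=> e0; apply: (@closed_bounded_compact R n _ M).
 have -> : [set z | e <= dist z] = ~` [set z | - e < -1 * dist z].
 by apply/seteqP; split => z /=; rewrite mulN1r ltrN2 leNgt => /negP.
 apply: open_closedC; apply: cont_open_gt; apply: contM; first exact: contC.
 exact: dist_cont.
by move=> z /= ez; apply: bO; apply: dist_in0; exact: lt_le_trans ez.
Qed.

Definition cut (d : R) z : R := Num.min 1 (Num.max 0 (dist z / d - 1)).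

Lemma cut_cont d : continuous (cut d).
have c1 : continuous (fun z => dist z / d + -1).
 by apply: contD; [apply: contM; [exact: dist_cont|exact: contC]|exact: contC].
have c0 : continuous (fun _ : C => 0 : R) by exact: contC.
have c2 : continuous (fun _ : C => 1 : R) by exact: contC.
move=> z; exact: (continuous_min (c2 z) (continuous_max (c0 z) (c1 z))).
Qed.

Lemma cut0 (d : R) z : 0 < d -> dist z <= d -> cut d z = 0.
move=> d0 h; rewrite /cut max_l; first by rewrite min_r.
by rewrite subr_le0 ler_pdivrMr// mul1r.
Qed.

Lemma cut1 (d : R) z : 0 < d -> 2 * d <= dist z -> cut d z = 1.
move=> d0 h; have h1 : 1 <= dist z / d - 1 by rewrite lerBrDr ler_pdivlMr// -(natrD _ 1 1).
by rewrite /cut min_l// le_max h1 orbT.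
Qed.

(** A function on [Omega] is cut off to a compactly supported continuous function on C^n that keeps
    its values at distance at least [2 * d] from the complement, so that it can be mollified. *)
Definition loc (d : R) u z := u z * cut d z.

Lemma loc_in (d : R) u z : 0 < d -> 2 * d <= dist z -> loc d u z = u z.
by move=> d0 h; rewrite /loc cut1// mulr1. Qed.

Lemma loc_Cc (d : R) u : 0 < d -> (forall z, Omega z -> {for z, continuous u}) -> Cc (loc d u).
move=> d0 cu; split; last first.
 exists M => z zM; rewrite /loc cut0 ?mulr0// dist_out ?(ltW d0)//.
 by move=> /bO; rewrite leNgt zM.
move=> z; have [Oz|Oz] := pselect (Omega z).
 exact: (cvgM (cu z Oz) (@cut_cont d z)).
apply/cont_nr => e e0; exists d => // w wz.
have dw : dist w <= d by have := dist_lip w z; rewrite (dist_out Oz) subr0 => /(le_trans (ler_norm _)) h; exact: le_trans h (ltW wz).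
by rewrite /loc !cut0 ?mulr0 ?subrr ?normr0// dist_out// ltW.
Qed.

Lemma submean_loc (d r0 r : R) u z rho v : 0 < d -> submean Omega u -> (forall z, Omega z -> {for z, continuous u}) ->
 mollifier r0 rho -> r0 < r -> 2 * d + r <= dist z -> 0 <= lap v (mollify (loc d u) rho) z.
move=> d0 su cu mr rr dz; apply: (submean_mollified (Omega := Omega) (u := u) v n0 (loc_Cc d0 cu) mr rr su).
move=> y yz; have h : 2 * d <= dist y.
 have := dist_lip z y; rewrite nrB => /(le_trans (ler_norm _)); move: dz yz; clear; move: (dist z) (dist y) (nr _) => x1 x2 x3; lra.
by split; [apply: dist_in0; apply: lt_le_trans h; rewrite mulr_gt0|exact: loc_in].
Qed.

End domain.

(** * Commuting wedge factors and changing potentials *)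

Section wedge_products.
Context {R : realType} {n : nat}.
Local Notation K := R[i].
Local Notation C := (Cn R n).
Local Notation array := ({set 'I_n} -> {set 'I_n} -> K).
Implicit Types (T : array) (H : 'I_n -> 'I_n -> K) (u q f g phi : C -> R) (z v w : C) (us ws : seq (C -> R)).

(** Both matrices expand into elementary ones; exchanging two elementary factors gives one sign on
    the left indices and one on the right. *)
Lemma wedge_comm H H' T : wedge H (wedge H' T) = wedge H' (wedge H T).
pose X := ('I_n * 'I_n)%type.
pose del (p i : 'I_n) : K := (p == i)%:R.
have hE (A : 'I_n -> 'I_n -> K) S : wedge A S =
 fun I J => \sum_(t : X) A t.1 t.2 * wedgel (del t.1) (wedger (del t.2) S) I J.
 ext => I; ext => J.
 have AE : A = fun (p q : 'I_n) => \sum_(t : X) A t.1 t.2 * (del t.1 p * del t.2 q).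
 ext => p; ext => q; rewrite (bigD1 (p, q))//= big1 ?addr0 ?/del ?eqxx ?mulr1//.
 move=> [p' q'] /= ne; rewrite -natrM mulnb.
 have -> : (p' == p) && (q' == q) = false by apply/negbTE; apply: contra ne => /andP[/eqP -> /eqP ->].
 by rewrite mulr0.
 rewrite {1}AE wedge_sum; bigr => t _.
 rewrite -wedge_rank1 /wedge mulr_sumr; bigr => p _; rewrite mulr_sumr; bigr => q _.
 by ring.
have lin (A : X -> K) (S : X -> array) (v w : 'I_n -> K) I J :
 wedgel v (wedger w (fun I J => \sum_(t : X) A t * S t I J)) I J = \sum_(t : X) A t * wedgel v (wedger w (S t)) I J.
 rewrite /wedgel /wedger.
 transitivity (\sum_(p in I) \sum_(t : X) wsign I p * v p * \sum_(q in J) wsign J q * w q * (A t * S t (I :\ p) (J :\ q))).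
 bigr => p _; rewrite -mulr_sumr; congr (_ * _); rewrite exchange_big; bigr => q _.
 by rewrite mulr_sumr.
 rewrite exchange_big; bigr => t _; rewrite mulr_sumr; bigr => p _.
 rewrite !mulr_sumr; bigr => q _; ring.
have comm (v w v' w' : 'I_n -> K) S : wedgel v (wedger w (wedgel v' (wedger w' S))) = wedgel v' (wedger w' (wedgel v (wedger w S))).
 rewrite -(wedge_lr v') wedgel_anti (wedger_anti w) !wedgelN -(wedge_lr v).
 by ext => I; ext => J; rewrite opprK.
rewrite (hE H) (hE H') (hE H' (wedge H T)) (hE H T).
ext => I; ext => J.
transitivity (\sum_(t : X) \sum_(s : X) H t.1 t.2 * H' s.1 s.2 *
 wedgel (del t.1) (wedger (del t.2) (wedgel (del s.1) (wedger (del s.2) T))) I J).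
 bigr => t _; rewrite lin mulr_sumr; bigr => s _; ring.
rewrite exchange_big; bigr => s _; rewrite lin mulr_sumr; bigr => t _.
by rewrite comm; ring.
Qed.

Lemma form_rcons us u z : form (rcons us u) z = form (u :: us) z.
elim: us => [//|v us IH]; apply: (etrans (congr1 (wedge (hess v z)) IH)).
exact: (wedge_comm (hess v z) (hess u z) (form us z)).
Qed.

Lemma form_nseq u z : form (nseq n u) z full full = mass (hess u z).
have E k : form (nseq k u) z = iter k (wedge (hess u z)) (@one_array R n) by elim: k => [//|k IH]; rewrite [RHS]/= -IH.
by rewrite E. Qed.

Lemma smooth_cat us ws : smooth (us ++ ws) <-> smooth us /\ smooth ws.
by elim: us => /= [|u us IH]; [split=> [|[]]|rewrite IH; split=> [[? []]|[[]]]]. Qed.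
Lemma smooth_rcons us u : smooth (rcons us u) <-> smooth us /\ sm u.
by rewrite -cats1 smooth_cat /=; split=> [[? []]|[? ?]]. Qed.

Lemma hess_eq u q z : (forall v w, dder v (dder w u) z = dder v (dder w q) z) -> hess u z = hess q z.
move=> d2; ext => i; ext => j.
have D (a b c d a' b' c' d' : R) : a = a' -> b = b' -> c = c' -> d = d' ->
 (4^-1 : K) * ((a + b) +i* (c - d)) = 4^-1 * ((a' + b') +i* (c' - d')) by move=> -> -> -> ->.
exact: (D _ _ _ _ _ _ _ _ (d2 _ _) (d2 _ _) (d2 _ _) (d2 _ _)).
Qed.

Lemma hess_near u q z (r : R) : 0 < r -> (forall w, nr (w - z) < r -> u w = q w) -> hess u z = hess q z.
move=> r0 H; apply: hess_eq => v w.
have r2 : 0 < r / 2 by rewrite divr_gt0.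
apply: (@dder_near _ _ _ _ v z (r / 2)) => // y yz.
apply: (@dder_near _ _ _ _ w y (r / 2)) => // x xy; apply: H.
rewrite (_ : x - z = (x - y) + (y - z)); last by rewrite addrA subrK.
by apply: le_lt_trans (nrD _ _) _; rewrite [r]splitr ltrD.
Qed.

Lemma rcone_form us z : smooth us -> foldr (fun (u : C -> R) P => (forall v, 0 <= lap v u z) /\ P) True us -> rcone (form us z).
elim: us => [_ _|u us IH /= [su sus] [pu pus]]; first exact: rcone1.
apply: rcone_wedge_psd; last exact: IH.
- by move=> p q; exact: hess_herm.
- move=> v; have := pu (\row_p v p); rewrite lap_hess//.
 by congr (_ <= qf _ _); ext => p; rewrite mxE.
Qed.

(* Only the values of [w] on the support of the second derivatives of [phi] matter. *)
Lemma form_change_head phi (w q : C -> R) us (I J : {set 'I_n}) : tf phi -> sm w -> sm q -> smooth us ->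
 (forall z, w z = q z \/ exists a, exists2 r : R, 0 < r & forall y, nr (y - z) < r -> phi y = a) ->
 cinteg (fun z => (phi z)%:C * form (w :: us) z I J) = cinteg (fun z => (phi z)%:C * form (q :: us) z I J).
move=> tp sw sq sus H; have cp := ctf_real tp.
apply: (etrans (esym (wedge_by_parts I J cp sw sus))); apply: (etrans _ (wedge_by_parts I J cp sq sus)).
bigr => i _; bigr => j _; congr (_ * cinteg _); ext => z.
have [->//|[a [r r0 Hr]]] := H z.
suff -> : cddbar i j (fun z => (phi z)%:C) z = 0 by rewrite !mulr0 !mul0r.
have E : ddbar i j phi z = ddbar i j (fun=> a) z.
 exact: (congr1 (fun A => A i j) (hess_near r0 Hr)).
rewrite -(ddbarE i j z tp.1) E (ddbarE i j z (sm_cst a)) /cddbar.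
have -> : wd 1 j (fun _ : C => (a%:C : K)) = fun=> 0 by ext => y; rewrite wd_cst.
by rewrite wd_cst.
Qed.

(** [form_change_head] acts on the first factor only; replaced factors are rotated to the end by
    [form_rcons] and collected in the tail [vs]. *)
Lemma form_change phi q us (I J : {set 'I_n}) : tf phi -> sm q -> smooth us ->
 foldr (fun (w : C -> R) P => (forall z, w z = q z \/ exists a, exists2 r : R, 0 < r & forall y, nr (y - z) < r -> phi y = a) /\ P) True us ->
 cinteg (fun z => (phi z)%:C * form us z I J) = cinteg (fun z => (phi z)%:C * form (nseq (size us) q) z I J).
move=> tp sq sus Hus.
suff key vs : smooth vs -> cinteg (fun z => (phi z)%:C * form (us ++ vs) z I J) =
 cinteg (fun z => (phi z)%:C * form (nseq (size us) q ++ vs) z I J).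
 by have := key [::] Logic.I; rewrite !cats0.
elim: us sus Hus vs => [//|w us IH] /= [sw sus] [Hw Hus] vs svs.
have suv : smooth (us ++ vs) by apply/smooth_cat.
transitivity (cinteg (fun z => (phi z)%:C * form (us ++ rcons vs q) z I J)).
 transitivity (cinteg (fun z => (phi z)%:C * form (q :: (us ++ vs)) z I J)).
 exact: form_change_head.
 by congr cinteg; ext => z; rewrite -rcons_cat form_rcons.
rewrite IH//; last by apply/smooth_rcons.
by congr cinteg; ext => z; rewrite -rcons_cat form_rcons.
Qed.

Lemma lap_comp (h : R -> R) g v z : sm1 h -> sm g ->
 lap v (fun z => h (g z)) z = derive1 h (g z) * lap v g z +
 4^-1 * (derive1 (derive1 h) (g z) * (dder v g z ^+ 2 + dder ('i%C *: v) g z ^+ 2)).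
move=> sh sg; have sh' := sm1_derive sh.
have d2 w : dder w (dder w (fun z => h (g z))) z = derive1 (derive1 h) (g z) * dder w g z ^+ 2 + derive1 h (g z) * dder w (dder w g) z.
 rewrite (dder_comp w sh sg) (dderM w (sm_comp sh' sg) (sm_dder w sg)) (dder_comp w sh' sg).
 have al (a b c d : R) : a * c + d * (b * d) = b * d ^+ 2 + a * c by ring.
 exact: al.
have alg (a b x y c d : R) : 4^-1 * ((a * x + b * c) + (a * y + b * d)) = b * (4^-1 * (c + d)) + 4^-1 * (a * (x + y)) by field.
apply: (etrans (congr2 (fun x y : R => 4^-1 * (x + y)) (d2 v) (d2 ('i%C *: v)))).
exact: alg.
Qed.

Lemma lap_cst (k : R) v z : lap v (fun _ : C => k) z = 0.
have d2 w : dder w (dder w (fun _ : C => k)) z = 0 by rewrite dder_cst dder_cst.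
apply: (etrans (congr2 (fun x y : R => 4^-1 * (x + y)) (d2 v) (d2 ('i%C *: v)))).
by rewrite addr0 mulr0.
Qed.

(* The Hessian of the regularized maximum is a convex combination of the
 Hessians plus a nonnegative term. *)
Lemma lap_smax_ge (e : R) u q v z : 0 < e -> sm u -> sm q ->
 (1 - step ((u z - q z) / e)) * lap v q z + step ((u z - q z) / e) * lap v u z <=
 lap v (fun z => q z + smax e (u z - q z)) z.
move=> e0 su sq; have sg : sm (fun z => u z - q z) by exact: smB.
have sh : sm1 (smax e) by exact: sm1_smax.
rewrite (lapD v z sq (sm_comp sh sg)) (lap_comp v z sh sg) (smax_derive1 e0).
have -> : lap v (fun z => u z - q z) z = lap v u z - lap v q z.
 have -> : (fun z => u z - q z) = fun z => u z + -1 * q z by ext => y; rewrite mulN1r.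
 by rewrite (lapD v z su (smZ (-1) sq)) (lapZ (-1) v z sq) mulN1r.
have : 0 <= 4^-1 * (derive1 (derive1 (smax e)) (u z - q z) * (dder v (fun z => u z - q z) z ^+ 2 + dder ('i%C *: v) (fun z => u z - q z) z ^+ 2)).
 by apply: mulr_ge0 => //; apply: mulr_ge0; [exact: smax_derive2_ge0|rewrite addr_ge0 ?sqr_ge0].
move: (4^-1 * _) (step _) (lap v q z) (lap v u z) => x1 x2 x3 x4; clear; nra.
Qed.

Lemma qf_close H H' v (e : R) : (forall p q : 'I_n, `|H p q - H' p q| <= e%:C) -> 0 <= e ->
 qf H' (fun p => v 0 p) - n%:R * n%:R * e * nr v ^+ 2 <= qf H (fun p => v 0 p).
move=> He e0; rewrite lerBlDl -lerBlDr.
have -> : qf H' (fun p => v 0 p) - qf H (fun p => v 0 p) = Re (- hform (fun p q : 'I_n => H p q - H' p q) (fun p => v 0 p)).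
 rewrite /qf -ReN -ReD; congr Re; rewrite /hform -!sumrN -big_split; bigr => p _ /=.
 by rewrite -!sumrN -big_split; bigr => q _ /=; ring.
have RN (a : K) (b : R) : `|a| <= b%:C -> Re a <= b.
 move=> ab; apply: le_trans (_ : Re `|a| <= b).
 by case: a {ab} => x y; rewrite normc_def /= (le_trans (ler_norm _))// -sqrtr_sqr ler_wsqrtr// lerDl sqr_ge0.
 by case: `|a| ab => x y; rewrite lecE => /andP[].
apply: RN; rewrite normrN /hform.
apply: le_trans (ler_norm_sum _ _ _) _.
apply: (@le_trans _ _ (\sum_(p < n) \sum_(q < n) (e * nr v ^+ 2)%:C)); last first.
 have E (y : R) : (n%:R * n%:R * y)%:C = y%:C *+ n *+ n by rewrite -mulrA !mulr_natl !raddfMn.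
 by rewrite -mulrA E !sumr_const !card_ord.
apply: ler_sum => p _; apply: le_trans (ler_norm_sum _ _ _) _; apply: ler_sum => q _.
rewrite !normrM norm_conjC mulrC rmorphM; apply: ler_pM => //.
by rewrite rmorphXn expr2; apply: ler_pM => //; exact: coord_le_nr.
Qed.

End wedge_products.

(** * Properties shared by a list of potentials *)

Section all_in.
Context {R : realType} {n : nat}.
Local Notation C := (Cn R n).
Implicit Types (u f : C -> R) (z v : C) (us : seq (C -> R)).

Lemma all_in_sub (U V : (C -> R) -> Prop) us : (forall w, U w -> V w) -> all_in U us -> all_in V us.
by move=> H; elim: us => //= w us IH [/H h /IH]. Qed.
Lemma all_in_map (U : (C -> R) -> Prop) (W : (C -> R) -> C -> R) us : all_in (fun w => U (W w)) us -> all_in U (map W us).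
by elim: us => //= w us IH [h /IH]. Qed.
Lemma form_map_id (W : (C -> R) -> C -> R) us z : all_in (fun w => hess (W w) z = hess w z) us -> form (map W us) z = form us z.
by elim: us => //= w us IH [-> /IH ->]. Qed.

Lemma form_map_cst (W : (C -> R) -> C -> R) q us z : all_in (fun w => hess (W w) z = hess q z) us ->
 form (map W us) z = form (nseq (size us) q) z.
by elim: us => //= w us IH [-> /IH ->]. Qed.

Lemma hess_subC (q : C -> R) (k : R) z : sm q -> hess (fun z => q z - k) z = hess q z.
move=> sq; apply: hess_eq => v w.
rewrite (dderB w sq (sm_cst k)) (dderB v (sm_dder w sq) (sm_dder w (sm_cst k))).
by rewrite dder_cst dder_cst subr0.
Qed.

Lemma lap_subC (q : C -> R) (k : R) v z : sm q -> lap v (fun z => q z - k) z = lap v q z.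
by move=> sq; rewrite (lapD v z sq (sm_cst (- k))) lap_cst addr0. Qed.

Lemma hess_near_gt (w f q : C -> R) z (a : R) : continuous f -> a < f z -> (forall y, a < f y -> w y = q y) -> hess w z = hess q z.
move=> cf fz H; have [r r0 Hr] := (openP_nr _).1 (cont_open_gt (e := a) cf) z fz.
by apply: (@hess_near _ _ w q z r) => // y /Hr /H.
Qed.

Lemma mass_ge0 (q : C -> R) z : sm q -> (forall v, 0 <= lap v q z) -> 0 <= Re (mass (hess q z)).
move=> sq Hq; rewrite -form_nseq.
have H m : smooth (nseq m q) /\ all_in (fun u => forall v, 0 <= lap v u z) (nseq m q) by elim: m => //= m [].
have := rcone_form (H n).1 (H n).2.
by move=> /(@rcone_ge0 _ _ _ full); rewrite lecE => /andP[].
Qed.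

End all_in.

(** * Comparison of Monge-Ampere masses on superlevel sets *)

Section mass_comparison.
Context {R : realType} {n : nat}.
Local Notation K := R[i].
Local Notation C := (Cn R n).
Local Notation L := (@lebesgue_Cn R n).
Variables (Omega B : set C) (c m' : R) (u ut Q phi : C -> R) (mu : {measure set (borelC R n) -> \bar R}).
Hypotheses (Bc : compact B) (BO : B `<=` Omega) (c0 : 0 < c) (m'0 : 0 <= m') (MA : monge_ampere c Omega u mu).
Hypotheses (utc : continuous ut) (utE : forall z, B z -> ut z = u z).
Hypothesis (psd_approx : forall h : R, 0 < h -> exists w : C -> R,
 [/\ sm w, forall z, B z -> forall v, 0 <= lap v w z & forall z, B z -> `|w z - ut z| <= h]).
Hypotheses (sQ : sm Q) (Qpsd : forall z, B z -> forall v, 0 <= lap v Q z)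
 (massQ : forall z, B z -> 2 ^+ n * c ^+ n * Re (mass (hess Q z)) <= m').
Hypotheses (tphi : tf phi) (phi01 : forall z, 0 <= phi z <= 1) (phiB : forall z, ~ B z -> phi z = 0).

Let lconst z := exists a, exists2 r : R, 0 < r & forall y : C, nr (y - z) < r -> phi y = a.

Section level.
Variables (k e : R).
Hypotheses (e0 : 0 < e) (Hout : forall z, B z -> ut z <= Q z - (k + 7 * e) \/ lconst z).

Let k' : R := k + 2 * e.
Let q : C -> R := fun z => Q z - k'.
(** The regularized maximum of [w] and the lowered [Q]. The shift [k'] lies strictly between the
    levels [k] and [k + 7 * e], so that near the first [W] is [w] and near the second it is [q],
    with room for all approximation errors. *)
Let W (w : C -> R) : C -> R := fun z => q z + smax e (w z - q z).
Let sq : sm q. Proof. by apply: smB => //; exact: sm_cst. Qed.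
Let e8 : 0 < e / 8. Proof. exact: divr_gt0. Qed.

Variable us0 : C -> R.
Hypotheses (su0 : sm us0) (u0c : forall z, B z -> `|us0 z - ut z| <= e / 8).
(** Smooth substitutes for indicators of superlevel sets. They are built from one fixed smooth
    approximation [us0] because [phi * s1] must be a test function. With an error [e / 8], [s1] is 1
    where [ut] exceeds [Q - k], and [s2] vanishes unless [ut] exceeds [Q - (k + 7 * e)]. *)
Let s1 z := step ((us0 z - Q z + k + e / 4) / (e / 8)).
Let s2 z := step ((us0 z - Q z + k + 5 * e) / (e / 2)).
Let U (w : C -> R) := [/\ sm w, forall z, B z -> forall v, 0 <= lap v w z & forall z, B z -> `|w z - ut z| <= e / 8].

Let sW w : sm w -> sm (W w).
by move=> sw; apply: smD => //; apply: sm_comp; [exact: sm1_smax|exact: smB]. Qed.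

Let W_psd w z v : sm w -> 0 <= lap v w z -> 0 <= lap v Q z -> 0 <= lap v (W w) z.
move=> sw pw pQ; apply: le_trans (lap_smax_ge v z e0 sw sq).
have := step_ge0 ((w z - q z) / e); have := step_le1 ((w z - q z) / e).
rewrite /q (lap_subC k' v z sQ); move: (step _) (lap v Q z) (lap v w z) pQ pw => a x y; nra.
Qed.

Let s2_hi z : s1 z != 0 -> s2 z = 1.
move=> h; apply: step_eq1; rewrite ler_pdivlMr ?divr_gt0// mul1r.
have : ~ (us0 z - Q z + k + e / 4) / (e / 8) <= -1 by move=> /step_eq0 E; rewrite /s1 E eqxx in h.
rewrite ler_pdivrMr// => /negP; rewrite -ltNge; move: (us0 z) (Q z) e0 => a b; lra.
Qed.

(** Where [s1] is nonzero, every potential exceeds [q] by [e], so [W] changes nothing and [s2] is 1.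
    Where [s2] is not 1, every potential is below [q - e], so [W] gives [q]. In between, positivity
    of the product suffices. *)
Let pointwise us z : B z -> all_in U us -> size us = n -> smooth us ->
 phi z * s1 z * Re (form us z full full) +
 phi z * (1 - s2 z) * Re (mass (hess Q z)) <=
 phi z * Re (form (map W us) z full full).
move=> Bz Uus sus smus; rewrite -(mulrA _ (s1 z)) -(mulrA _ (1 - s2 z)) -mulrDr; have /andP[p0 _] := phi01 z; apply: ler_wpM2l => //.
have W0 : 0 <= Re (form (map W us) z full full).
 have : rcone (form (map W us) z).
 apply: rcone_form.
 by move: Uus; rewrite -/(all_in _ _); elim: us {sus smus} => //= w us IH [[sw _ _] /IH h]; split => //; exact: sW.
 apply: (@all_in_map R n (fun w : C -> R => forall v, 0 <= lap v w z) W us); apply: all_in_sub Uus => w [sw pw _] v.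
 by apply: W_psd => //; [exact: pw|exact: Qpsd].
 by move=> /(@rcone_ge0 _ _ _ full); rewrite lecE => /andP[].
have M0 : 0 <= Re (mass (hess Q z)) by apply: mass_ge0 => //; exact: Qpsd.
have u0z := u0c Bz.
have [h|h] := eqVneq (s1 z) 0; last first.
 have h' : - (3 / 8 * e) < us0 z - Q z + k.
 have : ~ (us0 z - Q z + k + e / 4) / (e / 8) <= -1 by move=> /step_eq0 E; rewrite /s1 E eqxx in h.
 rewrite ler_pdivrMr// => /negP; rewrite -ltNge; move: (us0 z) (Q z) => a b; lra.
 rewrite (s2_hi h) subrr mul0r addr0 form_map_id.
 have := step_le1 ((us0 z - Q z + k + e / 4) / (e / 8)); rewrite -/(s1 z).
 have : 0 <= Re (form us z full full).
 have : rcone (form us z) by apply: rcone_form => //; apply: all_in_sub Uus => w [_ pw _]; exact: pw.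
 by move=> /(@rcone_ge0 _ _ _ full); rewrite lecE => /andP[].
 by move=> ? ?; rewrite ler_piMl.
 apply: all_in_sub Uus => w [sw _ wc]; have wz := wc z Bz.
 apply: (hess_near_gt (f := fun y => w y - q y) (a := e)).
 - by apply: sm_cont; exact: smB.
 - move: wz u0z h'; rewrite /q /k' !ler_norml; move: (us0 z) (Q z) (w z) (ut z) => a b x y /andP[h1 h2] /andP[h3 h4]; lra.
 - by move=> y hy; rewrite /W (smax_id e0 (ltW hy)) addrC subrK.
rewrite h mul0r add0r.
have s21 : s2 z <= 1 := step_le1 _.
have [h2|h2] := eqVneq (s2 z) 1; first by rewrite h2 subrr mul0r.
have h' : us0 z - Q z + k < - (9 / 2 * e).
 have : ~ 1 <= (us0 z - Q z + k + 5 * e) / (e / 2) by move=> /step_eq1 E; rewrite /s2 E eqxx in h2.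
 rewrite ler_pdivlMr ?divr_gt0// => /negP; rewrite -ltNge; move: (us0 z) (Q z) => a b; lra.
have -> : form (map W us) z full full = mass (hess Q z).
 rewrite (@form_map_cst R n W Q); first by rewrite sus form_nseq.
 apply: all_in_sub Uus => w [sw _ wc]; have wz := wc z Bz.
 rewrite -(hess_subC k' z sQ); apply: (hess_near_gt (f := fun y => q y - w y) (a := e)).
 - by apply: sm_cont; exact: smB.
 - move: wz u0z h'; rewrite /q /k' !ler_norml; move: (us0 z) (Q z) (w z) (ut z) => a b x y /andP[h1 h2'] /andP[h3 h4]; lra.
 - move=> y hy; rewrite /W smax_eq0 ?addr0//; move: hy; move: (w y) (q y) => a b; lra.
by rewrite ler_piMl// gerBl; exact: step_ge0.
Qed.

Let tpsi : tf (fun z => phi z * s1 z).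
apply: tfMl => //; have -> : s1 = fun z => step ((e / 8)^-1 * (us0 z - (Q z - (k + e / 4)))).
 by ext => z; rewrite /s1 mulrC; congr (step (_ * _)); ring.
by apply: sm_step; apply: smZ; apply: smB => //; apply: smB => //; exact: sm_cst.
Qed.

Let ttheta : tf (fun z => phi z * s2 z).
apply: tfMl => //; have -> : s2 = fun z => step ((e / 2)^-1 * (us0 z - (Q z - (k + 5 * e)))).
 by ext => z; rewrite /s2 mulrC; congr (step (_ * _)); ring.
by apply: sm_step; apply: smZ; apply: smB => //; apply: smB => //; exact: sm_cst.
Qed.

Lemma Re_cinteg F : Re (cinteg F) = integ (fun z : C => Re (F z)).
Transparent cinteg.
by [].
Qed.

Let cG us : smooth us -> continuous (fun z : C => Re (form us z full full)).
by move=> s; apply: sm_cont; have [] := csm_form full full s. Qed.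

Let smooth_nseq m : smooth (nseq m Q). Proof. by elim: m => //= m IH. Qed.

(** The potentials [W w] and [q] agree wherever [phi] is not locally constant, so both products have
    the same integral against [phi]. Subtracting the mass of [q] outside the superlevel set leaves
    the bound. *)
Let integral_bound us : all_in U us -> size us = n -> smooth us ->
 2 ^+ n * c ^+ n * integ (fun z => phi z * s1 z * Re (form us z full full)) <=
 m' * integ (fun z => phi z * s2 z).
move=> Uus sus smus; pose G z := Re (mass (hess Q z)).
have cGQ : continuous G.
 suff -> : G = fun z => Re (form (nseq n Q) z full full) by exact/cG/smooth_nseq.
 by ext => z; rewrite form_nseq.
have smW : smooth (map W us).
 by elim: us Uus {sus smus} => //= w us IH [[sw _ _] /IH h]; split => //; exact: sW.
have E : integ (fun z => phi z * Re (form (map W us) z full full)) = integ (fun z => phi z * G z).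
 transitivity (Re (cinteg (fun z => (phi z)%:C * form (map W us) z full full))).
 by rewrite Re_cinteg; congr integ; ext => z; rewrite ReZ.
 rewrite (@form_change _ _ phi q (map W us))//.
 rewrite Re_cinteg size_map sus; congr integ; ext => z.
 by rewrite form_nseq ReZ (hess_subC k' z sQ).
 apply: (@all_in_map R n (fun w : C -> R => forall z, w z = q z \/ lconst z) W us); apply: all_in_sub Uus => w [_ _ wc] z.
 have [Bz|Bz] := pselect (B z).
 have [h|h] := Hout Bz; last by right.
 left; rewrite /W smax_eq0 ?addr0//; move: (wc z Bz) h; rewrite /q /k' ler_norml; idtac.
 by move: (w z) (ut z) (Q z) => a b x /andP[h1 h2]; lra.
 right; exists 0; have [r r0 Hr] := (openP_nr (~` B)).1 (closed_openC (compact_closedC Bc)) z Bz.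
 by exists r => // y /Hr /phiB.
have c1 : Cc (fun z => phi z * s1 z * Re (form us z full full)).
 by apply: CcMl; [exact: tf_Cc|exact: cG].
have c2 : Cc (fun z => phi z * G z) by apply: CcMl => //; exact: tf_Cc.
have c3 : Cc (fun z => phi z * s2 z * G z) by apply: CcMl => //; exact: tf_Cc.
have c4 : Cc (fun z => phi z * Re (form (map W us) z full full)).
 by apply: CcMl; [exact: tf_Cc|exact: cG].
have k0 : 0 <= 2 ^+ n * c ^+ n by rewrite mulr_ge0// exprn_ge0// ltW.
have I1 : integ (fun z => phi z * s1 z * Re (form us z full full)) <= integ (fun z => phi z * s2 z * G z).
 have : integ (fun z => phi z * s1 z * Re (form us z full full) + (phi z * G z - phi z * s2 z * G z)) <=
 integ (fun z => phi z * Re (form (map W us) z full full)).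
 apply: integ_le => //; first by apply: CcD => //; exact: CcB.
 move=> z; have [Bz|Bz] := pselect (B z); last by rewrite phiB// !mul0r subr0 addr0.
 have -> : phi z * G z - phi z * s2 z * G z = phi z * (1 - s2 z) * G z by ring.
 exact: pointwise.
 by rewrite (integD c1 (CcB c2 c3)) (integB c2 c3) E; move: (integ _) (integ _) (integ _) => x y t; lra.
apply: le_trans (ler_wpM2l k0 I1) _.
rewrite -(integZ _ c3) -(integZ _ (tf_Cc ttheta)); apply: integ_le; [exact: CcZ|exact: (CcZ _ (tf_Cc ttheta))|].
move=> z; have [Bz|Bz] := pselect (B z); last by rewrite phiB// !(mul0r, mulr0).
rewrite mulrCA mulrC; apply: ler_wpM2r; last exact: massQ.
by have /andP[p0 _] := phi01 z; rewrite mulr_ge0//; exact: step_ge0.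
Qed.

(** The mass of [mu] against [phi * s1] is approximated by smooth products through [current_approx];
    the bound is uniform in the approximation. *)
Let mu_bound : Rintegral mu Omega (fun z => phi z * s1 z) <= m' * integ (fun z => phi z * s2 z).
apply/ler_addgt0Pr => h h0; have [_ [T [T0 TS TM]]] := MA.
have t1 : test_function Omega (fun z => phi z * s1 z).
 by split; [exact: tpsi.1|exists B; split => // z /phiB ->; rewrite mul0r].
pose F (_ : unit) z := (phi z * s1 z)%:C : K.
have h2 : 0 < h / 2 ^+ n by rewrite divr_gt0// exprn_gt0.
have Uap (a : R) : 0 < a -> exists w, [/\ U w, sm w & forall z, B z -> `|w z - ut z| <= a].
 move=> a0; have [|w [sw pw cw]] := psd_approx (h := Num.min a (e / 8)); first by rewrite lt_min a0.
 exists w; split => //; last by move=> z /cw; rewrite le_min => /andP[].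
 by split => // z /cw; rewrite le_min => /andP[].
have [||||us [sus Uus smus /(_ tt)]] := @current_approx R n Omega B c u ut T U Bc BO c0 T0 TS utc utE Uap n (leqnn n) unit
 (fun=> full) (fun=> full) F (h / 2 ^+ n).
- by case; rewrite cardsT card_ord.
- by case; exact: (ctf_real tpsi).1.
- by case=> z Bz; rewrite /F phiB// mul0r.
- by [].
have := congr1 (@Re R) (TM _ t1); rewrite [Re _%:C]/=.
have -> : (2 ^+ n : K) = (2 ^+ n)%:C by rewrite rmorphXn rmorph_nat.
rewrite ReZ -/(F tt) => -> H.
have RN (a : K) (b : R) : `|a| <= b%:C -> Re a <= b.
 move=> ab; apply: le_trans (_ : Re `|a| <= b).
 by case: a {ab} => x y; rewrite normc_def /= (le_trans (ler_norm _))// -sqrtr_sqr ler_wsqrtr// lerDl sqr_ge0.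
 by case: `|a| ab => x y; rewrite lecE => /andP[].
have := RN _ _ H; rewrite ReD ReN.
have -> : (c%:C ^+ n : K) = (c ^+ n)%:C by rewrite rmorphXn.
rewrite ReZ Re_cinteg lerBlDr => H'.
have n2 : (0 : R) < 2 ^+ n by rewrite exprn_gt0.
apply: le_trans (ler_wpM2l (ltW n2) H') _.
rewrite mulrDr mulrCA mulfV ?gt_eqF// mulr1 addrC lerD2r mulrA.
apply: le_trans (integral_bound Uus sus smus); rewrite le_eqVlt; apply/orP; left; apply/eqP.
by congr (_ * _); congr integ; ext => z; rewrite /F ReZ.
Qed.

(** The enlargement of the level by [7 * e] pays for the regularized maximum and for the smooth
    indicators. *)
Lemma mu_le_level (A : set C) : measurable (A : set (borelC R n)) -> A `<=` B ->
 (forall z, A z -> phi z = 1 /\ Q z - k < ut z) ->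
 (mu A <= m'%:E * L (B `&` [set z | Q z - (k + 7 * e) < ut z]%R))%E.
move=> mA AB HA; have mB : measurable (B : set (borelC R n)) by exact: compact_borel.
have [muK _] := MA.
have psi0 z : 0 <= phi z * s1 z by have /andP[p0 _] := phi01 z; rewrite mulr_ge0//; exact: step_ge0.
have m1 : measurable_fun setT ((fun z => phi z * s1 z) : borelC R n -> R) by apply: cont_measurable; exact: (tf_Cc tpsi).1.
have i1 : mu.-integrable B (EFin \o (fun z => phi z * s1 z)).
 apply: (@le_integrable _ _ _ mu B mB _ (cst 1%:E)).
 - by to_EFin; exact: measurable_funTS.
 - move=> z _ /=; rewrite lee_fin normr1 ger0_norm//.
 have /andP[p0 p1] := phi01 z; rewrite -[1 : R]mulr1 ler_pM//; [exact: step_ge0|exact: step_le1].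
 apply/integrableP; split; first exact: measurable_cst.
 under eq_integral do rewrite abse1.
 by rewrite integral_cst// mul1e; exact: muK.
have le1 : (mu A <= (Rintegral mu Omega (fun z => phi z * s1 z))%:E)%E.
 rewrite (Rintegral_supp BO) => [|z /phiB ->]; last by rewrite mul0r.
 rewrite /Rintegral fineK; last exact: integrable_fin_num.
 apply: (@le_trans _ _ (\int[mu]_(z in A) (phi z * s1 z)%:E)%E); last first.
 apply: ge0_subset_integral => //; last by move=> z _; rewrite lee_fin.
 by to_EFin; exact: measurable_funTS.
 rewrite -[leLHS]mul1e -integral_cst//; apply: ge0_le_integral => //.
 - by to_EFin; exact: measurable_funTS.
 move=> z Az; rewrite lee_fin; have [-> uz] := HA z Az; rewrite mul1r /s1 step_eq1//.
 rewrite ler_pdivlMr// mul1r; move: (u0c (AB z Az)) uz; rewrite ler_norml; idtac.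
 by move: (us0 z) (ut z) (Q z) => a b x /andP[h1 h2] h3; lra.
apply: le_trans le1 _.
have mS : measurable ((B `&` [set z | Q z - (k + 7 * e) < ut z]%R) : set (borelC R n)).
 apply: measurableI => //; apply: open_borel.
 have cg : continuous (fun z => ut z - Q z) by apply: (@contD _ _ ut (fun z => - Q z)) => //; apply: sm_cont; exact: smN.
 have := cont_open_gt (e := - (k + 7 * e)) cg; congr open.
 by apply/seteqP; split => z /= h; move: h; move: (ut z) (Q z) => a b h; lra.
set S := B `&` _ in mS *.
have th0 z : 0 <= phi z * s2 z by have /andP[p0 _] := phi01 z; rewrite mulr_ge0//; exact: step_ge0.
have le2 : ((integ (fun z => phi z * s2 z))%:E <= L S)%E.
 have iT := Cc_integrable (tf_Cc ttheta).
 rewrite integE /Rintegral fineK; last exact: integrable_fin_num.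
 have -> : (\int[L]_z (phi z * s2 z)%:E = \int[L]_(z in S) (phi z * s2 z)%:E)%E.
 rewrite [RHS]integral_mkcond; apply: eq_integral => z _; rewrite /patch; case: ifPn => //.
 rewrite notin_setE => Sz; have [Bz|Bz] := pselect (B z); last by rewrite phiB// mul0r.
 have [->|h2] := eqVneq (s2 z) 0; first by rewrite mulr0.
 exfalso; apply: Sz; split => //=.
 have : ~ (us0 z - Q z + k + 5 * e) / (e / 2) <= -1 by move=> /step_eq0 E; rewrite /s2 E eqxx in h2.
 rewrite ler_pdivrMr ?divr_gt0// => /negP; rewrite -ltNge.
 move: (u0c Bz); rewrite ler_norml; move: (us0 z) (ut z) (Q z) => a b x /andP[h3 h4] h; lra.
 rewrite -[leRHS]mul1e -integral_cst//; apply: ge0_le_integral => //.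
 - by move=> z _; rewrite lee_fin.
 - to_EFin; apply: measurable_funTS; apply: cont_measurable; exact: (tf_Cc ttheta).1.
 - move=> z _; rewrite lee_fin; have /andP[p0 p1] := phi01 z.
 by rewrite -[1 : R]mulr1 ler_pM//; [exact: step_ge0|exact: step_le1].
apply: (@le_trans _ _ (m' * integ (fun z => phi z * s2 z))%:E); first by rewrite lee_fin; exact: mu_bound.
by rewrite EFinM; apply: lee_wpmul2l.
Qed.
End level.

Lemma mu_le_superlevel (k e : R) (A : set C) : 0 < e -> (forall z, B z -> ut z <= Q z - (k + 7 * e) \/ lconst z) ->
 measurable (A : set (borelC R n)) -> A `<=` B -> (forall z, A z -> phi z = 1 /\ Q z - k < ut z) ->
 (mu A <= m'%:E * L (B `&` [set z | Q z - (k + 7 * e) < ut z]%R))%E.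
move=> e0 Hout mA AB HA; have [w [sw _ wc]] := psd_approx (divr_gt0 e0 (ltr0n R 8)).
exact: (mu_le_level e0 Hout sw wc mA AB HA).
Qed.

(** The volumes F(k) of the superlevel sets would satisfy m F(k) <= m' F(k + 7 e) for every small e.
    Splitting [k0 / 2, k0] into N steps gives F(k0 / 2) <= (m' / m)^N F(k0) for all N, although the
    set at level k0 / 2 contains a neighbourhood of [z0]. *)
Lemma no_touching (z0 : C) (k0 m : R) : 0 < k0 -> m' < m -> (B)° z0 -> ut z0 = Q z0 ->
 (forall z, B z -> Q z - k0 < ut z -> phi z = 1) ->
 (forall z, B z -> ut z <= Q z - k0 \/ lconst z) ->
 (forall A : set C, measurable (A : set (borelC R n)) -> A `<=` B -> (m%:E * L A <= mu A)%E) -> False.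
move=> k00 mm Bz0 uz0 Hphi Hout Hmu.
have m0 : 0 < m := le_lt_trans m'0 mm.
pose S (k : R) := B `&` [set z | Q z - k < ut z].
have cg : continuous (fun z => ut z - Q z).
 by apply: (@contD _ _ ut (fun z => - Q z)) => //; apply: sm_cont; exact: smN.
have oS k : open [set z | Q z - k < ut z].
 have := cont_open_gt (e := - k) cg; congr open.
 by apply/seteqP; split => z /= h; move: h; move: (ut z) (Q z) => a b h; lra.
have mB : measurable (B : set (borelC R n)) by exact: compact_borel.
have mS k : measurable (S k : set (borelC R n)) by apply: measurableI => //; exact: open_borel.
have LS k : (L (S k) < +oo)%E.
 by apply: le_lt_trans (lebesgue_Cn_compact Bc); apply: le_measure; rewrite ?inE// => z [].
pose F k := fine (L (S k)).
have FE k : L (S k) = (F k)%:E by rewrite fineK// ge0_fin_numE.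
have step k e : 0 < e -> k + 7 * e <= k0 -> m * F k <= m' * F (k + 7 * e).
 move=> e0 ke; rewrite -lee_fin !EFinM -!FE.
 apply: (le_trans (Hmu _ (mS k) _)); first by move=> z [].
 apply: mu_le_superlevel => //.
 - move=> z Bz; have [h|h] := Hout z Bz; [left|by right].
 by move: h ke; move: (ut z) (Q z) => a b; lra.
 - by move=> z [].
 - move=> z [Bz /= h]; split => //; apply: Hphi => //.
 by move: h ke e0; move: (ut z) (Q z) => a b; lra.
have pos : 0 < F (k0 / 2).
 rewrite -lte_fin -FE; have : (0 < L ((B)° `&` [set z | (Q z - (k0 / 2) < ut z)%R]))%E.
 apply: (@lebesgue_Cn_open _ _ _ z0); first by apply: openI => //; exact: open_interior.
 by split => //=; rewrite uz0 gtrBl divr_gt0.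
 move=> /lt_le_trans; apply; apply: le_measure; rewrite ?inE//.
 by apply: open_borel; apply: openI => //; exact: open_interior.
 by move=> z [/interior_subset h1 h2].
have iter N : m ^+ N * F (k0 / 2) <= m' ^+ N * F k0.
 have [->|N0] := posnP N.
 rewrite !expr0 !mul1r -lee_fin -!FE; apply: le_measure; rewrite ?inE// => z [h1 /= h2]; split => //=.
 by move: h2 k00; move: (ut z) (Q z) => a b; lra.
 have NR : (0 : R) < N%:R by rewrite ltr0n.
 (* Each step uses [e = d / 7], so that it raises the level by exactly [d]. *)
 pose d : R := k0 / 2 / N%:R; have d0 : 0 < d by rewrite !divr_gt0.
 have Nd : N%:R * d = k0 / 2 by rewrite /d mulrC divfK// gt_eqF.
 have H i : (i <= N)%N -> m ^+ i * F (k0 / 2) <= m' ^+ i * F (k0 / 2 + i%:R * d).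
 elim: i => [_|i IH iN]; first by rewrite !expr0 !mul1r mul0r addr0.
 have := IH (ltnW iN); rewrite !exprS => h.
 rewrite -mulrA; apply: (le_trans (ler_wpM2l (ltW m0) h)).
 rewrite mulrCA (mulrC m') -(mulrA (m' ^+ i)); apply: ler_wpM2l; first exact: exprn_ge0.
 have iN' : i.+1%:R * d <= k0 / 2 by rewrite -Nd ler_wpM2r ?ler_nat// ltW.
 have := step (k0 / 2 + i%:R * d) (d / 7) (divr_gt0 d0 (ltr0n R 7)).
 have -> : k0 / 2 + i%:R * d + 7 * (d / 7) = k0 / 2 + i.+1%:R * d by rewrite -natr1; field.
 by apply; move: iN'; lra.
 by have := H N (leqnn N); rewrite Nd -splitr.
pose x := m' / m; have x0 : 0 <= x by rewrite divr_ge0// ltW.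
have x1 : `|x| < 1 by rewrite ger0_norm// ltr_pdivrMr// mul1r.
have Fk0 : 0 < F k0 + 1 by rewrite ltr_wpDl// fine_ge0.
have e0 : 0 < F (k0 / 2) / (F k0 + 1) by rewrite divr_gt0.
have [N _ HN] := (@cvgrPdist_lt _ _ _ _ _ _ _).1 (cvg_expr x1) _ e0.
have := HN N (leqnn N); rewrite sub0r normrN ger0_norm ?exprn_ge0// ltr_pdivlMr// => h.
have := iter N; have mN : 0 < m ^+ N by rewrite exprn_gt0.
rewrite -ler_pdivlMl// mulrA => h2.
have xN : (m ^+ N)^-1 * m' ^+ N = x ^+ N by rewrite /x expr_div_n mulrC.
move: h2; rewrite xN leNgt => /negP; apply; apply: le_lt_trans h.
by rewrite ler_wpM2l ?exprn_ge0// lerDl.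
Qed.

End mass_comparison.

(** * Mass at a point of contact *)

Section touching.
Context {R : realType} {n : nat}.
Local Notation K := R[i].
Local Notation C := (Cn R n).
Local Notation L := (@lebesgue_Cn R n).
Implicit Types (u q f g : C -> R) (z v w : C).

Lemma mid_between (a b : R) : a < b -> a < (a + b) / 2 < b.
by move=> ab; apply/andP; split; lra. Qed.

Lemma common_radius (a b c d e : R) : 0 < a -> 0 < b -> 0 < c -> 0 < d -> 0 < e ->
 exists r, [/\ 0 < r, r < a, r < b & [/\ r < c, r < d & r <= e / 2]].
move=> a0 b0 c0 d0 e0; pose m := Num.min (Num.min a b) (Num.min (Num.min c d) e).
have m0 : 0 < m by rewrite !lt_min a0 b0 c0 d0 e0.
have : m / 2 < m by rewrite ltr_pdivrMr// ltr_pMr// ltr1n.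
rewrite {2}/m !lt_min -!andbA => /and5P[h1 h2 h3 h4 h5].
exists (m / 2); split => //; first exact: divr_gt0.
by split => //; rewrite ler_pM2r// /m !ge_min lexx !orbT.
Qed.

Lemma ReM_cont (f : C -> K) z : csm f -> forall e : R, 0 < e -> \forall y \near z, `|f z - f y| <= e%:C.
move=> [f1 f2] e e0; have e2 : 0 < e / 2 by rewrite divr_gt0.
have [r r0 Hr] := (cont_nr _ _).1 (sm_cont f1 z) _ e2.
have [s s0 Hs] := (cont_nr _ _).1 (sm_cont f2 z) _ e2.
apply/nearP_nr; exists (Num.min r s); first by rewrite lt_min r0.
move=> y; rewrite lt_min => /andP[/Hr h1 /Hs h2]; apply: le_trans (Defs.norm_le_ReIm _) _.
rewrite lecR !ReD !ReN !ImD !ImN [e]splitr; apply: lerD; apply: ltW; rewrite distrC//.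
Qed.

(** [mass] is polynomial in the parameter. Continuity is obtained by letting a real coordinate of
    C^n play the part of the parameter, so that the closure rules of [csm] apply. *)
Lemma mass_line (A B : 'I_n -> 'I_n -> K) (m : R) : (0 < n)%N -> Re (mass A) < m ->
 exists2 d : R, 0 < d & Re (mass (fun i j : 'I_n => A i j + d%:C * B i j)) < m.
move=> n0 Am; pose j := Ordinal n0.
pose H (z : C) (p q : 'I_n) := A p q + (xr j z)%:C * B p q.
have cH k I J : csm (fun z => iter k (wedge (H z)) (@one_array R n) I J).
 elim: k I J => [|k IH] I J /=; first exact: csm_cst.
 apply: csm_sum => p _; apply: csm_sum => q _; apply: csmM; last exact: IH.
 apply: csmM; first exact: csm_cst.
 apply: csmD; [exact: csm_cst|apply: csmM; [apply: csm_real; exact: sm_xr|exact: csm_cst]].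
have [cm _] := cH n full full.
pose G z := Re (mass (H z)).
have e0 : 0 < m - Re (mass A) by rewrite subr_gt0.
have G0 : G 0 = Re (mass A).
 by rewrite /G; congr (Re (mass _)); ext => p; ext => q; rewrite /H /xr mxE /= mul0r addr0.
have [r r0 Hr] := (cont_nr _ _).1 (sm_cont cm 0) _ e0.
have [k k0 Hk] := mulmx_bounded (1%:M : 'M[K]_n).
pose d := r / (nr (basis j : C) + 1); have b1 : 0 < nr (basis j : C) + 1 by rewrite ltr_wpDl// nr_ge0.
have d0 : 0 < d by rewrite divr_gt0.
exists d => //.
have := Hr (d%:C *: basis j); rewrite subr0 nrZ gtr0_norm// => h.
have : d * nr (basis j : C) < r by rewrite /d mulrAC ltr_pdivrMr// ltr_pM2l// ltrDl.
move=> /h; rewrite -/(G _) -/(G 0) G0 ltr_norml => /andP[_].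
rewrite ltrBlDr subrK; congr (Re (mass _) < _).
by ext => p; ext => q; rewrite /H /xr !mxE !eqxx mulr1.
Qed.

Lemma hess_addZ q g (d k : R) z : sm q -> sm g ->
 hess (fun y => q y + d * g y + k) z = fun i j => hess q z i j + d%:C * hess g z i j.
move=> sq sg; have sdg : sm (fun y => d * g y) by exact: smZ.
have d2 v w : dder v (dder w (fun y => q y + d * g y + k)) z = dder v (dder w q) z + d * dder v (dder w g) z.
 have sqd := smD sq sdg.
 rewrite (dderD w sqd (sm_cst k)) (dder_cst k w) (_ : (fun y => _ + 0) = dder w (fun y => q y + d * g y)); last first.
 by ext => y; exact: addr0.
 rewrite (dderD w sq sdg) (dderZ d w sg) (dderD v (sm_dder w sq) (smZ d (sm_dder w sg))).
 by rewrite (dderZ d v (sm_dder w sg)).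
ext => i; ext => j.
have D (a1 a2 a3 a4 b1 b2 b3 b4 x1 x2 x3 x4 : R) : x1 = a1 + d * b1 -> x2 = a2 + d * b2 -> x3 = a3 + d * b3 -> x4 = a4 + d * b4 ->
 (4^-1 : K) * ((x1 + x2) +i* (x3 - x4)) = 4^-1 * ((a1 + a2) +i* (a3 - a4)) + d%:C * (4^-1 * ((b1 + b2) +i* (b3 - b4))).
 move=> -> -> -> ->; rewrite mulrCA -mulrDr; congr (_ * _); apply: complex_eq; rewrite ?ReD ?ImD ?ReM ?ImM /=; ring.
exact: (D _ _ _ _ _ _ _ _ _ _ _ _ (d2 _ _) (d2 _ _) (d2 _ _) (d2 _ _)).
Qed.

Lemma lap_addZ q g (d k : R) v z : sm q -> sm g ->
 lap v (fun y => q y + d * g y + k) z = lap v q z + d * lap v g z.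
move=> sq sg; apply: (etrans (lapD v z (smD sq (smZ d sg)) (sm_cst k))).
apply: (etrans (congr2 (fun x y : R => x + y) (lapD v z sq (smZ d sg)) (lap_cst k v z))).
by rewrite addr0; exact: (congr1 (fun x : R => lap v q z + x) (lapZ d v z sg)).
Qed.

(* Where [u] is touched from above by a strictly plurisubharmonic [q], the
 Monge-Ampere mass of [u] near the point cannot exceed that of [q]. *)
Lemma touch_mass (Omega : set C) u (c M m r : R) mu q z : (0 < n)%N -> open Omega -> (forall y, Omega y -> nr y <= M) ->
 0 < c -> submean Omega u -> (forall w, Omega w -> {for w, continuous u}) -> monge_ampere c Omega u mu ->
 Omega z -> sm q -> touches u q z -> 0 < r ->
 (forall A : set C, measurable (A : set (borelC R n)) -> (forall y, A y -> nr (y - z) < r) -> (m%:E * L A <= mu A)%E) ->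
 m <= 2 ^+ n * c ^+ n * Re (mass (hess q z)).
move=> n0 oO bO c0 su cu MA Oz sq tq r0 Hmu.
have k0 : 0 < 2 ^+ n * c ^+ n by rewrite mulr_gt0// exprn_gt0.
set k := 2 ^+ n * c ^+ n in k0 *.
have psd v : 0 <= lap v q z := psh_touch v oO su cu Oz sq tq.
rewrite leNgt; apply/negP => qm.
pose g y := E2 (y - z); have sg : sm g by apply: sm_shift; exact: sm_E2.
(* Adding [d] times |y - z|^2 makes the contact strict; a small [d] keeps the mass of the touching
   function below the threshold at [z]. *)
have [d d0 Hd] : exists2 d : R, 0 < d & Re (mass (fun i j => hess q z i j + d%:C * hess g z i j)) < m / k.
 by apply: mass_line => //; rewrite ltr_pdivlMr// mulrC.
pose l := u z - q z; pose Q y := q y + d * g y + l.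
have sQ : sm Q by apply: smD; [apply: smD => //; exact: smZ|exact: sm_cst].
have HQ y : hess Q y = fun i j => hess q y i j + d%:C * hess g y i j by exact: hess_addZ.
have g0 : g z = 0 by rewrite /g subrr /E2 big1// => j _; rewrite /xr /xi mxE /= expr0n /= addr0.
have Qz : Q z = u z by rewrite /Q g0 mulr0 addr0 /l addrC subrK.
have lapQ v y : lap v Q y = lap v q y + d * E2 v.
 by apply: (etrans (lap_addZ d l v y sq sg)); rewrite (lap_E2 (- z)).
(* An entrywise error [e] changes the quadratic form by at most [d] times the squared norm, which
   the added barrier compensates; so [Q] stays plurisubharmonic near [z]. *)
pose e := d / (n%:R * n%:R); have nR : (0 : R) < n%:R by rewrite ltr0n.
have e0 : 0 < e by rewrite divr_gt0// mulr_gt0.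
have near1 : \forall y \near z, forall i j, `|hess Q z i j - hess Q y i j| <= e%:C.
 by do 2 (apply: (@filter_forall _ _ _ (nbhs z)) => ?); apply: ReM_cont => //; exact: csm_hess.
have [r1 r10 Hr1] := (nearP_nr _ _).1 near1.
have Qpsd y v : nr (y - z) < r1 -> 0 <= lap v Q y.
 move=> /Hr1 h; rewrite (lap_hess v y sQ).
 apply: (le_trans _ (@qf_close _ _ (hess Q y) (hess Q z) v e _ (ltW e0))); last first.
 by move=> i j; rewrite distrC; exact: h.
 rewrite -(lap_hess v z sQ) lapQ subr_ge0; apply: (@le_trans _ _ (d * E2 v)); last by rewrite lerDr.
 have -> : n%:R * n%:R * e = d by rewrite /e mulrC divfK// gt_eqF// mulr_gt0.
 by apply: ler_wpM2l; [exact: ltW|exact: E2_ge].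
pose G y := Re (mass (hess Q y)).
have cG : continuous G.
 have H j : smooth (nseq j Q) by elim: j.
 have -> : G = fun y => Re (form (nseq n Q) y full full).
 by ext => y; rewrite form_nseq.
 by apply: sm_cont; have [] := csm_form full full (H n).
have Gz : G z < m / k by rewrite /G HQ.
(* A value strictly between the mass at [z] and the assumed bound, so that the mass stays below it
   on a ball. *)
pose m1 := (G z + m / k) / 2.
have zr1 : nr (z - z) < r1 by rewrite subrr nr0.
have G0 : 0 <= G z := mass_ge0 sQ (fun v => Qpsd z v zr1).
have m10 : G z < m1 < m / k by exact: mid_between.
have [r2 r20 Hr2] : exists2 r2 : R, 0 < r2 & forall y, nr (y - z) < r2 -> G y <= m1.
 have e1 : 0 < m1 - G z by rewrite subr_gt0; case/andP: m10.
 have [r2 r20 Hr2] := (cont_nr _ _).1 (cG z) _ e1; exists r2 => // y /Hr2.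
 by rewrite ltr_norml => /andP[_]; rewrite ltrBlDr subrK => /ltW.
have [r3 r30 Hr3] := tq.
have r40 : 0 < dist Omega z by exact: dist_gt0 oO bO n0 _ Oz.
have [rr [rr0 rr1 rr2 [rrr rr3 rrd]]] := common_radius r10 r20 r0 r30 r40.
have rr4 : rr < dist Omega z by apply: le_lt_trans rrd _; rewrite ltr_pdivrMr// ltr_pMr// ltr1n.
pose B := cball z rr.
have BO : B `<=` Omega by move=> y yB; apply: (dist_in bO n0 (z := z)); exact: le_lt_trans yB rr4.
have Bc : compact B by exact: cball_compact.
pose dd := dist Omega z / 8; have dd0 : 0 < dd by rewrite divr_gt0.
have Bd y : B y -> dist Omega z / 2 <= dist Omega y.
 move=> yB; have := dist_lip bO n0 z y; rewrite nrB => /(le_trans (ler_norm _)) h.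
 have yB' : nr (y - z) <= rr := yB.
 move: h yB' rrd; move: (dist Omega z) (dist Omega y) (nr _) => a b x; clear; lra.
pose ut := loc Omega dd u.
have Cut : Cc ut by exact: loc_Cc bO n0 _ _ dd0 cu.
have utE y : B y -> ut y = u y.
 by move=> /Bd h; apply: loc_in => //; move: h r40; rewrite /dd; move: (dist _ _) (dist _ _) => a b; clear; lra.
have psd_approx h : 0 < h -> exists w : C -> R,
 [/\ sm w, forall y, B y -> forall v, 0 <= lap v w y & forall y, B y -> `|w y - ut y| <= h].
 move=> h0; have [s s0 Hs] := Cc_unif Cut h0.
 pose s' := Num.min s (dist Omega z / 8); have s'0 : 0 < s' by rewrite lt_min s0.
 have [rho mr] := @exists_mollifier R n _ s'0; exists (mollify ut rho); split.
 - by apply: conv_sm => //; have [[]] := mr.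
 - move=> y /Bd yd v; apply: (submean_loc bO n0 v dd0 su cu mr (r := dist Omega z / 4)).
 by rewrite gt_min; apply/orP; right; rewrite ltr_pM2l// ltf_pV2 ?posrE// ltr_nat.
 move: yd r40; rewrite /dd; move: (dist _ _) (dist _ _) => a b; clear; lra.
 - move=> y _; apply: (mollify_close Cut mr) => y' h'; apply: ltW; apply: Hs.
 by apply: lt_le_trans h' _; rewrite ge_min lexx.
(* It is 1 where |y - z|^2 is at most [rr ^+ 2 / 3] and 0 outside [B]; in between, the strict
   contact keeps [ut] below [Q] by [d * (rr ^+ 2 / 3)]. *)
pose phi y := step (2 - 3 / rr ^+ 2 * g y).
have rr20 : 0 < rr ^+ 2 by rewrite exprn_gt0.
have phi1 y : g y <= rr ^+ 2 / 3 -> phi y = 1.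
 move=> h; apply: step_eq1; have : 3 / rr ^+ 2 * g y <= 1; last by move: (3 / _ * _); clear => a; lra.
 by rewrite mulrAC ler_pdivrMr// mul1r -ler_pdivlMl// mulrC.
have phi0 y : ~ B y -> phi y = 0.
 move=> /negP; rewrite -ltNge => h; apply: step_eq0.
 have h2 : rr ^+ 2 <= g y by apply: (le_trans _ (E2_ge _)); rewrite ler_pXn2r ?nnegrE ?nr_ge0 ?(ltW rr0)// ltW.
 have : 3 <= 3 / rr ^+ 2 * g y; last by move: (3 / _ * _); clear => a; lra.
 by rewrite mulrAC ler_pdivlMr// ler_pM2l.
have tphi : tf phi.
 split; first by apply: sm_step; apply: smB; [exact: sm_cst|exact: smZ].
 have [N HN] := compact_nr_bounded Bc; exists N => y Ny; apply: phi0 => /HN.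
 by rewrite leNgt Ny.
have k10 : 0 < d * (rr ^+ 2 / 3) by rewrite mulr_gt0// divr_gt0.
have far y : B y -> rr ^+ 2 / 3 <= g y -> ut y <= Q y - d * (rr ^+ 2 / 3).
 move=> yB gy; rewrite utE//; have : u y - q y <= l by apply: Hr3; exact: le_lt_trans yB rr3.
 have : d * (rr ^+ 2 / 3) <= d * g y by rewrite ler_pM2l.
 by rewrite /Q; move: (d * (_ / 3)) (d * g y) (u y) (q y) => a b x t; clear; lra.
have cg : continuous g := sm_cont sg.
apply: (@no_touching R n Omega B c (k * m1) u ut Q phi mu Bc BO c0 _ MA Cut.1 utE psd_approx sQ _ _ tphi _ phi0 z (d * (rr ^+ 2 / 3)) m k10).
- by rewrite mulr_ge0// ?(ltW k0)//; case/andP: m10 => /ltW h _; exact: le_trans h.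
- by move=> y yB v; apply: Qpsd; exact: le_lt_trans yB rr1.
- by move=> y yB; rewrite ler_pM2l//; apply: Hr2; exact: le_lt_trans yB rr2.
- by move=> y; rewrite step_ge0 step_le1.
- by rewrite mulrC -ltr_pdivlMr//; case/andP: m10.
- by apply/nearP_nr; exists rr => // y /ltW.
- by rewrite Qz utE// /B /cball /= subrr nr0 ltW.
- move=> y yB h; apply: phi1; rewrite leNgt; apply/negP => /ltW /(far _ yB).
 by rewrite leNgt h.
- move=> y yB; have [h|h] := lerP (rr ^+ 2 / 3) (g y); first by left; exact: far.
 right; exists 1; have := cont_open_gt (e := - (rr ^+ 2 / 3)) (sm_cont (smN sg)).
 move=> /openP_nr /(_ y); rewrite /= ltrN2 => /(_ h)[s s0 Hs]; exists s => // x /Hs.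
 by rewrite ltrN2 => /ltW /phi1.
- by move=> A mA AB; apply: Hmu => // y /AB yB; exact: le_lt_trans yB rrr.
Qed.

End touching.

Lemma room_dist (R : realType) (D d r x y : R) : 2 * d + r <= D -> x < r -> D - y <= x -> 2 * d < y.
by lra. Qed.

(** * The convex class *)

Section smoothable.
Context {R : realType} {n : nat}.
Local Notation K := R[i].
Local Notation C := (Cn R n).
Local Notation L := (@lebesgue_Cn R n).
Local Notation frame := ('I_n -> 'I_n -> K).
Variables (Omega : set C) (M c : R) (f : C -> R).
Hypotheses (n0 : (0 < n)%N) (oO : open Omega) (bO : forall z, Omega z -> nr z <= M) (c0 : 0 < c).
Hypothesis (cf : {within closure Omega, continuous f}) (f0 : forall z, closure Omega z -> 0 <= f z).
Implicit Types (u v w q : C -> R) (z : C) (P : frame) (t : 'I_n -> R).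

Lemma pshC_cont u z : pshC Omega u -> Omega z -> {for z, continuous u}.
move=> [_ cu] Oz; have := continuous_subspaceW (@subset_closure _ Omega) cu.
by rewrite continuous_open_subspace// => /(_ z); apply; rewrite inE.
Qed.

Lemma pshC_submean u : pshC Omega u -> submean Omega u.
by move=> [[_ _ h] _] z w; exact: h. Qed.

Lemma pshC_intro u : {within closure Omega, continuous u} -> submean Omega u -> pshC Omega u.
move=> cu su; split => //; split => //= [z _|z a Oz]; first exact: ltry.
rewrite lte_fin => ua; have := continuous_subspaceW (@subset_closure _ Omega) cu.
rewrite continuous_open_subspace// => /(_ z); rewrite inE => /(_ Oz) /cont_nr.
have e0 : 0 < a - u z by rewrite subr_gt0.
move=> /(_ _ e0)[r r0 Hr]; apply/nearP_nr; exists r => // w /Hr.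
by rewrite lte_fin ltr_norml => /andP[_]; rewrite ltrBlDr subrK.
Qed.

Lemma measurable_density_on : measurable_fun (Omega : set (borelC R n)) (f : borelC R n -> R).
have cfO := continuous_subspaceW (@subset_closure _ Omega) cf.
have := continuous_open_subspace f oO; rewrite propeqE => -[h _]; have cf1 := h cfO.
have mO : measurable (Omega : set (borelC R n)) by exact: open_borel.
refine (@measurability _ _ (borelC R n) R Omega f (@RGenOInfty.G R) (RGenOInfty.measurableE R) _).
move=> _ [_ [a' ->] <-]; apply: open_borel; apply/openP_nr => x [Ox' /=]; rewrite in_itv /= andbT => ax.
have e0 : 0 < f x - a' by rewrite subr_gt0.
have [r1 r10 Hr1] := (openP_nr _).1 oO x Ox'.
have [r2 r20 Hr2] := (cont_nr _ _).1 (cf1 x (mem_set Ox')) _ e0.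
exists (Num.min r1 r2); first by rewrite lt_min r10.
move=> y'; rewrite lt_min => /andP[/Hr1 Oy /Hr2]; rewrite ltr_norml => /andP[h1 _].
by split => //=; rewrite in_itv /= andbT; move: h1; rewrite opprB ltrD2r.
Qed.

Lemma row_basis P t j : basis j *m (\matrix_(i, p) ((t i)%:C * P i p)) = (t j)%:C *: (\row_p P j p) :> C.
apply/rowP => p; rewrite !mxE (bigD1 j)//= !mxE !eqxx mul1r big1 ?addr0// => i ij.
by rewrite !mxE (negbTE ij) mul0r.
Qed.

Lemma frame_traceE P t u z : sm u -> frame_trace (hess u z) P t = \sum_j t j ^+ 2 * lap (\row_p P j p) u z.
move=> su; bigr => j _; congr (_ * _); apply: (etrans _ (esym (lap_hess _ _ su))).
by congr qf; ext => p; rewrite mxE.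
Qed.

Lemma frame_le P t u z (x : R) : sm u ->
 x <= frame_trace (hess u z) P t <-> x <= \sum_j t j ^+ 2 * lap (\row_p P j p) u z.
by move=> su; rewrite frame_traceE. Qed.

(** The arithmetic-geometric inequality for the identity matrix: the trace of D is at least n. *)
Lemma frame_sum_ge P t : unit_frame P t -> n%:R <= \sum_j t j ^+ 2.
move=> uf; have [oP _ _] := uf.
pose I1 (p q : 'I_n) : K := (p == q)%:R.
have hI (p q : 'I_n) : I1 q p = (I1 p q)^*%R by rewrite /I1 eq_sym; case: eqP => _; rewrite ?rmorph1 ?rmorph0.
have qE (v : 'I_n -> K) : qf I1 v = Re (dotc v v).
 rewrite /qf /hform /dotc; congr Re; bigr => p _.
 rewrite (bigD1 p)//= big1 ?addr0 /I1 ?eqxx ?mulr1// => q qp.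
 by rewrite eq_sym (negbTE qp) mulr0.
have pI (v : 'I_n -> K) : 0 <= qf I1 v.
 rewrite qE /dotc; have : 0 <= \sum_p v p * (v p)^*%R by apply: sumr_ge0 => p _; exact: mul_conjC_ge0.
 by rewrite lecE => /andP[].
have := @frame_trace_ge R n I1 P t 1 hI pI uf ltr01.
rewrite mulr1 expr1n mulr1 /I1 mass_id -(rmorph_nat (real_complex R)) lexx => /(_ isT).
by congr (_ <= _); bigr => j _; rewrite qE oP eqxx mulr1.
Qed.

(** The inequality tr(H D) >= n l, tested only for those [l] that the density allows on the whole
    ball seen by the mollifier. *)
Definition frame_bound u (r : R) z := forall P t (l : R), unit_frame P t -> 0 < l ->
 (forall y, nr (y - z) < r -> 2 ^+ n * c ^+ n * (n`!%:R * l ^+ n) <= f y) -> n%:R * l <= frame_trace (hess u z) P t.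

(* The class is convex, contains the subsolutions, and its members can be
 regularized into subsolutions. *)
Definition smoothable w := pshC Omega w /\ forall (d r0 r : R) z rho, 0 < d -> mollifier r0 rho -> r0 < r ->
 2 * d + r <= dist Omega z -> frame_bound (mollify (loc Omega d w) rho) r z.

(** In the coordinates given by [b], tr(H D) is the plain [laplacian]. A function touching w(a + z
    b) transports back to one touching [w]; [touch_mass] bounds its mass from below,
    [frame_trace_ge] turns this into a bound on the trace, and [viscosity_mollified] carries it over
    to the mollification. *)
Lemma subsolution_smoothable w : subsolutions c Omega f w -> smoothable w.
move=> [pw [mu MA muge]]; split => // d r0 r z rho d0 mr rr dz P t l uf l0 Hl.
have cw y : Omega y -> {for y, continuous w} by exact: pshC_cont.
have CF := loc_Cc bO n0 d0 cw; set F := loc Omega d w in CF *.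
have [oP t0 t1] := uf.
pose b : 'M[K]_n := \matrix_(i, p) ((t i)%:C * P i p).
(* The inverse of [b], explicit because the frame is orthonormal. *)
pose bi : 'M[K]_n := \matrix_(p, k) ((P k p)^*%R * ((t k)^-1)%:C).
have bbi : b *m bi = 1%:M.
 apply/matrixP => j k; rewrite !mxE; transitivity ((t j / t k)%:C * dotc (P j) (P k)).
 by rewrite /dotc mulr_sumr; bigr => p _; rewrite !mxE rmorphM; ring.
 by rewrite oP; have [->|jk] := eqVneq j k; rewrite ?mulr0// divff ?gt_eqF// mulr1.
have smc : sm (mollify F rho) by apply: conv_sm => //; have [[]] := mr.
apply/(frame_le P t z _ smc).
have -> : \sum_j t j ^+ 2 * lap (\row_p P j p) (mollify F rho) z = \sum_j lap (basis j *m b) (mollify F rho) z.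
 by bigr => j _; rewrite row_basis (lap_scaleR (t j) _ z smc).
apply: (viscosity_mollified CF mr rr) => a q y az sq yr tq.
pose z' := a + y *m b; pose q' x := q (- a *m bi + x *m bi).
have sq' : sm q' by exact: sm_affine.
have q'E x : q' (a + x *m b) = q x by rewrite /q' mulmxDl -mulmxA bbi mulmx1 mulNmx addKr.
have dz' x : nr (x - z) < r -> 2 * d < dist Omega x.
 move=> xr; have := dist_lip bO n0 z x; rewrite nrB => /(le_trans (ler_norm _)); move: dz xr.
 by move=> h1 h2 h3; exact: (room_dist h1 h2 h3).
have Ox x : nr (x - z) < r -> Omega x.
 by move=> /dz' h; apply: (dist_in0 bO n0); apply: lt_trans h; rewrite mulr_gt0.
have Oz' : Omega z' := Ox _ yr.
pose s := r - nr (z' - z); have s0 : 0 < s by rewrite subr_gt0.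
have in_r x : nr (x - z') < s -> nr (x - z) < r.
 move=> h; rewrite (_ : x - z = (x - z') + (z' - z)); last by rewrite addrA subrK.
 by apply: le_lt_trans (nrD _ _) _; rewrite -ltrBrDr.
have bK (x : C) : x *m bi *m b = x by rewrite -mulmxA (mulmx1C bbi) mulmx1.
have [k k0 Hk] := mulmx_bounded bi.
have tq' : touches w q' z'.
 have [e e0 He] := tq; exists (Num.min s (e / k)); first by rewrite lt_min s0 divr_gt0.
 move=> x; rewrite lt_min => /andP[xs xe].
 have xE : a + (x - a) = x by rewrite addrC subrK.
 have := He ((x - a) *m bi); rewrite bK xE -(loc_in w d0 (ltW (dz' _ (in_r x xs)))).
 rewrite -(loc_in w d0 (ltW (dz' _ yr))) -/F -/z' q'E.
 have -> : q ((x - a) *m bi) = q' x by rewrite /q' mulmxBl mulNmx addrC.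
 apply; have -> : (x - a) *m bi - y = (x - z') *m bi.
 by rewrite /z' opprD addrA [RHS]mulmxBl -(mulmxA y) bbi mulmx1.
 by apply: le_lt_trans (Hk _) _; rewrite mulrC -ltr_pdivlMr.
have sw := pshC_submean pw.
have kp : 0 < 2 ^+ n * c ^+ n by rewrite mulr_gt0// exprn_gt0.
have M1 : n`!%:R * l ^+ n <= Re (mass (hess q' z')).
 rewrite -(ler_pM2l kp); apply: (touch_mass n0 oO bO c0 sw cw MA Oz' sq' tq' s0) => A mA As.
 have AO : A `<=` Omega by move=> x /As /in_r /Ox.
 apply: le_trans (muge A mA AO); rewrite -integral_cst//; apply: ge0_le_integral => //.
 - by move=> x _; rewrite lee_fin mulr_ge0 ?(ltW kp)// mulr_ge0// exprn_ge0// ltW.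
 - have mO : measurable (Omega : set (borelC R n)) by exact: open_borel.
 by to_EFin; apply: (measurable_funS mO AO); exact: measurable_density_on.
 - by move=> x /As /in_r xr; rewrite lee_fin; exact: Hl.
have hq' p p' : hess q' z' p' p = (hess q' z' p p')^*%R by exact: hess_herm.
have psd (v : 'I_n -> K) : 0 <= qf (hess q' z') v.
 have := psh_touch (\row_p v p) oO sw cw Oz' sq' tq'; rewrite lap_hess//.
 by congr (_ <= qf _ _); ext => p; rewrite mxE.
have := frame_trace_ge hq' psd uf l0 M1; rewrite (frame_traceE P t z' sq').
congr (_ <= _); bigr => j _.
rewrite -(lap_scaleR (t j) _ z' sq') -(row_basis P t j).
apply: (etrans (esym (lap_affine q' a b (basis j) y))).
have q'F : (fun x : C => q' (a + x *m b)) = q by apply/funext.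
exact: (congr1 (fun g : C -> R => lap (basis j) g y) q'F).
Qed.

Lemma conv_loc_lin (d k1 k2 r0 : R) w1 w2 rho z : 0 < d -> mollifier r0 rho ->
 (forall z, Omega z -> {for z, continuous w1}) -> (forall z, Omega z -> {for z, continuous w2}) ->
 mollify (loc Omega d (fun y => k1 * w1 y + k2 * w2 y)) rho z =
 k1 * mollify (loc Omega d w1) rho z + k2 * mollify (loc Omega d w2) rho z.
move=> d0 [trho _ _ _] cw1 cw2.
have H w : (forall z, Omega z -> {for z, continuous w}) -> Cc (fun y => loc Omega d w y * rho (y - z)).
 move=> cw; apply: CcMl; first exact: loc_Cc bO n0 _ _ d0 cw.
 by apply: cont_shift; apply: sm_cont; case: trho.
have h1 := H _ cw1; have h2 := H _ cw2.
rewrite /mollify -(integZ k1 h1) -(integZ k2 h2) -(integD (CcZ k1 h1) (CcZ k2 h2)).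
by congr integ; ext => y; rewrite /loc; ring.
Qed.

Lemma lap_conv_loc_lin (d k1 k2 r0 : R) w1 w2 rho z (v : C) : 0 < d -> mollifier r0 rho ->
 (forall z, Omega z -> {for z, continuous w1}) -> (forall z, Omega z -> {for z, continuous w2}) ->
 lap v (mollify (loc Omega d (fun y => k1 * w1 y + k2 * w2 y)) rho) z =
 k1 * lap v (mollify (loc Omega d w1) rho) z + k2 * lap v (mollify (loc Omega d w2) rho) z.
move=> d0 mr cw1 cw2; have [[srho _] _ _ _] := mr.
have s1 := conv_sm (loc_Cc bO n0 d0 cw1) srho; have s2 := conv_sm (loc_Cc bO n0 d0 cw2) srho.
have -> : mollify (loc Omega d (fun y => k1 * w1 y + k2 * w2 y)) rho =
 fun z => k1 * mollify (loc Omega d w1) rho z + k2 * mollify (loc Omega d w2) rho z.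
 by ext => y; exact: conv_loc_lin mr cw1 cw2.
apply: (etrans (lapD v z (smZ k1 s1) (smZ k2 s2))).
exact: (congr2 (fun x y : R => x + y) (lapZ k1 v z s1) (lapZ k2 v z s2)).
Qed.

Lemma within_lin (k1 k2 : R) w1 w2 : {within closure Omega, continuous w1} -> {within closure Omega, continuous w2} ->
 {within closure Omega, continuous (fun y => k1 * w1 y + k2 * w2 y)}.
move=> c1 c2 x; apply: cvgD; apply: cvgM; [exact: cvg_cst|exact: c1|exact: cvg_cst|exact: c2].
Qed.

Lemma pshC_lin (k1 k2 : R) w1 w2 : 0 <= k1 -> 0 <= k2 -> pshC Omega w1 -> pshC Omega w2 ->
 pshC Omega (fun y => k1 * w1 y + k2 * w2 y).
move=> k10 k20 p1 p2; apply: pshC_intro; first by apply: within_lin; [case: p1|case: p2].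
by apply: submean_lin => //; [move=> z; exact: pshC_cont|move=> z; exact: pshC_cont|exact: pshC_submean|exact: pshC_submean].
Qed.

Lemma smoothable_convex (k1 k2 : R) w1 w2 : 0 <= k1 -> 0 <= k2 -> k1 + k2 = 1 -> smoothable w1 -> smoothable w2 ->
 smoothable (fun y => k1 * w1 y + k2 * w2 y).
move=> k10 k20 k12 [p1 h1] [p2 h2]; split; first exact: pshC_lin.
move=> d r0 r z rho d0 mr rr dz P t l uf l0 Hl.
have cw1 y : Omega y -> {for y, continuous w1} by exact: pshC_cont.
have cw2 y : Omega y -> {for y, continuous w2} by exact: pshC_cont.
have [[srho _] _ _ _] := mr.
have sc w : (forall y, Omega y -> {for y, continuous w}) -> sm (mollify (loc Omega d w) rho).
 by move=> cw; apply: conv_sm => //; exact: loc_Cc bO n0 _ _ d0 cw.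
have c12 y : Omega y -> {for y, continuous (fun y => k1 * w1 y + k2 * w2 y)}.
 by move=> Oy; apply: pshC_cont => //; exact: pshC_lin.
have H1 := (frame_le P t z _ (sc _ cw1)).1 (h1 d r0 r z rho d0 mr rr dz P t l uf l0 Hl).
have H2 := (frame_le P t z _ (sc _ cw2)).1 (h2 d r0 r z rho d0 mr rr dz P t l uf l0 Hl).
apply/(frame_le P t z _ (sc _ c12)).
have -> : n%:R * l = k1 * (n%:R * l) + k2 * (n%:R * l) by rewrite -mulrDl k12 mul1r.
apply: le_trans (lerD (ler_wpM2l k10 H1) (ler_wpM2l k20 H2)) _.
rewrite !mulr_sumr -big_split /=; apply: ler_sum => j _.
have al (x a b : R) : k1 * (x * a) + k2 * (x * b) = x * (k1 * a + k2 * b) by ring.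
rewrite le_eqVlt; apply/orP; left; apply/eqP; apply: (etrans (al _ _ _)).
exact: (congr1 (fun y : R => t j ^+ 2 * y) (esym (lap_conv_loc_lin k1 k2 z _ d0 mr cw1 cw2))).
Qed.

(** Integration by parts puts the operator on [E2], where it is constant; the cutoff is 1 on the
    support of the kernel. *)
Lemma lap_conv_E2 (d r0 r : R) z rho (v : C) : 0 < d -> mollifier r0 rho -> r0 < r -> 2 * d + r <= dist Omega z ->
 lap v (mollify (loc Omega d E2) rho) z = E2 v.
move=> d0 mr rr dz; have [trho rho0 rho1 rs] := mr.
have cE x : Omega x -> {for x, continuous (@E2 R n)} by move=> _; exact: (sm_cont sm_E2).
rewrite (lap_conv _ (loc_Cc bO n0 d0 cE) trho.1) /mollify.
have tr := tf_shift (- z) trho.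
have E (y : C) : lap v rho (y - z) = lap v (fun y => rho (y - z)) y by rewrite lap_shift.
transitivity (integ (fun y => lap v (fun y => rho (y - z)) y * E2 y)).
 congr integ; ext => y; rewrite E mulrC.
 have [yr|yr] := ltP (nr (y - z)) r; first congr (_ * _).
 apply: loc_in => //; apply: ltW; have := dist_lip bO n0 z y; rewrite nrB => /(le_trans (ler_norm _)).
 by move=> h; exact: (room_dist dz yr h).
 have -> : lap v (fun y => rho (y - z)) y = 0; last by rewrite !mul0r.
 rewrite -E (@lap_near _ _ rho (fun=> 0) v (y - z) (r - r0)) ?subr_gt0 ?lap_cst// => x xy.
 apply/eqP; apply: contraT => /rs xr; move: yr; rewrite leNgt => /negP[].
 rewrite -(subrK x (y - z)); apply: le_lt_trans (nrD _ _) _.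
 by rewrite -(subrK r0 r) nrB ltrD.
rewrite (lap_by_parts v tr sm_E2).
transitivity (integ (fun y => E2 v * rho (y - z))).
 congr integ; ext => y; rewrite mulrC; congr (_ * _).
 have := lap_E2 0 v y; rewrite (_ : (fun _ => _) = @E2 R n)//; ext => x; by rewrite addr0.
by rewrite (integZ _ (tf_Cc tr)) (integ_shift (- z) (tf_Cc trho)) rho1 mulr1.
Qed.

Lemma submean_E2 : submean Omega E2.
move=> z w _; apply: sm_circle_ge; first exact: sm_E2.
move=> x _; have := lap_E2 0 w (z + x *: w); rewrite (_ : (fun _ => _) = @E2 R n); last by ext => y; rewrite addr0.
by move=> ->; exact: le_trans (sqr_ge0 _) (E2_ge w).
Qed.

Lemma pshC_E2 : pshC Omega E2.
by apply: pshC_intro; [apply: continuous_subspaceT; exact: sm_cont sm_E2|exact: submean_E2]. Qed.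

Lemma subset_closure_bounded z : closure Omega z -> nr z <= M.
move=> cz; apply/ler_addgt0Pr => e e0.
have /cz[y [Oy yz]] : nbhs z [set y : C | nr (y - z) < e] by apply/nearP_nr; exists e.
rewrite -(subrK y z) addrC; apply: le_trans (nrD _ _) _; apply: lerD; first exact: bO.
by rewrite nrB ltW.
Qed.

Lemma closure_compact : compact (closure Omega).
by apply: (closed_bounded_compact (M := M)); [exact: closed_closure|exact: subset_closure_bounded]. Qed.

Lemma E2_row P t j : unit_frame P t -> E2 (\row_p P j p : C) = 1.
move=> [oP _ _]; have := oP j j; rewrite eqxx => /(congr1 (@Re R)) /= <-.
rewrite /dotc Re_sum; bigr => p _; rewrite /xr /xi mxE.
by case: (P j p) => x y; rewrite /= mulrN opprK -!expr2.
Qed.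

(* A large multiple of |z|^2 absorbs the density. *)
Lemma smoothable_E2 : exists2 A : R, 0 < A & forall v, pshC Omega v -> smoothable (fun y => A * E2 y + 1 * v y).
have [F F0 HF] := cont_bdd cf closure_compact.
have kp : 0 < 2 ^+ n * c ^+ n * n`!%:R :> R by rewrite !mulr_gt0// ?exprn_gt0// ltr0n fact_gt0.
set k := 2 ^+ n * c ^+ n * n`!%:R in kp.
(* With this value, [l > A >= 1] would give k l^n >= k l > k A > F, against the bound of [f] by [F];
   so every admissible [l] is at most [A]. *)
pose A := 1 + F / k; have A1 : 1 <= A by rewrite lerDl divr_ge0// ltW.
have A0 : 0 < A := lt_le_trans ltr01 A1.
exists A => // v pv; split; first by apply: pshC_lin => //; [exact: ltW|exact: pshC_E2].
move=> d r0 r z rho d0 mr rr dz P t l uf l0 Hl.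
have cv y : Omega y -> {for y, continuous v} by exact: pshC_cont.
have cE y : Omega y -> {for y, continuous (@E2 R n)} by move=> _; exact: (sm_cont sm_E2).
have [[srho _] _ _ _] := mr.
have c12 y : Omega y -> {for y, continuous (fun y => A * E2 y + 1 * v y)}.
 by move=> Oy; apply: pshC_cont => //; apply: pshC_lin => //; [exact: ltW|exact: pshC_E2].
apply/(frame_le P t z _ (conv_sm (loc_Cc bO n0 d0 c12) srho)).
have r00 : 0 < r.
 rewrite ltNge; apply/negP => rl; have [_ _ r1 rs] := mr.
 have : integ rho = 0.
 rewrite -[RHS](@integ0 R n); congr integ; ext => y; apply/eqP; apply: contraT => /rs.
 by rewrite ltNge (le_trans (le_trans (ltW rr) rl) (nr_ge0 _)).
 by rewrite r1 => /eqP; rewrite oner_eq0.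
have Oz : Omega z.
 by apply: (dist_in0 bO n0); apply: lt_le_trans dz; rewrite addr_gt0// mulr_gt0.
have lA : l <= A.
 rewrite leNgt; apply/negP => Al; have := Hl z; rewrite subrr nr0 => /(_ r00); rewrite mulrA -/k.
 have := le_trans (ler_norm _) (HF z (subset_closure Oz)) => h1 /(fun h => le_trans h h1).
 rewrite leNgt => /negP; apply; apply: (@lt_le_trans _ _ (k * A)).
 by rewrite /A mulrDr mulr1 mulrCA mulfV ?gt_eqF// mulr1 ltrDr.
 rewrite ler_pM2l//; apply: le_trans (ltW Al) _; rewrite -(prednK n0) exprS -[leLHS]mulr1.
 by apply: ler_pM => //; [exact: ltW|apply: exprn_ege1; exact: le_trans A1 (ltW Al)].
apply: (@le_trans _ _ (\sum_j t j ^+ 2 * A)).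
 rewrite -mulr_suml; apply: ler_pM => //; [exact: ltW|exact: frame_sum_ge uf].
apply: ler_sum => j _; apply: ler_wpM2l; first exact: sqr_ge0.
apply: (le_trans _ (_ : A * E2 (\row_p P j p) + 1 * lap (\row_p P j p) (mollify (loc Omega d v) rho) z <= _)); last first.
 rewrite le_eqVlt; apply/orP; left; apply/eqP; apply: esym; apply: (etrans (lap_conv_loc_lin A 1 z _ d0 mr cE cv)).
 exact: (congr1 (fun y : R => A * y + _) (lap_conv_E2 _ d0 mr rr dz)).
rewrite mul1r.
have h := submean_loc bO n0 (\row_p P j p) d0 (pshC_submean pv) cv mr rr dz.
rewrite -[A]addr0; apply: lerD => //; rewrite addr0 -[leLHS]mulr1 ler_pM2l//.
by rewrite (E2_row j uf).
Qed.

End smoothable.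

Section real_inequalities.
Context {R : realType}.
Implicit Types (a b k : R).

(** Superadditivity of the n-th power: an error of order s^n in the density becomes a loss of at
    most s in l. *)
Lemma exprD_ge a b n : 0 <= a -> 0 <= b -> (0 < n)%N -> a ^+ n + b ^+ n <= (a + b) ^+ n.
move=> a0 b0; elim: n => // -[_ _|n IH _]; first by rewrite !expr1.
rewrite ![_ ^+ n.+2]exprS mulrDl; apply: lerD; apply: ler_wpM2l => //.
- by apply: le_trans (IH isT); rewrite lerDl exprn_ge0.
- by apply: le_trans (IH isT); rewrite lerDr exprn_ge0.
Qed.

(** Consecutive regularizations differ here by more than the smoothing width [k / 8], so the
    regularized maximum equals one of its arguments. *)
Lemma glue_inner k k' w u u' : 0 < k -> 4 * k' <= k -> 0 < k' -> `|u - (w + k)| <= k / 8 -> u' <= w + 9 / 8 * k' -> k / 8 < u - u'.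
by move=> k0 kk k'0; rewrite ler_norml => /andP[h1 h2] h3; lra. Qed.
Lemma glue_outer k k' w u u' : 0 < k -> 4 * k' <= k -> 0 < k' -> `|u - (w - k)| <= k / 8 -> w - 9 / 8 * k' <= u' -> u - u' < - (k / 8).
by move=> k0 kk k'0; rewrite ler_norml => /andP[h1 h2] h3; lra. Qed.

Lemma glue_close k k' w u u' s : 0 < k -> 4 * k' <= k -> 0 < k' -> `|u - w| <= 9 / 8 * k -> `|u' - w| <= 9 / 8 * k' ->
 0 <= s -> s <= Num.max (u - u') 0 + k / 8 -> `|u' + s - w| <= 2 * k.
move=> k0 kk k'0; rewrite !ler_norml => /andP[h1 h2] /andP[h3 h4] s0 hs.
case: (leP (u - u') 0) => h.
- by move: hs; rewrite (max_r h) => hs; apply/andP; split; lra.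
- by move: hs; rewrite (max_l (ltW h)) => hs; apply/andP; split; lra.
Qed.

Lemma convex_le st x1 x2 x3 x4 x5 : 0 <= st -> st <= 1 -> x4 - x5 <= x2 -> x3 - x5 <= x1 ->
 (1 - st) * x4 + st * x3 - x5 <= (1 - st) * x2 + st * x1 :> R.
by move=> *; nra. Qed.

End real_inequalities.

(** * Gluing regularizations up to the boundary *)

Section gluing.
Context {R : realType} {n : nat}.
Local Notation K := R[i].
Local Notation C := (Cn R n).
Local Notation frame := ('I_n -> 'I_n -> K).
Variables (Omega : set C) (M c : R) (f : C -> R).
Hypotheses (n0 : (0 < n)%N) (oO : open Omega) (bO : forall z, Omega z -> nr z <= M) (c0 : 0 < c).
Hypothesis (cf : {within closure Omega, continuous f}).
Implicit Types (u v w q : C -> R) (z : C) (P : frame) (t : 'I_n -> R).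
Local Notation d := (dist Omega).

Lemma lap_lower b : tf b -> exists2 N : R, 0 < N & forall (v : C) z, - N * E2 v <= lap v b z.
move=> [sb [r Hr]].
have H (p q : 'I_n) : exists2 N : R, 0 < N & forall z, `|hess b z p q| <= N%:C.
 have [h1 h2] := csm_hess p q sb.
 have out z : r < nr z -> hess b z p q = 0.
 move=> /open_outside[s s0 Hs]; rewrite (@hess_near _ _ b (fun=> 0) z s)//; last by move=> y /Hs /Hr.
 have d2 (v w : C) : dder v (dder w (fun _ : C => 0 : R)) z = 0 by rewrite dder_cst dder_cst.
 rewrite /hess /ddbar.
 have al (x1 x2 x3 x4 : R) : x1 = 0 -> x2 = 0 -> x3 = 0 -> x4 = 0 -> (4^-1 : K) * ((x1 + x2) +i* (x3 - x4)) = 0.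
 by move=> -> -> -> ->; rewrite subrr addr0 mulr0.
 exact: (al _ _ _ _ (d2 _ _) (d2 _ _) (d2 _ _) (d2 _ _)).
 have C1 : Cc (fun z => Re (hess b z p q)) by split; [exact: sm_cont|exists r => z /out ->].
 have C2 : Cc (fun z => Im (hess b z p q)) by split; [exact: sm_cont|exists r => z /out ->].
 have [N1 N10 H1] := Cc_bounded C1; have [N2 N20 H2] := Cc_bounded C2.
 exists (N1 + N2) => [|z]; first exact: addr_gt0.
 by apply: le_trans (Defs.norm_le_ReIm _) _; rewrite lecR lerD.
have [N HN] : {N : 'I_n * 'I_n -> R & forall pq, 0 < N pq /\ forall z, `|hess b z pq.1 pq.2| <= (N pq)%:C}.
 by apply: (@choice _ _ (fun (pq : 'I_n * 'I_n) (x : R) => 0 < x /\ forall z, `|hess b z pq.1 pq.2| <= x%:C)) => pq; have [x x0 Hx] := H pq.1 pq.2; exists x.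
pose S := \sum_pq N pq; have S0 : 0 <= S by apply: sumr_ge0 => pq _; apply: ltW; case: (HN pq).
have le_S (p q : 'I_n) z : `|hess b z p q| <= S%:C.
 apply: le_trans ((HN (p, q)).2 z) _; rewrite lecR /S (bigD1 (p, q))//= lerDl.
 by apply: sumr_ge0 => pq _; apply: ltW; case: (HN pq).
exists (n%:R * n%:R * S + 1) => [|v z]; first by rewrite ltr_wpDl// !mulr_ge0.
rewrite (lap_hess v z sb).
have := @qf_close R n (hess b z) (fun _ _ => 0) v S _ S0.
have -> : qf (fun _ _ : 'I_n => 0) (fun p => v 0 p) = 0.
 by rewrite /qf /hform big1// => p _; rewrite big1// => q _; rewrite mulr0.
move=> h; apply: le_trans (h _); last by move=> i j; rewrite subr0.
rewrite sub0r mulNr lerN2; apply: (@le_trans _ _ (n%:R * n%:R * S * E2 v)).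
 by apply: ler_wpM2l; [rewrite !mulr_ge0|exact: E2_ge].
by apply: ler_wpM2r; [exact: le_trans (sqr_ge0 _) (E2_ge v)|rewrite lerDl].
Qed.

(** The Lipschitz cutoff at scale [3 / 2 * a] goes from 0 to 1 between distances 3a/2 and 3a;
    mollifying at scale [a / 2] keeps it 0 up to a and 1 from 4a on. *)
Lemma exists_cutoff (a : R) : 0 < a -> exists b, [/\ tf b, forall z, 0 <= b z <= 1,
 forall z, d z <= a -> b z = 0 & forall z, 4 * a <= d z -> b z = 1].
move=> a0; have a32 : 0 < 3 / 2 * a by rewrite mulr_gt0.
have a2 : 0 < a / 2 by rewrite divr_gt0.
have [rho mr] := @exists_mollifier R n _ a2.
have CF := @loc_Cc R n Omega M bO n0 (3 / 2 * a) (fun=> 1) a32 (fun z _ => @contC R n 1 z).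
set F := loc _ _ _ in CF; exists (mollify F rho).
have [trho rho0 rho1 rs] := mr.
have F01 z : 0 <= F z <= 1.
 rewrite /F /loc mul1r /cut; apply/andP; split; last by rewrite ge_min lexx.
 by rewrite le_min ler01 le_max lexx.
have Cfr z : Cc (fun y => F y * rho (y - z)) by apply: CcMl => //; apply: cont_shift; exact: sm_cont trho.1.
have near_d z y : nr (y - z) < a / 2 -> d y <= d z + a / 2 /\ d z <= d y + a / 2.
 move=> h; have := dist_lip bO n0 z y; rewrite nrB ler_norml => /andP[h1 h2].
 by split; move: h1 h2 h; move: (d z) (d y) (nr _) => x1 x2 x3; lra.
have flat z (k : R) : (forall y, d y <= d z + a / 2 -> d z <= d y + a / 2 -> F y = k) -> mollify F rho z = k.
 move=> Hk; have Fz : F z = k by apply: Hk; rewrite lerDl ltW.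
 have := @mollify_close R n F _ 0 rho z CF mr; rewrite Fz => h.
 apply/eqP; rewrite -subr_eq0 -normr_le0; apply: h => y /near_d[h1 h2].
 by rewrite (Hk y h1 h2) subrr normr0.
split.
- by split; [apply: conv_sm => //; exact: trho.1|apply: conv_bsupp => //; exact: trho.2].
- move=> z; apply/andP; split.
 by apply: integ_ge0 => y; have /andP[h _] := F01 y; rewrite mulr_ge0.
 rewrite -rho1 -(integ_shift (- z) (tf_Cc trho)); apply: integ_le => //; first exact: Cc_shift (tf_Cc trho).
 by move=> y; have /andP[_ h] := F01 y; rewrite ler_piMl.
- move=> z dz; apply: flat => y h1 _; rewrite /F /loc cut0 ?mulr0//.
 by move: h1 dz; move: (d y) (d z) => x1 x2; lra.
- move=> z dz; apply: flat => y _ h1; rewrite /F /loc cut1 ?mulr1//.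
 by move: h1 dz; move: (d y) (d z) => x1 x2; lra.
Qed.

(** Over the mollification radius [f] varies by less than 2^n c^n n! s^n, so [l - s] is admissible
    on the whole ball when [l] is admissible at the centre. The missing [s] is restored by the extra
    [s] in each direction, since tr D >= n. *)
Lemma exists_regularization w (a s h : R) : smoothable Omega c f w -> 0 < a -> 0 < s -> 0 < h ->
 exists W, [/\ sm W, forall z, a <= d z -> `|W z - w z| <= h, forall z (v : C), a <= d z -> 0 <= lap v W z &
 forall z P t (l : R), a <= d z -> unit_frame P t -> 0 < l -> 2 ^+ n * c ^+ n * (n`!%:R * l ^+ n) <= f z ->
 n%:R * l <= \sum_j t j ^+ 2 * (lap (\row_p P j p) W z + s)].
move=> [pw Hw] a0 s0 h0.
have cw y : Omega y -> {for y, continuous w} by exact: pshC_cont.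
have a4 : 0 < a / 4 by rewrite divr_gt0.
have CF := loc_Cc bO n0 a4 cw; set F := loc _ _ _ in CF.
have [r1 r10 Hr1] := Cc_unif CF h0.
have kp : 0 < 2 ^+ n * c ^+ n * n`!%:R :> R by rewrite !mulr_gt0// ?exprn_gt0// ltr0n fact_gt0.
have e0 : 0 < 2 ^+ n * c ^+ n * n`!%:R * s ^+ n by rewrite mulr_gt0// exprn_gt0.
have cfO z : d z >= a -> {for z, continuous f}.
 move=> az; have := continuous_subspaceW (@subset_closure _ Omega) cf.
 rewrite continuous_open_subspace// => /(_ z); apply; rewrite inE.
 by apply: (dist_in0 bO n0); exact: lt_le_trans az.
have [r2 r20 Hr2] := unif_cont_compact (K := [set z | a <= d z]) cfO (dist_compact bO n0 a0) e0.
pose r := Num.min r2 (a / 4); have r0 : 0 < r by rewrite lt_min r20.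
pose r3 := Num.min r1 r / 2; have m0 : 0 < Num.min r1 r by rewrite lt_min r10.
have r30 : 0 < r3 by rewrite divr_gt0.
have r3m : r3 < Num.min r1 r by rewrite ltr_pdivrMr// ltr_pMr// ltr1n.
move: (r3m); rewrite lt_min => /andP[r31 r3r].
have [rho mr] := @exists_mollifier R n _ r30; have [trho _ _ _] := mr.
have sW : sm (mollify F rho) by apply: conv_sm => //; exact: trho.1.
have room z : a <= d z -> 2 * (a / 4) + r <= d z.
 move=> az; have ra : r <= a / 4 by rewrite ge_min lexx orbT.
 by move: az ra a0; move: (d z) => x; lra.
have psd z (v : C) : a <= d z -> 0 <= lap v (mollify F rho) z.
 by move=> az; exact: (submean_loc bO n0 v a4 (pshC_submean pw) cw mr r3r (room _ az)).
exists (mollify F rho); split => //.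
- move=> z az; have az2 : 2 * (a / 4) <= d z by move: az a0; move: (d z) => x; lra.
 rewrite -(loc_in w a4 az2).
 apply: (mollify_close CF mr) => y yz; apply: ltW; apply: Hr1; exact: lt_trans yz r31.
- move=> z P t l az uf l0 Hl.
 have sE : \sum_j t j ^+ 2 * (lap (\row_p P j p) (mollify F rho) z + s) =
 \sum_j t j ^+ 2 * lap (\row_p P j p) (mollify F rho) z + s * \sum_j t j ^+ 2.
 by rewrite mulr_sumr -big_split; bigr => j _ /=; rewrite mulrDr [_ * s]mulrC.
 rewrite sE; have ts := frame_sum_ge uf.
 have T0 : 0 <= \sum_j t j ^+ 2 * lap (\row_p P j p) (mollify F rho) z.
 by apply: sumr_ge0 => j _; rewrite mulr_ge0 ?sqr_ge0//; exact: psd.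
 have nR : (0 : R) < n%:R by rewrite ltr0n.
 have [ls|sl] := leP l s.
 apply: (@le_trans _ _ (s * \sum_j t j ^+ 2)); last by rewrite lerDr.
 by rewrite mulrC; apply: ler_pM => //; exact: ltW.
 have l'0 : 0 < l - s by rewrite subr_gt0.
 have -> : n%:R * l = n%:R * (l - s) + s * n%:R by ring.
 apply: lerD; last by apply: ler_wpM2l => //; exact: ltW.
 apply: (frame_le P t z _ sW).1; apply: (Hw _ _ _ _ _ a4 mr r3r (room _ az)) => // y yz.
 have := Hr2 z y az; have yr2 : nr (y - z) < r2 by apply: lt_le_trans yz _; rewrite ge_min lexx.
 move=> /(_ yr2); rewrite ltr_norml => /andP[h1 _].
 have := exprD_ge (ltW l'0) (ltW s0) n0; rewrite subrK => h2.
 have := ler_wpM2l (ltW kp) h2; rewrite mulrDr; move: Hl h1; rewrite !mulrA.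
 by move: (_ * (l - s) ^+ n) (_ * l ^+ n) (_ * s ^+ n) (f z) (f y) => x1 x2 x3 x4 x5; lra.
Qed.

(** Stated through local smooth representatives [G]: the glued function is smooth in [Omega] only,
    whereas [sm] concerns functions on all of C^n. *)
Definition strict_subsolution V := forall z, Omega z -> exists G, [/\ sm G,
 exists2 r : R, 0 < r & forall y, nr (y - z) < r -> V y = G y,
 exists2 e : R, 0 < e & forall v : C, e * E2 v <= lap v G z &
 forall P t (l : R), unit_frame P t -> 0 < l -> 2 ^+ n * c ^+ n * (n`!%:R * l ^+ n) <= f z ->
 n%:R * l <= frame_trace (hess G z) P t].

(* [u_j] is a regularization of [w] on the shell of index [j], raised by [k_j]
 inside and lowered by [k_j] outside, so that the regularized maximum of
 [u_j] and [u_(j+1)] passes smoothly from one to the other. *)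
Lemma smoothable_approx w (s : R) : smoothable Omega c f w -> 0 < s ->
 exists V, [/\ strict_subsolution V, forall z, `|V z - (w z + 3 * s * E2 z)| <= s &
 exists N : R, forall z, `|V z - (w z + 3 * s * E2 z)| <= N * d z].
move=> Sw s0.
have [A A0 HA] : exists2 A : R, 0 < A & forall z, d z <= A.
 have cd : Cc d by split; [exact: dist_cont bO n0|exists M => z zM; apply: (dist_out bO n0) => Oz; have := bO Oz; rewrite leNgt zM].
 by have [A A0 HA] := Cc_bounded cd; exists A => // z; exact: le_trans (ler_norm _) (HA z).
(* [Omega] is divided into the shells [a j.+1 < d z <= a j]; the ratio 4 is the room that
   [exists_cutoff] needs. *)
pose a (j : nat) : R := A / 4 ^+ j.
have p4 j : (0 : R) < 4 ^+ j by rewrite exprn_gt0.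
have a0 j : 0 < a j by rewrite divr_gt0.
have aS j : a j = 4 * a j.+1 by rewrite /a exprS; field; exact: lt0r_neq0.
have a_le i j : (i <= j)%N -> a j <= a i.
 by move=> ij; rewrite /a ler_pM2l// lef_pV2 ?posrE//; apply: ler_weXn2l => //; rewrite ler1n.
have [b Hb] : {b : nat -> C -> R & forall j, [/\ tf (b j), forall z, 0 <= b j z <= 1,
 forall z, d z <= a j.+1 -> b j z = 0 & forall z, a j <= d z -> b j z = 1]}.
 apply: (@choice _ _ (fun (j : nat) (g : C -> R) => [/\ tf g, forall z, 0 <= g z <= 1,
 forall z, d z <= a j.+1 -> g z = 0 & forall z, a j <= d z -> g z = 1])) => j.
 by have [g Hg] := exists_cutoff (a0 j.+1); exists g; rewrite (aS j).
have [N HN] : {N : nat -> R & forall j, 0 < N j /\ forall (v : C) z, - N j * E2 v <= lap v (b j) z}.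
 apply: (@choice _ _ (fun (j : nat) (x : R) => 0 < x /\ forall (v : C) z, - x * E2 v <= lap v (b j) z)) => j.
 by have [tb _ _ _] := Hb j; have [x x0 Hx] := lap_lower tb; exists x.
(* The recursive product secures three things: [k j.+1 <= k j / 4], for a clear order of neighbours;
   [2 * k j * N j <= s], so that the cutoff costs at most [s] in the Hessian; and decay at least as
   fast as 4^(-j), hence like the distance. *)
pose k j : R := s / 2 * \prod_(i < j.+1) (4 * (1 + N i))^-1.
have Np j : 0 < 4 * (1 + N j) by rewrite mulr_gt0// addr_gt0//; case: (HN j).
have k0 j : 0 < k j by rewrite mulr_gt0 ?divr_gt0// prodr_gt0// => i _; rewrite invr_gt0.
have kS j : k j.+1 = k j / (4 * (1 + N j.+1)) by rewrite /k big_ord_recr /= mulrA.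
have k4 j : 4 * k j.+1 <= k j.
 rewrite kS mulrCA ler_piMr ?(ltW (k0 j))// invfM mulrA mulfV// mul1r invf_le1//; first by rewrite lerDl ltW//; case: (HN j.+1).
 by rewrite addr_gt0//; case: (HN j.+1).
have kA j : k j <= s / 2 / 4 ^+ j.+1.
 elim: j => [|j IH].
 rewrite /k big_ord_recr big_ord0 /= mul1r expr1 ler_pM2l ?divr_gt0// lef_pV2 ?posrE//.
 by rewrite ler_pMr// lerDl ltW//; case: (HN 0%N).
 rewrite exprS invfM mulrCA; have := k4 j; rewrite -ler_pdivlMl// => /le_trans; apply.
 by rewrite ler_pM2l// invr_gt0.
have kN j : 2 * k j * N j <= s.
 have Nj : 0 < N j by case: (HN j).
 suff h : k j * N j <= s / 2 by rewrite -mulrA; move: h; move: (k j * N j) => x; lra.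
 have kj : k j <= s / 2 / (4 * (1 + N j)).
 case: j Nj => [|j] Nj; first by rewrite /k big_ord_recr big_ord0 /= mul1r.
 rewrite kS ler_pM2r ?invr_gt0//; apply: le_trans (kA j) _.
 by rewrite ler_pdivrMr// ler_peMr ?exprn_ege1 ?ler1n ?divr_ge0 ?(ltW s0).
 apply: (le_trans (ler_wpM2r (ltW Nj) kj)); rewrite mulrAC ler_pdivrMr// ler_pM2l ?divr_gt0//.
 by move: Nj; move: (N j) => x; lra.
have [W HW] : {W : nat -> C -> R & forall j, [/\ sm (W j), forall z, a j.+1 <= d z -> `|W j z - w z| <= k j / 8,
 forall z (v : C), a j.+1 <= d z -> 0 <= lap v (W j) z &
 forall z P t (l : R), a j.+1 <= d z -> unit_frame P t -> 0 < l -> 2 ^+ n * c ^+ n * (n`!%:R * l ^+ n) <= f z ->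
 n%:R * l <= \sum_i t i ^+ 2 * (lap (\row_p P i p) (W j) z + s)]}.
 apply: (@choice _ _ (fun (j : nat) (g : C -> R) => [/\ sm g, forall z, a j.+1 <= d z -> `|g z - w z| <= k j / 8,
 forall z (v : C), a j.+1 <= d z -> 0 <= lap v g z &
 forall z P t (l : R), a j.+1 <= d z -> unit_frame P t -> 0 < l -> 2 ^+ n * c ^+ n * (n`!%:R * l ^+ n) <= f z ->
 n%:R * l <= \sum_i t i ^+ 2 * (lap (\row_p P i p) g z + s)])) => j.
 exact: exists_regularization Sw (a0 j.+1) s0 (divr_gt0 (k0 j) _).
pose u j z : R := W j z + 2 * k j * b j z + - k j.
have su j : sm (u j).
 have [sW _ _ _] := HW j; have [[sb _] _ _ _] := Hb j.
 by apply: smD; [apply: smD => //; exact: smZ|exact: sm_cst].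
have ulap j z (v : C) : lap v (W j) z - s * E2 v <= lap v (u j) z.
 have [sW _ _ _] := HW j; have [[sb _] _ _ _] := Hb j.
 apply: (le_trans _ (_ : lap v (W j) z + 2 * k j * lap v (b j) z <= _)); last first.
 by rewrite le_eqVlt; apply/orP; left; apply/eqP; exact: esym (lap_addZ (2 * k j) (- k j) v z sW sb).
 rewrite lerD2l; have k2 : 0 <= 2 * k j by rewrite mulr_ge0// ltW.
 apply: le_trans (ler_wpM2l k2 ((HN j).2 v z)); rewrite mulNr mulrN lerN2 mulrA.
 by apply: ler_wpM2r => //; exact: le_trans (sqr_ge0 _) (E2_ge v).
have uin j z : a j <= d z -> `|u j z - (w z + k j)| <= k j / 8.
 move=> az; have [_ h _ _] := HW j; have [_ _ _ b1] := Hb j; rewrite /u b1// mulr1.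
 have -> : W j z + 2 * k j + - k j - (w z + k j) = W j z - w z by ring.
 by apply: h; apply: le_trans az; exact: a_le.
have uout j z : a j.+1 = d z -> `|u j z - (w z - k j)| <= k j / 8.
 move=> az; have [_ h _ _] := HW j; have [_ _ b1 _] := Hb j; rewrite /u b1 -?az// mulr0 addr0.
 have -> : W j z + - k j - (w z - k j) = W j z - w z by ring.
 by apply: h; rewrite az.
have uall j z : a j.+1 <= d z -> `|u j z - w z| <= 9 / 8 * k j.
 move=> az; have [_ h _ _] := HW j; have [_ b01 _ _] := Hb j; have := h z az; have /andP[b0 b1] := b01 z.
 rewrite /u !ler_norml => /andP[h1 h2]; have := k0 j; move: (b j z) (k j) (W j z) (w z) b0 b1 h1 h2.
 by move=> x y x1 x2 *; apply/andP; split; nra.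
pose G j z : R := u j.+1 z + smax (k j / 8) (u j z - u j.+1 z).
have e0 j : 0 < k j / 8 by rewrite divr_gt0.
have sG j : sm (G j) by apply: smD => //; apply: sm_comp; [exact: sm1_smax|exact: smB].
pose cond i z := a i.+1 < d z <= a i.
have cond_uniq i j z : cond i z -> cond j z -> i = j.
 move=> /andP[i1 i2] /andP[j1 j2]; have [ij|ji|//] := ltngtP i j.
 - by have := lt_le_trans i1 (le_trans j2 (a_le _ _ ij)); rewrite ltxx.
 - by have := lt_le_trans j1 (le_trans i2 (a_le _ _ ji)); rewrite ltxx.
have cond_ex z : Omega z -> exists i, cond i z.
 move=> Oz; have dz := dist_gt0 oO bO n0 Oz.
 have ex : exists j, a j < d z.
 have x1 : `|4^-1 : R| < 1 by rewrite ger0_norm ?invr_ge0// invf_lt1// ltr1n.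
 have [j _ Hj] := (@cvgrPdist_lt _ _ _ _ _ _ _).1 (cvg_expr x1) _ (divr_gt0 dz A0).
 exists j; have := Hj j (leqnn j); rewrite sub0r normrN ger0_norm ?exprn_ge0 ?invr_ge0//.
 by rewrite ltr_pdivlMr// exprVn mulrC.
 case: (ex_minnP ex) => -[|m] H0 Hm.
 by move: H0; rewrite /a expr0 divr1 ltNge HA.
 exists m; rewrite /cond H0 leNgt; apply/negP => /Hm; by rewrite ltnn.
(* No shell contains a point off [Omega]; there the value [w z] is the boundary value to which the
   glued function tends. *)
pose V0 z : R := if pselect (exists i, cond i z) is left H then G (projT1 (cid H)) z else w z.
have V0E i z : cond i z -> V0 z = G i z.
 rewrite /V0 => ci; case: pselect => [H|nH]; last by case: nH; exists i.
 by case: (cid H) => j cj /=; rewrite (cond_uniq _ _ _ cj ci).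
have cd : continuous d := dist_cont bO n0.
have near_gt i z : a i < d z -> \forall y \near z, a i < d y.
 move=> h; have [r r0 Hr] := (openP_nr _).1 (cont_open_gt (e := a i) cd) z h.
 by apply/nearP_nr; exists r.
have near_lt i z : d z < a i -> \forall y \near z, d y < a i.
 move=> h; have cN : continuous (fun y => -1 * d y) by apply: contM => //; exact: contC.
 have [|r r0 Hr] := (openP_nr _).1 (cont_open_gt (e := - a i) cN) z.
 by rewrite /= mulN1r ltrN2.
 by apply/nearP_nr; exists r => // y /Hr /=; rewrite mulN1r ltrN2.
have near_u i j (e : R) z : e < u i z - u j z -> \forall y \near z, e < u i y - u j y.
 move=> h; have [r r0 Hr] := (openP_nr _).1 (cont_open_gt (e := e) (sm_cont (smB (su i) (su j)))) z h.
 by apply/nearP_nr; exists r.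
have V0near i z : cond i z -> \forall y \near z, V0 y = G i y.
 move=> ci; have /andP[i1 i2] := ci.
 have [dl|dg|de] := ltgtP (d z) (a i); last 1 first.
 (* On the interface [d z = a i]. For [i = 0] there is nothing on the inner side, as [A] bounds the
    distance; for [i = j.+1] both [G j] and [G j.+1] equal [u j.+1] near [z]. *)
 - case: i ci i1 i2 de => [|j] ci i1 i2 de.
 near=> y; apply: V0E; rewrite /cond (_ : d y <= a 0%N) ?andbT; [by near: y; exact: near_gt|by rewrite /a expr0 divr1].
 have in1 : k j.+1 / 8 < u j.+1 z - u j.+2 z.
 apply: (glue_inner (k0 j.+1) (k4 j.+1) (k0 j.+2) (uin j.+1 z _)); first by rewrite de.
 by have := uall j.+2 z (le_trans (a_le _ _ (leqnSn _)) (ltW i1)); rewrite ler_norml lerBlDl => /andP[].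
 have out1 : u j z - u j.+1 z < - (k j / 8).
 apply: (glue_outer (k0 j) (k4 j) (k0 j.+1) (uout j z (esym de))).
 by have := uall j.+1 z (ltW i1); rewrite ler_norml lerBrDr addrC => /andP[].
 have out2 : k j / 8 < u j.+1 z - u j z by rewrite ltrNr opprB in out1.
 near=> y.
 have Gj1 : G j.+1 y = u j.+1 y.
 rewrite /G smax_id//; first by rewrite addrC subrK.
 by apply: ltW; near: y; exact: near_u in1.
 have Gj : G j y = u j.+1 y.
 rewrite /G smax_eq0 ?addr0// lerNr opprB; apply: ltW; near: y; exact: near_u out2.
 have d1 : a j.+2 < d y by near: y; exact: near_gt.
 have d2 : d y < a j by near: y; apply: near_lt; rewrite de (aS j) ltr_pMl// ltr1n.
 have [h|h] := leP (d y) (a j.+1).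
 by apply: V0E; rewrite /cond d1 h.
 by rewrite Gj1 -Gj; apply: V0E; rewrite /cond h ltW.
 - near=> y; apply: V0E; apply/andP; split; first by near: y; exact: near_gt.
 by apply: ltW; near: y; exact: near_lt.
 - by move: i2; rewrite leNgt dg.
(* Of [3 * s], one [s] absorbs the Hessians of the cutoffs and another the variation of [f]; the
   first alone leaves a Levi form of at least [2 * s]. *)
pose V z := V0 z + 3 * s * E2 z; exists V.
have VE z : V z - (w z + 3 * s * E2 z) = V0 z - w z by rewrite /V; ring.
have close i z : cond i z -> `|V0 z - w z| <= 2 * k i.
 move=> ci; have /andP[i1 _] := ci; rewrite (V0E i z ci).
 apply: (glue_close (k0 i) (k4 i) (k0 i.+1) (uall i z (ltW i1)) (uall i.+1 z (le_trans (a_le _ _ (leqnSn _)) (ltW i1)))).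
 - exact: smax_ge0.
 - exact: smax_le.
have out z : ~ Omega z -> V0 z - w z = 0.
 move=> Oz; rewrite /V0; case: pselect => [H|_]; last by rewrite subrr.
 have [i /andP[i1 _]] := H.
 by move: i1; rewrite (dist_out bO n0 Oz) ltNge (ltW (a0 i.+1)).
split.
- move=> z Oz; have [i ci] := cond_ex z Oz; have /andP[i1 i2] := ci.
 pose Gs y : R := G i y + 3 * s * E2 y + 0; exists Gs.
 have sGs : sm Gs by apply: smD; [apply: smD => //; apply: smZ; exact: sm_E2|exact: sm_cst].
 have lapE (v : C) : lap v (@E2 R n) z = E2 v.
 by have := lap_E2 0 v z; rewrite (_ : (fun _ => _) = @E2 R n)//; ext => y; rewrite addr0.
 have lapGs (v : C) : lap v Gs z = lap v (G i) z + 3 * s * E2 v.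
 by apply: (etrans (lap_addZ (3 * s) 0 v z (sG i) (@sm_E2 R n))); rewrite lapE.
 have E0 (v : C) : 0 <= E2 v by exact: le_trans (sqr_ge0 _) (E2_ge v).
 pose st := step ((u i z - u i.+1 z) / (k i / 8)).
 have st0 : 0 <= st := step_ge0 _; have st1 : st <= 1 := step_le1 _.
 have lapG (v : C) : (1 - st) * lap v (W i.+1) z + st * lap v (W i) z - s * E2 v <= lap v (G i) z.
 apply: le_trans (lap_smax_ge v z (e0 i) (su i) (su i.+1)); rewrite -/st.
 have := ulap i z v; have := ulap i.+1 z v; move: (lap v (u i) z) (lap v (u i.+1) z) (lap v (W i) z) (lap v (W i.+1) z) (s * E2 v).
 by move=> x1 x2 x3 x4 x5 h1 h2; exact: convex_le.
 have [_ _ psd1 fr1] := HW i; have [_ _ psd2 fr2] := HW i.+1.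
 have i3 : a i.+2 <= d z := le_trans (a_le _ _ (leqnSn _)) (ltW i1).
 split => //.
 + have [r r0 Hr] := (nearP_nr _ _).1 (V0near i z ci); exists r => // y /Hr h.
 by rewrite /V /Gs h addr0.
 + exists (2 * s) => [|v]; first by rewrite mulr_gt0.
 rewrite lapGs; have := lapG v; have := psd1 z v (ltW i1); have := psd2 z v i3; have := E0 v.
 move: (lap v (G i) z) (lap v (W i) z) (lap v (W i.+1) z) (E2 v) => x1 x2 x3 x4 h1 h2 h3 h4.
 have : 0 <= (1 - st) * x3 + st * x2 by rewrite addr_ge0// mulr_ge0// subr_ge0.
 by move: h4; clear; lra.
 + move=> P t l uf l0 Hl; apply/(frame_le P t z _ sGs).
 have h1 := fr1 z P t l (ltW i1) uf l0 Hl; have h2 := fr2 z P t l i3 uf l0 Hl.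
 have -> : n%:R * l = (1 - st) * (n%:R * l) + st * (n%:R * l) by rewrite -mulrDl subrK mul1r.
 have st1' : 0 <= 1 - st by rewrite subr_ge0.
 apply: le_trans (lerD (ler_wpM2l st1' h2) (ler_wpM2l st0 h1)) _.
 rewrite !mulr_sumr -big_split /=; apply: ler_sum => j _.
 have al2 (x y y' p q : R) : p * (x * (y + s)) + q * (x * (y' + s)) = x * (p * (y + s) + q * (y' + s)) by ring.
 rewrite [leLHS]al2; apply: ler_wpM2l; first exact: sqr_ge0.
 rewrite lapGs; have := lapG (\row_p P j p); rewrite (E2_row j uf) !mulr1.
 by have := s0; move: (lap _ (G i) z) (lap _ (W i) z) (lap _ (W i.+1) z) => x1 x2 x3; clear; lra.
- move=> z; rewrite VE; have [Oz|/out ->] := pselect (Omega z); last by rewrite normr0 ltW.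
 have [i ci] := cond_ex z Oz; apply: le_trans (close i z ci) _.
 have h : s / 2 / 4 ^+ i.+1 <= s / 2 by rewrite ler_pdivrMr// ler_peMr ?exprn_ege1 ?ler1n ?divr_ge0 ?(ltW s0).
 by have := le_trans (kA i) h; move: (k i) => x; lra.
- exists (4 * s / A) => z; rewrite VE; have [Oz|/out ->] := pselect (Omega z); last first.
 by rewrite normr0; apply: mulr_ge0 (dist_ge0 bO n0 z); rewrite divr_ge0 ?mulr_ge0 ?(ltW s0) ?(ltW A0).
 have [i ci] := cond_ex z Oz; apply: le_trans (close i z ci) _; have /andP[i1 _] := ci.
 apply: (@le_trans _ _ (4 * s / A * a i.+1)); last by apply: ler_wpM2l (ltW i1); rewrite divr_ge0 ?mulr_ge0 ?ltW.
 have -> : 4 * s / A * a i.+1 = 8 * (s / 2 / 4 ^+ i.+1) by rewrite /a; field; rewrite !lt0r_neq0.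
 by have := kA i; have := k0 i; move: (k i) (s / 2 / _) => x1 x2; lra.
Unshelve. all: by end_near. Qed.

End gluing.

(** * Measures with a density *)

Section density.
Import HBNNSimple.
Context {d : measure_display} {T : measurableType d} {R : realType}.
Variables (mu : {measure set T -> \bar R}) (g : T -> R).
Local Open Scope ereal_scope.

(** The two proofs are arguments so that the measure structure can be attached to the constant
    itself. *)
Definition dens_measure (g0 : forall x, (0 <= g x)%R) (mg : measurable_fun setT g) (A : set T) : \bar R :=
 \int[mu]_(x in A) (g x)%:E.

Hypotheses (g0 : forall x, (0 <= g x)%R) (mg : measurable_fun setT g).
Local Notation nu := (dens_measure g0 mg).

Let nu0 : nu set0 = 0. Proof. by rewrite /dens_measure integral_set0. Qed.
Let nu_ge0 A : 0 <= nu A. Proof. by apply: integral_ge0 => x _; rewrite lee_fin. Qed.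
Let nu_sigma_additive : semi_sigma_additive nu.
move=> F mF tF mUF; rewrite /dens_measure; apply: cvg_toP.
 apply: ereal_nondecreasing_is_cvgn => m n mn.
 apply: lee_sum_nneg_natr => // k _ _.
 by apply: integral_ge0 => x _; rewrite lee_fin.
rewrite ge0_integral_bigcup//=.
- by to_EFin; exact: measurable_funTS.
- by move=> x _; rewrite lee_fin.
Qed.

HB.instance Definition _ := isMeasure.Build _ _ _ nu nu0 nu_ge0 nu_sigma_additive.

Lemma integral_dens_nnsfun (h : {nnsfun T >-> R}) : \int[nu]_x (h x)%:E = \int[mu]_x (h x * g x)%:E.
under [LHS]eq_integral do rewrite fimfunE -fsumEFin//.
rewrite [LHS]ge0_integral_fsum//; last 2 first.
 - by move=> r; exact/measurable_EFinP/measurableT_comp.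
 - by move=> n x _; rewrite EFinM nnfun_muleindic_ge0.
under [RHS]eq_integral.
 move=> x xD; rewrite EFinM fimfunE -fsumEFin// ge0_mule_fsuml; last first.
 by move=> r; rewrite EFinM nnfun_muleindic_ge0.
 over.
rewrite [RHS]ge0_integral_fsum//; last 2 first.
 - move=> r; apply: emeasurable_funM; last exact/measurable_EFinP.
 by to_EFin; apply: measurableT_comp.
 - by move=> n x _; apply: mule_ge0; [rewrite EFinM nnfun_muleindic_ge0|rewrite lee_fin].
apply: eq_fsbigr => r _.
have mr : measurable (h @^-1` [set r]) by rewrite -[X in measurable X]setTI; exact: measurable_funP.
rewrite [in LHS](_ : (fun x => _) = (fun x => r%:E * (\1_(h @^-1` [set r]) x)%:E)); last by ext => x; rewrite EFinM.
have [r0|r0] := ltP r 0%R.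
 rewrite preimage_nnfun0// !integral0_eq// => x _; by rewrite indicE in_set0 ?EFinM ?mulr0 ?mule0 ?mul0e.
rewrite ge0_integralZl//; [|first [exact/measurable_EFinP|by move=> x _; rewrite lee_fin]].
rewrite integral_indic// setIT.
rewrite [in RHS](_ : (fun x => _) = (fun x => r%:E * ((g x)%:E * (\1_(h @^-1` [set r]) x)%:E))); last first.
 by ext => x; rewrite EFinM -muleA [X in _ * X]muleC.
rewrite ge0_integralZl//; last 2 first.
 - by apply: emeasurable_funM; exact/measurable_EFinP.
 - by move=> x _; rewrite mule_ge0// lee_fin.
congr (_ * _); rewrite /= /dens_measure [LHS]integral_mkcond; apply: eq_integral => x _.
by rewrite patchE indicE; case: ifP => _; rewrite ?mule1 ?mule0.
Qed.

Lemma integral_dens_ge0 (f : T -> R) : measurable_fun setT f -> (forall x, (0 <= f x)%R) ->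
 \int[nu]_x (f x)%:E = \int[mu]_x (f x * g x)%:E.
move=> mf f0; have mF : measurable_fun setT (EFin \o f) by exact/measurable_EFinP.
pose h := nnsfun_approx measurableT mF.
have hc x : (h k x)%:E @[k --> \oo] --> (f x)%:E.
 by apply: (@cvg_nnsfun_approx _ _ _ _ measurableT _ mF) => // y _; rewrite lee_fin.
transitivity (lim (\int[nu]_x (h k x)%:E @[k --> \oo])).
 rewrite -monotone_convergence//=.
 - by apply: eq_integral => x _; apply/esym/cvg_lim => //; exact: hc.
 - by move=> k; exact/measurable_EFinP.
 - by move=> k x _; rewrite lee_fin.
 - by move=> x _ i j ij; rewrite lee_fin; exact/lefP/nd_nnsfun_approx.
under eq_fun do rewrite integral_dens_nnsfun.
rewrite -monotone_convergence//=.
- apply: eq_integral => x _; apply/cvg_lim => //.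
 under eq_fun do rewrite EFinM; rewrite EFinM; apply: cvgeM; [by []|exact: hc|exact: cvg_cst].
- by move=> k; to_EFin; exact: measurable_funM.
- by move=> k x _; rewrite lee_fin mulr_ge0.
- by move=> x _ i j ij; rewrite lee_fin ler_wpM2r//; exact/lefP/nd_nnsfun_approx.
Qed.

Lemma Rintegral_dens (f : T -> R) : measurable_fun setT f ->
 (Rintegral nu setT f = Rintegral mu setT (fun x => f x * g x))%R.
move=> mf; rewrite /Rintegral [in LHS]integralE [in RHS]integralE; congr (fine (_ - _)).
- apply: (etrans _ (etrans (integral_dens_ge0 (measurable_funrpos mf) (funrpos_ge0 f)) _)); apply: eq_integral => x _.
 by rewrite funeposE /funrpos EFin_max.
 by rewrite funeposE /funrpos -EFin_max maxr_pMl// mul0r.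
- apply: (etrans _ (etrans (integral_dens_ge0 (measurable_funrneg mf) (funrneg_ge0 f)) _)); apply: eq_integral => x _.
 by rewrite funenegE /funrneg EFin_max.
 by rewrite funenegE /funrneg -EFin_max -mulNr maxr_pMl// mul0r.
Qed.

End density.

(** * The Monge-Ampere measure of a strict subsolution *)

Section smooth_subsolution.
Context {R : realType} {n : nat}.
Local Notation K := R[i].
Local Notation C := (Cn R n).
Local Notation B := (borelC R n).
Local Notation L := (@lebesgue_Cn R n).
Local Notation top := full.
Variables (Omega : set C) (M c : R) (f : C -> R) (V : C -> R).
Hypotheses (n0 : (0 < n)%N) (oO : open Omega) (bO : forall z, Omega z -> nr z <= M) (c0 : 0 < c).
Hypothesis (f0 : forall z, Omega z -> 0 <= f z).
Hypothesis (mf : measurable_fun (Omega : set B) (f : B -> R)).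
Hypothesis (SV : strict_subsolution Omega c f V).
Implicit Types (u w q phi : C -> R) (z v : C) (F : C -> K).
Local Notation d := (dist Omega).

Lemma compact_dist (A : set C) : compact A -> A `<=` Omega -> exists2 a : R, 0 < a & forall z, A z -> a <= d z.
move=> cA AO; have [[z0 Az0]|nA] := pselect (exists z, A z); last first.
 by exists 1 => // z Az; case: nA; exists z.
have cd : {within A, continuous (fun z => -1 * d z)}.
 by apply: continuous_subspaceT; apply: contM; [exact: contC|exact: dist_cont bO n0].
have [z Az Hz] := @compact_EVT_max _ _ _ _ (ex_intro _ z0 Az0) cA cd.
exists (d z); first by apply: (dist_gt0 oO bO n0); apply: AO; exact: set_mem.
by move=> y Ay; have := Hz y (mem_set Ay); rewrite !mulN1r lerN2.
Qed.

Lemma near_dist (a : R) z : a < d z -> exists2 r : R, 0 < r & forall y, nr (y - z) < r -> a < d y.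
by move=> h; exact: (openP_nr _).1 (cont_open_gt (e := a) (dist_cont bO n0)) z h. Qed.

Lemma strict_localize (a : R) : 0 < a -> exists2 W, sm W & forall z, a <= d z -> W z = V z.
move=> a0; have a4 : 0 < a / 4 by rewrite divr_gt0.
have [b [[sb _] _ b0 b1]] := exists_cutoff n0 bO a4.
exists (fun z => b z * V z); last first.
 by move=> z az; rewrite b1 ?mul1r// mulrC divfK.
apply: sm_local => z; have [Oz|Oz] := pselect (Omega z).
 have [G [sG [r r0 Hr] _ _]] := SV Oz.
 by exists (fun y => b y * G y); [exact: smM|exists r => // y /Hr ->].
exists (fun=> 0); first exact: sm_cst.
exists (a / 4) => // y yz; rewrite b0 ?mul0r//.
have := dist_lip bO n0 y z; rewrite (dist_out bO n0 Oz) subr0 => /(le_trans (ler_norm _)) h.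
exact: le_trans h (ltW yz).
Qed.

Lemma strict_near (a : R) W z : (forall z, a <= d z -> W z = V z) -> a < d z ->
 exists2 r : R, 0 < r & forall y, nr (y - z) < r -> V y = W y.
by move=> HW /near_dist[r r0 Hr]; exists r => // y /Hr /ltW /HW. Qed.

Lemma strict_psd (a : R) W z : 0 < a -> (forall z, a <= d z -> W z = V z) -> a < d z -> forall v, 0 <= lap v W z.
move=> a0 HW az v; have [r r0 Hr] := strict_near HW az.
have Oz : Omega z by apply: (dist_in0 bO n0); exact: lt_trans az.
have [G [sG [s s0 Hs] [e e0 He] _]] := SV Oz.
rewrite (@lap_near _ _ W G v z (Num.min r s)) ?lt_min ?r0//.
 by apply: le_trans (He v); rewrite mulr_ge0 ?(ltW e0)//; exact: le_trans (sqr_ge0 _) (E2_ge v).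
by move=> y; rewrite lt_min => /andP[/Hr h1 /Hs h2]; rewrite -h1.
Qed.

(** Compactness of the closed unit disc, parametrized by [Cn R 1] so that compactness of closed
    balls applies. *)
Lemma disc_dist z (w : C) : (forall x : K, `|x| <= 1 -> Omega (z + x *: w)) ->
 exists2 a : R, 0 < a & forall x : K, `|x| <= 1 -> a <= d (z + x *: w).
move=> HO; pose p (y : Cn R 1) : C := z + (y 0 0) *: w.
have w1 : 0 < nr w + 1 by rewrite ltr_wpDl ?nr_ge0.
have cp : continuous (fun y => -1 * d (p y)).
 move=> y; apply/cont_nr => e e0; exists (e / (nr w + 1)); first by rewrite divr_gt0.
 move=> x; rewrite ltr_pdivlMr// => h.
 have al (a b : R) : -1 * a - -1 * b = - (a - b) by ring.
 rewrite al normrN; apply: le_lt_trans (dist_lip bO n0 _ _) _.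
 have -> : p x - p y = (x - y) 0 0 *: w by rewrite /p opprD addrACA subrr add0r -scalerBl !mxE.
 have h2 : nr ((x - y) 0 0 *: w) <= nr (x - y) * nr w.
 rewrite nrcZ; apply: ler_wpM2r; first exact: nr_ge0.
 by have := coord_le_nr (x - y) 0; rewrite normc_def lecR.
 by apply: le_lt_trans h2 _; apply: le_lt_trans h; rewrite ler_wpM2l ?nr_ge0// lerDl.
have [|y0 /set_mem By0 Hy] := @compact_EVT_max _ _ _ _ _ (@cball_compact R 1 0 1) (continuous_subspaceT cp).
 by exists 0; rewrite /cball /= subrr nr0.
have in1 (y : Cn R 1) : nr y <= 1 -> `|y 0 0| <= 1.
 by move=> h; apply: le_trans (coord_le_nr y 0) _; rewrite lecR.
have Op : Omega (p y0) by apply: HO; apply: in1; move: By0; rewrite /cball /= subr0.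
exists (d (p y0)); first by apply: (dist_gt0 oO bO n0).
move=> x x1; pose y : Cn R 1 := const_mx x.
have By : cball 0 1 y.
 rewrite /cball /= subr0; apply/ler_addgt0Pr => e e0; apply/ltW.
 rewrite nr_lt; last by rewrite ltr_wpDl.
 apply/forallP => j; rewrite mxE; apply: (le_lt_trans x1).
 by rewrite rmorphD ltrDl ltcR.
have py : p y = z + x *: w by rewrite /p /y mxE.
have neg (a b : R) : -1 * a <= -1 * b -> b <= a by rewrite !mulN1r lerN2.
by rewrite -py; apply: neg; exact: (Hy y (mem_set By)).
Qed.

Lemma strict_submean : submean Omega V.
move=> z w HO; have [a a0 Ha] := disc_dist HO.
have a2 : 0 < a / 2 by rewrite divr_gt0.
have aa : a / 2 < a by rewrite ltr_pdivrMr// ltr_pMr// ltr1n.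
have [W sW HW] := strict_localize a2.
have HWz x : `|x| <= 1 -> W (z + x *: w) = V (z + x *: w) by move=> /Ha h; apply: HW; exact: le_trans (ltW aa) h.
have Vz : V z = W z by have := HWz 0; rewrite normr0 scale0r addr0 => ->.
rewrite Vz (@circle_mean_eq R n V W z w z w); last by move=> t; rewrite HWz// expi_norm.
apply: sm_circle_ge => // x x1; apply: (strict_psd a2 HW).
exact: lt_le_trans aa (Ha x x1).
Qed.

Local Notation form_of k u z I J := (form (nseq k u) z I J).

Definition smooth_current : nat -> @current R n :=
 fun k I J => CMeasure L (fun z => c%:C ^+ k * form_of k V z I J).

Lemma smooth_nseq k u : sm u -> smooth (nseq k u). Proof. by move=> su; elim: k. Qed.

Lemma strict_hess (a : R) W z : (forall z, a <= d z -> W z = V z) -> a < d z -> hess V z = hess W z.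
by move=> HW az; have [r r0 Hr] := strict_near HW az; exact: hess_near r0 Hr. Qed.

Lemma form_nseq_hess k u w z I J : hess u z = hess w z -> form_of k u z I J = form_of k w z I J.
move=> E; suff -> : form (nseq k u) z = form (nseq k w) z by [].
elim: k => [//|k IH]; apply: (etrans (congr1 (wedge (hess u z)) IH)).
exact: (congr1 (fun H => wedge H (form (nseq k w) z)) E).
Qed.

Lemma integ_supp (A : set C) (g : C -> R) : A `<=` Omega -> (forall z, ~ A z -> g z = 0) -> \int[L]_(z in Omega) g z = integ g.
move=> AO g0; rewrite integE [LHS]Rintegral_mkcond; congr Rintegral; ext => z; rewrite /patch.
by case: ifPn => //; rewrite notin_setE => Oz; rewrite g0//; move=> /AO.
Qed.

Lemma smooth_cm_int k (I J : {set 'I_n}) F (A : set C) (a : R) W : A `<=` Omega -> (forall z, ~ A z -> F z = 0) ->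
 (forall z, A z -> a < d z) -> (forall z, a <= d z -> W z = V z) ->
 cm_int Omega (smooth_current k I J) F = cinteg (fun z => F z * (c%:C ^+ k * form_of k W z I J)).
move=> AO F0 Aa HW.
have E z : F z * (c%:C ^+ k * form_of k V z I J) = F z * (c%:C ^+ k * form_of k W z I J).
 have [Az|Az] := pselect (A z); last by rewrite F0// !mul0r.
 by rewrite (@form_nseq_hess k V W z I J (strict_hess HW (Aa z Az))).
Transparent cinteg.
rewrite /cm_int /cinteg /=; apply: complex_eq => /=.
- by rewrite (@integ_supp A)//; [congr integ; ext => z; rewrite E|move=> z Az; rewrite F0// mul0r].
- by rewrite (@integ_supp A)//; [congr integ; ext => z; rewrite E|move=> z Az; rewrite F0// mul0r].
Qed.

Lemma compact_room (A : set C) : compact A -> A `<=` Omega -> exists a W,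
 [/\ 0 < a, forall z, A z -> a < d z, sm W & forall z, a <= d z -> W z = V z].
move=> cA AO; have [a a0 Ha] := compact_dist cA AO.
have a2 : 0 < a / 2 by rewrite divr_gt0.
have [W sW HW] := strict_localize a2.
exists (a / 2), W; split => // z /Ha; apply: lt_le_trans; by rewrite ltr_pdivrMr// ltr_pMr// ltr1n.
Qed.

Lemma smooth_radon k I J : radon Omega (smooth_current k I J).
move=> A cA AO; have [a [W [a0 Aa sW HW]]] := compact_room cA AO.
have mA : measurable (A : set B) by exact: compact_borel.
have [s1 s2] : csm (fun z => c%:C ^+ k * form_of k W z I J).
 by apply: csmZ; apply: csm_form; exact: smooth_nseq.
have H (g : C -> R) : sm g -> L.-integrable A (EFin \o g).
 move=> sg; have [N N0 HN] := cont_bdd (continuous_subspaceT (sm_cont sg)) cA.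
 apply: measurable_bounded_integrable => //; first exact: lebesgue_Cn_compact.
 by apply: measurable_funTS; exact: cont_measurable (sm_cont sg).
 exists N; split; first exact: num_real.
 by move=> x Nx z Az /=; apply: le_trans (HN z Az) (ltW Nx).
split.
- have := H _ s1; apply: eq_integrable => // z /set_mem Az /=.
 by rewrite (@form_nseq_hess k V W z I J (strict_hess HW (Aa z Az))).
- have := H _ s2; apply: eq_integrable => // z /set_mem Az /=.
 by rewrite (@form_nseq_hess k V W z I J (strict_hess HW (Aa z Az))).
Qed.

Lemma test_ctf (phi : C -> R) (A : set C) : (forall k, Ck k phi) -> compact A -> (forall z, ~ A z -> phi z = 0) -> tf phi.
move=> sp cA pA; split => //; have [N HN] := compact_nr_bounded cA; exists N => z Nz; apply: pA => /HN.
by rewrite leNgt Nz.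
Qed.

Lemma smooth_ddc k : ddc_wedge c Omega k V (smooth_current k) (smooth_current k.+1).
move=> I J _ _; split; first exact: smooth_radon.
move=> phi [sp [A [cA AO pA]]]; have [a [W [a0 Aa sW HW]]] := compact_room cA AO.
have tp := test_ctf sp cA pA; have cp := ctf_real tp; have sus := smooth_nseq k sW.
have pA' z : ~ A z -> (phi z)%:C = 0 by move=> /pA ->.
rewrite (@smooth_cm_int k.+1 I J _ A a W AO pA' Aa HW).
have cf1 : cCc (fun z => (phi z)%:C * form (nseq k.+1 W) z I J).
 by apply: ctf_cCc; apply: ctfM cp _; apply: csm_form; exact: smooth_nseq.
transitivity (c%:C ^+ k.+1 * cinteg (fun z => (phi z)%:C * form (W :: nseq k W) z I J)).
 by rewrite -(cintegZ _ cf1); congr cinteg; ext => z; rewrite mulrCA.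
rewrite -(wedge_by_parts I J cp sW sus) exprS -mulrA; congr (_ * _).
rewrite mulr_sumr; bigr => p _; rewrite mulr_sumr; bigr => q _.
rewrite mulrCA; congr (_ * _).
have tdd : ctf (cddbar p q (fun z => (phi z)%:C)) by apply: ctf_wd; exact: ctf_wd.
have dA z : ~ A z -> cddbar p q (fun z => (phi z)%:C) z = 0.
 by move=> Az; apply: (supp_wd (B := A)) => // y Ay; exact: (supp_wd (B := A)).
have cf2 : cCc (fun z => (W z)%:C * cddbar p q (fun z => (phi z)%:C) z * form (nseq k W) z (I :\ p) (J :\ q)).
 by apply: ctf_cCc; apply: ctfM (csm_form _ _ sus); apply: ctfMr tdd (csm_real sW).
rewrite -(cintegZ _ cf2) (@smooth_cm_int k (I :\ p) (J :\ q) _ A a W AO _ Aa HW); last first.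
 by move=> z Az; rewrite (ddbarE p q z tp.1) dA// mulr0.
congr cinteg; ext => z; rewrite (ddbarE p q z tp.1).
have [Az|Az] := pselect (A z); last by rewrite dA// !(mulr0, mul0r).
by rewrite (HW z (ltW (Aa z Az))); ring.
Qed.

(** Extended by 0 because [V] is controlled only inside [Omega], while the density must be
    nonnegative and measurable everywhere. *)
Definition ma_density z : R := if pselect (Omega z) then 2 ^+ n * c ^+ n * Re (mass (hess V z)) else 0.

Arguments ma_density : simpl never.

Lemma ma_densityE (a : R) W z : (forall z, a <= d z -> W z = V z) -> 0 < a -> a < d z ->
 ma_density z = 2 ^+ n * c ^+ n * Re (mass (hess W z)).
move=> HW a0 az; rewrite /ma_density; case: pselect => [Oz|[]]; first by rewrite (strict_hess HW az).
by apply: (dist_in0 bO n0); exact: lt_trans az.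
Qed.

Let k0 : 0 < 2 ^+ n * c ^+ n. Proof. by rewrite mulr_gt0// exprn_gt0. Qed.

Lemma ma_density_ge0 z : 0 <= ma_density z.
rewrite /ma_density; case: pselect => // Oz; apply: mulr_ge0; first exact: ltW.
have [G [sG [r r0 Hr] [e e0 He] _]] := SV Oz; rewrite (hess_near r0 Hr); apply: mass_ge0 => // v.
by apply: le_trans (He v); rewrite mulr_ge0 ?(ltW e0)//; exact: le_trans (sqr_ge0 _) (E2_ge v).
Qed.

Lemma mass_continuous W : sm W -> continuous (fun z => Re (mass (hess W z))).
move=> sW; rewrite (_ : (fun _ => _) = fun z => Re (form (nseq n W) z top top)).
 by apply: sm_cont; have [] := csm_form top top (smooth_nseq n sW).
by ext => z; rewrite form_nseq.
Qed.

Lemma measurable_ma_density : measurable_fun setT (ma_density : B -> R).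
refine (@measurability _ _ B R setT ma_density (@RGenOInfty.G R) (RGenOInfty.measurableE R) _).
move=> _ [_ [a ->] <-]; rewrite setTI; apply: open_borel.
have inE' z : (ma_density @^-1` `]a, +oo[) z <-> a < ma_density z by rewrite /preimage /mkset in_itv andbT.
apply/openP_nr => z /inE' az.
have [a0|a0] := ltP a 0.
 by exists 1 => // y _; apply/inE'; exact: lt_le_trans (ma_density_ge0 y).
have Oz : Omega z.
 by apply: contrapT => Oz; move: az; rewrite /ma_density; case: pselect => [/Oz//|nO]; rewrite ltNge a0.
have dz := dist_gt0 oO bO n0 Oz; have d2 : 0 < d z / 2 by rewrite divr_gt0.
have d3 : d z / 2 < d z by rewrite ltr_pdivrMr// ltr_pMr// ltr1n.
have [W sW HW] := strict_localize d2; have [r r0 Hr] := near_dist d3.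
have cm : continuous (fun y => 2 ^+ n * c ^+ n * Re (mass (hess W y))).
 by apply: contM; [exact: contC|exact: mass_continuous].
have [|s s0 Hs] := (openP_nr _).1 (cont_open_gt (e := a) cm) z; first by rewrite /mkset -(ma_densityE HW d2 d3).
exists (Num.min r s); first by rewrite lt_min r0.
move=> y; rewrite lt_min => /andP[/Hr dy /Hs ay]; apply/inE'.
by rewrite (ma_densityE HW d2 dy).
Qed.

(** [mass_ge] is applied with the [l] that solves 2^n c^n n! l^n = f(z). The strict lower bound on
    the Levi form provides the positive definiteness it requires. *)
Lemma ma_density_ge z : Omega z -> f z <= ma_density z.
move=> Oz; rewrite /ma_density; case: pselect => [Oz'|/(_ Oz)//].
have [G [sG [r r0 Hr] [e e0 He] Hl]] := SV Oz; rewrite (hess_near r0 Hr).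
pose k := 2 ^+ n * c ^+ n * n`!%:R : R.
have kp : 0 < k by rewrite mulr_gt0// ltr0n fact_gt0.
pose l := (f z / k) `^ (n%:R^-1).
have fk : 0 <= f z / k by rewrite divr_ge0 ?f0// ltW.
have l0 : 0 <= l := powR_ge0 _ _.
have nR : (n%:R : R) != 0 by rewrite pnatr_eq0 -lt0n.
have ln : l ^+ n = f z / k by rewrite -powR_mulrn// -powRrM mulVf// powRr1.
have E : 2 ^+ n * c ^+ n * (n`!%:R * l ^+ n) = f z by rewrite ln mulrA -/k mulrC divfK// gt_eqF.
suff : f z <= 2 ^+ n * c ^+ n * Re (mass (hess G z)) by [].
rewrite -E ler_pM2l//; have hh (p q : 'I_n) : hess G z q p = (hess G z p q)^*%R by exact: hess_herm.
have lapE (v : 'I_n -> K) : qf (hess G z) v = lap (\row_p v p) G z.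
 by rewrite lap_hess//; congr qf; ext => p; rewrite mxE.
have pos (v : C) : 0 <= lap v G z.
 by apply: le_trans (He v); rewrite mulr_ge0 ?(ltW e0)//; exact: le_trans (sqr_ge0 _) (E2_ge v).
apply: mass_ge => //.
- move=> v v1; rewrite lapE; apply: lt_le_trans (He _).
 have -> : E2 (\row_p v p : C) = 1.
 move/(congr1 (@Re R)): v1 => /= <-; rewrite /dotc Re_sum; bigr => p _; rewrite /xr /xi mxE.
 by case: (v p) => x y; rewrite /= mulrN opprK -!expr2.
 by rewrite mulr1.
- move=> P t uf; move: l0; rewrite le_eqVlt => /predU1P[<-|lp].
 by rewrite mulr0; apply: sumr_ge0 => j _; apply: mulr_ge0; [exact: sqr_ge0|rewrite lapE; exact: pos].
 by apply: Hl => //; rewrite E.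
Qed.

Definition ma_measure : {measure set B -> \bar R} :=
 [the {measure set B -> \bar R} of dens_measure L ma_density_ge0 measurable_ma_density].

Lemma strict_monge_ampere : monge_ampere_ge c Omega V f.
have mOm : measurable (Omega : set B) by exact: open_borel.
exists ma_measure; last first.
 move=> A mA AO; apply: ge0_le_integral => //.
 - by move=> z /AO Oz; rewrite lee_fin f0.
 - by to_EFin; exact: measurable_funS mOm AO mf.
 - by to_EFin; apply: measurable_funTS; exact: measurable_ma_density.
 - by move=> z /AO Oz; rewrite lee_fin; exact: ma_density_ge.
split.
 move=> A cA AO; have [a [W [a0 Aa sW HW]]] := compact_room cA AO.
 have mA : measurable (A : set B) by exact: compact_borel.
 have [N N0 HN] := cont_bdd (continuous_subspaceT (mass_continuous sW)) cA.
 apply: (@le_lt_trans _ _ (\int[L]_(z in A) (2 ^+ n * c ^+ n * N)%:E)%E).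
 apply: ge0_le_integral => //; first by move=> z _; rewrite lee_fin ma_density_ge0.
 by to_EFin; apply: measurable_funTS; exact: measurable_ma_density.
 move=> z Az; rewrite lee_fin (ma_densityE HW a0 (Aa z Az)) ler_pM2l//.
 exact: le_trans (ler_norm _) (HN z Az).
 rewrite integral_cst//; apply: lte_mul_pinfty; [|by []|exact: lebesgue_Cn_compact].
 by rewrite lee_fin mulr_ge0 ?(ltW k0) ?(ltW N0).
exists smooth_current; split.
- ext => I; ext => J; congr CMeasure; ext => z.
 by rewrite expr0 mul1r.
- by move=> k _; exact: smooth_ddc.
move=> phi [sp [A [cA AO pA]]]; have [a [W [a0 Aa sW HW]]] := compact_room cA AO.
have tp := test_ctf sp cA pA.
have pA' z : ~ A z -> (phi z)%:C = 0 by move=> /pA ->.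
rewrite (@smooth_cm_int n top top _ A a W AO pA' Aa HW).
have real z : A z -> form (nseq n W) z top top = (Re (mass (hess W z)))%:C.
 move=> Az; have H m : smooth (nseq m W) /\ all_in (fun u => forall v, 0 <= lap v u z) (nseq m W).
 by elim: m => //= m [h1 h2]; split; split => // v; exact: strict_psd a0 HW (Aa z Az) v.
 have := rcone_ge0 top (rcone_form (H n).1 (H n).2); rewrite -form_nseq.
 by case: (form _ _ _ _) => x y; rewrite lecE /= => /andP[/eqP -> _].
have -> : Rintegral ma_measure Omega phi = integ (fun z => phi z * ma_density z).
 transitivity (Rintegral ma_measure setT phi).
 rewrite [LHS]Rintegral_mkcond; congr Rintegral; ext => z; rewrite /patch.
 by case: ifPn => //; rewrite notin_setE => Oz; rewrite pA// => /AO.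
 rewrite integE; apply: (Rintegral_dens L ma_density_ge0 measurable_ma_density).
 exact: cont_measurable (sm_cont tp.1).
have E z : phi z * ma_density z = 2 ^+ n * c ^+ n * (phi z * Re (mass (hess W z))).
 have [Az|Az] := pselect (A z); last by rewrite pA// !mul0r mulr0.
 by rewrite (ma_densityE HW a0 (Aa z Az)) mulrCA.
have C1 : Cc (fun z => phi z * Re (mass (hess W z))).
 by apply: CcMl; [exact: tf_Cc|exact: mass_continuous].
rewrite (_ : (fun z => phi z * ma_density z) = fun z => 2 ^+ n * c ^+ n * (phi z * Re (mass (hess W z)))); last exact/funext.
rewrite (integZ _ C1).
have -> : cinteg (fun z => (phi z)%:C * (c%:C ^+ n * form (nseq n W) z top top)) =
 cinteg (fun z => (c ^+ n)%:C * ((phi z * Re (mass (hess W z)))%:C)).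
 congr cinteg; ext => z; have [Az|Az] := pselect (A z); last by rewrite pA// !mul0r mulr0.
 by rewrite real// rmorphXn rmorphM mulrCA.
have cC : cCc (fun z => (phi z * Re (mass (hess W z)))%:C) by split => //=; exact: Cc0.
rewrite (cintegZ _ cC).
Transparent cinteg.
have -> : cinteg (fun z => (phi z * Re (mass (hess W z)))%:C) = (integ (fun z => phi z * Re (mass (hess W z))))%:C.
 by rewrite /cinteg /= (@integ0 R n).
by rewrite !rmorphM !rmorphXn rmorph_nat mulrA.
Qed.

End smooth_subsolution.

Lemma eq_le_of (R : realType) (a b : R) : a = b -> a <= b.
by move=> ->. Qed.

Lemma within_nr (R : realType) (n : nat) (A : set (Cn R n)) (g : Cn R n -> R) : {within A, continuous g} <->
 forall z, A z -> forall e : R, 0 < e -> exists2 r : R, 0 < r & forall y, A y -> nr (y - z) < r -> `|g y - g z| < e.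
split=> [/subspace_continuousP H z Az e e0|H].
 have /cvgrPdist_lt/(_ _ e0) := H z Az; rewrite near_withinE => /nearP_nr[r r0 Hr].
 by exists r => // y Ay yz; rewrite distrC; exact: Hr.
apply/subspace_continuousP => z Az; apply/cvgrPdist_lt => e e0; rewrite near_withinE; apply/nearP_nr.
by have [r r0 Hr] := H z Az e e0; exists r => // y yz Ay; rewrite distrC; exact: Hr.
Qed.

(** * Uniform approximation by subsolutions *)

Section density_of_subsolutions.
Context {R : realType} {n : nat}.
Local Notation C := (Cn R n).
Variables (Omega : set C) (M c : R) (f : C -> R).
Hypotheses (n0 : (0 < n)%N) (oO : open Omega) (bO : forall z, Omega z -> nr z <= M) (c0 : 0 < c).
Hypothesis (cf : {within closure Omega, continuous f}) (f0 : forall z, closure Omega z -> 0 <= f z).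

Lemma strict_subsolutionD V (k : R) : strict_subsolution Omega c f V -> strict_subsolution Omega c f (fun z => V z - k).
move=> SV z Oz; have [G [sG [r r0 Hr] [e e0 He] Hl]] := SV z Oz.
exists (fun z => G z - k); split.
- by apply: smB => //; exact: sm_cst.
- by exists r => // y /Hr ->.
- exists e; first exact: e0.
 move=> v; apply: le_trans (He v) _; apply: eq_le_of; exact: esym (lap_subC k v z sG).
- move=> P t l uf l0 hl; apply: le_trans (Hl P t l uf l0 hl) _.
 exact: eq_le_of (congr1 (fun h => frame_trace h P t) (esym (hess_subC k z sG))).
Qed.

Lemma subsolutions_dense (w : C -> R) (k e : R) : smoothable Omega c f w -> 0 < e ->
 exists2 V, subsolutions c Omega f V & forall z, closure Omega z -> `|V z - (w z - k)| <= e.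
move=> Sw e0; have [N N0 HN] := cont_bdd (continuous_subspaceT (sm_cont (@sm_E2 R n))) (closure_compact bO).
have N1 : 0 < 1 + 3 * N by rewrite ltr_wpDr// mulr_ge0// ltW.
(* The gluing error [s] and the added [3 * s * E2], with [E2] at most [N], sum to [e]. *)
pose s := e / (1 + 3 * N); have s0 : 0 < s by rewrite divr_gt0.
have se : s + 3 * s * N = e by rewrite /s; field; exact: lt0r_neq0.
have [V [SV Vs [D VD]]] := smoothable_approx n0 oO bO c0 cf Sw s0.
have pw := Sw.1; exists (fun z => V z - k); last first.
 move=> z cz; have -> : V z - k - (w z - k) = (V z - (w z + 3 * s * E2 z)) + 3 * s * E2 z by ring.
 apply: le_trans (ler_normD _ _) _; rewrite -se; apply: lerD => //.
 have s3 : 0 <= 3 * s by rewrite mulr_ge0// ltW.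
 rewrite normrM (ger0_norm s3); apply: (ler_wpM2l s3); exact: HN.
have SVk := strict_subsolutionD k SV.
split; last first.
 apply: (strict_monge_ampere n0 oO bO c0 _ _ SVk); last exact: measurable_density_on oO cf.
 by move=> z Oz; apply: f0; exact: subset_closure.
apply: pshC_intro => //; last exact: strict_submean n0 oO bO SVk.
apply/within_nr => z cz e1 e10.
have [Oz|Oz] := pselect (Omega z).
 have [G [sG [r r0 Hr] _ _]] := SV z Oz.
 have [q q0 Hq] := (cont_nr _ _).1 (sm_cont sG z) _ e10.
 exists (Num.min q r); first by rewrite lt_min q0.
 move=> y _; rewrite lt_min => /andP[/Hq h yr]; rewrite (Hr y yr) (Hr z) ?subrr ?nr0//.
 by have -> : G y - k - (G z - k) = G y - G z by ring.
(* At a boundary point [V] equals [w + 3 * s * E2], and nearby it differs from it by at most [D]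
   times the distance to the complement; so continuity up to the boundary is inherited. *)
have e3 : 0 < e1 / 3 by rewrite divr_gt0.
have D1 : 0 < `|D| + 1 by rewrite ltr_wpDl.
have [r r0 Hr] := (within_nr _ _).1 pw.2 z cz _ e3.
have [q q0 Hq] := (cont_nr _ _).1 (sm_cont (smZ (3 * s) (@sm_E2 R n)) z) _ e3.
have k0 : 0 < e1 / 3 / (`|D| + 1) by rewrite divr_gt0.
exists (Num.min (Num.min r q) (e1 / 3 / (`|D| + 1))); first by rewrite !lt_min r0 q0.
move=> y cy; rewrite !lt_min -andbA => /and3P[/(Hr y cy) h1 /Hq h2 h3].
have h4 : `|V y - (w y + 3 * s * E2 y)| < e1 / 3.
 apply: le_lt_trans (VD y) _; have := dist_lip bO n0 y z; rewrite (dist_out bO n0 Oz) subr0 => /(le_trans (ler_norm _)) h5.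
 apply: (@le_lt_trans _ _ (`|D| * nr (y - z))).
 apply: (@le_trans _ _ (`|D| * dist Omega y)); last by apply: ler_wpM2l.
 by apply: ler_wpM2r; [exact: dist_ge0 bO n0 y|exact: ler_norm].
 move: h3; rewrite ltr_pdivlMr// mulrDr mulr1 mulrC; apply: le_lt_trans.
 by rewrite lerDl nr_ge0.
have h5 : V z = w z + 3 * s * E2 z.
 by apply/eqP; rewrite -subr_eq0 -normr_le0; apply: le_trans (VD z) _; rewrite (dist_out bO n0 Oz) mulr0.
rewrite h5; have -> : V y - k - (w z + 3 * s * E2 z - k) = (V y - (w y + 3 * s * E2 y)) + ((w y - w z) + (3 * s * E2 y - 3 * s * E2 z)) by ring.
apply: le_lt_trans (ler_normD _ _) _; apply: (@lt_le_trans _ _ (e1 / 3 + (e1 / 3 + e1 / 3))); last by lra.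
apply: ltrD => //; apply: le_lt_trans (ler_normD _ _) _; exact: ltrD.
Qed.

End density_of_subsolutions.

(** * The Hahn-Banach theorem *)

Section hahn_banach.
Context {R : realType} {V : lmodType R}.
Variables (S : V -> Prop) (q : V -> R).
Hypotheses (S0 : S 0) (SD : forall u v, S u -> S v -> S (u + v)) (SZ : forall (a : R) u, S u -> S (a *: u)).
Hypotheses (qD : forall u v, S u -> S v -> q (u + v) <= q u + q v) (qZ : forall (a : R) u, S u -> 0 <= a -> q (a *: u) <= a * q u).

(** Partial linear functionals below [q], encoded as graphs so that extension is inclusion. *)
Let graph (G : set (V * R)) := [/\ G (0, 0), forall (a : R) x y, G x -> G y -> G (a *: x.1 + y.1, a * x.2 + y.2),
 forall x, G x -> S x.1 & forall x, G x -> x.2 <= q x.1].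

Let q0 : 0 <= q 0.
by have := qD S0 S0; rewrite addr0 -subr_ge0 addrK. Qed.

(** The value at [v0] must lie between all [x.2 - q (x.1 - v0)] and all [q (y.1 + v0) - y.2];
    subadditivity orders these bounds, and the supremum of the lower ones is taken. *)
Let graph_extend G v0 : graph G -> S v0 -> exists G', [/\ graph G', G `<=` G' & exists a, G' (v0, a)].
move=> [G0 GL GS Gq] Sv0.
have SN u : S u -> S (- u) by move=> Su; rewrite -scaleN1r; exact: SZ.
pose E := [set x.2 - q (x.1 - v0) | x in G].
have ub x y : G x -> G y -> x.2 - q (x.1 - v0) <= q (y.1 + v0) - y.2.
 move=> Gx Gy; have := Gq _ (GL 1 x y Gx Gy); rewrite /= scale1r mul1r => h.
 have := qD (SD (GS _ Gx) (SN _ Sv0)) (SD (GS _ Gy) Sv0); rewrite addrACA addNr addr0 => h2.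
 by move: h h2; move: (q _) (q _) (q _) => a b d; lra.
have hE : has_sup E.
 split; first by exists (0 - q (0 - v0)), (0, 0).
 by exists (q (0 + v0) - 0) => _ [x Gx <-]; exact: (ub x (0, 0)).
pose a := sup E.
have a1 x : G x -> x.2 - q (x.1 - v0) <= a by move=> Gx; apply: ub_le_sup; [case: hE|exists x].
have a2 y : G y -> a <= q (y.1 + v0) - y.2 by move=> Gy; apply: ge_sup; [case: hE|move=> _ [x Gx <-]; exact: ub].
exists [set w | exists x t, G x /\ w = (x.1 + t *: v0, x.2 + t * a)]; split.
- split.
 + by exists (0, 0), 0; rewrite scale0r mul0r !addr0.
 + move=> b _ _ [x [t [Gx ->]]] [y [s [Gy ->]]] /=.
 exists (b *: x.1 + y.1, b * x.2 + y.2), (b * t + s); split; first exact: GL.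
 by congr (_, _) => /=; [rewrite scalerDr scalerDl !scalerA addrACA|ring].
 + by move=> _ [x [t [Gx ->]]] /=; apply: SD; [exact: GS|exact: SZ].
 + move=> _ [x [t [Gx ->]]] /=; have [t0|t0|<-] := ltgtP 0 t.
 * have := a2 _ (GL t^-1 x (0, 0) Gx G0); rewrite /= !addr0 => h.
 have := qZ (SD (GS _ Gx) (SZ t Sv0)) (ltW (_ : 0 < t^-1)); rewrite invr_gt0 => /(_ t0).
 rewrite scalerDr scalerA mulVf ?gt_eqF// scale1r => h2; have := le_trans h (lerB h2 (lexx _)).
 by rewrite -mulrBr ler_pdivlMl// lerBrDl mulrC.
 * have s0 : 0 < - t by rewrite oppr_gt0.
 have := a1 _ (GL (- t)^-1 x (0, 0) Gx G0); rewrite /= !addr0 => h.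
 have := qZ (SD (GS _ Gx) (SZ t Sv0)) (ltW (_ : 0 < (- t)^-1)); rewrite invr_gt0 => /(_ s0).
 rewrite scalerDr scalerA invrN mulNr mulVf ?lt_eqF// scaleN1r -invrN => h2.
 have : (- t)^-1 * x.2 - a <= (- t)^-1 * q (x.1 + t *: v0) by move: h h2; move: (q _) (q _) => y1 y2; lra.
 rewrite lerBlDr -lerBlDl -mulrBr ler_pdivrMl// mulNr; move: (q _) => y; lra.
 * by rewrite scale0r mul0r !addr0; exact: Gq.
- by move=> x Gx; exists x, 0; rewrite scale0r mul0r !addr0; split => //; case: x Gx.
- by exists a, (0, 0), 1; rewrite scale1r mul1r !add0r.
Qed.

Theorem hahn_banach : exists L : V -> R, [/\ forall u v, S u -> S v -> L (u + v) = L u + L v,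
 forall (a : R) u, S u -> L (a *: u) = a * L u & forall u, S u -> L u <= q u].
(* The empty chain has empty union, hence the alternative [G = set0]; a maximal element is not
   empty, as the graph at the origin alone is larger. *)
have [|G [gG maxG]] := @Zorn_bigcup _ (fun G : set (V * R) => graph G \/ G = set0).
- move=> F FP tot; have [[G0 [FG0 gG0]]|nF] := pselect (exists G, F G /\ graph G); last first.
 right; apply/seteqP; split => // x [X FX Xx]; have [gX|X0] := FP X FX; first by case: nF; exists X.
 by rewrite X0 in Xx.
 have gr X x : F X -> X x -> graph X by move=> FX Xx; have [//|X0] := FP X FX; rewrite X0 in Xx.
 left; split.
 + by exists G0 => //; case: gG0.
 + move=> a x y [X FX Xx] [Y FY Yy]; have [XY|YX] := tot X Y FX FY.
 by exists Y => //; have [_ h _ _] := gr Y y FY Yy; apply: h => //; exact: XY.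
 by exists X => //; have [_ h _ _] := gr X x FX Xx; apply: h => //; exact: YX.
 + by move=> x [X FX Xx]; have [_ _ h _] := gr X x FX Xx; exact: h.
 + by move=> x [X FX Xx]; have [_ _ _ h] := gr X x FX Xx; exact: h.
have {}gG : graph G.
 have [//|G0] := gG; exfalso; apply: (maxG [set (0, 0)]).
 by rewrite G0; split => // /(_ (0, 0) erefl).
 left; split => //.
 + by move=> a x y /= -> ->; rewrite scaler0 mulr0 !addr0.
 + by move=> x /= ->.
 + by move=> x /= ->.
have ex v : S v -> exists a, G (v, a).
 move=> Sv; have [G' [gG' GG' [a G'a]]] := graph_extend gG Sv.
 exists a; apply: contrapT => nGa; apply: (maxG G'); last by left.
 by split => // G'G; apply: nGa; exact: G'G.
have [G0 GL GS Gq] := gG.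
have q00 : q 0 <= 0 by have := qZ S0 (lexx 0); rewrite scale0r mul0r.
have uniq v a b : G (v, a) -> G (v, b) -> a = b.
 have le a' b' : G (v, a') -> G (v, b') -> a' <= b'.
 move=> h1 h2; have := Gq _ (GL (-1) _ _ h2 h1); rewrite /= scaleN1r addNr mulN1r => h.
 by move: (le_trans h q00); lra.
 by move=> h1 h2; apply/le_anti; rewrite !le.
have [L HL] := @choice V R (fun v a => S v -> G (v, a)) (fun v => match pselect (S v) with
 | left Sv => let: ex_intro a h := ex v Sv in ex_intro _ a (fun=> h) | right nS => ex_intro _ 0 (fun Sv => False_ind _ (nS Sv)) end).
exists L; split.
- move=> u v Su Sv; apply: (uniq (u + v)); first by apply: HL; exact: SD.
 by have := GL 1 _ _ (HL u Su) (HL v Sv); rewrite /= scale1r mul1r.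
- move=> a u Su; apply: (uniq (a *: u)); first by apply: HL; exact: SZ.
 by have := GL a _ _ (HL u Su) G0; rewrite /= !addr0.
- by move=> u Su; exact: (Gq _ (HL u Su)).
Qed.

End hahn_banach.

(** * Measurability, uniform continuity and binary coding on compact sets *)

Lemma integrable_bounded d (T : measurableType d) (R : realType) (mu : {measure set T -> \bar R}) (A : set T) (f : T -> R) (B : R) :
 measurable A -> (mu A < +oo)%E -> measurable_fun A f -> (forall x, A x -> `|f x| <= B) -> mu.-integrable A (EFin \o f).
move=> mA fA mf HB; apply: measurable_bounded_integrable => //.
by exists B; split; [exact: num_real|move=> y By x Ax; exact: le_trans (HB x Ax) (ltW By)].
Qed.

Lemma compact_measurable_within (R : realType) n (K : set (Cn R n)) (h : Cn R n -> R) : compact K -> {within K, continuous h} ->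
 measurable_fun (K : set (borelC R n)) (h : borelC R n -> R).
move=> cK ch; have mK : measurable (K : set (borelC R n)) by exact: compact_borel.
have /within_nr H := ch.
refine (@measurability _ _ (borelC R n) R K h (@RGenOInfty.G R) (RGenOInfty.measurableE R) _).
move=> _ [_ [a ->] <-].
pose U := \bigcup_(zr in [set zr : Cn R n * R | K zr.1 /\ forall y, K y -> nr (y - zr.1) < zr.2 -> a < h y]) [set y | nr (y - zr.1) < zr.2].
have oU : open U by apply: bigcup_open => zr _; exact: nr_ball_open.
rewrite (_ : K `&` _ = K `&` U); first by apply: measurableI => //; exact: open_borel.
apply/seteqP; split => y [Ky] /=.
 rewrite in_itv /= andbT => ay; split => //.
 have e0 : 0 < h y - a by rewrite subr_gt0.
 have [r r0 Hr] := H y Ky _ e0; exists (y, r) => /=; last by rewrite subrr nr0.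
 split => // x Kx /(Hr x Kx); rewrite ltr_norml => /andP[h1 _]; move: h1; rewrite opprB ltrD2r; exact.
by move=> [[z r] /= [_ Hz] /(Hz y Ky)] ay; split => //; rewrite in_itv /= andbT.
Qed.

Lemma compact_seq_cluster (R : realType) n (K : set (Cn R n)) (z : nat -> Cn R n) : compact K -> (forall m, K (z m)) ->
 exists2 p, K p & forall (e : R) k, 0 < e -> exists2 m, (k <= m)%N & nr (z m - p) < e.
move=> cK Kz; have [|p [Kp clp]] := cK (z @ \oo) _; first by exists 0%N => // m _; exact: Kz.
exists p => // e k e0.
have nb : nbhs p [set y | nr (y - p) < e] by apply/nbhs_nr; exists e.
have nk : (z @ \oo) [set y | exists2 m, (k <= m)%N & y = z m] by exists k => // m /= km; exists m.
by have [y [[m km ->] h]] := clp _ _ nk nb; exists m.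
Qed.

Lemma lt_half_sum (R : realType) (a b d e : R) : a < e / 2 -> b < e / 2 -> d <= a + b -> d < e.
lra. Qed.

Lemma compact_uniform (R : realType) n (K : set (Cn R n)) (h : Cn R n -> R) (e : R) : compact K -> {within K, continuous h} -> 0 < e ->
 exists2 r : R, 0 < r & forall y z, K y -> K z -> nr (y - z) < r -> `|h y - h z| < e.
move=> cK /within_nr ch e0; apply: contrapT => nex.
have ex (k : nat) : exists yz : Cn R n * Cn R n, [/\ K yz.1, K yz.2, nr (yz.1 - yz.2) < k.+1%:R^-1 & e <= `|h yz.1 - h yz.2|].
 apply: contrapT => nk; apply: nex; exists k.+1%:R^-1; first by rewrite invr_gt0.
 by move=> y z Ky Kz yz; rewrite ltNge; apply/negP => ge; apply: nk; exists (y, z).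
have [s Hs] := @choice _ _ (fun (k : nat) (yz : Cn R n * Cn R n) => [/\ K yz.1, K yz.2, nr (yz.1 - yz.2) < k.+1%:R^-1 & e <= `|h yz.1 - h yz.2|]) ex.
have K1s m : K (s m).1 by case: (Hs m).
have [p Kp Hp] := compact_seq_cluster cK K1s.
have e2 : 0 < e / 2 by rewrite divr_gt0.
have [r r0 Hr] := ch p Kp _ e2.
have r2 : 0 < r / 2 by rewrite divr_gt0.
have [k kr] : exists k : nat, k.+1%:R^-1 < r / 2 by have [k] := ltr_add_invr r2; rewrite add0r; exists k.
have [m km mp] := Hp _ k r2; have [K1 K2 h12] := Hs m; apply/negP; rewrite -ltNge.
have mk : m.+1%:R^-1 <= k.+1%:R^-1 :> R by rewrite lef_pV2 ?posrE// ler_nat ltnS.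
have a1 : `|h (s m).1 - h p| < e / 2 by apply: Hr => //; lra.
have a2 : `|h (s m).2 - h p| < e / 2.
 apply: Hr => //; have := nrD ((s m).2 - (s m).1) ((s m).1 - p); rewrite addrA subrK (nrB (s m).2 (s m).1).
 by move=> le; exact: lt_half_sum (lt_trans (lt_le_trans h12 mk) kr) mp le.
have -> : h (s m).1 - h (s m).2 = (h (s m).1 - h p) + (h p - h (s m).2) by ring.
by apply: le_lt_trans (ler_normD _ _) _; rewrite (distrC (h p)); lra.
Qed.

(** For each k a finite net of mesh 1/(k+1) is chosen, and each of its points gives one ball test;
    [pickle] enumerates all of them. The bits of the answers code the points of [K], a prefix
    determining a point up to a small error. *)
Lemma exists_tests (R : realType) n (K : set (Cn R n)) : compact K -> exists test : nat -> Cn R n -> bool,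
 forall e : R, 0 < e -> exists m, forall y z, K y -> K z -> mkseq (test^~ y) m = mkseq (test^~ z) m -> nr (y - z) < e.
move=> cK.
have ex (k : nat) : exists s : seq (Cn R n), forall z, K z -> exists2 y, y \in s & nr (z - y) < k.+1%:R^-1.
 have := cK; rewrite compact_cover => /(_ _ K (fun y => [set z | nr (z - y) < k.+1%:R^-1])) [|z Kz|D' _ HD].
 - by move=> y _; exact: nr_ball_open.
 - by exists z => //=; rewrite subrr nr0 invr_gt0.
 - by exists (finmap.enum_fset D') => z /HD [y yD h]; exists y.
have [net Hnet] := @choice _ _ (fun (k : nat) s => forall z, K z -> exists2 y, y \in s & nr (z - y) < k.+1%:R^-1) ex.
pose test i (z : Cn R n) := if unpickle i is Some ki then nr (z - nth 0 (net ki.1) ki.2) < ki.1.+1%:R^-1 else false.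
exists test => e e0; have e2 : 0 < e / 2 by rewrite divr_gt0.
have [k kr] : exists k : nat, k.+1%:R^-1 < e / 2 by have [k] := ltr_add_invr e2; rewrite add0r; exists k.
(* A prefix long enough to contain all tests of the net of index [k]. *)
exists (\max_(i < size (net k)) (pickle (k, i : nat)).+1) => y z Ky Kz yz.
have [x xs yx] := Hnet k y Ky; have ix : (index x (net k) < size (net k))%N by rewrite index_mem.
have im := @leq_bigmax _ (fun i : 'I_(size (net k)) => (pickle (k, i : nat)).+1) (Ordinal ix).
have := congr1 (fun s => nth false s (pickle (k, index x (net k)))) yz; rewrite !nth_mkseq// /test pickleK /= nth_index// yx => zx.
have := nrD (y - x) (x - z); rewrite addrA subrK (nrB x).
by move=> le; exact: lt_half_sum (lt_trans yx kr) (lt_trans (esym zx) kr) le.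
Qed.

(** * A quantile map on bit sequences *)

Section bits.
Context {R : realType}.
Variable nu : bitseq -> R.
Hypotheses (nu0 : forall w, 0 <= nu w) (nu1 : nu [::] = 1).
Hypothesis nuS : forall w, nu w = nu (rcons w false) + nu (rcons w true).

(* The inverse of the distribution function: the subdivision of [0, 1) into
 cells of lengths [nu w], [size w = m], in lexicographic order; the second
 component is the offset of [s] in its cell. *)
Fixpoint quantile (s : R) (m : nat) : bitseq * R :=
 if m is k.+1 then
 let x := quantile s k in let t := nu (rcons x.1 false) in
 if x.2 < t then (rcons x.1 false, x.2) else (rcons x.1 true, x.2 - t)
 else ([::], s).

Lemma quantile_bound s m : 0 <= s < 1 -> 0 <= (quantile s m).2 < nu (quantile s m).1.
move=> s01; elim: m => [|m] /=; first by rewrite nu1.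
move: (quantile s m) => [w r] /=; have := nuS w; case: (ltP r (nu (rcons w false))) => h1 h2 /andP[h3 h4] /=; apply/andP; split; lra.
Qed.

Lemma size_quantile s m : size (quantile s m).1 = m.
by elim: m => //= m; case: ifP => _ /=; rewrite size_rcons => ->. Qed.

Lemma take_quantile s k m : (k <= m)%N -> take k (quantile s m).1 = (quantile s k).1.
elim: m => [|m IH]; first by rewrite leqn0 => /eqP ->.
rewrite leq_eqVlt => /orP[/eqP ->|]; first by rewrite -[X in take X]((size_quantile s m.+1)) take_size.
rewrite ltnS => km; rewrite -(IH km) /=; by case: ifP => _ /=; rewrite -cats1 takel_cat// size_quantile.
Qed.

(** The parameters whose bits start with [w] form an interval of length [nu w]; so under Lebesgue
    measure the bits are distributed according to [nu]. *)
Lemma quantile_cell w : exists a : R, [/\ 0 <= a, a + nu w <= 1 & forall s, 0 <= s < 1 ->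
 ((quantile s (size w)).1 == w) = (a <= s < a + nu w) /\ ((quantile s (size w)).1 = w -> (quantile s (size w)).2 = s - a)].
elim/last_ind: w => [|w b [a [a0 a1 H]]].
 exists 0; rewrite nu1 add0r; split => // s s01; split => [|_]; last by rewrite subr0.
 by rewrite s01.
have nw := nuS w; have n0 := nu0 (rcons w false); have n1 := nu0 (rcons w true).
exists (if b then a + nu (rcons w false) else a); split; [by case: b; lra|by case: b; lra|].
move=> s s01; have [] := H s s01; rewrite size_rcons /=; move: (quantile s (size w)) => [w' r] /= E1 E2.
have [ww|ww] := eqVneq w' w; last first.
 have F : (a <= s < a + nu w) = false by rewrite -E1; exact: negbTE.
 split; last by case: ifP => _ /= /rcons_inj[ww' _]; rewrite ww' eqxx in ww.
 transitivity false; first by case: ifP => _ /=; rewrite eqseq_rcons (negbTE ww).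
 by apply/esym/negbTE/negP => /andP[h1 h2]; move/negP: F; apply; apply/andP; split; case: b h1 h2; lra.
have rE := E2 ww; move: E1; rewrite ww eqxx => /esym sa.
move/andP: (sa) => [sa1 sa2].
have bw b1 b2 : b1 != b2 -> rcons w b1 <> rcons w b2 by move=> + /rcons_inj[] => /eqP.
rewrite rE; case: (ltP (s - a) (nu (rcons w false))) => h; case: b; rewrite eqseq_rcons eqxx /=; split.
- by apply/esym/negbTE/negP => /andP[h1 h2]; lra.
- by move=> /bw; case.
- by apply/esym/andP; split; lra.
- by [].
- by apply/esym/andP; split; lra.
- by move=> _; lra.
- by apply/esym/negbTE/negP => /andP[h1 h2]; lra.
- by move=> /bw; case.
Qed.

End bits.

Section as_probability.
Context d (T : measurableType d) (R : realType).
Variables (m : {measure set T -> \bar R}) (m1 : m setT = 1%E).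

Definition to_probability : set T -> \bar R := m.
HB.instance Definition _ := Measure.on to_probability.
HB.instance Definition _ := Measure_isProbability.Build _ _ _ to_probability m1.

Lemma as_probability : exists P : probability T R, forall A, P A = m A.
by exists to_probability. Qed.
End as_probability.

(** * The Riesz representation on a compact set *)

Section riesz.
Context {R : realType} {n : nat}.
Local Notation C := (Cn R n).
Variables (K : set C) (k0 : C) (Lam : (C -> R) -> R).
Hypotheses (cK : compact K) (Kk0 : K k0).
(** [Lam] acts on all functions bounded on [K], in particular on the indicators of test prefixes,
    whose values [nu] are the weights of the measure to be built. *)
Let bd (h : C -> R) := exists B : R, forall z, K z -> `|h z| <= B.
Hypotheses (LD : forall g h, bd g -> bd h -> Lam (fun z => g z + h z) = Lam g + Lam h)
 (LZ : forall (a : R) h, bd h -> Lam (fun z => a * h z) = a * Lam h)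
 (Lp : forall h, bd h -> (forall z, K z -> 0 <= h z) -> 0 <= Lam h) (L1 : Lam (fun=> 1) = 1).

Let bdD g h : bd g -> bd h -> bd (fun z => g z + h z).
move=> [A HA] [B HB]; exists (A + B) => z Kz; apply: le_trans (ler_normD _ _) _.
by apply: lerD; [exact: HA|exact: HB].
Qed.

Let bdZ (a : R) h : bd h -> bd (fun z => a * h z).
by move=> [B HB]; exists (`|a| * B) => z Kz; rewrite normrM ler_wpM2l//; exact: HB. Qed.

Let bdc (a : R) : bd (fun=> a). Proof. by exists `|a|. Qed.

Let Lc (a : R) : Lam (fun=> a) = a.
by have := LZ a (bdc 1); rewrite L1 !mulr1. Qed.

Let Lmono g h : bd g -> bd h -> (forall z, K z -> g z <= h z) -> Lam g <= Lam h.
move=> bg bh gh; have := Lp (bdD bh (bdZ (-1) bg)); rewrite LD//; last exact: bdZ.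
rewrite LZ// mulN1r subr_ge0; apply => z Kz; by rewrite mulN1r subr_ge0; exact: gh.
Qed.

Let bd_sum (I : Type) (s : seq I) (F : I -> C -> R) : (forall i, bd (F i)) -> bd (fun z => \sum_(i <- s) F i z).
move=> bF; elim: s => [|i s IH]; first by exists 0 => z _; rewrite big_nil normr0.
have := bdD (bF i) IH; by congr bd; ext => z; rewrite big_cons.
Qed.

Let L_sum (I : Type) (s : seq I) (F : I -> C -> R) : (forall i, bd (F i)) ->
 Lam (fun z => \sum_(i <- s) F i z) = \sum_(i <- s) Lam (F i).
move=> bF; elim: s => [|i s IH].
 by rewrite big_nil -[RHS](Lc 0); congr Lam; ext => z; rewrite big_nil.
rewrite big_cons -IH -LD//; last exact: bd_sum.
by congr Lam; ext => z; rewrite big_cons.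
Qed.

Variable test : nat -> C -> bool.
Hypothesis Htest : forall e : R, 0 < e -> exists m, forall y z, K y -> K z -> mkseq (test^~ y) m = mkseq (test^~ z) m -> nr (y - z) < e.

Let pref z m := mkseq (test^~ z) m.
Let ind w : C -> R := fun z => (pref z (size w) == w)%:R.
Let nu w := Lam (ind w).

Let bd_ind w : bd (ind w).
by exists 1 => z _; rewrite /ind; case: eqP => _; rewrite ?normr1// normr0. Qed.
Let nu0 w : 0 <= nu w.
by apply: Lp => // z _; rewrite /ind ler0n. Qed.
Let nu1 : nu [::] = 1.
by rewrite -L1; congr Lam. Qed.

Let nuS w : nu w = nu (rcons w false) + nu (rcons w true).
rewrite -LD//; congr Lam; ext => z; rewrite /ind !size_rcons /pref mkseqS !eqseq_rcons.
by case: eqP => _; case: (test _ z); rewrite /= ?addr0 ?add0r.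
Qed.

(** A point of [K] whose answers begin with [w]; the default [k0] keeps it in [K] when there is
    none, which by [rep_nu] happens only for prefixes of weight 0. *)
Let rep w := xget k0 [set z | K z /\ pref z (size w) = w].

Let repK w : K (rep w).
by rewrite /rep; case: xgetP => [z -> []|]. Qed.
Let rep_ex w z : K z -> pref z (size w) = w -> pref (rep w) (size w) = w.
by move=> Kz zw; rewrite /rep; case: xgetP => [x -> []//|/(_ z)]; case. Qed.

Let rep_nu w : 0 < nu w -> pref (rep w) (size w) = w.
move=> nw; apply: contrapT => nrep; move: nw; apply/negP; rewrite -leNgt -(Lc 0); apply: Lmono => // z Kz.
by rewrite /ind; case: eqP => // /(rep_ex Kz).
Qed.

Let I : set (mtR R) := `[0, 1[%classic.
Let mI : measurable I. Proof. exact: measurable_itv. Qed.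
Let P : {measure set (mtR R) -> \bar R} := mrestr (@lebesgue_measure R) mI.
(** Sends parameters outside [0, 1) to 0, so that the properties of [quantile] hold for every [s];
    [P] does not charge those parameters. *)
Let tr (s : mtR R) : R := if (0 <= s < 1) then s else 0.

Let tr01 s : 0 <= tr s < 1.
by rewrite /tr; case: ifP => // _; rewrite lexx ltr01. Qed.

Let bits s m := (quantile nu (tr s) m).1.

Let mtr : measurable_fun setT (tr : mtR R -> R).
have := (@measurable_restrictT _ _ (mtR R) _ I (fun s => s) mI).1 (@measurable_id _ _ _).
by congr measurable_fun; ext => s; rewrite /patch /tr mem_setE in_itv.
Qed.

Let P1 : P setT = 1%E.
by rewrite /P /= /mrestr setTI /I lebesgue_measure_itv /= lte_fin ltr01 oppr0 adde0. Qed.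

Let cell w : exists E : set (mtR R), [/\ measurable E, P E = (nu w)%:E & forall s, (bits s (size w) == w) = (s \in E)].
have [a [a0 a1 Ha]] := quantile_cell nu0 nu1 nuS w.
pose J := `[a, a + nu w[%classic : set R.
have mJ : measurable (J : set (mtR R)) by exact: measurable_itv.
exists (tr @^-1` J); split.
- by rewrite -[X in measurable X]setTI; exact: mtr.
- rewrite /P /= /mrestr (_ : _ `&` I = J).
 rewrite /J lebesgue_measure_itv /= lte_fin; case: ltP => h; first by rewrite -EFinD addrC addKr.
 by congr EFin; apply/le_anti; rewrite nu0 /=; move: h; rewrite gerDl.
 apply/seteqP; split => s /=.
 by rewrite /J /I /= !in_itv /= /tr => -[h1 h2]; move: h1; rewrite h2.
 rewrite /J /I /= !in_itv /= => /andP[h1 h2].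
 by rewrite /tr (le_trans a0 h1) (lt_le_trans h2 a1) h1.
- by move=> s; have [-> _] := Ha _ (tr01 s); apply/idP/idP; rewrite inE /= /J /= in_itv.
Qed.

Let bitsE (g : bitseq -> R) m : exists E : m.-tuple bool -> set (mtR R),
 [/\ forall w, measurable (E w), forall w, P (E w) = (nu w)%:E & forall s, g (bits s m) = \sum_(w : m.-tuple bool) g w * \1_(E w) s].
have [E HE] := @choice _ _ (fun (w : bitseq) E => [/\ measurable E, P E = (nu w)%:E & forall s, (bits s (size w) == w) = (s \in E)]) cell.
exists (fun w => E w); split => [w|w|s]; [by case: (HE w)|by case: (HE w)|].
have bm : size (bits s m) == m by rewrite size_quantile.
rewrite (bigD1 (Tuple bm)) //= big1 ?addr0 => [|w ww].
 have [_ _ h] := HE (bits s m); rewrite indicE -h (eqP bm) eqxx mulr1//.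
have [_ _ h] := HE w; rewrite indicE -h size_tuple.
case: eqP => [wb|_]; last by rewrite mulr0.
by move/eqP: ww; case; apply: val_inj => /=; rewrite wb.
Qed.

Let measurable_bits (g : bitseq -> R) m : measurable_fun setT (fun s : mtR R => g (bits s m)).
have [E [mE _ gE]] := bitsE g m; rewrite (funext gE).
by apply: measurable_sum => w; apply: measurable_funM => //; exact: measurable_indic.
Qed.

Let integral_bits (g : bitseq -> R) m : (\int[P]_s (g (bits s m))%:E = (Lam (fun z => g (pref z m)))%:E)%E.
have [E [mE PE gE]] := bitsE g m.
have iE (w : m.-tuple bool) : P.-integrable setT (fun s : mtR R => (g w * \1_(E w) s)%:E).
 apply: (@integrable_bounded _ _ _ P setT (fun s => g w * \1_(E w) s) `|g w|) => //.
 - by rewrite P1 ltry.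
 - by apply: measurable_funM => //; exact: measurable_indic.
 - by move=> s _; rewrite normrM ler_piMr// indicE; case: (_ \in _); rewrite ?normr1// normr0.
transitivity (\int[P]_s (\sum_(w : m.-tuple bool) (g w * \1_(E w) s)%:E))%E.
 by apply: eq_integral => s _; rewrite gE sumEFin.
rewrite integral_sum//; transitivity (\sum_(w : m.-tuple bool) (g w * nu w)%:E)%E.
 bigr => w _; under eq_integral do rewrite EFinM.
 rewrite integralZl//; last first.
 apply: (@integrable_bounded _ _ _ P setT (\1_(E w)) 1) => //.
 - by rewrite P1 ltry.
 - by move=> s _; rewrite indicE; case: (_ \in _); rewrite ?normr1// normr0.
 by rewrite integral_indic// setIT PE.
rewrite sumEFin; congr EFin; rewrite (_ : (fun z => g (pref z m)) = fun z => \sum_(w : m.-tuple bool) g w * ind w z).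
 by rewrite L_sum => [|w]; [bigr => w _; rewrite LZ|exact: bdZ].
ext => z; have bm : size (pref z m) == m by rewrite size_mkseq.
rewrite (bigD1 (Tuple bm)) //= big1 ?addr0 => [|w ww].
 by rewrite /ind /= (eqP bm) eqxx mulr1.
rewrite /ind size_tuple; case: eqP => [wb|_]; last by rewrite mulr0.
by move/eqP: ww; case; apply: val_inj => /=; rewrite wb.
Qed.

Let rep_bits s m : pref (rep (bits s m)) m = bits s m.
have /andP[h1 h2] := quantile_bound nu1 nuS m (tr01 s).
by have := rep_nu (le_lt_trans h1 h2); rewrite {2}/bits size_quantile.
Qed.

Let pref_take z k m : (k <= m)%N -> take k (pref z m) = pref z k.
by move=> km; rewrite /pref /mkseq -map_take take_iota (minn_idPl km). Qed.

Let refines m (e : R) := forall y z, K y -> K z -> pref y m = pref z m -> nr (y - z) < e.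

Let close s k m (e : R) : refines k e -> (k <= m)%N -> nr (rep (bits s m) - rep (bits s k)) < e.
move=> rk km; apply: rk => //; rewrite -(pref_take _ km) !rep_bits.
exact: take_quantile.
Qed.

(** Representatives of growing prefixes are eventually close together by [Htest]; compactness
    supplies the limit as a cluster point. *)
Let limit s : exists p, K p /\ forall k (e : R), 0 < e -> refines k e -> nr (rep (bits s k) - p) < e + e.
have [p Kp Hp] := compact_seq_cluster cK (fun m => repK (bits s m)).
exists p; split => // k e e0 rk; have [m km mp] := Hp e k e0.
have := nrD (rep (bits s k) - rep (bits s m)) (rep (bits s m) - p); rewrite addrA subrK => /le_lt_trans; apply.
by apply: ltrD => //; rewrite nrB; exact: close.
Qed.

(** The measure is the law of the limit point [X s] for s uniform in [0, 1). At level m, the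
    integral of a function of the bits is [Lam] of a function of the prefix ([integral_bits]), and a
    continuous function on [K] is uniformly close to such functions. *)
Lemma riesz_of_tests : exists2 mu : probability (borelC R n) R, mu K = 1%E &
 forall h, {within K, continuous h} -> (\int[mu]_(z in K) (h z)%:E = (Lam h)%:E)%E.
have [X HX] := @choice _ _ (fun s p => K p /\ forall k (e : R), 0 < e -> refines k e -> nr (rep (bits s k) - p) < e + e) limit.
have mX : measurable_fun setT (X : mtR R -> borelC R n).
 have cvgX (F : C -> R) : (forall y z, `|F y - F z| <= nr (y - z)) -> measurable_fun setT (fun s : mtR R => F (X s)).
 move=> HF; apply: (@measurable_fun_cvg _ _ _ setT (fun m s => F (rep (bits s m)))) => [m|s _].
 exact: (measurable_bits (fun w => F (rep w))).
 apply/cvgrPdist_lt => e e0; have e4 : 0 < e / 4 by rewrite divr_gt0.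
 have [k rk] := Htest e4; exists k => // m /= km; rewrite distrC; apply: le_lt_trans (HF _ _) _.
 have h1 := close s rk km; have h2 := (HX s).2 k _ e4 rk.
 have := nrD (rep (bits s m) - rep (bits s k)) (rep (bits s k) - X s); rewrite addrA subrK.
 by move: h1 h2; move: (nr _) (nr _) (nr _) => a b d; lra.
 apply: measurable_fun_borelC => j; [apply: (cvgX (fun z => Re (z 0 j)))|apply: (cvgX (fun z => Im (z 0 j)))] => y z.
 - have := coord_le_nr (y - z) j; rewrite !mxE; case: (y 0 j) (z 0 j) => [a b] [a' b'].
 rewrite normc_def lecR /=; apply: le_trans; rewrite -sqrtr_sqr ler_sqrt; last by rewrite addr_ge0// sqr_ge0.
 by rewrite lerDl sqr_ge0.
 - have := coord_le_nr (y - z) j; rewrite !mxE; case: (y 0 j) (z 0 j) => [a b] [a' b'].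
 rewrite normc_def lecR /=; apply: le_trans; rewrite -sqrtr_sqr ler_sqrt; last by rewrite addr_ge0// sqr_ge0.
 by rewrite lerDr sqr_ge0.
have mK : measurable (K : set (borelC R n)) by exact: compact_borel.
pose m := image_measure P mX.
have mE A : m A = P (X @^-1` A) by [].
have mT : m setT = 1%E by rewrite mE preimage_setT.
have [mu muE] := as_probability mT.
exists mu; first by rewrite muE mE (_ : _ @^-1` _ = setT)//; apply/seteqP; split => // s _; exact: (HX s).1.
move=> h ch; have mh := compact_measurable_within cK ch.
have [B B0 HB] := cont_bdd ch cK.
have mhX : measurable_fun setT (fun s : mtR R => h (X s)).
 have mhK : measurable_fun setT (h \_ K : borelC R n -> R) by exact: (measurable_restrictT (h : borelC R n -> R) mK).1.
 have := measurableT_comp mhK mX.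
 by congr measurable_fun; ext => s /=; rewrite /patch mem_set//; exact: (HX s).1.
have iX (g : C -> R) : measurable_fun setT (fun s : mtR R => g (X s)) -> (exists B, forall z, K z -> `|g z| <= B) ->
 P.-integrable setT (fun s => (g (X s))%:E).
 move=> mg [B' HB']; apply: (@integrable_bounded _ _ _ P setT (fun s => g (X s)) B') => //; first by rewrite P1 ltry.
 by move=> s _; apply: HB'; exact: (HX s).1.
have -> : (\int[mu]_(z in K) (h z)%:E = \int[P]_s (h (X s))%:E)%E.
 rewrite (eq_measure_integral m) => [|A _ _]; last by rewrite -muE.
 pose hK : borelC R n -> \bar R := (fun z => (h z)%:E) \_ K.
 have hKX s : hK (X s) = (h (X s))%:E by rewrite /hK /patch mem_set//; exact: (HX s).1.
 have mhE : measurable_fun setT hK.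
 by apply: (measurable_restrictT (fun z : borelC R n => (h z)%:E) mK).1; exact/measurable_EFinP.
 have ihE : P.-integrable (X @^-1` setT) (hK \o X).
 by rewrite preimage_setT; apply: eq_integrable (iX h mhX (ex_intro _ B HB)) => // s _ /=; rewrite hKX.
 rewrite integral_mkcond; apply: (etrans (@integral_pushforward _ _ _ (borelC R n) R X mX P setT hK mhE ihE measurableT)).
 by rewrite preimage_setT; apply: eq_integral => s _ /=; rewrite hKX.
(* One inequality is enough: applied to [- h] it gives the other. *)
have ub (g : C -> R) : {within K, continuous g} -> measurable_fun setT (fun s : mtR R => g (X s)) ->
 (\int[P]_s (g (X s))%:E <= (Lam g)%:E)%E.
 move=> cg mg; have [B' B'0 HB'] := cont_bdd cg cK.
 apply/lee_addgt0Pr => e e0; have e2 : 0 < e / 2 by rewrite divr_gt0.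
 have [r r0 Hr] := compact_uniform cK cg e2.
 have [k rk] := Htest (divr_gt0 r0 (ltr0n R 2)).
 pose G w := g (rep w) + e / 2.
 apply: (@le_trans _ _ (\int[P]_s (G (bits s k))%:E)%E).
 apply: le_integral => //; first by apply: iX => //; exists B'.
 apply: (@integrable_bounded _ _ _ P setT (fun s => G (bits s k)) (B' + e / 2)) => //; first by rewrite P1 ltry.
 by move=> s _; apply: le_trans (ler_normD _ _) _; apply: lerD; [exact: HB'|rewrite ger0_norm// ltW].
 move=> s _; rewrite lee_fin /G; have [Ks Hs] := HX s.
 have Xr : nr (X s - rep (bits s k)) < r by rewrite nrB [r]splitr; apply: Hs => //; exact: divr_gt0.
 have := Hr _ _ Ks (repK _) Xr; rewrite ltr_norml => /andP[_]; move: (g _) (g _) => a b; lra.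
 rewrite integral_bits -EFinD lee_fin -[X in _ <= _ + X](Lc e) -LD//; last by exists B'.
 apply: Lmono.
 - by exists (B' + e / 2) => z Kz; apply: le_trans (ler_normD _ _) _; apply: lerD; [exact: HB'|rewrite ger0_norm// ltW].
 - by apply: bdD => //; exists B'.
 - move=> z Kz; have pz := @rep_ex (pref z k) z Kz; rewrite size_mkseq in pz.
 have zr : nr (rep (pref z k) - z) < r.
 by apply: lt_trans (rk _ _ (repK _) Kz (pz erefl)) _; rewrite ltr_pdivrMr// ltr_pMr// ltr1n.
 have := Hr _ _ (repK _) Kz zr; rewrite /G ltr_norml => /andP[_]; move: (g _) (g _) => a b; lra.
apply/le_anti; rewrite ub//=.
have cN : {within K, continuous (fun z => - h z)} by move=> z; apply: cvgN; exact: ch.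
have mN : measurable_fun setT (fun s : mtR R => - h (X s)) by exact: measurableT_comp mhX.
have := ub _ cN mN; have -> : (\int[P]_s (- h (X s))%:E = - \int[P]_s (h (X s))%:E)%E.
 have := integralZl measurableT (iX h mhX (ex_intro _ B HB)) (-1); rewrite mulN1e => <-.
 by apply: eq_integral => s _; rewrite -EFinM mulN1r.
have bh : bd h by exists B.
have := LZ (-1) bh; rewrite (_ : (fun z => -1 * h z) = fun z => - h z); last by ext => z; rewrite mulN1r.
by move=> ->; rewrite mulN1r EFinN leeN2.
Qed.

End riesz.

Lemma ray_bound (R : realType) (a b : R) : (forall t, 0 <= t -> t * a <= b) -> a <= 0.
move=> H; rewrite leNgt; apply/negP => a0; have b0 : 0 <= b by have := H 0 (lexx 0); rewrite mul0r.
have b1 : 0 <= (b + 1) / a by rewrite divr_ge0 ?addr_ge0// ltW.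
by have := H _ b1; rewrite divfK ?gt_eqF// gerDl ler10.
Qed.

(** * Duality *)

Section duality.
Context {R : realType} {n : nat}.
Local Notation C := (Cn R n).
Variables (Omega : set C) (M c : R) (f phi : C -> R) (x : C).
Hypotheses (n0 : (0 < n)%N) (oO : open Omega) (bO : forall z, Omega z -> nr z <= M) (c0 : 0 < c) (Ox : Omega x).
Hypothesis (cf : {within closure Omega, continuous f}) (f0 : forall z, closure Omega z -> 0 <= f z).
Hypothesis (cphi : {within boundary Omega, continuous phi}).

Let K := boundary Omega.

Let Kcl z : K z -> closure Omega z. Proof. by case. Qed.

Let cK : compact K.
apply: (@closed_bounded_compact R n _ M).
 by apply: closedI; [exact: closed_closure|apply: open_closedC; exact: open_interior].
by move=> z [cz _]; exact: (subset_closure_bounded bO).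
Qed.

Let clx : closure Omega x. Proof. exact: subset_closure. Qed.

Let pshK v : pshC Omega v -> {within K, continuous v}.
by move=> [_ cv]; apply: continuous_subspaceW cv => z []. Qed.

Let pE2 : pshC Omega (E2 : C -> R).
exact: pshC_E2. Qed.

Lemma jensen_integral mu h : jensen Omega x mu -> {within K, continuous h} ->
 exists b : R, (\int[mu]_(z in K) (h z)%:E = b%:E)%E /\ mu.-integrable K (EFin \o h).
move=> [muK' _] ch; have muK : mu K = 1%E by exact: muK'.
have mK : measurable (K : set (borelC R n)) by exact: compact_borel.
have [B B0 HB] := cont_bdd ch cK.
have ih : mu.-integrable K (EFin \o h).
 have muf : (mu K < +oo)%E by rewrite muK ltry.
 exact: (integrable_bounded mK muf (compact_measurable_within cK ch) HB).
by exists (fine (\int[mu]_(z in K) (h z)%:E)); split => //; rewrite fineK//; exact: integrable_fin_num.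
Qed.

Lemma perron_le_jensen mu : jensen Omega x mu ->
 (perron c Omega f phi x <= \int[mu]_(z in K) (phi z)%:E - Bpsh c Omega f x mu)%E.
move=> Jmu; apply: ge_ereal_sup => _ [u [Su uphi] <-].
have [a [aE ia]] := jensen_integral Jmu cphi; have [b [bE ib]] := jensen_integral Jmu (pshK Su.1).
have ba : b <= a.
 rewrite -lee_fin -aE -bE; apply: le_integral => //; first exact: compact_borel.
 by move=> z /set_mem Kz; rewrite lee_fin; exact: uphi.
have : (Bpsh c Omega f x mu <= (b - u x)%:E)%E by apply: ereal_inf_lbound; exists u => //; rewrite bE.
rewrite aE; case: (Bpsh c Omega f x mu) => [d| |]; rewrite ?lee_fin//=; last by rewrite leey.
by move: (u x) => u1; lra.
Qed.

Let sol := smoothable Omega c f.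

(** Passing from subsolutions to the larger class does not raise the envelope: a subsolution within
    [e / 2] of [u], shifted by [b - e / 2], obeys the boundary condition. *)
Lemma smoothable_le_perron u (b e : R) : sol u -> (forall z, K z -> b <= phi z - u z) -> 0 < e ->
 ((u x + b - e)%:E <= perron c Omega f phi x)%E.
move=> Su Hb e0; have e2 : 0 < e / 2 by rewrite divr_gt0.
have [V SV HV] := subsolutions_dense n0 oO bO c0 cf f0 (e / 2 - b) Su e2.
apply: (@le_trans _ _ (V x)%:E).
 by rewrite lee_fin; have := HV x clx; rewrite ler_norml => /andP[+ _]; move: (V x) (u x) => a d; lra.
apply: ereal_sup_ubound; exists V => //; split => // z Kz.
by have := Hb z Kz; have := HV z (Kcl Kz); rewrite ler_norml => /andP[_]; move: (V z) (u z) (phi z) => a d g; lra.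
Qed.

Let exsol : exists u, sol u.
by have [A A0 HA] := smoothable_E2 n0 oO bO c0 cf; exists (fun y => A * E2 y + 1 * E2 y); exact: HA. Qed.

Lemma perron_gtNy : (-oo < perron c Omega f phi x)%E.
have [u Su] := exsol; have [A A0 HA] := cont_bdd cphi cK.
have [B B0 HB] := cont_bdd (pshK Su.1) cK.
apply: lt_le_trans (smoothable_le_perron (b := - A - B) Su _ ltr01); first exact: ltNyr.
move=> z Kz; have := HA z Kz; have := HB z Kz; rewrite !ler_norml => /andP[_ +] /andP[+ _].
by move: (u z) (phi z) => a d; lra.
Qed.

Variable alpha : R.
Hypothesis alphaE : perron c Omega f phi x = alpha%:E.

Let sol_bound u b : sol u -> (forall z, K z -> b <= phi z - u z) -> b <= alpha - u x.
move=> Su Hb; apply/ler_addgt0Pr => e e0; have := smoothable_le_perron Su Hb e0.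
by rewrite alphaE lee_fin; move: (u x) => a; lra.
Qed.

Let bd (h : C -> R^o) := exists B : R, forall z, K z -> `|h z| <= B.

Let bdD (g h : C -> R^o) : bd g -> bd h -> bd (g + h).
move=> [A HA] [B HB]; exists (A + B) => z Kz; apply: le_trans (ler_normD _ _) _.
by apply: lerD; [exact: HA|exact: HB].
Qed.

Let bdZ (a : R) (h : C -> R^o) : bd h -> bd (a *: h).
by move=> [B HB]; exists (`|a| * B) => z Kz; rewrite normrM ler_wpM2l//; exact: HB. Qed.
Let bdK h : {within K, continuous h} -> bd h.
by move=> ch; have [B _ HB] := cont_bdd ch cK; exists B. Qed.

(** On an empty boundary the hypothesis of [sol_bound] would hold for every [b], including one that
    is too large. *)
Let exK : exists k0, K k0.
apply: contrapT => nK; have [u Su] := exsol.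
have : alpha - u x + 1 <= alpha - u x by apply: (sol_bound Su) => z Kz; case: nK; exists z.
by rewrite gerDl ler10.
Qed.

(* The values [b] for which [h] is dominated on the boundary by [b] plus a
 nonnegative multiple of some [(phi - u) - (alpha - u x)]; a functional below
 their infimum is positive, normalized, and at most [alpha - u x] at
 [phi - u]. *)
Let Q (h : C -> R^o) : set R := [set b | exists t u, [/\ 0 <= t, sol u &
 forall z, K z -> h z <= b + t * ((phi z - u z) - (alpha - u x))]].
Let q h := inf (Q h).

(** For t > 0, division by t turns the domination into a lower bound for [phi - u] on the boundary,
    to which [sol_bound] applies: here [alpha] enters as the Perron value. For t = 0 a boundary
    point is used. In particular [q] is finite on bounded functions. *)
Let Q_lb h (m b : R) : (forall z, K z -> m <= h z) -> Q h b -> m <= b.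
move=> Hm [t [u [t0 Su Hu]]]; have [k0 Kk0] := exK.
move: t0; rewrite le_eqVlt => /orP[/eqP t0|t0].
 by have := le_trans (Hm _ Kk0) (Hu _ Kk0); rewrite -t0 mul0r addr0.
have := @sol_bound u ((m - b) / t + (alpha - u x)) Su.
rewrite gerDr pmulr_lle0 ?invr_gt0// subr_le0; apply => z Kz.
rewrite -lerBrDr ler_pdivrMr// lerBlDl mulrC; exact: le_trans (Hm _ Kz) (Hu _ Kz).
Qed.

Let Q_const h b : (forall z, K z -> h z <= b) -> Q h b.
by move=> H; have [u Su] := exsol; exists 0, u; split => // z Kz; rewrite mul0r addr0; exact: H. Qed.

Let Q_inf h : bd h -> has_inf (Q h).
move=> [B HB]; split.
 by exists B; apply: Q_const => z Kz; exact: le_trans (ler_norm _) (HB z Kz).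
exists (- B) => b; apply: Q_lb => z Kz; by have := HB z Kz; rewrite ler_norml => /andP[].
Qed.

Let q_le h b : bd h -> Q h b -> q h <= b.
by move=> bh Qb; apply: ge_inf => //; case: (Q_inf bh). Qed.

Let qD (g h : C -> R^o) : bd g -> bd h -> q (g + h) <= q g + q h.
move=> bg bh; rewrite -lerBlDr; apply: lb_le_inf; first by case: (Q_inf bg).
move=> a Qa; rewrite lerBlDr -lerBlDl; apply: lb_le_inf; first by case: (Q_inf bh).
move=> b Qb; rewrite lerBlDl; apply: q_le; first exact: bdD.
have [t [u [t0 Su Hu]]] := Qa; have [s [v [s0 Sv Hv]]] := Qb.
have [ts|ts] := eqVneq (t + s) 0.
 move/eqP: ts; rewrite paddr_eq0// => /andP[/eqP t0' /eqP s0']; apply: Q_const => z Kz.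
 by have := lerD (Hu z Kz) (Hv z Kz); rewrite t0' s0' !mul0r !addr0.
have ts0 : 0 < t + s by rewrite lt_def ts addr_ge0.
(* Convexity of the class enters here: the two multiples combine into the multiple [t + s] of one
   convex combination. *)
exists (t + s), (fun y => t / (t + s) * u y + s / (t + s) * v y); split; first exact: ltW.
 have t1 : 0 <= t / (t + s) by rewrite divr_ge0// ltW.
 have s1 : 0 <= s / (t + s) by rewrite divr_ge0// ltW.
 have ts1 : t / (t + s) + s / (t + s) = 1 by rewrite -mulrDl divff.
 exact: (smoothable_convex n0 oO bO t1 s1 ts1 Su Sv).
move=> z Kz; have := lerD (Hu z Kz) (Hv z Kz); congr (_ <= _).
move: (u z) (v z) (u x) (v x) (phi z) => u1 v1 u2 v2 p; by field.
Qed.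

Let qZ (a : R) h : bd h -> 0 <= a -> q (a *: h) <= a * q h.
move=> bh; rewrite le_eqVlt => /orP[/eqP <-|a0].
 by rewrite mul0r scale0r; apply: q_le; [by exists 0 => z _; rewrite normr0|exact: Q_const].
rewrite -ler_pdivrMl//; apply: lb_le_inf; first by case: (Q_inf bh).
move=> b [t [u [t0 Su Hu]]]; rewrite ler_pdivrMl//; apply: q_le; first exact: bdZ.
exists (a * t), u; split => //; first by rewrite mulr_ge0// ltW.
by move=> z Kz; rewrite -mulrA -mulrDr; apply: ler_wpM2l; [exact: ltW|exact: Hu].
Qed.

Lemma dual_measure : exists2 mu, jensen Omega x mu &
 (\int[mu]_(z in K) (phi z)%:E - Bpsh c Omega f x mu <= alpha%:E)%E.
have bd0 : bd 0 by exists 0 => z _; rewrite normr0.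
have [L [LD LZ Lq]] := hahn_banach bd0 bdD bdZ qD qZ.
have Lb h b : bd h -> (forall z, K z -> h z <= b) -> L h <= b.
 by move=> bh hb; apply: le_trans (Lq _ bh) _; apply: q_le => //; exact: Q_const.
have LN h : bd h -> L (fun z => - h z) = - L h.
 move=> bh; rewrite -mulN1r -(LZ (-1) h bh); congr L; ext => z; exact: esym (mulN1r _).
have bN h : bd h -> bd (fun z => - h z) by move=> [B HB]; exists B => z Kz; rewrite normrN; exact: HB.
have Lp h : bd h -> (forall z, K z -> 0 <= h z) -> 0 <= L h.
 move=> bh h0; rewrite -oppr_le0 -LN//; apply: Lb; first exact: bN.
 by move=> z Kz; rewrite oppr_le0; exact: h0.
have b1 : bd (fun=> 1) by exists 1 => z _; rewrite normr1.
have L1 : L (fun=> 1) = 1.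
 apply/le_anti/andP; split; first exact: Lb.
 by rewrite -lerN2 -LN//; apply: Lb => //; exact: bN.
have [k0 Kk0] := exK; have [test Htest] := exists_tests cK.
have [mu muK muL] := @riesz_of_tests R n K k0 L cK Kk0 LD LZ Lp L1 test Htest.
have Lsol u : sol u -> L phi - L u <= alpha - u x.
 move=> Su; have bu := bdK (pshK Su.1); have bp := bdK cphi.
 rewrite -LN// -LD//; last exact: bN.
 apply: le_trans (Lq _ (bdD bp (bN _ bu))) _; apply: q_le; first exact: bdD bp (bN _ bu).
 by exists 1, u; split => // z Kz; rewrite mul1r [leRHS]addrC subrK.
have Jmu : jensen Omega x mu.
 split=> // v pv; rewrite muL; last exact: pshK.
 rewrite lee_fin -subr_le0; have [A A0 HA] := smoothable_E2 n0 oO bO c0 cf.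
 have bE := bdK (pshK pE2); have bv := bdK (pshK pv).
 (* The function [A * E2 + t * v] lies in the class for all t >= 0. The inequality is affine in t
    and bounded above, so the coefficient of t, which is [v x - L v], is at most 0. *)
 apply: (@ray_bound _ _ (alpha - A * E2 x - (L phi - A * L E2))) => t t0.
 have ptv : pshC Omega (fun y => t * v y + 0 * v y) by exact: pshC_lin.
 have := Lsol _ (HA _ ptv).
 rewrite (_ : (fun y => _) = (A *: (E2 : C -> R^o)) + t *: (v : C -> R^o)); last first.
 by ext => y; rewrite /GRing.scale/= mul0r addr0 mul1r.
 rewrite LD; [|exact: bdZ|exact: bdZ]; rewrite !LZ// mul0r addr0 mul1r.
 move: (L phi) (L E2) (L v) (E2 x) (v x) => a1 a2 a3 a4 a5; lra.
exists mu => //; rewrite muL//.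
(* Every subsolution lies in the class, so [Lsol] bounds each term of the infimum from below. *)
have : ((L phi - alpha)%:E <= Bpsh c Omega f x mu)%E.
 apply: le_ereal_inf_tmp => _ [u Su <-]; have Sm := subsolution_smoothable n0 oO bO c0 cf Su.
 rewrite muL; last exact: pshK Su.1.
 by have := Lsol u Sm; rewrite -EFinB lee_fin; move: (L phi) (L u) (u x) => a b d; lra.
case: (Bpsh c Omega f x mu) => [d| |]; rewrite ?lee_fin//=; last by rewrite leNye.
by move: (L phi) => a; lra.
Qed.

End duality.

Theorem theorem5p3 (R : realType) (n : nat) (c : R)
    (Omega : set (Cn R n)) (x : Cn R n) (f : Cn R n -> R)
    (n_gt0 : (0 < n)%N) (c_gt0 : 0 < c)
    (Omega_open : open Omega) (Omega_connected : connected Omega)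
    (Omega_bounded : bounded_set Omega) (Omega_x : Omega x)
    (f_cont : {within closure Omega, continuous f})
    (f_ge0 : forall z, closure Omega z -> 0 <= f z) :
  forall phi : Cn R n -> R, {within boundary Omega, continuous phi} ->
    perron c Omega f phi x =
    ereal_inf [set (\int[mu]_(z in boundary Omega) (phi z)%:E -
                    Bpsh c Omega f x mu)%E | mu in jensen Omega x].
Proof.
move=> phi cphi; have [M bO] : exists M : R, forall z, Omega z -> nr z <= M.
 have [N [rN HN]] := Omega_bounded.
 (* [bounded_set] provides a bound in [R[i]] valid above a real element [N]; one more than its real
    part is such a bound. *)
 exists (Re N + 1) => z Oz; rewrite -lecR -nrE; apply: HN => //.
 move: rN; rewrite realE !lecE ltcE; case: N => a b /= /orP[] /andP[/eqP -> _]; by rewrite eqxx ltrDl ltr01.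
apply/le_anti/andP; split.
 by apply: le_ereal_inf_tmp => _ [mu Jmu <-]; exact: (perron_le_jensen c f bO cphi Jmu).
(* The value minus infinity is excluded by [perron_gtNy], and for plus infinity the inequality is
   immediate; Hahn-Banach treats the finite case. *)
case pE : (perron c Omega f phi x) => [alpha| |]; last first.
- by have := perron_gtNy n_gt0 Omega_open bO c_gt0 Omega_x f_cont f_ge0 cphi; rewrite pE.
- by rewrite leey.
have [mu Jmu le] := dual_measure n_gt0 Omega_open bO c_gt0 Omega_x f_cont f_ge0 cphi pE.
by apply: le_trans le; apply: ereal_inf_lbound; exists mu.
Qed.
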